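(* Let $X$ be a finite CW complex. Then the following are equivalent: (1) $X$ is large. (2) There is a finite cover $Y\to X$ such that for each $N\in\mathbb{N}$ there is a finite abelian cover $Y_N\to Y$ with $b_1(Y_N)\geq N$. (3) There is a finite cover $Y\to X$ such that the Alexander variety $V_1(Y)$ of $Y$ contains infinitely many torsion points.
   Context: CW complexes and covers are connected. $b_1$ denotes the first Betti number. A finite CW complex $X$ (equivalently, the finitely presented group $\pi_1(X)$) is *large* if there is a finite cover $Y\to X$ and a surjective homomorphism $\pi_1(Y)\to F_2$, where $F_2$ is the free group of rank two. A *finite abelian cover* of $Y$ is a finite regular cover with abelian deck group, i.e. the cover corresponding to the kernel of a surjection from $\pi_1(Y)$ to a finite abelian group. Alexander variety. Let $G$ be a finitely presented group with a presentation $G=\langle F_r\mid\mathcal{R}\rangle$, where $F_r$ is free on $x_1,\ldots,x_r$ and $\mathcal{R}=\{R_j\}$ is a finite set of relations. The group of characters is $\widehat{G}=\mathrm{Hom}(G,\mathbb{C}^* )$, which embeds as an algebraic subgroup of $(\mathbb{C}^* )^r$ via $\chi\mapsto(\chi(x_1),\ldots,\chi(x_r))$. The Fox derivatives are the maps $D_i:F_r\to\mathbb{Z}[F_r^{ab}]$ ($1\le i\le r$) determined by $D_i(x_j)=\delta_{i,j}$ and $D_i(fg)=D_i(f)+\overline{f}\,D_i(g)$, where $\overline{f}$ is the image of $f$ in $F_r^{ab}$. The Alexander matrix $M=M(F_r,\mathcal{R})$ is the matrix whose entries are the images of $D_i(R_j)$ in $\mathbb{Z}[G^{ab}]$. For a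 character $\chi$, $M(\chi)$ is the complex matrix obtained by applying $\chi$ to each entry of $M$. For $i\ge 1$, $V_i(G)\subset\widehat{G}\subset(\mathbb{C}^* )^r$ is the set of characters $\chi$ such that $M(\chi)$ has rank less than $r-i$. The Alexander variety of $G$ is $V_1(G)$, and for a finite CW complex $Y$ one sets $V_1(Y)=V_1(\pi_1(Y))$. A torsion point is an element of finite order in $(\mathbb{C}^* )^r$. *)

(* Defs.v *)
From HB Require Import structures.
From mathcomp Require Import all_boot all_order all_algebra.
From mathcomp Require Import freeg complex generic_quotient ring lra.
From mathcomp Require Import all_classical all_reals topology normedtype.
From mathcomp Require Import homotopy.
Set Implicit Arguments.
Unset Strict Implicit.
Unset Printing Implicit Defensive.
Import Order.TTheory GRing.Theory Num.Theory.
Import numFieldNormedType.Exports.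
Local Open Scope classical_set_scope.
Local Open Scope ring_scope.

Section FreeGroup.
Variable r : nat.

(* (i, true) stands for x_i and (i, false) for x_i^-1. *)
Definition letter : Type := ('I_r * bool)%type.
HB.instance Definition _ := Choice.on letter.

Definition letter_inv (a : letter) : letter := (a.1, ~~ a.2).

Definition reduced_word (w : seq letter) : bool :=
  sorted (fun a b => b != letter_inv a) w.

Record free_group := FreeGroup {
  free_word :> seq letter;
  free_wordP : reduced_word free_word }.

HB.instance Definition _ := [isSub for free_word].
HB.instance Definition _ := [Choice of free_group by <:].

Definition letter_mul (a : letter) (w : seq letter) : seq letter :=
  if w is b :: w' then (if b == letter_inv a then w' else a :: w) else [:: a].

Definition word_mul (u w : seq letter) : seq letter := foldr letter_mul w u.

Definition word_inv (w : seq letter) : seq letter := rev (map letter_inv w).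

Lemma letter_invK : involutive letter_inv.
Proof. by case=> i b; rewrite /letter_inv /= negbK. Qed.

Lemma letter_mul_reduced a w : reduced_word w -> reduced_word (letter_mul a w).
Proof.
case: w => [|b w] //=.
case: ifPn => [_|nab /= ->]; last by rewrite nab.
exact: path_sorted.
Qed.

Lemma word_mul_reduced u w : reduced_word w -> reduced_word (word_mul u w).
Proof. by elim: u => //= a u IH /IH; apply: letter_mul_reduced. Qed.

Lemma word_inv_reduced w : reduced_word w -> reduced_word (word_inv w).
Proof.
rewrite /reduced_word /word_inv rev_sorted sorted_map.
congr (sorted _ _ = true); do 2!apply: funext => ?.
by rewrite /= letter_invK eq_sym (can2_eq letter_invK letter_invK).
Qed.

Lemma letter_mulK a w : reduced_word w ->
  letter_mul a (letter_mul (letter_inv a) w) = w.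
Proof.
case: w => [|b w] /=; first by rewrite eqxx.
rewrite letter_invK; case: ifPn => [/eqP ->|nba _ /=]; last by rewrite eqxx.
by case: w => [|c w] //= /andP[/negPf ->].
Qed.

Lemma word_mulA u v w : reduced_word w ->
  word_mul u (word_mul v w) = word_mul (word_mul u v) w.
Proof.
move=> rw; elim: u => //= a u ->.
case: (word_mul u v) => [|b t] //=; case: ifPn => // /eqP ->.
by rewrite letter_mulK // word_mul_reduced.
Qed.

Lemma word_mulw1 w : reduced_word w -> word_mul w [::] = w.
Proof.
elim: w => //= a w IH p.
rewrite IH; last exact: path_sorted p.
by case: w p {IH} => //= b w /andP[/negPf ->].
Qed.

Lemma word_mulVK w v : reduced_word v ->
  word_mul w (word_mul (word_inv w) v) = v.
Proof.
elim: w v => //= a w IH v rv.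
rewrite /word_inv /= rev_cons -cats1 /word_mul foldr_cat /= -/(word_inv w).
by rewrite -/(word_mul _ _) -/(word_mul _ _) IH ?letter_mul_reduced // letter_mulK.
Qed.

Lemma word_invK : involutive word_inv.
Proof. by move=> w; rewrite /word_inv map_rev revK mapK //; exact: letter_invK. Qed.

Lemma word_mulV w : reduced_word w -> word_mul w (word_inv w) = [::].
Proof.
by move=> rw; rewrite -[X in word_mul _ X]word_mulw1 ?word_mulVK ?word_inv_reduced.
Qed.

Definition free_one : free_group := FreeGroup (isT : reduced_word [::]).
Definition free_inv (f : free_group) : free_group :=
  FreeGroup (word_inv_reduced (free_wordP f)).
Definition free_mul (f g : free_group) : free_group :=
  FreeGroup (word_mul_reduced f (free_wordP g)).

Fact free_mulA : associative free_mul.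
Proof. by move=> f g h; apply/val_inj/word_mulA/free_wordP. Qed.
Fact free_mul1 : left_id free_one free_mul.
Proof. by move=> f; apply/val_inj. Qed.
Fact free_mulr1 : right_id free_one free_mul.
Proof. by move=> f; apply/val_inj/word_mulw1/free_wordP. Qed.
Fact free_mulV : right_inverse free_one free_inv free_mul.
Proof. by move=> f; apply/val_inj/word_mulV/free_wordP. Qed.
Fact free_mulVl : left_inverse free_one free_inv free_mul.
Proof.
move=> f; apply/val_inj; rewrite /= -[X in word_mul _ X]word_invK.
exact/word_mulV/word_inv_reduced/free_wordP.
Qed.

HB.instance Definition _ := isGroup.Build free_group
  free_mulA free_mul1 free_mulr1 free_mulVl free_mulV.

Definition free_gen (i : 'I_r) : free_group :=
  FreeGroup (isT : reduced_word [:: (i, true)]).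

End FreeGroup.

Section Fox.
Variable r : nat.

(* F_r^ab is identified with Z^r, so that {freeg 'rV[int]_r / int} is the
   group ring Z[F_r^ab]; its product is only needed in the form of the
   translation action of F_r^ab. *)
Definition letter_ab (a : letter r) : 'rV[int]_r :=
  if a.2 then delta_mx 0 a.1 else - delta_mx 0 a.1.

Definition free_ab (f : free_group r) : 'rV[int]_r := \sum_(a <- f) letter_ab a.

Definition translate (t : 'rV[int]_r) :
    {freeg 'rV[int]_r / int} -> {freeg 'rV[int]_r / int} :=
  fglift (fun k => << t + k >>).

(* D_i (x_j) = delta_ij forces D_i (x_j^-1) = - delta_ij x_j^-1. *)
Definition fox_letter (i : 'I_r) (a : letter r) : {freeg 'rV[int]_r / int} :=
  if a.1 == i then (if a.2 then << 0 >> else - << letter_ab a >>) else 0.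

Definition fox_word (i : 'I_r) (w : seq (letter r)) : {freeg 'rV[int]_r / int} :=
  foldr (fun a D => fox_letter i a + translate (letter_ab a) D) 0 w.

Definition fox (i : 'I_r) (f : free_group r) : {freeg 'rV[int]_r / int} :=
  fox_word i f.

Lemma translateB t : {morph translate t : D E / D - E}.
Proof. by move=> D E; rewrite /translate (@lift_is_additive int). Qed.

Lemma translate0 t : translate t 0 = 0.
Proof. by have := translateB t 0 0; rewrite !subrr. Qed.

Lemma translateN t : {morph translate t : D / - D}.
Proof. by move=> D; rewrite -sub0r translateB translate0 sub0r. Qed.

Lemma translateD t : {morph translate t : D E / D + E}.
Proof. by move=> D E; rewrite -[E]opprK translateB !translateN opprK. Qed.

Lemma translateU t n k : translate t << n *g k >> = << n *g t + k >>.
Proof.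
rewrite /translate liftU.
by apply/eqP/freeg_eqP => x; rewrite coeffZ !coeffU mul1r.
Qed.

Lemma translate_sum t I (s : seq I) (F : I -> {freeg 'rV[int]_r / int}) :
  translate t (\sum_(j <- s) F j) = \sum_(j <- s) translate t (F j).
Proof. exact: (big_morph _ (translateD t) (translate0 t)). Qed.

Lemma translate_translate s t D :
  translate s (translate t D) = translate (s + t) D.
Proof.
rewrite -[D in LHS]freeg_sumE -[D in RHS]freeg_sumE !translate_sum.
by apply: eq_bigr => k _; rewrite !translateU addrA.
Qed.

Lemma translate_0 D : translate 0 D = D.
Proof.
rewrite -[D in LHS]freeg_sumE -[D in RHS]freeg_sumE translate_sum.
by apply: eq_bigr => k _; rewrite !translateU add0r.
Qed.

Lemma letter_ab_inv a : letter_ab (letter_inv a) = - letter_ab a.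
Proof. by case: a => i []; rewrite /letter_ab /= ?opprK. Qed.

Lemma fox_letter_inv i a :
  fox_letter i a + translate (letter_ab a) (fox_letter i (letter_inv a)) = 0.
Proof.
rewrite /fox_letter letter_ab_inv /=; case: ifP => _; last first.
  by rewrite translate0 addr0.
case: a.2 => /=; last by rewrite translateU addr0 addNr.
by rewrite translateN translateU subrr subrr.
Qed.

Lemma fox_letter_mul i a w : fox_word i (letter_mul a w) =
  fox_letter i a + translate (letter_ab a) (fox_word i w).
Proof.
case: w => [|b w] //=; case: ifPn => // /eqP ->.
rewrite translateD addrA fox_letter_inv add0r translate_translate.
by rewrite letter_ab_inv subrr translate_0.
Qed.

Lemma free_abM (f g : free_group r) :
  free_ab (f * g)%g = free_ab f + free_ab g.
Proof.
rewrite /free_ab /=; elim: (free_word f) => /= [|a u IH]; first by rewrite big_nil add0r.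
rewrite big_cons -addrA -IH.
case: (word_mul u g) => [|b t] /=; first by rewrite big_seq1 big_nil addr0.
case: ifPn => [/eqP ->|_]; rewrite !big_cons //.
by rewrite letter_ab_inv addrA subrr add0r.
Qed.

Lemma fox_gen (i j : 'I_r) : fox i (free_gen j) = if j == i then << 0 >> else 0.
Proof. by rewrite /fox /= translate0 addr0. Qed.

Lemma foxM (i : 'I_r) (f g : free_group r) :
  fox i (f * g)%g = fox i f + translate (free_ab f) (fox i g).
Proof.
rewrite /fox /free_ab /=; elim: (free_word f) => /= [|a u IH].
  by rewrite big_nil translate_0 add0r.
by rewrite fox_letter_mul IH translateD translate_translate big_cons addrA.
Qed.

End Fox.

Section AlexanderVariety.
Variable C : fieldType.

Definition normal_subgroup (G : groupType) (N : set G) : Prop :=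
  [/\ N 1%g, forall g h, N g -> N h -> N (g * h)%g,
      forall g, N g -> N (g^-1)%g & forall g h, N g -> N (g ^ h)%g].

Definition normal_closure (G : groupType) (A : set G) : set G :=
  \bigcap_(N in [set N | normal_subgroup N /\ A `<=` N]) N.

(* G = < F_r | rel_0, ..., rel_(s-1) >, the quotient map being [pi]. *)
Definition presentation (r s : nat) (rel : 'I_s -> free_group r)
    (G : groupType) (pi : free_group r -> G) : Prop :=
  [/\ {morph pi : f g / (f * g)%g}, forall g, exists f, pi f = g
    & pi @^-1` [set 1%g] = normal_closure (range rel)].

Definition character (G : groupType) (chi : G -> C) : Prop :=
  (forall g, chi g != 0) /\ {morph chi : g h / (g * h)%g >-> g * h}.

(* The value of a Laurent polynomial in Z[Z^r] at a point of (C^* )^r. *)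
Definition laurent_eval (r : nat) (z : 'rV[C]_r) (D : {freeg 'rV[int]_r / int}) : C :=
  \sum_(a <- dom D) (coeff a D)%:~R * \prod_k z 0 k ^ a 0 k.

(* If z = (chi x_1, ..., chi x_r), then evaluation at z is the composition
   of Z[F_r^ab] -> Z[G^ab] with chi : Z[G^ab] -> C. *)
Definition alexander_matrix (r s : nat) (rel : 'I_s -> free_group r)
    (z : 'rV[C]_r) : 'M[C]_(r, s) :=
  \matrix_(i, j) laurent_eval z (fox i (rel j)).

Definition alexander_variety (i r s : nat) (rel : 'I_s -> free_group r)
    (G : groupType) (pi : free_group r -> G) : set 'rV[C]_r :=
  [set z | exists chi : G -> C, [/\ character chi,
     z = \row_k chi (pi (free_gen k))
   & (\rank (alexander_matrix rel z) < r - i)%N]].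

Definition torsion_point (r : nat) : set 'rV[C]_r :=
  [set z | exists2 n, (0 < n)%N & forall k, z 0 k ^+ n = 1].

End AlexanderVariety.

Arguments character C {G} chi.
Arguments alexander_variety C i {r s} rel {G} pi.
Arguments torsion_point C r : clear implicits.

Section UnitInterval.
Variable R : realType.

Definition I01 : Type := set_type `[0 : R, 1]%classic.
HB.instance Definition _ := Topological.on I01.

Fact clamp_subproof (t : R) :
  Num.max 0 (Num.min t 1) \in (`[0, 1]%classic : set R).
Proof.
by rewrite inE /= in_itv /= le_max lexx /= ge_max ler01 /= ge_min lexx orbT.
Qed.
Definition clamp (t : R) : I01 :=
  exist (fun x => x \in `[0, 1]%classic) _ (clamp_subproof t).

Lemma I01P (t : I01) : 0 <= \val t <= 1.
Proof. by have := valP t; rewrite inE /= in_itv. Qed.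

Lemma clampK (t : I01) : clamp (\val t) = t.
Proof.
by apply: val_inj; have /andP[t0 t1] := I01P t; rewrite /= (min_idPl t1) (max_idPr t0).
Qed.

Lemma val_clamp (t : R) : 0 <= t <= 1 -> \val (clamp t) = t.
Proof. by case/andP=> t0 t1; rewrite /= (min_idPl t1) (max_idPr t0). Qed.

Lemma I01_val_continuous : continuous (\val : I01 -> R).
Proof. exact: initial_continuous. Qed.

Lemma cts_min (T : topologicalType) (f g : T -> R) :
  continuous f -> continuous g -> continuous (fun x => Num.min (f x) (g x)).
Proof. by move=> cf cg x; exact: (continuous_min (cf x) (cg x)). Qed.

Lemma cts_max (T : topologicalType) (f g : T -> R) :
  continuous f -> continuous g -> continuous (fun x => Num.max (f x) (g x)).
Proof. by move=> cf cg x; exact: (continuous_max (cf x) (cg x)). Qed.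

Lemma cts_add (T : topologicalType) (f g : T -> R) :
  continuous f -> continuous g -> continuous (fun x => f x + g x).
Proof. by move=> cf cg x; apply: continuousD; [exact: cf|exact: cg]. Qed.

Lemma cts_opp (T : topologicalType) (f : T -> R) :
  continuous f -> continuous (fun x => - f x).
Proof. by move=> cf x; apply: continuousN; exact: cf. Qed.

Lemma cts_mul (T : topologicalType) (f g : T -> R) :
  continuous f -> continuous g -> continuous (fun x => f x * g x).
Proof. by move=> cf cg x; apply: continuousM; [exact: cf|exact: cg]. Qed.

Lemma cts_const (T U : topologicalType) (c : U) : continuous (fun _ : T => c).
Proof. by move=> x; exact: cst_continuous. Qed.

Lemma cts_comp (T U V : topologicalType) (f : U -> V) (g : T -> U) :
  continuous f -> continuous g -> continuous (fun x => f (g x)).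
Proof. by move=> cf cg x; apply: continuous_comp; [exact: cg|exact: cf]. Qed.

Lemma cts_pair (T U V : topologicalType) (f : T -> U) (g : T -> V) :
  continuous f -> continuous g -> continuous (fun x => (f x, g x)).
Proof. by move=> cf cg x; apply: cvg_pair; [exact: cf|exact: cg]. Qed.

Lemma clamp_continuous : continuous clamp.
Proof.
apply: continuous_comp_initial; apply: cts_max; first exact: cts_const.
by apply: cts_min; [move=> x; exact: cvg_id|exact: cts_const].
Qed.

Lemma cts_paste (T U : topologicalType) (a : T -> R) (c : R) (F G : T -> U) :
  continuous a -> continuous F -> continuous G ->
  (forall x, a x = c -> F x = G x) ->
  continuous (fun x => if a x <= c then F x else G x).
Proof.
move=> ca cF cG FG; apply/continuous_subspace_setT.
have -> : [set: T] = (a @^-1` [set t | t <= c]) `|` (a @^-1` [set t | c <= t]).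
  by apply/seteqP; split=> // x _ /=; case: (leP (a x) c) => [|/ltW]; [left|right].
have clA : closed (a @^-1` [set t | t <= c]).
  by apply: closed_comp; [by move=> x _; exact: ca|exact: closed_le].
have clB : closed (a @^-1` [set t | c <= t]).
  by apply: closed_comp; [by move=> x _; exact: ca|exact: closed_ge].
apply: withinU_continuous => //.
- apply: (@subspace_eq_continuous _ _ _ F); last exact: continuous_subspaceT.
  by move=> x; rewrite inE /= => ac; rewrite /from_subspace /= ac.
- have cG' : {within a @^-1` [set t | c <= t], continuous G} by exact: continuous_subspaceT.
  have GE : {in a @^-1` [set t | c <= t], G =1 (fun x => if a x <= c then F x else G x)}.
    move=> z; rewrite inE /= => cx; case: ifP => // xc.
    by rewrite FG //; apply/eqP; rewrite eq_le xc cx.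
  exact: (subspace_eq_continuous GE cG').
Qed.

Fact I01_zero_neq_one : clamp 0 != clamp 1.
Proof.
apply/eqP => /(congr1 val) /eqP.
by rewrite !val_clamp ?lexx ?ler01 //= eq_sym oner_eq0.
Qed.
HB.instance Definition _ := @isBiPointed.Build I01 (clamp 0) (clamp 1) I01_zero_neq_one.


Lemma I01_zero : \val (zero : I01) = 0.
Proof. by apply: val_clamp; rewrite lexx ler01. Qed.
Lemma I01_one : \val (one : I01) = 1.
Proof. by apply: val_clamp; rewrite lexx ler01. Qed.

End UnitInterval.

Section FundamentalGroup.
Variables (R : realType) (Y : topologicalType) (y : Y).
Notation I01 := (I01 R).
Notation loop := {path I01 from y to y in Y}.
Notation val := (\val : I01 -> R).

Definition homotopic (f g : loop) : Prop :=
  exists2 H : I01 * I01 -> Y, continuous H &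
    (forall s, H (s, zero) = f s /\ H (s, one) = g s) /\
    (forall t, H (zero, t) = y /\ H (one, t) = y).

Definition loop_cat_fun (f g : loop) (s : I01) : Y :=
  if val s <= 2^-1 then f (clamp (2 * val s)) else g (clamp (2 * val s - 1)).
Definition loop_inv_fun (f : loop) (s : I01) : Y := f (clamp (1 - val s)).

Lemma loop_continuous (f : loop) : continuous f.
Proof. exact: cts_fun. Qed.

Local Ltac cont := lazymatch goal with
  | |- continuous (fun x => @?a x + @?b x) => apply: (@cts_add R _ a b); cont
  | |- continuous (fun x => - (@?a x)) => apply: (@cts_opp R _ a); cont
  | |- continuous (fun x => @?a x * @?b x) => apply: (@cts_mul R _ a b); cont
  | |- continuous (fun x => Num.min (@?a x) (@?b x)) => apply: (@cts_min R _ a b); cont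
  | |- continuous (fun x => Num.max (@?a x) (@?b x)) => apply: (@cts_max R _ a b); cont
  | |- continuous (fun x => (@?a x, @?b x)) => apply: (@cts_pair _ _ _ a b); cont
  | |- continuous (fun x => clamp (@?a x)) =>
      apply: (@cts_comp _ _ _ _ a (@clamp_continuous R)); cont
  | _ => first [ assumption | exact: cts_const
               | move=> ?; exact: cvg_fst | move=> ?; exact: cvg_snd
               | move=> ?; exact: cvg_id | exact: I01_val_continuous
               | by apply: (cts_comp (@I01_val_continuous R)) => ?; exact: cvg_fst
               | by apply: (cts_comp (@I01_val_continuous R)) => ?; exact: cvg_snd ]
  end.

Fact loop_cat_continuous f g : continuous (loop_cat_fun f g).
Proof.
apply: (cts_paste (@I01_val_continuous R)).
- by apply: (cts_comp (@loop_continuous f)); cont.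
- by apply: (cts_comp (@loop_continuous g)); cont.
move=> s ->; rewrite divff ?pnatr_eq0 // subrr.
by rewrite -/(one : I01) -/(zero : I01) path_one path_zero.
Qed.

Fact loop_cat_zero f g : loop_cat_fun f g zero = y.
Proof.
rewrite /loop_cat_fun I01_zero invr_ge0 ler0n mulr0.
by rewrite -/(zero : I01) path_zero.
Qed.

Fact loop_cat_one f g : loop_cat_fun f g one = y.
Proof.
rewrite /loop_cat_fun I01_one ifF; last by apply/negbTE; rewrite -ltNge; lra.
by rewrite mulr1 -natr1 addrK -/(one : I01) path_one.
Qed.

Definition loop_cat (f g : loop) : loop :=
  mk_path (@loop_cat_continuous f g) (loop_cat_zero f g) (loop_cat_one f g).

Fact loop_inv_continuous f : continuous (loop_inv_fun f).
Proof.
rewrite /loop_inv_fun; apply: (cts_comp (@loop_continuous f)).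
apply: (cts_comp (@clamp_continuous R)).
move=> s; apply: continuousB; [exact: cts_const|exact: I01_val_continuous].
Qed.

Fact loop_inv_zero f : loop_inv_fun f zero = y.
Proof. by rewrite /loop_inv_fun I01_zero subr0 -/(one : I01) path_one. Qed.

Fact loop_inv_one f : loop_inv_fun f one = y.
Proof. by rewrite /loop_inv_fun I01_one subrr -/(zero : I01) path_zero. Qed.

Definition loop_inv (f : loop) : loop :=
  mk_path (@loop_inv_continuous f) (loop_inv_zero f) (loop_inv_one f).

Lemma loop_catE f g s : loop_cat f g s =
  if val s <= 2^-1 then f (clamp (2 * val s)) else g (clamp (2 * val s - 1)).
Proof. by []. Qed.

Lemma loop_invE f s : loop_inv f s = f (clamp (1 - val s)).
Proof. by []. Qed.

Definition loop_const : loop :=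
  mk_path (@cts_const I01 Y y) erefl erefl.

Lemma homotopic_reparam (f g h : loop) (phi psi : I01 -> R) :
  continuous phi -> continuous psi ->
  phi zero = psi zero -> phi one = psi one ->
  (forall s, g s = f (clamp (phi s))) -> (forall s, h s = f (clamp (psi s))) ->
  homotopic g h.
Proof.
move=> cphi cpsi e0 e1 gE hE.
exists (fun st => f (clamp (phi st.1 + val st.2 * (psi st.1 + (-1) * phi st.1)))).
  apply: (cts_comp (@loop_continuous f)).
  have c1 : continuous (fun st : I01 * I01 => phi st.1).
    by apply: (cts_comp cphi) => ?; exact: cvg_fst.
  have c2 : continuous (fun st : I01 * I01 => psi st.1).
    by apply: (cts_comp cpsi) => ?; exact: cvg_fst.
  by cont.
split=> [s|t]; cbn [fst snd].
  by rewrite I01_zero I01_one mul0r addr0 mul1r mulN1r addrC subrK hE gE.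
rewrite -e0 -e1 !mulN1r !subrr mulr0 !addr0 -!gE.
by rewrite path_zero path_one.
Qed.

Lemma homotopic_refl f : homotopic f f.
Proof.
apply: (@homotopic_reparam f _ _ val val) => // [||s|s].
- exact: I01_val_continuous.
- exact: I01_val_continuous.
- by rewrite clampK.
- by rewrite clampK.
Qed.

Lemma homotopic_sym f g : homotopic f g -> homotopic g f.
Proof.
case=> H cH [Hfg Hy].
exists (fun st => H (st.1, clamp (1 + (-1) * val st.2))).
  by apply: (cts_comp cH); cont.
split=> [s|t]; cbn [fst snd]; last by split; apply Hy.
rewrite I01_zero I01_one mulr0 addr0 mulr1 subrr.
by rewrite -/(one : I01) -/(zero : I01); split; apply Hfg.
Qed.

Lemma homotopic_trans f g h : homotopic f g -> homotopic g h -> homotopic f h.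
Proof.
case=> H cH [Hfg Hy] [K cK [Kgh Ky]].
exists (fun st => if val st.2 <= 2^-1 then H (st.1, clamp (2 * val st.2))
                  else K (st.1, clamp (2 * val st.2 + (- 1)))).
  apply: (@cts_paste _ _ _ (fun st : I01 * I01 => val st.2)
    _ (fun st => H (st.1, clamp (2 * val st.2)))
    (fun st => K (st.1, clamp (2 * val st.2 + (-1))))).
  - by cont.
  - by apply: (cts_comp cH); cont.
  - by apply: (cts_comp cK); cont.
  move=> st ->; rewrite divff ?pnatr_eq0 // subrr.
  by rewrite -/(one : I01) -/(zero : I01) (Hfg _).2 (Kgh _).1.
split=> [s|t]; cbn [fst snd]; last by case: ifP => _; [exact: Hy|exact: Ky].
rewrite I01_zero I01_one invr_ge0 ler0n mulr0.
rewrite [1 <= _]lt_geF; last by lra.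
rewrite mulr1 -natr1 addrK.
by rewrite -/(one : I01) -/(zero : I01) (Hfg _).1 (Kgh _).2.
Qed.

Lemma homotopic_cat f f' g g' : homotopic f f' -> homotopic g g' ->
  homotopic (loop_cat f g) (loop_cat f' g').
Proof.
case=> H cH [Hff Hy] [K cK [Kgg Ky]].
exists (fun st => if val st.1 <= 2^-1 then H (clamp (2 * val st.1), st.2)
                  else K (clamp (2 * val st.1 - 1), st.2)).
  apply: (@cts_paste _ _ _ (fun st : I01 * I01 => val st.1)
    _ (fun st => H (clamp (2 * val st.1), st.2))
    (fun st => K (clamp (2 * val st.1 - 1), st.2))).
  - by cont.
  - by apply: (cts_comp cH); cont.
  - by apply: (cts_comp cK); cont.
  move=> st ->; rewrite divff ?pnatr_eq0 // subrr.
  by rewrite -/(one : I01) -/(zero : I01) (Hy _).2 (Ky _).1.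
split=> [s|t]; cbn [fst snd].
  rewrite !loop_catE.
  by case: ifP => _; split; rewrite ?(Hff _).1 ?(Hff _).2 ?(Kgg _).1 ?(Kgg _).2.
rewrite I01_zero I01_one invr_ge0 ler0n mulr0.
rewrite [1 <= _]lt_geF; last by lra.
rewrite mulr1 -natr1 addrK.
by rewrite -/(one : I01) -/(zero : I01) (Hy _).1 (Ky _).2.
Qed.

Lemma homotopic_inv f f' : homotopic f f' -> homotopic (loop_inv f) (loop_inv f').
Proof.
case=> H cH [Hff Hy].
exists (fun st => H (clamp (1 + (-1) * val st.1), st.2)).
  by apply: (cts_comp cH); cont.
split=> [s|t]; cbn [fst snd].
  by rewrite !loop_invE mulN1r (Hff _).1 (Hff _).2.
rewrite I01_zero I01_one mulr0 addr0 mulr1 subrr.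
by rewrite -/(one : I01) -/(zero : I01); split; apply Hy.
Qed.

Lemma loop_cat_constl f : homotopic (loop_cat loop_const f) f.
Proof.
apply: (@homotopic_reparam f _ _ (fun s => Num.max 0 (2 * val s - 1)) val).
- by cont.
- by cont.
- by rewrite I01_zero mulr0 sub0r max_l // lerN10.
- by rewrite I01_one mulr1 -natr1 addrK max_r.
- move=> s; rewrite !loop_catE.
  case: ifPn => [sh|]; last first.
    by rewrite -ltNge => sh; rewrite max_r //; lra.
  rewrite max_l; last by lra.
  by rewrite -/(zero : I01) path_zero.
- by move=> s; rewrite clampK.
Qed.

Lemma loop_cat_constr f : homotopic (loop_cat f loop_const) f.
Proof.
apply: (@homotopic_reparam f _ _ (fun s => Num.min 1 (2 * val s)) val).
- by cont.
- by cont.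
- by rewrite I01_zero mulr0 min_r // ler01.
- by rewrite I01_one mulr1 min_l // ler1n.
- move=> s; rewrite !loop_catE.
  case: ifPn => [sh|]; first by rewrite min_r //; lra.
  rewrite -ltNge => sh; rewrite min_l; last by lra.
  by rewrite -/(one : I01) path_one.
- by move=> s; rewrite clampK.
Qed.

Lemma loop_cat_inv f : homotopic (loop_cat f (loop_inv f)) loop_const.
Proof.
apply: (@homotopic_reparam f _ _
  (fun s => Num.min (2 * val s) (2 + (-2) * val s)) (fun=> 0)).
- by cont.
- by cont.
- by rewrite I01_zero !mulr0 addr0 min_l // ler0n.
- by rewrite I01_one !mulr1 subrr min_r // ler0n.
- move=> s; rewrite !loop_catE.
  case: ifPn => [sh|]; first by rewrite min_l //; lra.
  rewrite -ltNge => sh; rewrite min_r; last by lra.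
  have /andP[s0 s1] := I01P s.
  rewrite !loop_invE val_clamp; last by apply/andP; split; lra.
  by congr (f (clamp _)); lra.
- by move=> s; rewrite -/(zero : I01) path_zero.
Qed.

Lemma loop_invK f : loop_inv (loop_inv f) = f.
Proof.
apply/path_eqP => s; have /andP[s0 s1] := I01P s.
rewrite !loop_invE val_clamp; last by apply/andP; split; lra.
by rewrite opprB addrC subrK clampK.
Qed.

Lemma loop_catA f g h :
  homotopic (loop_cat f (loop_cat g h)) (loop_cat (loop_cat f g) h).
Proof.
apply: homotopic_sym.
apply: (@homotopic_reparam (loop_cat f (loop_cat g h)) _ _
  (fun s => Num.min (2 * val s) (Num.min (val s + 4^-1) (2^-1 * val s + 2^-1)))
  val).
- by cont.
- by cont.
- by rewrite I01_zero !mulr0 !add0r min_l // le_min !invr_ge0 !ler0n.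
- by rewrite I01_one !mulr1 minA min_r; [lra|rewrite le_min; apply/andP; split; lra].
- move=> s; have /andP[s0 s1] := I01P s.
  rewrite !loop_catE.
  case: ifPn => [sh|]; last first.
    rewrite -ltNge => sh; rewrite minA min_r; last by rewrite le_min; apply/andP; split; lra.
    rewrite val_clamp; last by apply/andP; split; lra.
    rewrite ifF; last by apply/negbTE; rewrite -ltNge; lra.
    rewrite val_clamp; last by apply/andP; split; lra.
    rewrite ifF; last by apply/negbTE; rewrite -ltNge; lra.
    by congr (h (clamp _)); lra.
  rewrite val_clamp; last by apply/andP; split; lra.
  case: ifPn => [sq|].
    rewrite min_l; last by rewrite le_min; apply/andP; split; lra.
    rewrite val_clamp; last by apply/andP; split; lra.
    by rewrite sq.
  rewrite -ltNge => sq.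
  rewrite min_r; last by rewrite ge_min; apply/orP; left; lra.
  rewrite min_l; last by lra.
  rewrite val_clamp; last by apply/andP; split; lra.
  rewrite ifF; last by apply/negbTE; rewrite -ltNge; lra.
  rewrite val_clamp; last by apply/andP; split; lra.
  rewrite ifT; last by lra.
  by congr (g (clamp _)); lra.
- by move=> s; rewrite clampK.
Qed.

Definition homotopicb (f g : loop) : bool := `[< homotopic f g >].

Fact homotopicb_refl : reflexive homotopicb.
Proof. by move=> f; apply/asboolP/homotopic_refl. Qed.
Fact homotopicb_sym : symmetric homotopicb.
Proof. by move=> f g; apply/asboolP/asboolP; exact: homotopic_sym. Qed.
Fact homotopicb_trans : transitive homotopicb.
Proof. by move=> g f h /asboolP fg /asboolP gh; apply/asboolP/(homotopic_trans fg). Qed.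

Canonical homotopic_equiv :=
  EquivRel homotopicb homotopicb_refl homotopicb_sym homotopicb_trans.

Local Open Scope quotient_scope.

Definition pi1 : Type := {eq_quot homotopicb}.
HB.instance Definition _ := Choice.on pi1.
HB.instance Definition _ := EqQuotient.on pi1.

Definition loop_class (f : loop) : pi1 := \pi_pi1 f.

Lemma loop_classP f g : loop_class f = loop_class g <-> homotopic f g.
Proof.
by split=> [/eqquotP/asboolP //|fg]; apply/eqquotP/asboolP.
Qed.

Lemma loop_class_repr (a : pi1) : loop_class (repr a) = a.
Proof. exact: reprK. Qed.

Lemma repr_loop_class f : homotopic (repr (loop_class f)) f.
Proof. by apply/loop_classP; rewrite loop_class_repr. Qed.

Definition pi1_one : pi1 := loop_class loop_const.
Definition pi1_mul (a b : pi1) : pi1 := loop_class (loop_cat (repr a) (repr b)).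
Definition pi1_inv (a : pi1) : pi1 := loop_class (loop_inv (repr a)).

Lemma pi1_mulE f g : pi1_mul (loop_class f) (loop_class g) = loop_class (loop_cat f g).
Proof. by apply/loop_classP/homotopic_cat; exact: repr_loop_class. Qed.

Lemma pi1_invE f : pi1_inv (loop_class f) = loop_class (loop_inv f).
Proof. by apply/loop_classP/homotopic_inv/repr_loop_class. Qed.

Fact pi1_mulA : associative pi1_mul.
Proof.
move=> a b c; rewrite -(loop_class_repr a) -(loop_class_repr b) -(loop_class_repr c).
by rewrite !pi1_mulE; apply/loop_classP/loop_catA.
Qed.
Fact pi1_mul1 : left_id pi1_one pi1_mul.
Proof.
by move=> a; rewrite -(loop_class_repr a) pi1_mulE; apply/loop_classP/loop_cat_constl.
Qed.
Fact pi1_mulr1 : right_id pi1_one pi1_mul.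
Proof.
by move=> a; rewrite -(loop_class_repr a) pi1_mulE; apply/loop_classP/loop_cat_constr.
Qed.
Fact pi1_mulV : right_inverse pi1_one pi1_inv pi1_mul.
Proof.
move=> a; rewrite -(loop_class_repr a) pi1_invE pi1_mulE.
exact/loop_classP/loop_cat_inv.
Qed.
Fact pi1_mulVl : left_inverse pi1_one pi1_inv pi1_mul.
Proof.
move=> a; rewrite -(loop_class_repr a) pi1_invE pi1_mulE -[X in loop_cat _ X]loop_invK.
exact/loop_classP/loop_cat_inv.
Qed.

HB.instance Definition _ := isGroup.Build pi1
  pi1_mulA pi1_mul1 pi1_mulr1 pi1_mulVl pi1_mulV.

End FundamentalGroup.
Arguments pi1 R {Y} y.

Section Disks.
Variable R : realType.

Definition closed_disk n : set 'rV[R]_n := [set v | \sum_i v 0 i ^+ 2 <= 1].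
Definition open_disk n : set 'rV[R]_n := [set v | \sum_i v 0 i ^+ 2 < 1].
Definition sphere n : set 'rV[R]_n := [set v | \sum_i v 0 i ^+ 2 = 1].

End Disks.
Arguments closed_disk R n : clear implicits.
Arguments open_disk R n : clear implicits.
Arguments sphere R n : clear implicits.

Section CWComplex.
Variables (R : realType) (X : topologicalType).

(* Whitehead's definition. The cells being finitely many, closure-finiteness
   and the weak topology are automatic, and so is the fact that each
   characteristic map restricts to a homeomorphism from the open disk to its
   cell (X being Hausdorff). *)
Definition finite_CW_complex : Prop :=
  hausdorff_space X /\
  exists (I : finType) (d : I -> nat) (Phi : forall i, 'rV[R]_(d i) -> X),
  let cell i := Phi i @` open_disk R (d i) in
  [/\ forall i, {within closed_disk R (d i), continuous (Phi i)},
      forall i, set_inj (open_disk R (d i)) (Phi i),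
      \bigcup_i cell i = [set: X],
      trivIset [set: I] cell
    & forall i, Phi i @` sphere R (d i) `<=`
                \bigcup_(j in [set j | (d j < d i)%N]) cell j].

End CWComplex.

Section Coverings.
Variables (Y X : topologicalType) (p : Y -> X).

(* Finite covering maps with connected total space; X is meant to be connected
   and nonempty. *)
Definition finite_cover : Prop :=
  [/\ continuous p, connected [set: Y]
    & forall x, exists (U : set X) (n : nat) (V : 'I_n.+1 -> set Y),
      [/\ open_nbhs x U, p @^-1` U = \bigcup_i V i, trivIset [set: 'I_n.+1] V
        & forall i, [/\ open (V i), set_bij (V i) U p
          & forall O, open O -> O `<=` V i -> open (p @` O)]]].

Definition deck_transformation (h : Y -> Y) : Prop :=
  [/\ continuous h, exists2 k, continuous k & cancel h k /\ cancel k h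
    & p \o h = p].

Definition finite_abelian_cover : Prop :=
  [/\ finite_cover,
      forall y y', p y = p y' -> exists2 h, deck_transformation h & h y = y'
    & forall h k, deck_transformation h -> deck_transformation k ->
        h \o k = k \o h].

End Coverings.

Section SingularHomology.
Variables (R : realType).

Definition std_simplex n : set 'rV[R]_n.+1 :=
  [set v | (forall i, 0 <= v 0 i) /\ \sum_i v 0 i = 1].

Arguments std_simplex n : clear implicits.

Definition face_vec n (i : 'I_n.+2) (v : 'rV[R]_n.+1) : 'rV[R]_n.+2 :=
  \row_j (if unlift i j is Some k then v 0 k else 0).

Fact face_vec_simplex n (i : 'I_n.+2) (v : set_type (std_simplex n)) :
  face_vec i (\val v) \in std_simplex n.+1.
Proof.
case: v => v vS; have [v0 v1] := set_mem vS; rewrite inE /=; split.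
  by move=> j; rewrite mxE; case: unliftP.
rewrite (bigD1_ord i) //= mxE unlift_none add0r -v1.
by apply: eq_bigr => k _; rewrite mxE liftK.
Qed.

Definition face_map n (i : 'I_n.+2) (v : set_type (std_simplex n)) :
    set_type (std_simplex n.+1) :=
  exist (fun v => v \in std_simplex n.+1) _ (face_vec_simplex i v).

Fact face_map_continuous n (i : 'I_n.+2) : continuous (@face_map n i).
Proof.
apply: continuous_comp_initial => v A [P Pv PA] /=.
suff H : \forall w \near v, forall k j, P k j (face_vec i (\val w) k j).
  by apply: filterS H => w Pw; apply: PA.
apply: (@filter_forall _ _
  (fun k w => forall j, P k j (face_vec i (\val w) k j)) (nbhs v)) => k.
apply: (@filter_forall _ _ (fun j w => P k j (face_vec i (\val w) k j)) (nbhs v)) => j.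
have {Pv} := Pv k j; rewrite /= mxE.
case: unliftP => [l ->|->] Pl; last first.
  by apply: nearW => w; rewrite mxE unlift_none; exact: nbhs_singleton.
have c : continuous (fun w : set_type (std_simplex n) => (\val w : 'rV[R]_n.+1) 0 l).
  move=> w; apply: (@continuous_comp _ _ _ (\val : set_type (std_simplex n) -> _)
    (fun M : 'rV[R]_n.+1 => M 0 l)); first exact: initial_continuous.
  exact: coord_continuous.
apply: (@filterS _ (nbhs v) _ _ _ _ (c v _ Pl)) => w /=.
by rewrite mxE liftK.
Qed.

HB.instance Definition _ n (i : 'I_n.+2) :=
  isContinuous.Build _ _ (@face_map n i) (@face_map_continuous n i).

Variable Y : topologicalType.

Definition singular_simplex n := continuousType (set_type (std_simplex n)) Y.

Definition singular_chain n := {freeg (singular_simplex n) / int}.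

Definition singular_face n (i : 'I_n.+2) (s : singular_simplex n.+1) :
  singular_simplex n := s \o @face_map n i.

Definition boundary n : singular_chain n.+1 -> singular_chain n :=
  fglift (fun s => \sum_(i < n.+2) (-1) ^+ i *: << singular_face i s >>).

(* b_1(Y) >= N: the abelian group H_1(Y; Z) contains N classes that are
   linearly independent over Z. *)
Definition betti1_ge (N : nat) : Prop :=
  exists z : 'I_N -> singular_chain 1, (forall i, boundary (z i) = 0) /\
    forall a : 'I_N -> int,
      (exists c : singular_chain 2, boundary c = \sum_i a i *: z i) ->
      forall i, a i = 0.

End SingularHomology.

Definition large (R : realType) (X : topologicalType) : Prop :=
  exists (Y : topologicalType) (p : Y -> X), finite_cover p /\
  exists (y : Y) (f : pi1 R y -> free_group 2),
    {morph f : a b / (a * b)%g} /\ forall w, exists a, f a = w.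

(* Main.v *)
(* (1) => (2).  Let [pi_1(Y)] surject onto the free group on [a], [b].  The
   action of [a] by rotation and of [b] trivially on [Z/n] gives a cyclic cover
   of [Y]; counting the letters [b] read at a given position of [Z/n] is a
   homomorphism to [Z], and these [n] homomorphisms are dual to the loops lifting
   [a^i b a^-i].

   (2) => (3).  Let [S] be the fibre of an abelian cover [Z] of [Y].  Every
   1-cycle of [Z] is homologous to a cycle of the graph with vertices [S] and
   edges [S * {x_1, .., x_r}], in which the lifted relators bound, so that
   [b_1(Z) <= |S| r - (|S| - 1) - rank D], where [D] is the matrix of the lifted
   relators.  Diagonalizing the deck group over [C] turns [D] into the block sum
   of the [M(chi)], where [chi] runs through [|S|] distinct torsion characters.
   If only [m] torsion characters are in [V_1], then [b_1(Z) <= 1 + m r].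

   (3) => (1).  Let [z] in [V_1] be a torsion point of large order [N], say
   [z_i = zeta^(a_i)], and let [x_i] act on [Z/N] by translation by [a_i].  All
   Galois conjugates of [z] lie in [V_1], so the space of 1-cocycles on the graph
   with vertices [Z/N] has dimension at least [N + phi(N) - 1].  By Dirichlet's
   theorem some [k] makes all [k a_i] modulo [N] small compared to [phi(N)]; hence
   [v |-> k v] maps the graph to a circle with short steps, and removing the
   vertices over two short arcs of the circle cuts the graph into two halves,
   exchanged by a translation, which no relator joins.  There are more cocycles
   than vertices even among those vanishing near the removed vertices, so some
   integral cocycle has a nonzero period on a component of one half.  It and its
   translate to the other half never meet along a relator; adding two cyclic
   counters that they drive makes their carries a homomorphism onto a free group
   of rank two. *)
From HB Require Import structures.
Require Import Defs.
From mathcomp Require Import all_boot all_order all_algebra.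
From mathcomp Require Import finmap freeg complex generic_quotient zify ring lra.
From mathcomp Require Import all_classical all_reals topology normedtype.
From mathcomp Require Import homotopy realfun.
From mathcomp Require separable cyclotomic cyclic algC.
Set Implicit Arguments.
Unset Strict Implicit.
Unset Printing Implicit Defensive.
Import Order.TTheory GRing.Theory Num.Theory.
Import numFieldNormedType.Exports.
Local Open Scope classical_set_scope.
Local Open Scope ring_scope.

(** * Path homotopy *)

Section PathHomotopy.
Variable R : realType.

(** Of the complex, Hausdorffness, compactness and local contractibility are kept. They yield a good
    cover, whose nerve presents the fundamental group; covers are then glued from charts by actions
    on sets. After this translation the group theory lives on a graph with vertex set [S], and a
    homomorphism to a free group is a labelling of edges with trivial product along every relator.

    The delicate point is quantitative. The cocycles outnumber the vertices by about phi(N), while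
    each removed vertex costs up to 2 r dimensions, and phi(N) / N is not bounded below. With omega
    prime divisors, phi(N) (omega + 1) >= N, so the removed arcs must have proportion below a
    constant over omega + 1. An approximation with [q] proportional to omega + 1 requires q^r < N;
    this holds for large N because N >= 2^omega.

    Two integral periods alone give a map to an abelian group. The two counters turn the fact that
    the supports never meet along a relator into freeness: each counter registers carries only while
    the other one is at zero. *)

Definition cl01 (t : R) : R := Num.max 0 (Num.min t 1).

Lemma cl01_in t : 0 <= cl01 t <= 1.
Proof. by rewrite /cl01 le_max lexx /= ge_max ler01 /= ge_min lexx orbT. Qed.

Lemma cl01_id t : 0 <= t <= 1 -> cl01 t = t.
Proof. by case/andP=> t0 t1; rewrite /cl01 (min_idPl t1) (max_idPr t0). Qed.

Lemma cl01_0 : cl01 0 = 0. Proof. by rewrite cl01_id ?lexx ?ler01. Qed.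
Lemma cl01_1 : cl01 1 = 1. Proof. by rewrite cl01_id ?lexx ?ler01. Qed.

Lemma cts_id (T : topologicalType) : continuous (fun x : T => x).
Proof. by move=> x; exact: cvg_id. Qed.

Lemma cts_fst (T U : topologicalType) : continuous (fun x : T * U => x.1).
Proof. by move=> x; exact: cvg_fst. Qed.

Lemma cts_snd (T U : topologicalType) : continuous (fun x : T * U => x.2).
Proof. by move=> x; exact: cvg_snd. Qed.

Lemma cl01_continuous : continuous cl01.
Proof.
apply: cts_max; first exact: cts_const.
by apply: cts_min; [exact: cts_id|exact: cts_const].
Qed.

(** Paths are continuous functions on the whole line and homotopies are continuous functions on the
    plane; only their values on the unit interval and square count. Reparametrizations may thus
    leave [0, 1] freely, without dependent types. *)
Definition ispath (Y : topologicalType) (x y : Y) (c : R -> Y) : Prop :=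
  [/\ continuous c, c 0 = x & c 1 = y].

Definition hpath (Y : topologicalType) (c c' : R -> Y) : Prop :=
  exists2 H : R * R -> Y, continuous H &
    (forall s, 0 <= s <= 1 -> H (s, 0) = c s /\ H (s, 1) = c' s) /\
    (forall t, 0 <= t <= 1 -> H (0, t) = c 0 /\ H (1, t) = c 1).

Definition pcat (Y : Type) (c c' : R -> Y) (s : R) : Y :=
  if s <= 2^-1 then c (2 * s) else c' (2 * s - 1).

Definition prv (Y : Type) (c : R -> Y) (s : R) : Y := c (1 - s).

End PathHomotopy.

(** The goal is first eta-expanded so that the second-order patterns apply. *)
Ltac cts :=
  lazymatch goal with |- continuous ?f =>
    let g := eval cbv beta in (fun x => f x) in change (continuous g) end;
  lazymatch goal with
  | |- continuous (fun x => @?a x + @?b x) => apply: (@cts_add _ _ a b); cts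
  | |- continuous (fun x => - (@?a x)) => apply: (@cts_opp _ _ a); cts
  | |- continuous (fun x => @?a x * @?b x) => apply: (@cts_mul _ _ a b); cts
  | |- continuous (fun x => Num.min (@?a x) (@?b x)) => apply: (@cts_min _ _ a b); cts
  | |- continuous (fun x => Num.max (@?a x) (@?b x)) => apply: (@cts_max _ _ a b); cts
  | |- continuous (fun x => (@?a x, @?b x)) => apply: (@cts_pair _ _ _ a b); cts
  | |- continuous (fun x => cl01 (@?a x)) =>
      apply: (@cts_comp _ _ _ _ a (@cl01_continuous _)); cts
  | _ => first [ assumption | exact: cts_const | exact: cts_id
               | exact: cts_fst | exact: cts_snd
               | (apply: cts_comp; [eassumption|]); cts ]
  end.

Section PathHomotopyTheory.
Variables (R : realType) (Y : topologicalType).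
Implicit Types (c d : R -> Y).

Lemma half_ge0 : (0 : R) <= 2^-1. Proof. by rewrite invr_ge0. Qed.
Lemma one_gt_half : (1 : R) <= 2^-1 = false.
Proof. by apply/negbTE; rewrite -ltNge; lra. Qed.

Lemma pcat0 c d : pcat c d 0 = c 0.
Proof. by rewrite /pcat half_ge0 mulr0. Qed.
Lemma pcat1 c d : pcat c d 1 = d 1.
Proof. by rewrite /pcat one_gt_half; congr d; lra. Qed.
Lemma prv0 c : prv c 0 = c 1. Proof. by rewrite /prv subr0. Qed.
Lemma prv1 c : prv c 1 = c 0. Proof. by rewrite /prv subrr. Qed.

Lemma pcat_continuous c d : continuous c -> continuous d -> c 1 = d 0 ->
  continuous (pcat c d).
Proof.
move=> cc cd e; apply: (@cts_paste R _ _ id 2^-1 (fun s => c (2 * s)) (fun s => d (2 * s - 1))).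
- exact: cts_id.
- by apply: (cts_comp cc); cts.
- by apply: (cts_comp cd); cts.
by move=> s ->; rewrite divff ?pnatr_eq0 // subrr.
Qed.

Lemma prv_continuous c : continuous c -> continuous (prv c).
Proof. by move=> cc; apply: (cts_comp cc); cts. Qed.

Lemma ispath_cat x y z c d : ispath x y c -> ispath y z d -> ispath x z (pcat c d).
Proof.
case=> cc c0 c1 [cd d0 d1]; split; rewrite ?pcat0 ?pcat1 //.
by apply: pcat_continuous => //; rewrite c1.
Qed.

Lemma ispath_rev x y c : ispath x y c -> ispath y x (prv c).
Proof. by case=> cc c0 c1; split; rewrite ?prv0 ?prv1 //; apply: prv_continuous. Qed.

Lemma ispath_cst x : ispath x x ((fun=> x) : R -> Y).
Proof. by split=> //; exact: cts_const. Qed.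

(** The straight-line homotopy from [p] to [q] in the plane, followed by [F]. Units, inverses and
    associativity below come from it by a choice of [p] and [q] on the line. *)
Lemma hpath_plane (F : R * R -> Y) (p q : R -> R * R) c d :
  continuous F -> continuous p -> continuous q -> p 0 = q 0 -> p 1 = q 1 ->
  (forall s, 0 <= s <= 1 -> c s = F (p s)) ->
  (forall s, 0 <= s <= 1 -> d s = F (q s)) -> hpath c d.
Proof.
move=> cF cp cq e0 e1 cE dE.
have c1 : continuous (fun st : R * R => (p st.1).1).
  by apply: (@cts_comp _ _ _ fst (fun st : R * R => p st.1)); [exact: cts_fst|cts].
have c2 : continuous (fun st : R * R => (p st.1).2).
  by apply: (@cts_comp _ _ _ snd (fun st : R * R => p st.1)); [exact: cts_snd|cts].
have d1 : continuous (fun st : R * R => (q st.1).1).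
  by apply: (@cts_comp _ _ _ fst (fun st : R * R => q st.1)); [exact: cts_fst|cts].
have d2 : continuous (fun st : R * R => (q st.1).2).
  by apply: (@cts_comp _ _ _ snd (fun st : R * R => q st.1)); [exact: cts_snd|cts].
exists (fun st => F ((p st.1).1 + st.2 * ((q st.1).1 - (p st.1).1),
                     (p st.1).2 + st.2 * ((q st.1).2 - (p st.1).2))).
  by apply: (cts_comp cF); cts.
have i0 : 0 <= (0 : R) <= 1 by rewrite ?lexx ?ler01.
have i1 : 0 <= (1 : R) <= 1 by rewrite ?lexx ?ler01.
split=> [s sI|t tI] /=.
  by rewrite cE // dE // !mul0r !mul1r !addr0 !subrKC -!surjective_pairing.
by rewrite e0 e1 !subrr !mulr0 !addr0 cE // cE // e0 e1 -!surjective_pairing.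
Qed.

Lemma hpath_reparam (F : R -> Y) (p q : R -> R) c d :
  continuous F -> continuous p -> continuous q -> p 0 = q 0 -> p 1 = q 1 ->
  (forall s, 0 <= s <= 1 -> c s = F (p s)) ->
  (forall s, 0 <= s <= 1 -> d s = F (q s)) -> hpath c d.
Proof.
move=> cF cp cq e0 e1 cE dE.
refine (@hpath_plane (fun z => F z.1) (fun s => (p s, 0)) (fun s => (q s, 0)) c d _ _ _ _ _ _ _) => //.
- by apply: (cts_comp cF); cts.
- by cts.
- by cts.
- by rewrite e0.
- by rewrite e1.
Qed.

Lemma hpath_eq c d : continuous c -> (forall s, 0 <= s <= 1 -> c s = d s) -> hpath c d.
Proof.
move=> cc e; apply: (@hpath_reparam c id id) => //; [exact: cts_id|exact: cts_id|].
by move=> s sI; rewrite -e.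
Qed.

Lemma hpath_refl c : continuous c -> hpath c c.
Proof. by move=> cc; apply: hpath_eq. Qed.

Lemma in01_0 : 0 <= (0 : R) <= 1. Proof. by rewrite ?lexx ?ler01. Qed.
Lemma in01_1 : 0 <= (1 : R) <= 1. Proof. by rewrite ?lexx ?ler01. Qed.

Lemma hpath0 c d : hpath c d -> c 0 = d 0.
Proof.
case=> H _ [h1 h2]; have [_ <-] := h1 0 in01_0.
by have [-> _] := h2 1 in01_1.
Qed.

Lemma hpath1 c d : hpath c d -> c 1 = d 1.
Proof.
case=> H _ [h1 h2]; have [_ <-] := h1 1 in01_1.
by have [_ ->] := h2 1 in01_1.
Qed.

Lemma hpath_sym c d : hpath c d -> hpath d c.
Proof.
move=> hcd; have e0 := hpath0 hcd; have e1 := hpath1 hcd.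
case: hcd => H cH [h1 h2]; exists (fun z => H (z.1, 1 - z.2)).
  by apply: (cts_comp cH); cts.
split=> [s sI|t tI] /=; first by rewrite subr0 subrr; have [] := h1 s sI.
by rewrite -e0 -e1; apply: h2; lra.
Qed.

Lemma hpath_trans d c c' : hpath c d -> hpath d c' -> hpath c c'.
Proof.
move=> hcd hdc'; have e0 := hpath0 hcd; have e1 := hpath1 hcd.
case: hcd hdc' => H cH [h1 h2] [K cK [k1 k2]].
(* The two halves agree at time 1/2 only over [0, 1]; clamping the first coordinate makes them agree
   everywhere, as pasting demands. *)
exists (fun z => if z.2 <= 2^-1 then H (cl01 z.1, 2 * z.2) else K (cl01 z.1, 2 * z.2 - 1)).
  apply: (@cts_paste R _ _ (fun z : R * R => z.2) 2^-1
    (fun z => H (cl01 z.1, 2 * z.2)) (fun z => K (cl01 z.1, 2 * z.2 - 1))).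
  - by cts.
  - by apply: (cts_comp cH); cts.
  - by apply: (cts_comp cK); cts.
  move=> z ->; rewrite divff ?pnatr_eq0 // subrr.
  by rewrite (h1 _ (cl01_in _)).2 (k1 _ (cl01_in _)).1.
split=> [s sI|t tI] /=; rewrite ?half_ge0 ?one_gt_half ?cl01_0 ?cl01_1.
  rewrite cl01_id // mulr0 (h1 s sI).1; split=> //.
  by rewrite (_ : 2 * 1 - 1 = 1); [rewrite (k1 s sI).2|lra].
case: ifPn => [ht|]; first by apply: h2; lra.
by rewrite -ltNge e0 e1 => ht; apply: k2; lra.
Qed.

Lemma hpath_cat c c' d d' : c 1 = d 0 ->
  hpath c c' -> hpath d d' -> hpath (pcat c d) (pcat c' d').
Proof.
move=> e [H cH [h1 h2]] [K cK [k1 k2]].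
exists (fun z => if z.1 <= 2^-1 then H (2 * z.1, cl01 z.2) else K (2 * z.1 - 1, cl01 z.2)).
  apply: (@cts_paste R _ _ (fun z : R * R => z.1) 2^-1
    (fun z => H (2 * z.1, cl01 z.2)) (fun z => K (2 * z.1 - 1, cl01 z.2))).
  - by cts.
  - by apply: (cts_comp cH); cts.
  - by apply: (cts_comp cK); cts.
  move=> z ->; rewrite divff ?pnatr_eq0 // subrr.
  by rewrite (h2 _ (cl01_in _)).2 (k2 _ (cl01_in _)).1.
split=> [s sI|t tI] /=; rewrite ?half_ge0 ?one_gt_half ?cl01_0 ?cl01_1 /pcat.
  by case: ifPn => hs; [apply: h1; lra|apply: k1; move: hs; rewrite -ltNge; lra].
rewrite half_ge0 one_gt_half cl01_id // !mulr0 (h2 _ tI).1; split=> //.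
by rewrite (_ : 2 * 1 - 1 = 1); [rewrite (k2 _ tI).2|lra].
Qed.

Lemma hpath_rev c d : hpath c d -> hpath (prv c) (prv d).
Proof.
case=> H cH [h1 h2]; exists (fun z => H (1 - z.1, z.2)).
  by apply: (cts_comp cH); cts.
split=> [s sI|t tI] /=; first by apply: h1; lra.
by rewrite subr0 subrr prv0 prv1; split; have [] := h2 _ tI.
Qed.

Lemma hpath_catA c d c' : continuous c -> continuous d -> continuous c' ->
  c 1 = d 0 -> d 1 = c' 0 ->
  hpath (pcat (pcat c d) c') (pcat c (pcat d c')).
Proof.
move=> cc cd cc' e e'.
apply: (@hpath_reparam (pcat c (pcat d c'))
  (fun s => Num.min (2 * s) (Num.min (s + 4^-1) (2^-1 * s + 2^-1))) id).
- by apply: pcat_continuous; rewrite ?pcat0 //; apply: pcat_continuous.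
- by cts.
- by cts.
- by rewrite !mulr0 !add0r min_l // le_min !invr_ge0 !ler0n.
- by rewrite !mulr1 minA min_r; [lra|rewrite le_min; apply/andP; split; lra].
- move=> s sI; rewrite /pcat.
  case: ifPn => [sh|]; last first.
    rewrite -ltNge => sh; rewrite minA min_r; last by rewrite le_min; apply/andP; split; lra.
    rewrite ifF; last by apply/negbTE; rewrite -ltNge; lra.
    rewrite ifF; last by apply/negbTE; rewrite -ltNge; lra.
    by congr c'; lra.
  case: ifPn => [sq|].
    rewrite min_l; last by rewrite le_min; apply/andP; split; lra.
    by rewrite sq.
  rewrite -ltNge => sq.
  rewrite min_r; last by rewrite ge_min; apply/orP; left; lra.
  rewrite min_l; last by lra.
  rewrite ifF; last by apply/negbTE; rewrite -ltNge; lra.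
  rewrite ifT; last by lra.
  by congr d; lra.
- by [].
Qed.

Lemma hpath_cat1p c : continuous c -> hpath (pcat (fun=> c 0) c) c.
Proof.
move=> cc; apply: (@hpath_reparam c (fun s => Num.max 0 (2 * s - 1)) id) => //.
- by cts.
- by cts.
- by rewrite mulr0 sub0r max_l // lerN10.
- by rewrite max_r; lra.
move=> s sI; rewrite /pcat; case: ifPn => [sh|]; first by rewrite max_l //; lra.
by rewrite -ltNge => sh; rewrite max_r //; lra.
Qed.

Lemma hpath_catp1 c : continuous c -> hpath (pcat c (fun=> c 1)) c.
Proof.
move=> cc; apply: (@hpath_reparam c (fun s => Num.min 1 (2 * s)) id) => //.
- by cts.
- by cts.
- by rewrite mulr0 min_r // ler01.
- by rewrite min_l; lra.
move=> s sI; rewrite /pcat; case: ifPn => [sh|]; first by rewrite min_r //; lra.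
by rewrite -ltNge => sh; rewrite min_l //; lra.
Qed.

Lemma hpath_catV c : continuous c -> hpath (pcat c (prv c)) (fun=> c 0).
Proof.
move=> cc; apply: (@hpath_reparam c (fun s => Num.min (2 * s) (2 - 2 * s)) (fun=> 0)) => //.
- by cts.
- by cts.
- by rewrite !mulr0 subr0 min_l // ler0n.
- by rewrite !mulr1 subrr min_r // ler0n.
move=> s sI; rewrite /pcat; case: ifPn => [sh|]; first by rewrite min_l //; lra.
by rewrite -ltNge => sh; rewrite min_r /prv; [congr c; lra|lra].
Qed.

Lemma prvK c : prv (prv c) = c.
Proof. by apply/funext => s; rewrite /prv opprB addrC subrK. Qed.

Lemma hpath_Vcat c : continuous c -> hpath (pcat (prv c) c) (fun=> c 1).
Proof.
move=> cc; have := hpath_catV (prv_continuous cc); rewrite prvK prv0; exact.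
Qed.

End PathHomotopyTheory.

Section LoopClass.
Variables (R : realType) (Y : topologicalType) (y : Y).
Implicit Types (c d : R -> Y).
Local Notation loop := {path (I01 R) from y to y in Y}.

Definition path_of_loop (f : loop) : R -> Y := fun s => f (clamp s).

Lemma path_of_loopP f : ispath y y (path_of_loop f).
Proof.
split; last 2 first.
- by rewrite /path_of_loop -/(zero : I01 R) path_zero.
- by rewrite /path_of_loop -/(one : I01 R) path_one.
by apply: (@cts_comp _ _ _ f (@clamp R)); [exact: loop_continuous|exact: clamp_continuous].
Qed.

Section LoopOfPath.
Variable c : R -> Y.
Hypothesis pc : ispath y y c.

Definition loop_fun (s : I01 R) : Y := c (\val s).
Fact loop_fun_continuous : continuous loop_fun.
Proof. by case: pc => cc _ _; apply: (cts_comp cc); exact: I01_val_continuous. Qed.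
Fact loop_fun_zero : loop_fun zero = y.
Proof. by rewrite /loop_fun I01_zero; case: pc. Qed.
Fact loop_fun_one : loop_fun one = y.
Proof. by rewrite /loop_fun I01_one; case: pc. Qed.
Definition loop_of_path : loop := mk_path loop_fun_continuous loop_fun_zero loop_fun_one.

Lemma loop_of_pathE s : loop_of_path s = c (\val s). Proof. by []. Qed.
End LoopOfPath.

(** Total, with value 1 on functions that are not loops at [y], so that classes can be rewritten
    without carrying proofs. *)
Definition pclass c : pi1 R y :=
  match pselect (ispath y y c) with
  | left pc => loop_class (loop_of_path pc)
  | right _ => 1%g
  end.

Lemma pclassE c (pc : ispath y y c) : pclass c = loop_class (loop_of_path pc).
Proof. by rewrite /pclass; case: pselect => // p; congr (loop_class (loop_of_path _)); exact: Prop_irrelevance. Qed.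

Lemma pclassP c d : ispath y y c -> ispath y y d -> pclass c = pclass d <-> hpath c d.
Proof.
move=> pc pd; rewrite !pclassE loop_classP; split.
  case=> H cH [h1 h2]; exists (fun z => H (clamp z.1, clamp z.2)).
    apply: (cts_comp cH); apply: cts_pair; apply: (cts_comp (@clamp_continuous R)); cts.
  split=> [s sI|t tI] /=.
    have := h1 (clamp s); rewrite !loop_of_pathE val_clamp //.
  have [_ -> ->] := pc; exact: h2 (clamp t).
case=> H cH [h1 h2]; exists (fun z => H (\val z.1, \val z.2)).
  apply: (cts_comp cH); apply: cts_pair.
    by apply: (cts_comp (@I01_val_continuous R)) => ?; exact: cvg_fst.
  by apply: (cts_comp (@I01_val_continuous R)) => ?; exact: cvg_snd.
split=> [s|t]; cbn [fst snd]; rewrite ?I01_zero ?I01_one.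
  by rewrite !loop_of_pathE; apply: h1; exact: I01P.
by have [_ e0 e1] := pc; have [-> ->] := h2 _ (I01P t).
Qed.

Lemma pclass_surj (g : pi1 R y) : exists2 c, ispath y y c & pclass c = g.
Proof.
exists (path_of_loop (repr g)); first exact: path_of_loopP.
rewrite (pclassE (path_of_loopP _)) -[RHS]loop_class_repr; congr loop_class.
by apply/path_eqP => s; rewrite loop_of_pathE /path_of_loop clampK.
Qed.

Lemma pclassM c d : ispath y y c -> ispath y y d -> pclass (pcat c d) = (pclass c * pclass d)%g.
Proof.
move=> pc pd; rewrite !(pclassE pc, pclassE pd, pclassE (ispath_cat pc pd)).
rewrite [RHS]pi1_mulE; congr loop_class; apply/path_eqP => s.
rewrite loop_catE !loop_of_pathE /pcat; have := I01P s => sI.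
case: ifPn => hs; first by rewrite val_clamp //; lra.
by rewrite val_clamp //; move: hs; rewrite -ltNge; lra.
Qed.

Lemma pclass1 : pclass (fun=> y) = 1%g.
Proof. by rewrite (pclassE (ispath_cst R y)); congr loop_class; apply/path_eqP. Qed.

Lemma pclassV c : ispath y y c -> pclass (prv c) = (pclass c)^-1%g.
Proof.
move=> pc; suff h : (pclass c * pclass (prv c) = 1)%g.
  by rewrite -[LHS](mulKg (pclass c)) h mulg1.
rewrite -pclassM //; last exact: ispath_rev.
rewrite -pclass1; apply/(pclassP (ispath_cat pc (ispath_rev pc)) (ispath_cst R y)).
by case: pc => cc c0 _; rewrite -c0; apply: hpath_catV.
Qed.

Lemma pclass_hpath c d : ispath y y c -> hpath c d -> continuous d -> pclass c = pclass d.
Proof.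
move=> pc h cd; apply/pclassP => //.
by have [cc c0 c1] := pc; split => //; [rewrite -(hpath0 h)|rewrite -(hpath1 h)].
Qed.

(** The class of g c g'^-1: a path [c] becomes an element of the fundamental group once its ends are
    tied to the base point by [g] and [g']. *)
Definition transport (g c g' : R -> Y) : pi1 R y := pclass (pcat (pcat g c) (prv g')).

Lemma transportP u v g c g' : ispath y u g -> ispath u v c -> ispath y v g' ->
  ispath y y (pcat (pcat g c) (prv g')).
Proof. by move=> pg pc pg'; apply: ispath_cat (ispath_rev pg'); exact: ispath_cat pc. Qed.

Lemma hpath_insert u v w (c : R -> Y) (d : R -> Y) (g : R -> Y) :
  ispath u v c -> ispath w v g -> ispath v y d ->
  hpath (pcat (pcat c (prv g)) (pcat g d)) (pcat c d).
Proof.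
move=> [cc c0 c1] [cg g0 g1] [cd d0 d1].
have crg := prv_continuous cg.
apply: (hpath_trans (hpath_catA _ _ _ _ _)) => //.
- by apply: pcat_continuous; rewrite ?g1.
- by rewrite c1 prv0 g1.
- by rewrite prv1 pcat0.
apply: hpath_cat; first by rewrite c1 pcat0 prv0 g1.
  exact: hpath_refl.
apply: hpath_trans (hpath_sym (hpath_catA _ _ _ _ _)) _ => //.
- by rewrite prv1.
- by rewrite g1 d0.
apply: hpath_trans (hpath_cat _ (hpath_Vcat cg) (hpath_refl cd)) _.
  by rewrite pcat1 g1 d0.
by rewrite g1 -d0; apply: hpath_cat1p.
Qed.

Lemma transportM u v w g c g' c' g'' :
  ispath y u g -> ispath u v c -> ispath y v g' -> ispath v w c' -> ispath y w g'' ->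
  (transport g c g' * transport g' c' g'')%g = transport g (pcat c c') g''.
Proof.
move=> pg pc pg' pc' pg''.
rewrite /transport -pclassM; [|exact: transportP pg pc pg'|exact: transportP pg' pc' pg''].
have pg''r := ispath_rev pg''.
have pgc := ispath_cat pg pc; have pgc' := ispath_cat pg' pc'.
apply: pclass_hpath.
- by apply: ispath_cat; [exact: transportP pg pc pg'|exact: transportP pg' pc' pg''].
- have pcc := ispath_cat pc' pg''r.
  apply: (@hpath_trans _ _ (pcat (pcat (pcat g c) (prv g')) (pcat g' (pcat c' (prv g''))))).
    apply: hpath_cat; first by rewrite pcat1 prv1 !pcat0.
      by apply: hpath_refl; case: (ispath_cat pgc (ispath_rev pg')).
    move: pg' pc' pg''r => [? ? ?] [? ? ?] [? ? ?].
    by apply: hpath_catA => //; congruence.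
  apply: hpath_trans (hpath_insert pgc pg' pcc) _.
  apply: hpath_trans (hpath_sym (hpath_catA _ _ _ _ _)) _.
  + by case: pgc.
  + by case: pc'.
  + by case: pg''r.
  + by case: pgc pc' => [_ _ ->] [_ -> _].
  + by case: pc' pg''r => [_ _ ->] [_ -> _].
  apply: hpath_cat.
  + by rewrite pcat1; case: pc' pg''r => [_ _ ->] [_ -> _].
  + move: pg pc pc' => [? ? ?] [? ? ?] [? ? ?].
    by apply: hpath_catA => //; congruence.
  + by apply: hpath_refl; case: pg''r.
- by case: (transportP pg (ispath_cat pc pc') pg'').
Qed.

Lemma transport_hpath u v g c d g' : ispath y u g -> ispath u v c -> ispath y v g' ->
  hpath c d -> continuous d -> transport g c g' = transport g d g'.
Proof.
move=> pg pc pg' h cd.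
have pd : ispath u v d.
  by case: pc => cc c0 c1; split=> //; rewrite -?(hpath0 h) -?(hpath1 h).
apply/(pclassP (transportP pg pc pg') (transportP pg pd pg')).
apply: hpath_cat.
- by rewrite pcat1 prv0; case: pc pg' => [_ _ ->] [_ _ ->].
- apply: hpath_cat => //; first by case: pc pg => [_ -> _] [_ _ ->].
  by apply: hpath_refl; case: pg.
- by apply: hpath_refl; case: (ispath_rev pg').
Qed.

End LoopClass.
Arguments pclass {R Y} y c.
Arguments transport {R Y} y g c g'.

(** * Lifting in covering spaces *)

Section Covering.
Variables (R : realType).

(** The sheets have an arbitrary index type and the total space may be disconnected: the cover that
    detects relations in the fundamental group may have an infinite fibre. *)
Definition covering (E Y : topologicalType) (p : E -> Y) : Prop :=
  continuous p /\ forall x, exists (U : set Y) (J : Type) (V : J -> set E),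
    [/\ open_nbhs x U, p @^-1` U = \bigcup_i V i, trivIset [set: J] V
      & forall i, [/\ open (V i), set_bij (V i) U p
        & forall O, open O -> O `<=` V i -> open (p @` O)]].

Lemma finite_cover_covering (E Y : topologicalType) (p : E -> Y) :
  finite_cover p -> covering p.
Proof. by case=> cp _ h; split=> // x; have [U [n [V hV]]] := h x; exists U, 'I_n.+1, V. Qed.

Variables (E Y : topologicalType) (p : E -> Y).
Hypothesis covp : covering p.

(** The agreement set is open because [p] is injective on each sheet, and so is its complement
    because distinct sheets over one open set are disjoint. *)
Lemma covering_unique (T : topologicalType) (f g : T -> E) (t0 : T) :
  connected [set: T] -> continuous f -> continuous g ->
  (forall t, p (f t) = p (g t)) -> f t0 = g t0 -> forall t, f t = g t.
Proof.
move=> cT cf cg pfg e0.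
set A := [set t | f t = g t].
have loc t : exists U (J : Type) (V : J -> set E) i j,
    [/\ U (p (f t)), V i (f t), V j (g t), trivIset [set: J] V
      & forall i, open (V i) /\ set_bij (V i) U p].
  have [_ /(_ (p (f t)) ) [U [J [V [[oU Ux] UV tV hV]]]]] := covp.
  have [i _ Vi] : (\bigcup_i V i) (f t) by rewrite -UV.
  have [j _ Vj] : (\bigcup_i V i) (g t) by rewrite -UV /= -pfg.
  by exists U, J, V, i, j; split=> // k; have [] := hV k.
have oA : open A.
  rewrite openE => t At; have [U [J [V [i [j [Ux Vi Vj tV hV]]]]]] := loc t.
  have eij : i = j.
    by apply: tV => //; exists (f t); split=> //; rewrite /A /= in At; rewrite At.
  have nf : \forall u \near t, V i (f u) by apply: cf; apply: open_nbhs_nbhs; split; [exact: (hV i).1|].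
  have ng : \forall u \near t, V i (g u).
    by apply: cg; apply: open_nbhs_nbhs; split; [exact: (hV i).1|rewrite eij].
  apply: filterS2 nf ng => u fu gu; have [_ [_ inj _]] := hV i.
  by apply: inj; rewrite ?inE.
have oC : open (~` A).
  rewrite openE => t At; have [U [J [V [i [j [Ux Vi Vj tV hV]]]]]] := loc t.
  have nf : \forall u \near t, V i (f u) by apply: cf; apply: open_nbhs_nbhs; split; [exact: (hV i).1|].
  have ng : \forall u \near t, V j (g u) by apply: cg; apply: open_nbhs_nbhs; split; [exact: (hV j).1|].
  apply: filterS2 nf ng => u fu gu fgu; apply: At.
  have eij : i = j by apply: tV => //; exists (f u); split=> //; rewrite fgu.
  have [_ [_ inj _]] := hV i; apply: inj; rewrite ?inE //.
  by rewrite eij.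
have AT : A = setT.
  apply: cT.
  - by exists t0.
  - by exists A => //; rewrite setTI.
  - by exists A; rewrite ?setTI // -(setCK A); exact: open_closedC.
by move=> t; have : A t by rewrite AT.
Qed.

(** One neighbourhood [U] serves all points above it. The local inverse [sg] is a total function,
    controlled only over [U]. *)
Lemma covering_section x : exists2 U : set Y, open_nbhs x U &
  forall e, U (p e) -> exists (V : set E) (sg : Y -> E),
    [/\ open V, V e, forall e', V e' -> U (p e') /\ sg (p e') = e',
        forall u, U u -> p (sg u) = u /\ V (sg u) &
        forall u, U u -> {for u, continuous sg}].
Proof.
have [_ /(_ x) [U [J [V [oU UV tV hV]]]]] := covp.
exists U => // e Ue.
have [i _ Vi] : (\bigcup_i V i) e by rewrite -UV.
have [oV [fV iV sV] om] := hV i.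
pose sg u := xget e [set e' | V i e' /\ p e' = u].
have sgP u : U u -> V i (sg u) /\ p (sg u) = u.
  move=> Uu; have [e' Ve' pe'] := sV _ Uu.
  by apply: (@xgetPex _ e [set e' | V i e' /\ p e' = u]); exists e'.
have sgK e' : V i e' -> sg (p e') = e'.
  by move=> Ve'; have [V1 p1] := sgP _ (fV _ Ve'); apply: iV; rewrite ?inE.
exists (V i), sg; split=> //.
- by move=> e' Ve'; split; [exact: fV|exact: sgK].
- by move=> u /sgP[].
- move=> u Uu O; rewrite nbhsE => -[O' [oO' O'u] sO'].
  have [Vu pu] := sgP _ Uu.
  have op : open (p @` (O' `&` V i)) by apply: om; [exact: openI|exact: subIsetr].
  apply: (@filterS _ (nbhs u) _ (p @` (O' `&` V i))); last first.
    by apply: open_nbhs_nbhs; split=> //; exists (sg u).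
  by move=> w [e' [O'e' Ve'] <-] /=; apply: sO'; rewrite sgK.
Qed.

Lemma connectedR : connected [set: R].
Proof. by apply/connected_intervalP => x y _ _ z _. Qed.

(** Continuous induction, by the supremum of the [x] with [P 0 x]. It takes the place of
    subdivisions of [0, 1] and Lebesgue numbers. *)
Lemma interval_ind (P : R -> R -> Prop) :
  (forall a b c, a <= b -> b <= c -> P a b -> P b c -> P a c) ->
  (forall x, 0 <= x <= 1 -> exists2 e, 0 < e &
     forall a b, x - e < a -> a <= b -> b < x + e -> P a b) ->
  P 0 1.
Proof.
move=> add loc.
pose S := [set x : R | 0 <= x <= 1 /\ P 0 x].
have S0 : S 0.
  have [e e0 he] := loc 0 (in01_0 R); split; first exact: in01_0.
  by apply: he; lra.
have Sub : has_sup S by split; [exists 0|exists 1 => x [/andP[]]].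
set s := sup S.
have s0 : 0 <= s by apply: ub_le_sup => //; case: Sub.
have s1 : s <= 1 by apply: ge_sup; [exists 0|move=> x [/andP[]]].
have [|e e0 he] := loc s; first by rewrite s0.
have [x Sx xs] := sup_adherent e0 Sub; rewrite -/s in xs.
have xs' : x <= s by apply: ub_le_sup => //; case: Sub.
have [/andP[x0 x1] Px] := Sx.
set y := Num.min 1 (s + e / 2).
have ye : y < s + e by rewrite gt_min; apply/orP; right; lra.
have xy : x <= y by rewrite le_min x1 /=; lra.
have Py : P 0 y by apply: (add _ x) => //; apply: he.
have y1 : y <= 1 by rewrite ge_min lexx.
have ys : y <= s.
  by apply: ub_le_sup; [case: Sub|split=> //; rewrite y1 andbT (le_trans x0)].
suff <- : y = 1 by [].
rewrite /y; case: leP => // h.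
by move: ys; rewrite /y min_r; [lra|exact: ltW].
Qed.

Definition clp (a b x : R) : R := Num.max a (Num.min x b).

Lemma clp_in a b x : a <= b -> a <= clp a b x <= b.
Proof. by move=> ab; rewrite /clp le_max lexx ge_max ab ge_min lexx orbT. Qed.
Lemma clp_id a b x : a <= x <= b -> clp a b x = x.
Proof. by case/andP=> ax xb; rewrite /clp (min_idPl xb) (max_idPr ax). Qed.
Lemma clp_continuous a b : continuous (clp a b).
Proof. by rewrite /clp; cts. Qed.
Lemma clp_left a b c x : a <= b -> b <= c -> x <= b -> clp a c x = clp a b x.
Proof.
by move=> ab bc xb; rewrite /clp (min_idPl xb) (min_idPl (le_trans xb bc)).
Qed.
Lemma clp_right a b c x : a <= b -> b <= c -> b <= x -> clp a c x = clp b c x.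
Proof.
move=> ab bc xb; have h : b <= Num.min x c by rewrite le_min xb bc.
by rewrite /clp (max_idPr h) (max_idPr (le_trans ab h)).
Qed.

Section Square.
Variable F : R * R -> Y.
Hypothesis cF : continuous F.

(** A lift over the rectangle [a, b] x [c, d], extended to the plane by clamping the coordinates, so
    that lifts over adjacent rectangles are total functions that can be pasted. *)
Definition liftable a b c d := forall e, p e = F (a, c) ->
  exists G : R * R -> E, [/\ continuous G,
    forall z, p (G z) = F (clp a b z.1, clp c d z.2) & G (a, c) = e].

Lemma liftable_local x y : exists2 e, 0 < e & forall a b c d,
  x - e < a -> a <= b -> b < x + e -> y - e < c -> c <= d -> d < y + e ->
  liftable a b c d.
Proof.
have [U [oU Ux] hU] := covering_section (F (x, y)).
have : nbhs (x, y) (F @^-1` U) by apply: cF; apply: open_nbhs_nbhs.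
rewrite nbhs_ballP => -[e e0 he]; exists e => // a b c d xa ab bx yc cd dy e1 pe1.
have inU z : U (F (clp a b z.1, clp c d z.2)).
  apply: he; split=> /=; rewrite /ball /= ltr_distl;
    [have := clp_in z.1 ab|have := clp_in z.2 cd]; lra.
have Ue : U (p e1).
  by rewrite pe1; have := inU (a, c); rewrite /= !clp_id ?lexx ?ab ?cd.
have [V [sg [_ Ve1 Vsg psg csg]]] := hU _ Ue.
have [_ sge] := Vsg _ Ve1.
exists (fun z => sg (F (clp a b z.1, clp c d z.2))); split.
- move=> z; apply: (@continuous_comp _ _ _ (fun z : R * R => F (clp a b z.1, clp c d z.2)) sg).
    apply: (cts_comp cF); apply: cts_pair.
      by apply: (cts_comp (@clp_continuous a b)); cts.
    by apply: (cts_comp (@clp_continuous c d)); cts.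
  by apply: csg.
- by move=> z; have [] := psg _ (inU z).
- by rewrite /= !clp_id ?lexx ?ab ?cd // -pe1.
Qed.

Lemma liftable_addx a b b' c d : a <= b -> b <= b' -> c <= d ->
  liftable a b c d -> liftable b b' c d -> liftable a b' c d.
Proof.
move=> ab bb cd L1 L2 e pe.
have [G [cG pG Ge]] := L1 e pe.
have pe' : p (G (b, c)) = F (b, c) by rewrite pG /= !clp_id ?lexx ?ab ?cd.
have [H [cH pH He]] := L2 _ pe'.
have GH y : G (b, y) = H (b, y).
  apply: (@covering_unique R (fun y => G (b, y)) (fun y => H (b, y)) c) => //.
  - exact: connectedR.
  - by apply: (cts_comp cG); cts.
  - by apply: (cts_comp cH); cts.
  - by move=> t; rewrite pG pH /= !(@clp_id _ _ b) ?lexx ?ab ?bb.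
exists (fun z => if z.1 <= b then G z else H z); split.
- apply: (@cts_paste R _ _ (fun z : R * R => z.1) b G H) => //; first exact: cts_fst.
  by case=> z1 z2 /= ->.
- move=> z; case: ifPn => hz; first by rewrite pG (clp_left ab).
  by rewrite pH (@clp_right a b b') // ltW // ltNge.
- by rewrite /= ab.
Qed.

Lemma liftable_addy a b c d d' : a <= b -> c <= d -> d <= d' ->
  liftable a b c d -> liftable a b d d' -> liftable a b c d'.
Proof.
move=> ab cd dd L1 L2 e pe.
have [G [cG pG Ge]] := L1 e pe.
have pe' : p (G (a, d)) = F (a, d) by rewrite pG /= !clp_id ?lexx ?ab ?cd.
have [H [cH pH He]] := L2 _ pe'.
have GH x : G (x, d) = H (x, d).
  apply: (@covering_unique R (fun x => G (x, d)) (fun x => H (x, d)) a) => //.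
  - exact: connectedR.
  - by apply: (cts_comp cG); cts.
  - by apply: (cts_comp cH); cts.
  - by move=> t; rewrite pG pH /= !(@clp_id _ _ d) ?lexx ?cd ?dd.
exists (fun z => if z.2 <= d then G z else H z); split.
- apply: (@cts_paste R _ _ (fun z : R * R => z.2) d G H) => //; first exact: cts_snd.
  by case=> z1 z2 /= ->.
- move=> z; case: ifPn => hz; first by rewrite pG (clp_left cd).
  by rewrite pH (@clp_right c d d') // ltW // ltNge.
- by rewrite /= cd.
Qed.

(** Two nested continuous inductions: at each height [y] small rectangles are joined horizontally
    into a strip over [0, 1] of positive thickness, then the strips are joined vertically. The
    thickness is part of the inner property, where joining takes a minimum. *)
Lemma liftable01 : liftable 0 1 0 1.
Proof.
suff [_] : 0 <= (1 : R) /\ liftable 0 1 0 1 by [].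
apply: (interval_ind (P := fun c d => c <= d /\ liftable 0 1 c d)).
  move=> c d d' _ _ [cd L] [dd' L']; split; first exact: le_trans dd'.
  exact: liftable_addy L L'.
move=> y _.
have : 0 <= (1 : R) /\ exists2 e, 0 < e & forall c d, y - e < c -> c <= d -> d < y + e ->
    liftable 0 1 c d.
  apply: (interval_ind (P := fun a b => a <= b /\ exists2 e, 0 < e &
    forall c d, y - e < c -> c <= d -> d < y + e -> liftable a b c d)).
    move=> a b c _ _ [ab [e1 e10 h1]] [bc [e2 e20 h2]].
    split; first exact: le_trans bc.
    exists (Num.min e1 e2) => [|c' d]; first by rewrite lt_min e10.
    have m1 : Num.min e1 e2 <= e1 by rewrite ge_min lexx.
    have m2 : Num.min e1 e2 <= e2 by rewrite ge_min lexx orbT.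
    by move=> yc cd dy; apply: (liftable_addx ab bc cd); [apply: h1|apply: h2]; lra.
  move=> x _; have [e e0 he] := liftable_local x y.
  by exists e => // a b xa ab bx; split=> //; exists e => // c d; apply: he.
case=> _ [e e0 he]; exists e => // c d yc cd dy; split=> //; exact: he.
Qed.

End Square.

Lemma lift_square (F : R * R -> Y) e : continuous F -> p e = F (0, 0) ->
  exists G : R * R -> E, [/\ continuous G,
    forall s t, 0 <= s <= 1 -> 0 <= t <= 1 -> p (G (s, t)) = F (s, t) & G (0, 0) = e].
Proof.
move=> cF /(liftable01 cF)[G [cG pG Ge]]; exists G; split=> // s t sI tI.
by rewrite pG /= !clp_id.
Qed.

Lemma lift_path (c : R -> Y) e : continuous c -> p e = c 0 ->
  exists l : R -> E, [/\ continuous l, forall s, 0 <= s <= 1 -> p (l s) = c s & l 0 = e].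
Proof.
move=> cc pe; have [|//|G [cG pG Ge]] := @lift_square (fun z => c z.1) e.
  by apply: (cts_comp cc); cts.
exists (fun s => G (s, 0)); split=> //; first by apply: (cts_comp cG); cts.
by move=> s sI; rewrite pG // in01_0.
Qed.

Lemma lift_unique (l l' : R -> E) : continuous l -> continuous l' ->
  (forall s, 0 <= s <= 1 -> p (l s) = p (l' s)) -> l 0 = l' 0 ->
  forall s, 0 <= s <= 1 -> l s = l' s.
Proof.
move=> cl cl' e e0 s sI; rewrite -(cl01_id sI).
apply: (@covering_unique R (fun s => l (cl01 s)) (fun s => l' (cl01 s)) 0).
- exact: connectedR.
- by apply: (cts_comp cl); cts.
- by apply: (cts_comp cl'); cts.
- by move=> t; apply: e; apply: cl01_in.
- by rewrite cl01_0.
Qed.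

(** The vertical sides of the lifted square cover constant paths, so they are constant by unique
    lifting; hence the endpoints stay fixed. *)
Lemma hpath_lift (l l' : R -> E) : continuous l -> continuous l' -> l 0 = l' 0 ->
  hpath (fun s => p (l s)) (fun s => p (l' s)) -> hpath l l'.
Proof.
move=> cl cl' e0 [H cH [h1 h2]].
have i0 := in01_0 R; have i1 := in01_1 R.
have [//||G [cG pG Ge]] := @lift_square H (l 0).
  by rewrite (h1 _ i0).1.
have G0 t : 0 <= t <= 1 -> G (0, t) = l 0.
  apply: (lift_unique (l := fun t => G (0, t)) (l' := fun=> l 0)) => //.
  - by apply: (cts_comp cG); cts.
  - exact: cts_const.
  - by move=> s sI; rewrite pG // (h2 _ sI).1.
have Gs s : 0 <= s <= 1 -> G (s, 0) = l s.
  apply: (lift_unique (l := fun s => G (s, 0)) (l' := l)) => //.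
  - by apply: (cts_comp cG); cts.
  - by move=> t tI; rewrite pG // (h1 _ tI).1.
have Gs' s : 0 <= s <= 1 -> G (s, 1) = l' s.
  apply: (lift_unique (l := fun s => G (s, 1)) (l' := l')) => //.
  - by apply: (cts_comp cG); cts.
  - by move=> t tI; rewrite pG // (h1 _ tI).2.
  - by rewrite G0.
have G1 t : 0 <= t <= 1 -> G (1, t) = l 1.
  apply: (lift_unique (l := fun t => G (1, t)) (l' := fun=> l 1)) => //.
  - by apply: (cts_comp cG); cts.
  - exact: cts_const.
  - by move=> s sI; rewrite pG // (h2 _ sI).2.
  - by rewrite Gs.
exists G => //; split=> [s sI|t tI]; first by rewrite Gs // Gs'.
by rewrite G0 // G1.
Qed.

Definition lift (c : R -> Y) (e : E) : R -> E :=
  xget (fun=> e) [set l : R -> E | [/\ continuous l, forall s, 0 <= s <= 1 -> p (l s) = c s & l 0 = e]].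

Lemma liftP (c : R -> Y) e : continuous c -> p e = c 0 ->
  [/\ continuous (lift c e), forall s, 0 <= s <= 1 -> p (lift c e s) = c s & lift c e 0 = e].
Proof.
move=> cc pe; have [l hl] := lift_path cc pe.
by apply: (@xgetPex _ (fun=> e) [set l : R -> E | [/\ continuous l, forall s, 0 <= s <= 1 -> p (l s) = c s & l 0 = e]]); exists l.
Qed.

Lemma lift_uniq c e (l : R -> E) : continuous c -> continuous l -> l 0 = e ->
  (forall s, 0 <= s <= 1 -> p (l s) = c s) -> forall s, 0 <= s <= 1 -> lift c e s = l s.
Proof.
move=> cc cl l0 pl.
have [|ck pk k0] := @liftP c e cc; first by rewrite -l0 pl // in01_0.
by apply: lift_unique => //; [move=> s sI; rewrite pk // pl|rewrite k0].
Qed.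

Definition lift_end c e := lift c e 1.

Lemma lift_end_uniq c e (l : R -> E) : continuous c -> continuous l -> l 0 = e ->
  (forall s, 0 <= s <= 1 -> p (l s) = c s) -> lift_end c e = l 1.
Proof. by move=> cc cl l0 pl; apply: lift_uniq => //; exact: in01_1. Qed.

Lemma p_lift_end c e : continuous c -> p e = c 0 -> p (lift_end c e) = c 1.
Proof. by move=> cc pe; have [_ -> //] := liftP cc pe; exact: in01_1. Qed.

Lemma lift_end_hpath (c d : R -> Y) e : continuous c -> continuous d -> p e = c 0 ->
  hpath c d -> lift_end c e = lift_end d e.
Proof.
move=> cc cd pe h; have e0 := hpath0 h.
have [cl pl l0] := liftP cc pe.
have [|cl' pl' l0'] := liftP cd (e := e); first by rewrite -e0.
apply: hpath1; apply: hpath_lift => //; first by rewrite l0.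
apply: hpath_trans; last apply: hpath_trans h _.
- apply: hpath_eq; last by move=> s sI; rewrite pl.
  by apply: (@cts_comp _ _ _ p) => //; case: covp.
- by apply: hpath_eq => // s sI; rewrite pl'.
Qed.

Lemma lift_cat (c d : R -> Y) e : continuous c -> continuous d -> c 1 = d 0 -> p e = c 0 ->
  forall s, 0 <= s <= 1 -> lift (pcat c d) e s = pcat (lift c e) (lift d (lift_end c e)) s.
Proof.
move=> cc cd cd0 pe.
have [cl pl l0] := liftP cc pe.
have [|cl' pl' l0'] := liftP cd (e := lift_end c e); first by rewrite p_lift_end.
apply: lift_uniq; first exact: pcat_continuous.
- by apply: pcat_continuous => //; rewrite l0'.
- by rewrite pcat0.
- move=> s sI; rewrite /pcat; case: ifPn => [hs|]; first by rewrite pl //; lra.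
  by rewrite -ltNge => hs; rewrite pl' //; lra.
Qed.

Lemma lift_end_cat (c d : R -> Y) e : continuous c -> continuous d -> c 1 = d 0 -> p e = c 0 ->
  lift_end (pcat c d) e = lift_end d (lift_end c e).
Proof. by move=> cc cd cd0 pe; rewrite {1}/lift_end lift_cat ?in01_1 // pcat1. Qed.

Lemma lift_end_cst e : lift_end (fun=> p e) e = e.
Proof. by apply: (@lift_end_uniq _ _ (fun=> e)) => //; exact: cts_const. Qed.

Lemma lift_rev (c : R -> Y) e : continuous c -> p e = c 0 ->
  forall s, 0 <= s <= 1 -> lift (prv c) (lift_end c e) s = prv (lift c e) s.
Proof.
move=> cc pe; have [cl pl l0] := liftP cc pe.
apply: lift_uniq; [exact: prv_continuous|exact: prv_continuous|by rewrite prv0|].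
by move=> s sI; rewrite /prv pl //; lra.
Qed.

Lemma lift_end_rev (c : R -> Y) e : continuous c -> p e = c 0 ->
  lift_end (prv c) (lift_end c e) = e.
Proof.
move=> cc pe; rewrite {1}/lift_end lift_rev ?in01_1 // prv1.
by have [] := liftP cc pe.
Qed.

Lemma lift_end_deck (h : E -> E) (c : R -> Y) e : continuous h -> (forall e, p (h e) = p e) ->
  continuous c -> p e = c 0 -> lift_end c (h e) = h (lift_end c e).
Proof.
move=> ch ph cc pe; have [cl pl l0] := liftP cc pe.
apply: (@lift_end_uniq _ _ (fun s => h (lift c e s))) => //.
- by apply: (cts_comp ch).
- by rewrite l0.
- by move=> s sI; rewrite ph pl.
Qed.

End Covering.

(** * Covers from locally constant coordinate changes *)

(* A locally constant system of coordinate changes: [ls_tr i j] turns the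
   coordinate of a point of the fibre in the chart [ls_V i] into its coordinate
   in the chart [ls_V j]; [ls_chart] chooses a chart around each point. *)
Record local_system (Y : topologicalType) := LocalSystem {
  ls_I : Type;
  ls_V : ls_I -> set Y;
  ls_S : Type;
  ls_tr : ls_I -> ls_I -> ls_S -> ls_S;
  ls_chart : Y -> ls_I;
  ls_open : forall i, open (ls_V i);
  ls_chartP : forall y, ls_V (ls_chart y) y;
  ls_tr_id : forall i s, ls_tr i i s = s;
  ls_tr_comp : forall i j k s y, ls_V i y -> ls_V j y -> ls_V k y ->
    ls_tr j k (ls_tr i j s) = ls_tr i k s }.

Section TotalSpace.
Variables (Y : topologicalType) (L : local_system Y).
Notation I := (ls_I L).
Notation V := (@ls_V Y L).
Notation S := (ls_S L).
Notation tr := (@ls_tr Y L).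
Notation chart := (@ls_chart Y L).

(* Fibre coordinates are stored with respect to the chosen chart. *)
Definition total : Type := (Y * S)%type.
HB.instance Definition _ := gen_eqMixin total.
HB.instance Definition _ := gen_choiceMixin total.

Definition total_pt (i : I) (s : S) (y : Y) : total := (y, tr i (chart y) s).
Definition total_proj (e : total) : Y := e.1.
Definition total_coord (i : I) (e : total) : S := tr (chart e.1) i e.2.

Lemma total_coordK i e : V i (total_proj e) -> total_pt i (total_coord i e) (total_proj e) = e.
Proof.
case: e => y s /= Vy; rewrite /total_pt /total_coord /=.
by rewrite (@ls_tr_comp _ _ _ _ _ _ y) ?ls_tr_id //; exact: ls_chartP.
Qed.

Lemma total_ptK i s y : V i y -> total_coord i (total_pt i s y) = s.
Proof.
move=> Vy; rewrite /total_coord /=.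
by rewrite (@ls_tr_comp _ _ _ _ _ _ y) ?ls_tr_id //; exact: ls_chartP.
Qed.

Lemma total_coord_tr i j e : V i (total_proj e) -> V j (total_proj e) ->
  tr i j (total_coord i e) = total_coord j e.
Proof. by move=> Vi Vj; apply: ls_tr_comp Vi Vj; exact: ls_chartP. Qed.

(** The final topology for the local sections [total_pt i s] over the charts. Sheets are open in it
    because coordinate changes do not depend on the point of the overlap. *)
Definition total_open (O : set total) : Prop :=
  forall i s, open [set y | V i y /\ O (total_pt i s y)].

Fact total_openT : total_open setT.
Proof.
move=> i s; rewrite (_ : [set y | _] = V i); first exact: ls_open.
by apply/seteqP; split=> [y []|y].
Qed.
Fact total_openI : setI_closed total_open.
Proof.
move=> A B oA oB i s; have := openI (oA i s) (oB i s); congr open.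
by apply/seteqP; split=> [y [[? ?] [? ?]]|y [? [? ?]]].
Qed.
Fact total_open_bigU (J : Type) (f : J -> set total) :
  (forall j, total_open (f j)) -> total_open (\bigcup_j f j).
Proof.
move=> of_ i s; have : open (\bigcup_j [set y | V i y /\ f j (total_pt i s y)]).
  by apply: bigcup_open => j _; exact: of_.
congr open; apply/seteqP; split=> [y [j _ [Vy fy]]|y [Vy [j _ fy]]].
  by split=> //; exists j.
by exists j.
Qed.

HB.instance Definition _ := isOpenTopological.Build total
  total_openT total_openI total_open_bigU.

Lemma total_openE (O : set total) : open O = total_open O.
Proof. by []. Qed.

Lemma total_proj_continuous : continuous total_proj.
Proof.
apply/continuousP => A oA; rewrite total_openE => i s.
by apply: openI => //; exact: ls_open.
Qed.

Definition sheet (i : I) (s : S) : set total :=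
  [set e | V i (total_proj e) /\ total_coord i e = s].

Lemma sheet_open i s : open (sheet i s).
Proof.
rewrite total_openE => j t; rewrite openE => y [Vj [Vi sE]].
apply: (@filterS _ (nbhs y) _ (V i `&` V j)); last first.
  by apply: open_nbhs_nbhs; split=> //; apply: openI; exact: ls_open.
move=> z [Vi' Vj']; split=> //; split=> //; rewrite -sE.
rewrite -(@total_coord_tr j i) // -(@total_coord_tr j i (total_pt j t y)) //.
by rewrite !total_ptK.
Qed.

Lemma sheet_bij i s : set_bij (sheet i s) (V i) total_proj.
Proof.
split.
- by move=> e [].
- move=> e e'; rewrite !inE => -[V1 c1] [V2 c2] pe.
  by rewrite -(total_coordK V1) -(total_coordK V2) c1 c2 pe.
- by move=> y Vy; exists (total_pt i s y) => //; split=> //; apply: total_ptK.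
Qed.

Lemma sheet_open_map i s O : open O -> O `<=` sheet i s -> open (total_proj @` O).
Proof.
rewrite total_openE => oO sO; have := oO i s; congr open.
apply/seteqP; split=> [y [Vy Oy]|y [e Oe <-]]; first by exists (total_pt i s y).
by have [Ve ce] := sO _ Oe; split=> //; rewrite -ce total_coordK.
Qed.

Lemma sheet_cover i : total_proj @^-1` V i = \bigcup_s sheet i s.
Proof.
by apply/seteqP; split=> [e Ve|e [s _ []] //]; exists (total_coord i e).
Qed.

Lemma sheet_trivIset i : trivIset [set: S] (sheet i).
Proof. by move=> s t _ _ [e [[_ <-] [_ <-]]]. Qed.

Lemma total_covering : covering total_proj.
Proof.
split; first exact: total_proj_continuous.
move=> y; exists (V (chart y)), S, (sheet (chart y)); split.
- by split; [exact: ls_open|exact: ls_chartP].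
- exact: sheet_cover.
- exact: sheet_trivIset.
- by move=> s; split; [exact: sheet_open|exact: sheet_bij|exact: sheet_open_map].
Qed.

Lemma total_section_continuous i s : {in V i, continuous (total_pt i s)}.
Proof.
move=> y /set_mem Vy O; rewrite nbhsE => -[O' [oO' O'y] sO].
apply: (@filterS _ (nbhs y) _ [set z | V i z /\ O' (total_pt i s z)]).
  by move=> z [_ /sO].
by apply: open_nbhs_nbhs; split=> //; exact: oO'.
Qed.

(** The source of deck transformations: in every chart the map sends the section of coordinate [s]
    to the section of coordinate [h s]. *)
Lemma total_map_continuous (h : S -> S) :
  (forall i j s y, V i y -> V j y -> h (tr i j s) = tr i j (h s)) ->
  continuous (fun e : total => (e.1, h e.2) : total).
Proof.
move=> hc; apply/continuousP => A oA; rewrite total_openE => i s.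
have := oA i (h s); congr open; apply/seteqP; split=> y [Vy Ay]; split=> //; move: Ay;
  by rewrite /preimage /= /total_pt /= (hc i (chart y) s y) //; exact: ls_chartP.
Qed.

End TotalSpace.

(** * Local contractibility of finite CW complexes *)

Section ContinuousOn.

(** Continuity of a restriction, spelled out with ambient open sets; in this form it restricts,
    composes and glues without subspace types. *)
Definition cont_on (T U : topologicalType) (A : set T) (f : T -> U) : Prop :=
  forall x, A x -> forall O, open O -> O (f x) ->
    exists W, [/\ open W, W x & forall y, A y -> W y -> O (f y)].

Lemma cont_onP (T U : topologicalType) (A : set T) (f : T -> U) :
  {within A, continuous f} <-> cont_on A f.
Proof.
split=> [/subspace_continuousP cf x Ax O oO Ofx|cf].
  have /= := cf x Ax O (open_nbhs_nbhs (conj oO Ofx)).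
  rewrite /fmap /within /= nbhsE => -[W [oW Wx] sW]; exists W; split=> // y Ay Wy.
  exact: sW.
apply/subspace_continuousP => x Ax O; rewrite nbhsE => -[O' [oO' O'x] sO].
have [W [oW Wx hW]] := cf x Ax O' oO' O'x.
rewrite /fmap /within /=; apply: (@filterS _ (nbhs x) _ W); last exact: open_nbhs_nbhs.
by move=> y Wy Ay; apply: sO; apply: hW.
Qed.

Lemma cont_on_cts (T U : topologicalType) (A : set T) (f : T -> U) :
  continuous f -> cont_on A f.
Proof.
move=> /continuousP cf x Ax O oO Ofx; exists (f @^-1` O); split=> //; exact: cf.
Qed.

Lemma cont_on_sub (T U : topologicalType) (A B : set T) (f : T -> U) :
  A `<=` B -> cont_on B f -> cont_on A f.
Proof.
move=> sAB cf x Ax O oO Ofx; have [W [oW Wx hW]] := cf x (sAB _ Ax) O oO Ofx.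
by exists W; split=> // y /sAB; apply: hW.
Qed.

Lemma cont_on_ext (T U : topologicalType) (A : set T) (f g : T -> U) :
  (forall x, A x -> f x = g x) -> cont_on A f -> cont_on A g.
Proof.
move=> e cf x Ax O oO; rewrite -e // => Ofx; have [W [oW Wx hW]] := cf x Ax O oO Ofx.
by exists W; split=> // y Ay Wy; rewrite -e //; apply: hW.
Qed.

Lemma cont_on_comp (T U V : topologicalType) (A : set T) (B : set U)
    (f : T -> U) (g : U -> V) : cont_on B g -> cont_on A f ->
  (forall x, A x -> B (f x)) -> cont_on A (fun x => g (f x)).
Proof.
move=> cg cf AB x Ax O oO Ogx.
have [W [oW Wx hW]] := cg _ (AB _ Ax) O oO Ogx.
have [W' [oW' W'x hW']] := cf _ Ax W oW Wx.
by exists W'; split=> // y Ay W'y; apply: hW; [exact: AB|exact: hW'].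
Qed.

Lemma cont_on_pair (T U V : topologicalType) (A : set T) (f : T -> U) (g : T -> V) :
  cont_on A f -> cont_on A g -> cont_on A (fun x => (f x, g x)).
Proof.
move=> cf cg x Ax O oO Ox.
have : nbhs (f x, g x) O by apply: open_nbhs_nbhs.
case=> -[P Q] /= []; rewrite !nbhsE => -[P' [oP' P'x] sP] [Q' [oQ' Q'x] sQ] sPQ.
have [W [oW Wx hW]] := cf x Ax P' oP' P'x.
have [W' [oW' W'x hW']] := cg x Ax Q' oQ' Q'x.
exists (W `&` W'); split=> //; first exact: openI.
by move=> y Ay [Wy W'y]; apply: sPQ; split; [apply/sP/hW|apply/sQ/hW'].
Qed.

Lemma cont_on_glue (T U : topologicalType) (A C C' : set T) (f : T -> U) :
  closed C -> closed C' -> A `<=` C `|` C' ->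
  cont_on (A `&` C) f -> cont_on (A `&` C') f -> cont_on A f.
Proof.
move=> clC clC' sA cf cf' x Ax O oO Ox.
have loc D : closed D -> cont_on (A `&` D) f ->
    exists W, [/\ open W, W x & forall y, A y -> D y -> W y -> O (f y)].
  move=> clD cD; have [Dx|nDx] := pselect (D x).
    have [W [oW Wx hW]] := cD x (conj Ax Dx) O oO Ox.
    by exists W; split=> // y Ay Dy Wy; apply: hW.
  by exists (~` D); split=> //; rewrite openC.
have [W [oW Wx hW]] := loc C clC cf; have [W' [oW' W'x hW']] := loc C' clC' cf'.
exists (W `&` W'); split=> //; first exact: openI.
by move=> y Ay [Wy W'y]; case: (sA _ Ay) => Cy; [apply: hW|apply: hW'].
Qed.

Lemma compact_relopenD (T : topologicalType) (K P : set T) : compact K ->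
  (forall w, K w -> P w -> exists W, [/\ open W, W w & forall v, K v -> W v -> P v]) ->
  compact (K `&` ~` P).
Proof.
move=> cK hP.
pose G := [set w | exists W, [/\ open W, W w & forall v, K v -> W v -> P v]].
have oG : open G.
  rewrite openE => w [W [oW Ww hW]].
  apply: (@filterS _ (nbhs w) _ W); last exact: open_nbhs_nbhs.
  by move=> v Wv; exists W.
have -> : K `&` ~` P = K `&` ~` G.
  apply/seteqP; split=> w [Kw nP]; split=> // h; apply: nP; last exact: hP.
  by case: h => W [_ Ww]; apply.
by apply: compact_closedI => //; rewrite closedC.
Qed.

Lemma cont_on_compact (T U : topologicalType) (K : set T) (f : T -> U) :
  compact K -> cont_on K f -> compact (f @` K).
Proof. by move=> cK /cont_onP cf; apply: continuous_compact. Qed.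

(** A continuous map from a compact set to a Hausdorff space is closed, hence a quotient map onto
    its image, and this persists over the open set [W]. *)
Lemma cont_on_quotient (T X U : topologicalType) (K : set T) (Psi : T -> X)
    (W : set X) (h : X -> U) :
  hausdorff_space X -> compact K -> cont_on K Psi -> open W ->
  cont_on (K `&` Psi @^-1` W) (fun w => h (Psi w)) ->
  cont_on (Psi @` K `&` W) h.
Proof.
move=> hX cK cPsi oW ch y [[w0 Kw0 <-] Wy] O oO Oy.
pose P := [set w | W (Psi w) /\ O (h (Psi w))].
have cB : compact (K `&` ~` P).
  apply: compact_relopenD => // w Kw [Ww Ow].
  have [W1 [oW1 W1w h1]] := cPsi w Kw W oW Ww.
  have [W2 [oW2 W2w h2]] := ch w (conj Kw Ww) O oO Ow.
  exists (W1 `&` W2); split=> //; first exact: openI.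
  by move=> v Kv [W1v W2v]; have Wv := h1 v Kv W1v; split=> //; apply: h2.
have clB : closed (Psi @` (K `&` ~` P)).
  apply: compact_closed => //; apply: cont_on_compact => //.
  by apply: cont_on_sub cPsi => w [].
exists (~` (Psi @` (K `&` ~` P))); split.
- by rewrite openC.
- by case=> w [Kw nP] e; apply: nP; rewrite /P /= e.
- move=> _ [[w Kw <-] Ww] nw; apply: contrapT => nO; apply: nw.
  by exists w => //; split=> // -[].
Qed.

Lemma hausdorff_prod (X Y : topologicalType) :
  hausdorff_space X -> hausdorff_space Y -> hausdorff_space (X * Y)%type.
Proof.
rewrite !open_hausdorff => hX hY [x y] [x' y'] ne.
have [e|nx] := eqVneq x x'.
  have ny : y != y' by apply: contra_neq ne => ->; rewrite e.
  have [[A B] [/= Ay By] [oA oB AB]] := hY _ _ ny.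
  exists (snd @^-1` A, snd @^-1` B) => /=; first by split; apply/mem_set; apply: set_mem.
  split; [by apply: open_comp oA => z _; exact: cts_snd|by apply: open_comp oB => z _; exact: cts_snd|].
  by rewrite -preimage_setI (eqP AB) preimage_set0.
have [[A B] [/= Ay By] [oA oB AB]] := hX _ _ nx.
exists (fst @^-1` A, fst @^-1` B) => /=; first by split; apply/mem_set; apply: set_mem.
split; [by apply: open_comp oA => z _; exact: cts_fst|by apply: open_comp oB => z _; exact: cts_fst|].
by rewrite -preimage_setI (eqP AB) preimage_set0.
Qed.

End ContinuousOn.

Section DiskGeometry.
Variables (R : realType) (n : nat).
Notation rV := 'rV[R]_n.

Definition nrm2 (v : rV) : R := \sum_i v 0 i ^+ 2.

Lemma cts_sum (T : topologicalType) (J : Type) (s : seq J) (F : J -> T -> R) :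
  (forall j, continuous (F j)) -> continuous (fun x => \sum_(j <- s) F j x).
Proof.
move=> cF; elim: s => [|j s IH].
  by under eq_fun do rewrite big_nil; exact: cts_const.
by under eq_fun do rewrite big_cons; apply: cts_add.
Qed.

Lemma nrm2_continuous : continuous nrm2.
Proof.
apply: cts_sum => i; have ci := @coord_continuous R 1 n 0 i.
by apply: cts_mul.
Qed.

Lemma nrm2_ge0 v : 0 <= nrm2 v.
Proof. by apply: sumr_ge0 => i _; exact: sqr_ge0. Qed.

Lemma nrm2Z a v : nrm2 (a *: v) = a ^+ 2 * nrm2 v.
Proof. by rewrite /nrm2 mulr_sumr; apply: eq_bigr => i _; rewrite mxE exprMn. Qed.

Lemma closed_disk_compact : compact (closed_disk R n).
Proof.
apply: bounded_closed_compact.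
  exists 1; split; first exact: num_real.
  move=> M M1 v vD; apply: (le_trans _ (ltW M1)).
  have v1 i : `|v 0 i| <= 1.
    rewrite -(@expr_le1 _ 2) // real_normK ?num_real //.
    apply: le_trans vD; rewrite (bigD1 i) //= lerDl.
    by apply: sumr_ge0 => j _; exact: sqr_ge0.
  rewrite [Num.norm v]mx_normrE; apply: bigmax_le => // -[i j] _ /=.
  by rewrite ord1.
by apply: (@closed_comp _ _ nrm2 [set t | t <= 1]) => [v _|]; [exact: nrm2_continuous|exact: closed_le].
Qed.

Lemma open_disk_open : open (open_disk R n).
Proof.
by apply: (@open_comp _ _ nrm2 [set t | t < 1]) => [v _|]; [exact: nrm2_continuous|exact: open_lt].
Qed.

Lemma open_disk_closed v : open_disk R n v -> closed_disk R n v.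
Proof. exact: ltW. Qed.

Lemma closed_disk_case v : closed_disk R n v -> open_disk R n v \/ sphere R n v.
Proof. by rewrite /closed_disk /= le_eqVlt => /orP[/eqP|]; [right|left]. Qed.

(** The maximum with 1/2 keeps [push] continuous at the centre, where the norm cannot be
    inverted. *)
Definition rad (v : rV) : R := Num.max (Num.sqrt (nrm2 v)) 2^-1.
(* Pushes the annulus of radii 1/2 and 1 radially to the unit sphere. *)
Definition push (z : rV * R) : rV := (1 - z.2 + z.2 * (rad z.1)^-1) *: z.1.

Lemma rad_gt0 v : 0 < rad v.
Proof. by rewrite /rad lt_max; apply/orP; right; rewrite invr_gt0. Qed.

Lemma rad_continuous : continuous rad.
Proof.
have c := nrm2_continuous; have c' := @sqrt_continuous R.
by rewrite /rad; cts.
Qed.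

Lemma push_continuous : continuous push.
Proof.
have c1 : continuous (fun z : rV * R => (rad z.1)^-1).
  move=> z; apply: (@continuous_comp _ _ _ (fun z : rV * R => rad z.1) (@GRing.inv R)).
    by apply: (cts_comp rad_continuous); cts.
  by apply: inv_continuous; rewrite gt_eqF // rad_gt0.
have c2 : continuous (fun z : rV * R => 1 - z.2 + z.2 * (rad z.1)^-1) by cts.
by move=> z; apply: (@continuousZ R rV (rV * R)%type _ fst z); [exact: c2|exact: cvg_fst].
Qed.

Lemma push0 v : push (v, 0) = v.
Proof. by rewrite /push /= mul0r addr0 subr0 scale1r. Qed.

Lemma push_sphere v t : sphere R n v -> push (v, t) = v.
Proof.
move=> sv; rewrite /push /= /rad [nrm2 v]sv sqrtr1 max_l; last by lra.
by rewrite invr1 mulr1 subrK scale1r.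
Qed.

Lemma push_disk v t : closed_disk R n v -> 0 <= t <= 1 -> closed_disk R n (push (v, t)).
Proof.
move=> Dv /andP[t0 t1]; rewrite /closed_disk /= -/(nrm2 _) nrm2Z /=.
set c := 1 - t + _; set r := Num.sqrt (nrm2 v).
have r0 : 0 <= r by exact: sqrtr_ge0.
have r1 : r <= 1 by rewrite -[X in _ <= X]sqrtr1 ler_sqrt ?ltr01.
have -> : nrm2 v = r ^+ 2 by rewrite sqr_sqrtr // nrm2_ge0.
have i0 : 0 <= (rad v)^-1 by rewrite invr_ge0 ltW // rad_gt0.
have rr : (rad v)^-1 * r <= 1.
  by rewrite mulrC ler_pdivrMr ?rad_gt0 // mul1r /rad le_max lexx.
have c0 : 0 <= c by rewrite /c addr_ge0 ?mulr_ge0 // subr_ge0.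
rewrite -exprMn expr_le1 ?mulr_ge0 //.
rewrite /c mulrDl -mulrA.
have h1 : (1 - t) * r <= (1 - t) by rewrite -[X in _ <= X]mulr1 ler_wpM2l // subr_ge0.
have h2 : t * ((rad v)^-1 * r) <= t by rewrite -[X in _ <= X]mulr1 ler_wpM2l.
lra.
Qed.

Lemma push1 v : 2^-1 < Num.sqrt (nrm2 v) -> sphere R n (push (v, 1)).
Proof.
move=> h; rewrite /sphere /= -/(nrm2 _) nrm2Z /= subrr add0r mul1r /rad max_l ?(ltW h) //.
have h0 : 0 < Num.sqrt (nrm2 v) by apply: lt_trans h; rewrite invr_gt0.
by rewrite -[X in _ * X]sqr_sqrtr ?nrm2_ge0 // -exprMn mulVf ?expr1n // gt_eqF.
Qed.

End DiskGeometry.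

Section CellAttachment.
Variables (R : realType) (X : topologicalType).
Hypothesis hX : hausdorff_space X.

(** Relative to a subset [A], since cells are attached one at a time. The contraction stays in [A]
    and in [U], but is free to leave [W] and to move [x]. *)
Definition locally_contractible (A : set X) : Prop :=
  forall x U, A x -> open U -> U x -> exists (W : set X) (h : X * R -> X),
    [/\ open W, W x, cont_on [set z : X * R | [/\ A z.1, W z.1 & 0 <= z.2 <= 1]] h
      & forall y, A y -> W y -> [/\ h (y, 0) = y, h (y, 1) = x
        & forall t, 0 <= t <= 1 -> A (h (y, t)) /\ U (h (y, t))]].

Variables (A : set X) (n : nat) (Phi : 'rV[R]_n -> X).
Notation D := (closed_disk R n).
Notation B := (open_disk R n).
Hypothesis cA : compact A.
Hypothesis cPhi : cont_on D Phi.
Hypothesis injPhi : set_inj B Phi.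
Hypothesis sphereA : Phi @` sphere R n `<=` A.
Hypothesis disjA : forall v, B v -> ~ A (Phi v).

Let clA : closed A. Proof. exact: compact_closed. Qed.

Lemma cell_closure : A `|` Phi @` B = A `|` Phi @` D.
Proof.
apply/seteqP; split=> x [Ax|[v Bv <-]]; [by left| |by left|].
  by right; exists v => //; exact: open_disk_closed.
by case: (closed_disk_case Bv) => h; [right; exists v|left; apply: sphereA; exists v].
Qed.

Lemma cell_compact : compact (A `|` Phi @` B).
Proof.
rewrite cell_closure; apply: compactU => //.
by apply: cont_on_compact => //; exact: closed_disk_compact.
Qed.

(** A point of the open cell is a centre of contraction along the segments of a small ball of the
    disk. *)
Lemma lc_cell (v : 'rV[R]_n) U : B v -> open U -> U (Phi v) ->
  exists (W : set X) (h : X * R -> X),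
    [/\ open W, W (Phi v), cont_on [set z : X * R | [/\ (A `|` Phi @` B) z.1, W z.1 & 0 <= z.2 <= 1]] h
      & forall y, (A `|` Phi @` B) y -> W y -> [/\ h (y, 0) = y, h (y, 1) = Phi v
        & forall t, 0 <= t <= 1 -> (A `|` Phi @` B) (h (y, t)) /\ U (h (y, t))]].
Proof.
move=> Bv oU Uv.
have [W1 [oW1 W1v hW1]] := cPhi (open_disk_closed Bv) oU Uv.
have : nbhs v (W1 `&` B).
  by apply: open_nbhs_nbhs; split=> //; apply: openI => //; exact: open_disk_open.
rewrite nbhs_ballP => -[e /= e0 he].
have bB w : ball v e w -> B w by move=> /he[].
have bU w : ball v e w -> U (Phi w).
  by move=> bw; have [W1w Bw] := he _ bw; apply: hW1 => //; exact: open_disk_closed.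
have cK : compact (D `&` ~` (ball v e : set 'rV[R]_n)).
  apply: compact_closedI; first exact: closed_disk_compact.
  by rewrite closedC; exact: ball_open.
have clK : closed (Phi @` (D `&` ~` (ball v e : set 'rV[R]_n))).
  apply: compact_closed => //; apply: cont_on_compact => //.
  by apply: cont_on_sub cPhi => w [].
(* [W] is open as the complement of compact sets, and it meets the enlarged set only in the image of
   the ball. *)
pose W := ~` (A `|` Phi @` (D `&` ~` (ball v e : set 'rV[R]_n))).
have WD w : D w -> W (Phi w) -> ball v e w.
  by move=> Dw nW; apply: contrapT => nb; apply: nW; right; exists w.
pose psi y := xget v [set w | ball v e w /\ Phi w = y].
have psiK w : ball v e w -> psi (Phi w) = w.
  move=> bw; have [b' e'] : [set w' | ball v e w' /\ Phi w' = Phi w] (psi (Phi w)).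
    by apply: (@xgetPex _ v [set w' | ball v e w' /\ Phi w' = Phi w]); exists w.
  by apply: injPhi; rewrite ?inE //; exact: bB.
have WP y : (A `|` Phi @` B) y -> W y -> exists2 w, ball v e w & Phi w = y.
  move=> [Ay|[w Bw <-]] Wy; first by case: Wy; left.
  by exists w => //; apply: WD => //; exact: open_disk_closed.
have seg w t : ball v e w -> 0 <= t <= 1 -> ball v e (v + (1 - t) *: (w - v)).
  rewrite !mx_norm_ball /ball_ /= => bw tI.
  rewrite opprD addrA subrr add0r -scalerN opprB normrZ.
  by apply: le_lt_trans bw; apply: ler_piMl => //; rewrite ger0_norm; lra.
exists W, (fun z => Phi (v + (1 - z.2) *: (psi z.1 - v))); split.
- by rewrite openC; apply: closedU.
- move=> [Av|[w [Dw nw] e']]; first exact: (disjA Bv Av).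
  case: (closed_disk_case Dw) => hw.
    by apply: nw; rewrite (injPhi _ _ e') ?inE //; exact: ballxx.
  by apply: (disjA Bv); rewrite -e'; apply: sphereA; exists w.
- have cpsi : cont_on (Phi @` D `&` W) psi.
    apply: cont_on_quotient => //; first exact: closed_disk_compact.
      by rewrite openC; apply: closedU.
    apply: (cont_on_ext (f := id)); last by apply: cont_on_cts; exact: cts_id.
    by move=> w [Dw Ww]; rewrite psiK //; exact: WD.
  apply: (@cont_on_comp (X * R)%type 'rV[R]_n X _ D (fun z : X * R => v + (1 - z.2) *: (psi z.1 - v)) Phi) => //.
    pose f (z : 'rV[R]_n * R) := v + (1 - z.2) *: (z.1 - v).
    apply: (@cont_on_comp (X * R)%type ('rV[R]_n * R)%type 'rV[R]_n _ setT (fun z : X * R => (psi z.1, z.2)) f) => //.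
      apply: cont_on_cts => z; apply: (@continuousD R 'rV[R]_n ('rV[R]_n * R)%type (fun=> v) (fun z => (1 - z.2) *: (z.1 - v)) z); first exact: cst_continuous.
      apply: (@continuousZ R 'rV[R]_n ('rV[R]_n * R)%type (fun z => 1 - z.2) (fun z => z.1 - v) z).
        have c : continuous (fun z : 'rV[R]_n * R => 1 - z.2) by cts.
        exact: c.
      by apply: (@continuousB R 'rV[R]_n ('rV[R]_n * R)%type fst (fun=> v) z); [exact: cvg_fst|exact: cst_continuous].
    apply: cont_on_pair; last by apply: cont_on_cts; exact: cts_snd.
    apply: (@cont_on_comp (X * R)%type X 'rV[R]_n _ (Phi @` D `&` W) fst psi) => //.
      by apply: cont_on_cts; exact: cts_fst.
    move=> [y t] [/= Ay Wy _]; split=> //; have [w bw <-] := WP y Ay Wy.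
    by exists w => //; apply: open_disk_closed; exact: bB.
  move=> [y t] [/= Ay Wy tI]; have [w bw e'] := WP y Ay Wy.
  by apply: open_disk_closed; apply: bB; apply: seg => //; rewrite -e' psiK.
- move=> y Ay Wy; have [w bw e'] := WP y Ay Wy; rewrite /= -e' psiK // e'.
  rewrite subr0 subrr scale1r scale0r addr0 addrC subrK; split=> // t tI.
  have b' := seg w t bw tI; split; last exact: bU.
  by right; exists (v + (1 - t) *: (w - v)) => //; exact: bB.
Qed.

(** Near a point of [A], the cell is pushed radially onto its boundary sphere, hence into [A]; then
    the contraction [h0] of [A] takes over. *)
Lemma lc_base x U : locally_contractible A -> A x -> open U -> U x ->
  exists (W : set X) (h : X * R -> X),
    [/\ open W, W x, cont_on [set z : X * R | [/\ (A `|` Phi @` B) z.1, W z.1 & 0 <= z.2 <= 1]] h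
      & forall y, (A `|` Phi @` B) y -> W y -> [/\ h (y, 0) = y, h (y, 1) = x
        & forall t, 0 <= t <= 1 -> (A `|` Phi @` B) (h (y, t)) /\ U (h (y, t))]].
Proof.
move=> lcA Ax oU Ux; have [W0 [h0 [oW0 W0x ch0 hh0]]] := lcA x U Ax oU Ux.
have cD := @closed_disk_compact R n.
pose K := D `*` [set t : R | 0 <= t <= 1].
have cK : compact K.
  apply: compact_setX => //; rewrite (_ : [set t | _] = `[0 : R, 1]%classic); first exact: segment_compact.
  by apply/seteqP; split=> t /=; rewrite in_itv.
(* The first clause ensures that the push reaches the sphere. Goodness is relatively open, so the
   disk points that fail it at some time form a compact set, whose image is removed from the
   neighbourhood. *)
pose good (z : 'rV[R]_n * R) := [/\ 2^-1 < Num.sqrt (nrm2 z.1),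
  U (Phi (push z)) & W0 (Phi (push (z.1, 1)))].
have cPp : cont_on K (fun z => Phi (push z)).
  apply: (cont_on_comp cPhi); first by apply: cont_on_cts; exact: push_continuous.
  by case=> w t [/= Dw tI]; exact: push_disk.
have cPp1 : cont_on K (fun z => Phi (push (z.1, 1))).
  apply: (cont_on_comp cPhi).
    by apply: cont_on_cts; apply: (cts_comp (@push_continuous R n)); cts.
  by case=> w t [/= Dw tI]; apply: push_disk => //; exact: in01_1.
have cbad : compact (K `&` ~` good).
  apply: compact_relopenD => // z Kz [r1 Uz Wz].
  have [W1 [oW1 W1z h1]] := cPp z Kz U oU Uz.
  have [W2 [oW2 W2z h2]] := cPp1 z Kz W0 oW0 Wz.
  have c3 : continuous (fun z : 'rV[R]_n * R => Num.sqrt (nrm2 z.1)).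
    apply: (cts_comp (@sqrt_continuous R)); apply: (cts_comp (@nrm2_continuous R n)); cts.
  exists ((fun z => Num.sqrt (nrm2 z.1)) @^-1` [set t : R | 2^-1 < t] `&` (W1 `&` W2)); split.
  - apply: openI; last exact: openI.
    by apply: open_comp; [by move=> ? _; exact: c3|exact: open_gt].
  - by [].
  - by move=> u Ku [ru [W1u W2u]]; split=> //; [exact: h1|exact: h2].
pose bad := fst @` (K `&` ~` good).
have badD : bad `<=` D by move=> _ [[w t] [[/= Dw _] _] <-].
have clbad : closed (Phi @` bad).
  apply: compact_closed => //; apply: cont_on_compact; last exact: cont_on_sub cPhi.
  by apply: cont_on_compact => //; apply: cont_on_cts; exact: cts_fst.
pose W := W0 `&` U `&` ~` (Phi @` bad).
have oW : open W by apply: openI; [exact: openI|rewrite openC].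
have Wgood w t : D w -> W (Phi w) -> 0 <= t <= 1 -> good (w, t).
  move=> Dw [_ nbad] tI; apply: contrapT => ng; apply: nbad.
  by exists w => //; exists (w, t).
pose psi y := xget (0 : 'rV[R]_n) [set w | B w /\ Phi w = y].
have psiK w : B w -> psi (Phi w) = w.
  move=> bw; have [b' e'] : [set w' | B w' /\ Phi w' = Phi w] (psi (Phi w)).
    by apply: (@xgetPex _ 0 [set w' | B w' /\ Phi w' = Phi w]); exists w.
  by apply: injPhi; rewrite ?inE.
(* On the sphere both clauses agree because [push] fixes it. Continuity on the closed cell descends
   from the disk through [cont_on_quotient]. *)
pose g (z : X * R) := if `[< A z.1 >] then z.1 else Phi (push (psi z.1, z.2)).
have gA y t : A y -> g (y, t) = y by move=> Ay; rewrite /g asboolT.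
have gD w t : D w -> g (Phi w, t) = Phi (push (w, t)).
  move=> Dw; case: (closed_disk_case Dw) => hw; last first.
    by rewrite push_sphere // gA //; apply: sphereA; exists w.
  by rewrite /g asboolF /= ?psiK //; exact: disjA.
have AB y : (A `|` Phi @` B) y -> A y \/ exists2 w, B w & y = Phi w.
  by case=> [|[w Bw <-]]; [left|right; exists w].
have g1 y : (A `|` Phi @` B) y -> W y -> A (g (y, 1)) /\ W0 (g (y, 1)).
  move=> /AB[Ay|[w Bw ->]] Wy; first by rewrite gA //; case: Wy => [[]].
  have Dw := open_disk_closed Bw; have [/= r1 U1 W1] := Wgood w 1 Dw Wy (in01_1 R).
  rewrite gD //; split=> //; apply: sphereA; exists (push (w, 1)) => //; exact: push1.
pose Z := [set z : X * R | [/\ (A `|` Phi @` B) z.1, W z.1 & 0 <= z.2 <= 1]].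
have cg : cont_on Z g.
  apply: (@cont_on_glue _ _ _ (fst @^-1` A) (fst @^-1` (Phi @` D))).
  - by apply: closed_comp => // z _; exact: cts_fst.
  - apply: closed_comp => [z _|]; first exact: cts_fst.
    by apply: compact_closed => //; exact: cont_on_compact.
  - move=> z [/AB[Ay|[w Bw e]] _ _]; [by left|right; exists w => //; exact: open_disk_closed].
  - apply: (cont_on_ext (f := fst)); last by apply: cont_on_cts; exact: cts_fst.
    by case=> y t [_ /= Ay]; rewrite gA.
  - apply: (@cont_on_sub _ _ _ ((fun z : 'rV[R]_n * R => (Phi z.1, z.2)) @` K `&` (fst @^-1` W))).
      case=> y t [[/= _ Wy tI] [w Dw e]]; split=> //; exists (w, t) => //=.
      by rewrite e.
    apply: cont_on_quotient => //.
    + by apply: hausdorff_prod => //; exact: Rhausdorff.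
    + apply: cont_on_pair; last by apply: cont_on_cts; exact: cts_snd.
      apply: (cont_on_comp cPhi); first by apply: cont_on_cts; exact: cts_fst.
      by move=> z [].
    + by apply: open_comp => // z _; exact: cts_fst.
    + apply: (cont_on_ext (f := fun z => Phi (push z))).
        by case=> w t [[/= Dw _] _]; rewrite gD.
      by apply: cont_on_sub cPp => z [].
exists W, (fun z => if z.2 <= 2^-1 then g (z.1, 2 * z.2) else h0 (g (z.1, 1), 2 * z.2 - 1)).
split=> //.
- split; first by [].
  case=> w [[w' t] [[/= Dw tI] ng] <-] e; apply: ng.
  case: (closed_disk_case Dw) => hw; first by case: (disjA hw); rewrite e.
  split=> /=; rewrite ?push_sphere ?e //.
  by rewrite [nrm2 _]hw sqrtr1; lra.
- apply: (@cont_on_glue _ _ _ [set z : X * R | z.2 <= 2^-1] [set z : X * R | 2^-1 <= z.2]).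
  + apply: (@closed_comp _ _ (snd : X * R -> R) [set t | t <= 2^-1]); last exact: closed_le.
    by move=> z _; exact: cts_snd.
  + apply: (@closed_comp _ _ (snd : X * R -> R) [set t | 2^-1 <= t]); last exact: closed_ge.
    by move=> z _; exact: cts_snd.
  + by move=> z _ /=; case: (leP z.2 2^-1) => [|/ltW]; [left|right].
  + apply: (@cont_on_ext (X * R)%type X _ (fun z : X * R => g (z.1, 2 * z.2))).
      by move=> z [_ /= ->].
    apply: (@cont_on_comp (X * R)%type (X * R)%type X _ Z (fun z : X * R => (z.1, 2 * z.2)) g) => //.
      by apply: cont_on_cts; cts.
    by move=> z [[Az Wz tI] /= th]; split=> //=; lra.
  + apply: (@cont_on_ext (X * R)%type X _ (fun z : X * R => h0 (g (z.1, 1), 2 * z.2 - 1))).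
      move=> z [[Az Wz tI] /= th]; case: ifPn => // th'.
      have -> : 2 * z.2 = 1 by lra.
      by rewrite subrr; have [a b] := g1 _ Az Wz; have [] := hh0 _ a b.
    apply: (cont_on_comp ch0).
      apply: cont_on_pair; last by apply: cont_on_cts; cts.
      apply: (@cont_on_comp (X * R)%type (X * R)%type X _ Z (fun z : X * R => (z.1, 1)) g) => //.
        by apply: cont_on_cts; cts.
      by move=> z [[Az Wz tI] /= th]; split=> //=; exact: in01_1.
    move=> z [[Az Wz tI] /= th]; have [a b] := g1 _ Az Wz.
    by split=> //=; lra.
- move=> y Ay Wy; have [a b] := g1 _ Ay Wy; rewrite /= half_ge0 one_gt_half.
  have [e0 e1 ht] := hh0 _ a b; split.
  + rewrite mulr0; case/AB: Ay => [Ay|[w Bw ->]]; first by rewrite gA.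
    by rewrite gD ?push0 //; exact: open_disk_closed.
  + by rewrite (_ : 2 * 1 - 1 = 1) //; lra.
  + move=> t tI; case: ifPn => th; last first.
      rewrite -ltNge in th; have [|A1 U1] := ht (2 * t - 1); first by lra.
      by split=> //; left.
    have t2 : 0 <= 2 * t <= 1 by lra.
    case/AB: Ay => [Ay|[w Bw e]]; first by rewrite gA //; split; [left|case: Wy => [[]]].
    rewrite e; have Dw := open_disk_closed Bw; rewrite gD //; split.
      suff : (A `|` Phi @` D) (Phi (push (w, 2 * t))) by rewrite -cell_closure.
      by right; exists (push (w, 2 * t)) => //; exact: push_disk.
    by rewrite e in Wy; have [] := Wgood w _ Dw Wy t2.
Qed.

End CellAttachment.

Section CWLocal.
Variables (R : realType) (X : topologicalType).

(** Induction on the number of cells in a set [J] that contains, with a cell, all cells of lower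
    dimension. Removing a cell of maximal dimension leaves such a set, and the attaching sphere lies
    in it. *)
Lemma CW_lc : finite_CW_complex R X ->
  [/\ hausdorff_space X, compact [set: X] & locally_contractible R [set: X]].
Proof.
case=> hX [I [d [Phi [cPhi injPhi cover triv sph]]]].
suff [? ?] : compact [set: X] /\ locally_contractible R [set: X] by split.
pose cell i := Phi i @` open_disk R (d i).
suff H (J : {set I}) : (forall i j, i \in J -> (d j < d i)%N -> j \in J) ->
    compact (\bigcup_(i in [set i | i \in J]) cell i) /\
    locally_contractible R (\bigcup_(i in [set i | i \in J]) cell i).
  have [|H1 H2] := H finset.setT; first by move=> *; rewrite finset.in_setT.
  have E : \bigcup_(i in [set i | i \in finset.setTfor I]) cell i = [set: X].
    by rewrite -cover; apply/seteqP; split=> x [i _ ?]; exists i => //=; rewrite finset.in_setT.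
  by rewrite -E.
have [m] := ubnP #|J|; elim: m J => // m IH J Jm Jd.
have [->|/finset.set0Pn[i0 Ji0]] := eqVneq J finset.set0.
  rewrite (_ : \bigcup_(i in _) _ = set0); first by split; [exact: compact0|].
  by apply/seteqP; split=> x [] // i /=; rewrite finset.in_set0.
have [i Ji imax] := @arg_maxnP I i0 (mem J) d Ji0; have {}Ji : i \in J := Ji.
have Jd' k j : k \in (J :\ i)%SET -> (d j < d k)%N -> j \in (J :\ i)%SET.
  rewrite !finset.in_setD1 => /andP[_ Jk] jk; rewrite (Jd k) // andbT.
  by apply: contraTneq jk => ->; rewrite -leqNgt; exact: imax.
have [|cA lcA] := IH _ _ Jd'.
  by move: Jm; rewrite (finset.cardsD1 i) Ji add1n ltnS.
set A := \bigcup_(k in [set k | k \in (J :\ i)%SET]) cell k in cA lcA.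
have -> : \bigcup_(i in [set i | i \in J]) cell i = A `|` Phi i @` open_disk R (d i).
  apply/seteqP; split=> x.
    move=> [k Jk cx]; have [e|ne] := eqVneq k i; first by right; rewrite -e.
    by left; exists k => //; apply/finset.setD1P.
  case=> [[k Jk cx]|cx]; last by exists i.
  by exists k => //; move: Jk; rewrite /= finset.in_setD1 => /andP[].
have sA : Phi i @` sphere R (d i) `<=` A.
  move=> x /sph [j /= ji cx]; exists j => //=; rewrite finset.in_setD1 (Jd i) // andbT.
  by apply: contraTneq ji => ->; rewrite ltnn.
have dA v : open_disk R (d i) v -> ~ A (Phi i v).
  move=> Bv [k /= Jk [w Bw e]]; move: Jk; rewrite finset.in_setD1 => /andP[/eqP ne _]; apply: ne.
  by apply: triv => //; exists (Phi i v); split; [exists w|exists v].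
have cPi : cont_on (closed_disk R (d i)) (Phi i) by exact/cont_onP.
split; first exact: cell_compact.
move=> x U [Ax|[v Bv <-]] oU Ux; first by apply: lc_base.
by apply: lc_cell.
Qed.

End CWLocal.

(** * Good covers *)

Section NiceSpaces.
Variable R : realType.

Definition locally_path_connected (X : topologicalType) : Prop :=
  forall (x : X) U, open U -> U x -> exists W, [/\ open W, W x &
    forall y, W y -> exists2 c : R -> X, ispath x y c & forall s, 0 <= s <= 1 -> U (c s)].

Definition semilocally_simply_connected (X : topologicalType) : Prop :=
  forall x : X, exists2 U, open_nbhs x U & forall c : R -> X, continuous c -> c 0 = c 1 ->
    (forall s, 0 <= s <= 1 -> U (c s)) -> hpath c (fun=> c 0).

Definition nice_space (X : topologicalType) : Prop :=
  [/\ hausdorff_space X, compact [set: X], locally_path_connected X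
    & semilocally_simply_connected X].

Lemma lc_lpc (X : topologicalType) :
  locally_contractible R [set: X] -> locally_path_connected X.
Proof.
move=> lc x U oU Ux; have [W [h [oW Wx ch hh]]] := lc x U I oU Ux.
exists W; split=> // y Wy; have [h0 h1 hU] := hh y I Wy.
exists (fun s => h (y, 1 - cl01 s)); last first.
  by move=> s sI; have [|] := hU (1 - cl01 s) => //; have := cl01_in s; lra.
split; rewrite ?cl01_0 ?cl01_1 ?subr0 ?subrr //.
apply/continuous_subspace_setT/cont_onP.
apply: (@cont_on_comp R (X * R)%type X _ _ (fun s => (y, 1 - cl01 s)) h ch) => [|s _].
  by apply: cont_on_cts; cts.
by split=> //=; have := cl01_in s; lra.
Qed.

(** On the square [F (s, t) = h (c s, t)] the bottom side is [c], the top side is constant, and the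
    two vertical sides coincide since [c] is closed. So [c] is homotopic to a path followed by its
    reverse. *)
Lemma lc_slsc (X : topologicalType) :
  locally_contractible R [set: X] -> semilocally_simply_connected X.
Proof.
move=> lc x; have [W [h [oW Wx ch hh]]] := lc x setT I openT I.
exists W => // c cc c01 cW.
have cWs s : W (c (cl01 s)) by apply: cW; exact: cl01_in.
pose F (z : R * R) := h (c (cl01 z.1), cl01 z.2).
have cF : continuous F.
  apply/continuous_subspace_setT/cont_onP.
  apply: (@cont_on_comp (R * R)%type (X * R)%type X _ _ (fun z => (c (cl01 z.1), cl01 z.2)) h ch) => [|z _].
    by apply: cont_on_cts; apply: cts_pair; [apply: (cts_comp cc)|]; cts.
  by split=> //=; exact: cl01_in.
pose q : R -> R * R := pcat (fun s => (0, s)) (pcat (fun s => (s, 1)) (fun s => (1, 1 - s))).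
have cq : continuous q.
  by apply: pcat_continuous; [cts|apply: pcat_continuous; [cts|cts|rewrite subr0]|rewrite pcat0].
pose de s := F (0, s).
have cde : continuous de by apply: (cts_comp cF); cts.
have F1 s : F (1, s) = de s by rewrite /de /F /= cl01_0 cl01_1 c01.
apply: hpath_trans (hpath_plane (F := F) (p := fun s => (s, 0)) (q := q) (d := F \o q) cF _ cq _ _ _ _) _ => //.
- by cts.
- by rewrite /q pcat0.
- by rewrite /q !pcat1 subrr.
- by move=> s sI; rewrite /F /= cl01_0 cl01_id //; have [-> _ _] := hh _ I (cW s sI).
have -> : F \o q = pcat de (pcat (fun=> de 1) (prv de)).
  apply/funext => s; rewrite /q /pcat /=; case: ifP => // _; case: ifP => // _.
    by rewrite /de /F /= cl01_1; have [_ -> _] := hh _ I (cWs (2 * (2 * s - 1)));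
       have [_ -> _] := hh _ I (cWs 0).
have cpde := prv_continuous cde.
have h1 : hpath (pcat (fun=> de 1) (prv de)) (prv de).
  by have := hpath_cat1p cpde; rewrite prv0.
apply: hpath_trans (hpath_cat _ (hpath_refl cde) h1) _; first by rewrite pcat0.
have -> : c 0 = de 0 by rewrite /de /F /= cl01_0; have [-> _ _] := hh _ I (cW 0 (in01_0 R)).
exact: hpath_catV.
Qed.

Lemma CW_nice (X : topologicalType) : finite_CW_complex R X -> nice_space X.
Proof. by move=> /CW_lc [? ? lc]; split=> //; [exact: lc_lpc|exact: lc_slsc]. Qed.

(** [W] is the path component of [x] in [U], so the connecting paths stay in [W]. *)
Lemma lpc_open (X : topologicalType) : locally_path_connected X ->
  forall (x : X) U, open U -> U x -> exists W, [/\ open W, W x, W `<=` U &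
    forall y, W y -> exists2 c : R -> X, ispath x y c & forall s, 0 <= s <= 1 -> W (c s)].
Proof.
move=> lpc x U oU Ux.
pose W := [set y | exists2 c : R -> X, ispath x y c & forall s, 0 <= s <= 1 -> U (c s)].
exists W; split.
- rewrite openE => y [c pc cU].
  have Uy : U y by case: pc => _ _ <-; apply: cU; exact: in01_1.
  have [W' [oW' W'y hW']] := lpc y U oU Uy.
  apply: (@filterS _ (nbhs y) _ W'); last exact: open_nbhs_nbhs.
  move=> z /hW' [d pd dU]; exists (pcat c d); first exact: ispath_cat pd.
  move=> s sI; rewrite /pcat; case: ifPn => [hs|]; first by apply: cU; lra.
  by rewrite -ltNge => hs; apply: dU; lra.
- by exists (fun=> x) => //; exact: ispath_cst.
- by move=> y [c [_ _ <-] cU]; apply: cU; exact: in01_1.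
- move=> y [c pc cU]; exists c => // s sI; exists (fun t => c (cl01 t * s)).
    case: pc => cc c0 c1; split; rewrite ?cl01_0 ?cl01_1 ?mul0r ?mul1r //.
    by apply: (cts_comp cc); cts.
  move=> t tI; apply: cU; rewrite cl01_id //.
  by case/andP: sI tI => s0 s1 /andP[t0 t1]; rewrite mulr_ge0 //= mulr_ile1.
Qed.

Lemma path_connected (X : topologicalType) : locally_path_connected X ->
  connected [set: X] -> forall x y : X, exists c : R -> X, ispath x y c.
Proof.
move=> lpc cX x; pose A := [set y | exists c : R -> X, ispath x y c].
suff E : A = setT by move=> y; have : A y by rewrite E.
have nb y : exists W, [/\ open W, W y & forall z, W z -> exists c : R -> X, ispath y z c].
  have [W [oW Wy hW]] := lpc y setT openT I.
  by exists W; split=> // z /hW [c pc _]; exists c.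
have oA : open A.
  rewrite openE => y [c pc]; have [W [oW Wy hW]] := nb y.
  apply: (@filterS _ (nbhs y) _ W); last exact: open_nbhs_nbhs.
  by move=> z /hW [d pd]; exists (pcat c d); exact: ispath_cat pd.
have oC : open (~` A).
  rewrite openE => y nA; have [W [oW Wy hW]] := nb y.
  apply: (@filterS _ (nbhs y) _ W); last exact: open_nbhs_nbhs.
  move=> z /hW [d pd] [c pc]; apply: nA; exists (pcat c (prv d)).
  exact: ispath_cat (ispath_rev pd).
apply: cX.
- by exists x, (fun=> x); exact: ispath_cst.
- by exists A => //; rewrite setTI.
- by exists A; rewrite ?setTI // -(setCK A); exact: open_closedC.
Qed.

Lemma path_connectedT (X : topologicalType) (x : X) :
  (forall y, exists c : R -> X, ispath x y c) -> connected [set: X].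
Proof.
move=> pc B [b Bb] [C oC BC] [C' cC' BC']; rewrite setTI in BC; rewrite setTI in BC'.
have oB : open B by rewrite BC.
have cB : closed B by rewrite BC'.
have bx y : exists c : R -> X, ispath b y c.
  have [c p1] := pc b; have [d p2] := pc y; exists (pcat (prv c) d).
  exact: ispath_cat (ispath_rev p1) p2.
apply/seteqP; split=> // y _; have [c [cc c0 c1]] := bx y.
suff E : c @^-1` B = setT by rewrite -c1; have : (c @^-1` B) 1 by rewrite E.
apply: (connectedR (R := R)).
- by exists 0; rewrite /preimage /= c0.
- exists (c @^-1` B); rewrite ?setTI //; apply: open_comp => // z _; exact: cc.
- exists (c @^-1` B); rewrite ?setTI //; apply: closed_comp => // z _; exact: cc.
Qed.

Lemma regular_point (X : topologicalType) : hausdorff_space X -> compact [set: X] ->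
  forall (x : X) U, open U -> U x -> exists W, [/\ open W, W x & closure W `<=` U].
Proof.
move=> hX cX x U oU Ux.
have cx : closed [set x] by apply: accessible_closed_set1; exact: hausdorff_accessible.
have nU : set_nbhs [set x] U by apply/set_nbhsP; exists U; split=> // y ->.
have [C /set_nbhsP[C' [oC' xC' CC']] clC] := compact_normal hX cX cx nU.
exists C'; split=> //; first exact: xC'.
by apply: subset_trans clC; exact: closureS.
Qed.

(** The union of two meeting members has to lie in one open set whose loops die in [X]. This is a
    star refinement, obtained from finitely many sets [W x] that cover [X] and have their closure in
    [U x]. *)
Lemma good_cover (X : topologicalType) : nice_space X ->
  exists (I : finType) (V : I -> set X) (v : I -> X),
  [/\ forall i, open (V i), forall x, exists i, V i x,
      forall i, V i (v i),
      forall i x, V i x -> exists2 c : R -> X, ispath (v i) x c &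
        forall s, 0 <= s <= 1 -> V i (c s) &
      forall i j, V i `&` V j !=set0 -> forall c : R -> X, continuous c -> c 0 = c 1 ->
        (forall s, 0 <= s <= 1 -> (V i `|` V j) (c s)) -> hpath c (fun=> c 0)].
Proof.
case=> hX cX lpc slsc.
have [U hU] : {U : X -> set X & forall x, open_nbhs x (U x) /\
    forall c : R -> X, continuous c -> c 0 = c 1 ->
    (forall s, 0 <= s <= 1 -> U x (c s)) -> hpath c (fun=> c 0)}.
  by apply: (@choice _ _ (fun x U => open_nbhs x U /\ forall c : R -> X, continuous c ->
    c 0 = c 1 -> (forall s, 0 <= s <= 1 -> U (c s)) -> hpath c (fun=> c 0))) => x;
    have [U oU h] := slsc x; exists U.
have [W hW] : {W : X -> set X & forall x, [/\ open (W x), W x x & closure (W x) `<=` U x]}.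
  apply: (@choice _ _ (fun x W => [/\ open W, W x & closure W `<=` U x])) => x.
  by have [[oU Ux] _] := hU x; exact: regular_point.
have fin (F : X -> set X) : (forall x, open (F x)) -> (forall x, F x x) ->
    exists D : {fset X}, forall x, exists2 y, y \in D & F y x.
  move=> oF Fx.
  (* Finite sets of points, filtered by inclusion, turn near-covering compactness into the
     extraction of a finite subfamily. *)
  pose Fil (S : set {fset X}) := exists D0 : {fset X}, forall D : {fset X},
    (forall y, y \in D0 -> y \in D) -> S D.
  have FF : Filter Fil.
    split; first by exists fset0%fset.
    - move=> S S' [D0 h0] [D1 h1]; exists (D0 `|` D1)%fset => D hD; split.
        by apply: h0 => y yD; apply: hD; rewrite inE yD.
      by apply: h1 => y yD; apply: hD; rewrite inE yD orbT.
    - by move=> S S' sS [D0 h0]; exists D0 => D hD; apply: sS; exact: h0.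
  have /compact_near_coveringP nc := cX.
  have [|D0 h0] := nc _ Fil (fun D x => exists2 y, y \in D & F y x) FF.
    move=> x _; exists (F x, [set D : {fset X} | x \in D]) => /=.
      split; first by apply: open_nbhs_nbhs; split.
      by exists [fset x]%fset => D; apply; rewrite inE.
    by case=> x' D /= [Fx' xD]; exists x.
  by exists D0 => x; exact: (h0 D0 (fun y yD => yD) x I).
have [D hD] := fin W (fun x => let: And3 a _ _ := hW x in a) (fun x => let: And3 _ a _ := hW x in a).
have [k hk] : {k : X -> X & forall y, k y \in D /\ W (k y) y}.
  by apply: (@choice _ _ (fun y x => x \in D /\ W x y)) => y; have [x ? ?] := hD y; exists x.
(* For each of the finitely many [x], the set [N y] lies in [U x] or misses the closure of [W x],
   according to the position of [y]. If [N y'] meets [N y], it meets [W (k y)], so the first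
   alternative holds for [y'] at [x = k y], and both sets lie in [U (k y)]. *)
pose N y := [set z | W (k y) z /\ forall x : D,
   (closure (W (fsval x)) y /\ U (fsval x) z) \/ (~ closure (W (fsval x)) y /\ (~` closure (W (fsval x))) z)].
have oN y : open (N y).
  rewrite openE => z [Wz hz].
  have : \forall z' \near z, W (k y) z'.
    by apply: open_nbhs_nbhs; split=> //; have [] := hW (k y).
  have : \forall z' \near z, forall x : D,
   (closure (W (fsval x)) y /\ U (fsval x) z') \/ (~ closure (W (fsval x)) y /\ (~` closure (W (fsval x))) z').
    apply: filter_forall => x; case: (hz x) => -[cl Uz].
      have : \forall z' \near z, U (fsval x) z'.
        by apply: open_nbhs_nbhs; split=> //; have [[]] := hU (fsval x).
      by apply: filterS => z' Uz'; left.
    have : \forall z' \near z, (~` closure (W (fsval x))) z'.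
      by apply: open_nbhs_nbhs; split=> //; rewrite openC; exact: closed_closure.
    by apply: filterS => z' Uz'; right.
  by apply: filterS2 => z' h1 h2.
have Ny y : N y y.
  split; first by have [] := hk y.
  move=> x; have [cl|ncl] := pselect (closure (W (fsval x)) y); last by right.
  by left; split=> //; have [_ _] := hW (fsval x); apply.
have [P hP] : {P : X -> set X & forall y, [/\ open (P y), P y y, P y `<=` N y &
    forall z, P y z -> exists2 c : R -> X, ispath y z c & forall s, 0 <= s <= 1 -> P y (c s)]}.
  apply: (@choice _ _ (fun y P => [/\ open P, P y, P `<=` N y &
    forall z, P z -> exists2 c : R -> X, ispath y z c & forall s, 0 <= s <= 1 -> P (c s)])) => y.
  exact: lpc_open.
have [D' hD'] := fin P (fun x => let: And4 a _ _ _ := hP x in a) (fun x => let: And4 _ a _ _ := hP x in a).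
exists D', (fun i => P (fsval i)), (fun i => fsval i); split.
- by move=> i; have [] := hP (fsval i).
- by move=> x; have [y yD Py] := hD' x; exists [` yD]%fset.
- by move=> i; have [] := hP (fsval i).
- by move=> i; have [] := hP (fsval i).
- move=> i j [w [Pi Pj]] c cc c01 cV.
  have [_ _ sNi _] := hP (fsval i); have [_ _ sNj _] := hP (fsval j).
  have [kD Wk] := hk (fsval i).
  have [_ hc] := hU (k (fsval i)); apply: hc => // s sI.
  have [Wkw _] := sNi _ Pi; have [_ hNj] := sNj _ Pj.
  have clj : closure (W (k (fsval i))) (fsval j).
    case: (hNj [` kD]%fset) => [[] //|[_ ncl]].
    by case: ncl; apply: subset_closure.
  case: (cV s sI) => [/sNi[_ /(_ [` kD]%fset)]|/sNj[_ /(_ [` kD]%fset)]] [[_ //]|[ncl _]].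
    by case: ncl; apply: subset_closure.
  by case: ncl.
Qed.

End NiceSpaces.

(** * Finite covers: inherited local properties and composition *)

Section FiniteCovers.
Variable R : realType.

Definition evenly (E Y : topologicalType) (p : E -> Y) (U : set Y) (J : Type) (V : J -> set E) :=
  [/\ p @^-1` U = \bigcup_i V i, trivIset [set: J] V
    & forall i, [/\ open (V i), set_bij (V i) U p
        & forall O, open O -> O `<=` V i -> open (p @` O)]].

Lemma evenly_ord (E Y : topologicalType) (p : E -> Y) U (J : finType) (V : J -> set E) (j0 : J) :
  evenly p U V -> exists (n : nat) (V' : 'I_n.+1 -> set E), evenly p U V'.
Proof.
case=> UV tV hV; have J0 : (0 < #|J|)%N by apply/card_gt0P; exists j0.
exists #|J|.-1; have e : #|J|.-1.+1 = #|J| by rewrite prednK.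
exists (fun i => V (enum_val (cast_ord e i))); split=> //.
- rewrite UV; apply/seteqP; split=> x [i _ Vi]; last by exists (enum_val (cast_ord e i)).
  by exists (cast_ord (esym e) (enum_rank i)) => //; rewrite cast_ordKV enum_rankK.
- move=> i j _ _ /(tV _ _ I I) /enum_val_inj; exact: cast_ord_inj.
Qed.

Lemma evenly_restrict (E Y : topologicalType) (p : E -> Y) U U' J (V : J -> set E) :
  continuous p -> open U' -> U' `<=` U -> evenly p U V ->
  evenly p U' (fun i => V i `&` p @^-1` U').
Proof.
move=> cp oU' sU [UV tV hV]; split.
- apply/seteqP; split=> [e U'e|e [i _ []] //].
  by have [i _ Vi] : (\bigcup_i V i) e; [rewrite -UV; exact: sU|exists i].
- by move=> i j _ _ [e [[Vi _] [Vj _]]]; apply: tV => //; exists e.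
- move=> i; have [oV [fV iV sV] om] := hV i; split.
  + by apply: openI => //; apply: open_comp => // z _; exact: cp.
  + split; first by move=> e [].
      by move=> e e'; rewrite !inE => -[Ve _] [Ve' _]; apply: iV; rewrite inE.
    by move=> y U'y; have [e Ve pe] := sV _ (sU _ U'y); exists e => //; split=> //; rewrite /preimage /= pe.
  + by move=> O oO sO; apply: om => // e /sO[].
Qed.

Variables (E Y : topologicalType) (p : E -> Y).
Hypothesis fp : finite_cover p.
Let covp := finite_cover_covering fp.

Lemma finite_cover_surj y : exists e, p e = y.
Proof.
have [_ _ /(_ y) [U [n [V [[oU Uy] UV _ hV]]]]] := fp.
by have [_ [_ _ /(_ _ Uy)[e _ pe]] _] := hV ord0; exists e.
Qed.

Lemma finite_cover_hausdorff : hausdorff_space Y -> hausdorff_space E.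
Proof.
have [cp _ ev] := fp; rewrite !open_hausdorff => hY e e' ne.
have [pe|npe] := eqVneq (p e) (p e').
  have [U [n [V [[oU Ue] UV tV hV]]]] := ev (p e).
  have [i _ Vi] : (\bigcup_i V i) e by rewrite -UV.
  have [j _ Vj] : (\bigcup_i V i) e' by rewrite -UV /preimage /= -pe.
  have [oVi [_ iV _] _] := hV i; have [oVj _ _] := hV j.
  exists (V i, V j); first by rewrite !inE.
  split=> //=; apply/eqP; apply/seteqP; split=> // z [Viz Vjz].
  have ij : i = j by apply: tV => //; exists z.
  by move/eqP: ne; apply; apply: iV; rewrite ?inE // ij.
have [[A B] [/= Ae Be] [oA oB AB]] := hY _ _ npe.
exists (p @^-1` A, p @^-1` B) => /=.
  by rewrite !inE in Ae Be *.
split; [by apply: open_comp oA => z _; exact: cp|by apply: open_comp oB => z _; exact: cp|].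
by rewrite -preimage_setI (eqP AB) preimage_set0.
Qed.

(** Let [y] be a cluster point of the image filter. If no point above [y] were a cluster point, each
    would have a neighbourhood avoided by some member of the filter; the fibre being finite, one
    member would avoid the preimage of a whole neighbourhood of [y]. *)
Lemma finite_cover_compact : compact [set: Y] -> compact [set: E].
Proof.
have [cp _ ev] := fp; move=> cY F FF _.
have [|y [_ cly]] := cY (p @ F); first exact: filterT.
have [U [n [V [[oU Uy] UV tV hV]]]] := ev y.
have [e he] : {e : 'I_n.+1 -> E & forall i, V i (e i) /\ p (e i) = y}.
  apply: (@choice _ _ (fun i e => V i e /\ p e = y)) => i.
  by have [_ [_ _ /(_ _ Uy)[x Vx px]] _] := hV i; exists x.
apply: contrapT => noc.
have [AB hAB] : {AB : 'I_n.+1 -> set E * set E & forall i,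
    [/\ F (AB i).1, open (AB i).2, (AB i).2 (e i) & (AB i).1 `&` (AB i).2 = set0]}.
  apply: (@choice _ _ (fun i (AB : set E * set E) =>
    [/\ F AB.1, open AB.2, AB.2 (e i) & AB.1 `&` AB.2 = set0])) => i.
  apply: contrapT => no; apply: noc; exists (e i); split=> // A B FA.
  rewrite nbhsE => -[B' [oB' B'e] sB]; apply: contrapT => h; apply: no.
  exists (A, B'); split=> //=; apply/seteqP; split=> // z [Az B'z].
  by apply: h; exists z; split=> //; exact: sB.
have FA : F [set x | forall i, (AB i).1 x].
  by apply: filter_forall => i; have [] := hAB i.
have nN : nbhs y [set x | U x /\ forall i, (p @` ((AB i).2 `&` V i)) x].
  have nU : nbhs y U by exact: open_nbhs_nbhs.
  suff h : nbhs y [set x | forall i, (p @` ((AB i).2 `&` V i)) x] by exact: filterI.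
  apply: filter_forall => i; have [_ oB Be _] := hAB i; have [oV _ om] := hV i.
  have [Ve pe] := he i; apply: open_nbhs_nbhs; split; last by exists (e i).
  by apply: om; [exact: openI|exact: subIsetr].
have pFA : F (p @^-1` (p @` [set x | forall i, (AB i).1 x])).
  by apply: filterS FA => x hx; exists x.
have [_ [[x hx <-] [Upx hpx]]] := cly _ _ pFA nN.
have [i _ Vi] : (\bigcup_i V i) x by rewrite -UV.
have [x' [Bx' Vx'] px'] := hpx i.
have [_ [_ iV _] _] := hV i; have xx' : x' = x by apply: iV; rewrite ?inE.
have [_ _ _ AB0] := hAB i; suff : ((AB i).1 `&` (AB i).2) x by rewrite AB0.
by split=> //; rewrite -xx'.
Qed.

Lemma finite_cover_lpc : locally_path_connected R Y -> locally_path_connected R E.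
Proof.
move=> lpc e O oO Oe.
have [U [oU Ue] hU] := covering_section covp (p e).
have [V [sg [oV Ve Vsg psg csg]]] := hU e Ue.
have oO' : open [set u | U u /\ O (sg u)].
  rewrite openE => u [Uu Ou].
  have h1 : \forall u' \near u, U u' by exact: open_nbhs_nbhs.
  have h2 : \forall u' \near u, O (sg u') by apply: (csg u Uu); exact: open_nbhs_nbhs.
  by apply: filterS2 h1 h2.
have [|W [oW We hW]] := lpc (p e) _ oO'; first by split=> //; rewrite (Vsg _ Ve).2.
have [cp _ _] := fp.
exists (V `&` p @^-1` W); split=> //; first by apply: openI => //; apply: open_comp => // z _; exact: cp.
move=> z [Vz Wz]; have [c [cc c0 c1] cO] := hW _ Wz.
exists (fun s => sg (c (cl01 s))); last by move=> s sI; have [] := cO _ (cl01_in s).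
split; last 2 first.
- by rewrite cl01_0 c0 (Vsg _ Ve).2.
- by rewrite cl01_1 c1 (Vsg _ Vz).2.
move=> s; apply: (@continuous_comp _ _ _ (fun s => c (cl01 s)) sg).
  by apply: (cts_comp cc); cts.
by apply: csg; have [] := cO _ (cl01_in s).
Qed.

Lemma finite_cover_slsc : semilocally_simply_connected R Y -> semilocally_simply_connected R E.
Proof.
move=> sl e; have [U [oU Ue] hU] := sl (p e); have [cp _ _] := fp.
exists (p @^-1` U); first by split=> //; apply: open_comp => // z _; exact: cp.
move=> c cc c01 cU; apply: (hpath_lift covp) => //; first exact: cts_const.
by apply: (hU (fun s => p (c s))) => //; [apply: (cts_comp cp)|rewrite c01].
Qed.

Lemma finite_cover_nice : nice_space R Y -> nice_space R E.
Proof.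
case=> hY cY lY sY; split; [exact: finite_cover_hausdorff|exact: finite_cover_compact
  |exact: finite_cover_lpc|exact: finite_cover_slsc].
Qed.

Variables (Z : topologicalType) (q : Z -> E).
Hypothesis fq : finite_cover q.

(** The neighbourhood [N] of [x] is so small that every sheet of [p] over it lies in an open set
    evenly covered by [q]; finitely many conditions suffice, one for each sheet. *)
Lemma finite_cover_comp : finite_cover (p \o q).
Proof.
have [cp cE evp] := fp; have [cq cZ evq] := fq.
split=> //; first by move=> z; apply: continuous_comp; [exact: cq|exact: cp].
move=> x; have [U [n [V [[oU Ux] UV tV hV]]]] := evp x.
have [e he] : {e : 'I_n.+1 -> E & forall i, V i (e i) /\ p (e i) = x}.
  apply: (@choice _ _ (fun i e => V i e /\ p e = x)) => i.
  by have [_ [_ _ /(_ _ Ux)[y Vy py]] _] := hV i; exists y.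
have [D hD] : {D : 'I_n.+1 -> {m : nat & 'I_m.+1 -> set Z} & forall i,
    exists2 O, open_nbhs (e i) O & evenly q O (projT2 (D i))}.
  apply: (@choice _ _ (fun i (D : {m : nat & 'I_m.+1 -> set Z}) =>
    exists2 O, open_nbhs (e i) O & evenly q O (projT2 D))) => i.
  by have [O [m [W [oO WO tW hW]]]] := evq (e i); exists (existT _ m W), O.
have [O hO] : {O : 'I_n.+1 -> set E & forall i, open_nbhs (e i) (O i) /\ evenly q (O i) (projT2 (D i))}.
  by apply: (@choice _ _ (fun i O => open_nbhs (e i) O /\ evenly q O (projT2 (D i)))) => i;
     have [O ? ?] := hD i; exists O.
pose N0 := [set u | U u /\ forall i, (p @` (O i `&` V i)) u].
have nN0 : nbhs x N0.
  have nU : nbhs x U by exact: open_nbhs_nbhs.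
  suff h : nbhs x [set u | forall i, (p @` (O i `&` V i)) u] by exact: filterI.
  apply: filter_forall => i; have [[oO Oe] _] := hO i; have [oV _ om] := hV i.
  have [Ve pe] := he i; apply: open_nbhs_nbhs; split; last by exists (e i).
  by apply: om; [exact: openI|exact: subIsetr].
move: nN0; rewrite nbhsE => -[N [oN Nx] sN].
have NU : N `<=` U by move=> u /sN[].
have evN : evenly p N (fun i => V i `&` p @^-1` N).
  by apply: (evenly_restrict cp oN NU); split.
have VO i : V i `&` p @^-1` N `<=` O i.
  move=> y [Vy Ny]; have [_ /(_ i) [y' [Oy' Vy'] py']] := sN _ Ny.
  by have [_ [_ iV _] _] := hV i; rewrite -(iV y' y) ?inE.
have evq' i : evenly q (V i `&` p @^-1` N)
    (fun k => projT2 (D i) k `&` q @^-1` (V i `&` p @^-1` N)).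
  apply: evenly_restrict => //; last by have [] := hO i.
  by have [_ _ h] := evN; have [] := h i.
(* The number of sheets of [q] may depend on the point of the fibre of [p], hence a dependent sum of
   index types. *)
pose J : finType := {i : 'I_n.+1 & 'I_(projT1 (D i)).+1}.
pose W (j : J) := projT2 (D (tag j)) (tagged j) `&` q @^-1` (V (tag j) `&` p @^-1` N).
suff evW : evenly (p \o q) N W.
  have j0 : J := Tagged (fun i => 'I_(projT1 (D i)).+1) (ord0 : 'I_(projT1 (D ord0)).+1).
  have [m [V' [h1 h2 h3]]] := evenly_ord j0 evW; exists N, m, V'; split=> //.
have [NV tN hN] := evN; split.
- apply/seteqP; split=> [z Nz|z [[i k] _ [_ [_ Nz]]] //].
  have [i _ Vi] : (\bigcup_i (V i `&` p @^-1` N)) (q z) by rewrite -NV.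
  have [h _ _] := evq' i.
  have [k _ Wk] : (\bigcup_k (projT2 (D i) k `&` q @^-1` (V i `&` p @^-1` N))) z by rewrite -h.
  by exists (Tagged (fun i => 'I_(projT1 (D i)).+1) k).
- move=> [i k] [i' k'] _ _ [z [[/= Wz Vz] [/= Wz' Vz']]].
  have ii : i = i' by apply: tN => //; exists (q z).
  subst i'; have [_ tq _] := evq' i.
  by have -> : k = k' by apply: tq => //; exists z.
- case=> i k; have [_ _ /(_ k) [oW bW omW]] := evq' i; have [oV bV omV] := hN i; split=> //.
    exact: (set_bij_comp bW bV).
  move=> A oA sA; rewrite -(image_comp q p).
  apply: omV; first exact: omW.
  by move=> _ [z Az <-]; have [_] := sA _ Az.
Qed.

End FiniteCovers.

(** * Free groups *)

Section FreeGroupTheory.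
Variable r : nat.
Implicit Types (f : free_group r).

Definition letter_elt (a : letter r) : free_group r :=
  if a.2 then free_gen a.1 else ((free_gen a.1)^-1)%g.

Lemma free_word_ind (P : free_group r -> Prop) :
  P 1%g -> (forall a f, P f -> P (letter_elt a * f)%g) -> forall f, P f.
Proof.
move=> P1 PM [w rw]; elim: w rw => [|a w IH] rw.
  by have -> : FreeGroup rw = 1%g by apply: val_inj.
have rw' : reduced_word w by exact: path_sorted rw.
have -> : FreeGroup rw = (letter_elt a * FreeGroup rw')%g; last exact: PM.
apply: val_inj; case: a rw => i [] rw /=; rewrite /letter_mul;
  by case: w rw rw' {IH} => //= b w /andP[/negPf ->].
Qed.

Lemma free_group_ind (P : free_group r -> Prop) :
  (forall i, P (free_gen i)) -> (forall f g, P f -> P g -> P (f * g)%g) ->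
  (forall f, P f -> P (f^-1)%g) -> P 1%g -> forall f, P f.
Proof.
move=> Pg PM PV P1; apply: free_word_ind => // -[i b] f Pf.
by apply: PM => //; case: b; [exact: Pg|apply: PV; exact: Pg].
Qed.

Variables (G : groupType) (x : 'I_r -> G).

Definition letter_val (a : letter r) : G := if a.2 then x a.1 else ((x a.1)^-1)%g.
Definition word_val (w : seq (letter r)) : G := foldr (fun a g => letter_val a * g)%g 1%g w.
Definition free_lift f : G := word_val f.

Lemma letter_val_inv a : letter_val (letter_inv a) = ((letter_val a)^-1)%g.
Proof. by case: a => i [] /=; rewrite /letter_val /= ?invgK. Qed.

Lemma word_val_mul a w : word_val (letter_mul a w) = (letter_val a * word_val w)%g.
Proof.
case: w => [|b w] //=; case: ifPn => // /eqP ->.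
by rewrite letter_val_inv mulVKg.
Qed.

Lemma free_liftM : {morph free_lift : f g / (f * g)%g}.
Proof.
move=> f g; rewrite /free_lift /=; elim: (free_word f) => /= [|a u IH]; first by rewrite mul1g.
by rewrite word_val_mul IH mulgA.
Qed.

Lemma free_lift_gen i : free_lift (free_gen i) = x i.
Proof. by rewrite /free_lift /= mulg1. Qed.

End FreeGroupTheory.

Section Morphisms.
Variables (G H : groupType) (f : G -> H).
Hypothesis fM : {morph f : x y / (x * y)%g}.

Lemma morph_one : f 1%g = 1%g.
Proof. by apply: (mulgI (f 1%g)); rewrite mulg1 -fM mulg1. Qed.

Lemma morph_inv x : f (x^-1)%g = ((f x)^-1)%g.
Proof. by apply: (mulgI (f x)); rewrite -fM !mulgV morph_one. Qed.

End Morphisms.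

Lemma free_lift_uniq r (G : groupType) (f : free_group r -> G) :
  {morph f : g h / (g * h)%g} -> forall g, f g = word_val (fun i => f (free_gen i)) g.
Proof.
move=> fM g; rewrite -/(free_lift _ g).
elim/free_group_ind: g => [i|g h eg eh|g eg|]; first by rewrite free_lift_gen.
- by rewrite fM eg eh free_liftM.
- by rewrite (morph_inv fM) eg (morph_inv (free_liftM _)).
- by rewrite (morph_one fM).
Qed.

(** * Finite presentation of the fundamental group *)

Section NullLoops.
Variables (R : realType) (Y : topologicalType).
Implicit Types c : R -> Y.

Lemma hpath_of_loop (x x' : Y) (c d : R -> Y) : ispath x x' c -> ispath x x' d ->
  hpath (pcat c (prv d)) (fun=> x) -> hpath c d.
Proof.
move=> [cc c0 c1] [cd d0 d1] h.
have cr := prv_continuous cd.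
have h1 : hpath c (pcat c (fun=> c 1)) by apply: hpath_sym; exact: hpath_catp1.
apply: hpath_trans h1 _.
have h2 : hpath (fun=> c 1) (pcat (prv d) d).
  by rewrite c1 -d1; apply: hpath_sym; exact: hpath_Vcat.
apply: hpath_trans (hpath_cat _ (hpath_refl cc) h2) _ => //.
apply: hpath_trans (hpath_sym (hpath_catA cc cr cd _ _)) _.
- by rewrite prv0 c1.
- by rewrite prv1.
apply: hpath_trans (hpath_cat _ h (hpath_refl cd)) _; first by rewrite pcat1 prv1.
by rewrite -d0; exact: hpath_cat1p.
Qed.

Lemma transport_eq1 (y u v : Y) (g c g' : R -> Y) :
  ispath y u g -> ispath u v c -> ispath y v g' ->
  hpath (pcat g c) g' -> transport y g c g' = 1%g.
Proof.
move=> pg pc pg' h; rewrite -pclass1; apply: pclass_hpath; last exact: cts_const.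
  exact: (transportP pg pc pg').
case: (pg') => cg' g0 g1; rewrite -g0.
apply: hpath_trans (hpath_catV cg').
apply: hpath_cat => //; last by apply: hpath_refl; exact: prv_continuous.
by rewrite pcat1 prv0 g1; case: pc.
Qed.

Definition seg (c : R -> Y) (a b s : R) : Y := c (a + (b - a) * s).

Lemma ispath_seg c a b : continuous c -> ispath (c a) (c b) (seg c a b).
Proof.
move=> cc; rewrite /seg; split; first by apply: (cts_comp cc); cts.
  by rewrite mulr0 addr0.
by rewrite mulr1 addrC subrK.
Qed.

Lemma seg_cat c a b b' : continuous c -> hpath (pcat (seg c a b) (seg c b b')) (seg c a b').
Proof.
move=> cc.
apply: (@hpath_reparam R Y c
  (pcat (fun s => a + (b - a) * s) (fun s => b + (b' - b) * s)) (fun s => a + (b' - a) * s)) => //.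
- by apply: pcat_continuous; [cts|cts|lra].
- by cts.
- by rewrite pcat0 !mulr0.
- by rewrite pcat1; lra.
- by move=> s sI; rewrite /pcat /seg; case: ifP.
Qed.

End NullLoops.

Section GoodCover.
Variables (R : realType) (Y : topologicalType) (y0 : Y).
Variables (I : finType) (V : I -> set Y) (v : I -> Y).
Hypothesis oV : forall i, open (V i).
Hypothesis covV : forall x, exists i, V i x.
Hypothesis Vv : forall i, V i (v i).
Hypothesis pathV : forall i x, V i x -> exists2 c : R -> Y, ispath (v i) x c &
        forall s, 0 <= s <= 1 -> V i (c s).
Hypothesis nullV : forall i j, V i `&` V j !=set0 -> forall c : R -> Y, continuous c ->
  c 0 = c 1 -> (forall s, 0 <= s <= 1 -> (V i `|` V j) (c s)) -> hpath c (fun=> c 0).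
Variables (i0 : I) (gam : I -> R -> Y).
Hypothesis Vy0 : V i0 y0.
Hypothesis pgam : forall i, ispath y0 (v i) (gam i).

Notation r := #|{: I * I}|.
Notation F := (free_group r).

(** One generator for every ordered pair of charts, meeting or not; relators later kill the pairs
    that do not meet. *)
Definition edge (i j : I) : F := free_gen (enum_rank (i, j)).
Definition meet (i j : I) : bool := `[< V i `&` V j !=set0 >].

Definition sig (i : I) (x : Y) : R -> Y :=
  xget (fun=> x) [set c | ispath (v i) x c /\ forall s, 0 <= s <= 1 -> V i (c s)].

Lemma sigP i x : V i x -> ispath (v i) x (sig i x) /\ forall s, 0 <= s <= 1 -> V i (sig i x s).
Proof.
move=> Vx; have [c pc cV] := pathV Vx.
by apply: (@xgetPex _ (fun=> x) [set c | ispath (v i) x c /\ forall s, 0 <= s <= 1 -> V i (c s)]); exists c.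
Qed.

Definition bpath (i : I) (x : Y) : R -> Y := pcat (gam i) (sig i x).

Lemma bpathP i x : V i x -> ispath y0 x (bpath i x).
Proof. by move=> Vx; have [ps _] := sigP Vx; exact: ispath_cat ps. Qed.

(** Parallel transport in charts: the path [c] is tied to [y0] through the chart [i] at its start
    and through the chart [j] at its end. *)
Definition hol (i j : I) (x : Y) (c : R -> Y) (x' : Y) : pi1 R y0 :=
  transport y0 (bpath i x) c (bpath j x').

Lemma holM i j k x x' x'' (c d : R -> Y) : V i x -> V j x' -> V k x'' ->
  ispath x x' c -> ispath x' x'' d ->
  (hol i j x c x' * hol j k x' d x'')%g = hol i k x (pcat c d) x''.
Proof.
by move=> Vx Vx' Vx'' pc pd; exact: (transportM (bpathP Vx) pc (bpathP Vx') pd (bpathP Vx'')).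
Qed.

Lemma hol_hpath i j x x' (c d : R -> Y) : V i x -> V j x' -> ispath x x' c -> hpath c d ->
  continuous d -> hol i j x c x' = hol i j x d x'.
Proof.
by move=> Vx Vx' pc h cd; apply: transport_hpath (bpathP Vx) pc (bpathP Vx') h cd.
Qed.

Lemma hpath_in i j x x' (c d : R -> Y) : V i `&` V j !=set0 -> ispath x x' c -> ispath x x' d ->
  (forall s, 0 <= s <= 1 -> V i (c s)) -> (forall s, 0 <= s <= 1 -> V j (d s)) -> hpath c d.
Proof.
move=> ne pc pd cV dV; apply: (hpath_of_loop pc pd).
have [ccd e0 e1] := ispath_cat pc (ispath_rev pd).
have := nullV ne ccd; rewrite e0 e1; apply=> // s sI; rewrite /pcat.
case: ifPn => [hs|]; first by left; apply: cV; lra.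
by rewrite -ltNge => hs; right; apply: dV; lra.
Qed.

Lemma hol_in i x x' (c : R -> Y) : V i x -> V i x' -> ispath x x' c ->
  (forall s, 0 <= s <= 1 -> V i (c s)) -> hol i i x c x' = 1%g.
Proof.
move=> Vx Vx' pc cV; have [ps sV] := sigP Vx; have [ps' sV'] := sigP Vx'.
apply: (transport_eq1 (bpathP Vx) pc (bpathP Vx')).
have [cg g0 g1] := pgam i; have [cs s0 s1] := ps; have [cc c0 c1] := pc.
apply: hpath_trans (hpath_catA cg cs cc _ _) _; rewrite ?g1 ?s1 //.
apply: hpath_cat; [by rewrite pcat0 g1|exact: hpath_refl|].
apply: (@hpath_in i i (v i) x') => //; first by exists x.
- exact: ispath_cat pc.
- move=> s sI; rewrite /pcat; case: ifPn => [hs|]; first by apply: sV; lra.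
  by rewrite -ltNge => hs; apply: cV; lra.
Qed.

(** The overlap may be disconnected, but its points can be joined inside [V i] and inside [V j], and
    the two joining paths are homotopic because loops in the union of the two charts are null. *)
Lemma hol_const i j x x' : V i x -> V j x -> V i x' -> V j x' ->
  hol i j x (fun=> x) x = hol i j x' (fun=> x') x'.
Proof.
move=> Vix Vjx Vix' Vjx'.
have [pi iV] := sigP Vix; have [pi' iV'] := sigP Vix'.
have [pj jV] := sigP Vjx; have [pj' jV'] := sigP Vjx'.
pose d := pcat (prv (sig i x)) (sig i x'); pose e := pcat (prv (sig j x)) (sig j x').
have pd : ispath x x' d by apply: ispath_cat (ispath_rev pi) pi'.
have pe : ispath x x' e by apply: ispath_cat (ispath_rev pj) pj'.
have dV s : 0 <= s <= 1 -> V i (d s).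
  move=> sI; rewrite /d /pcat /prv; case: ifPn => [hs|]; first by apply: iV; lra.
  by rewrite -ltNge => hs; apply: iV'; lra.
have eV s : 0 <= s <= 1 -> V j (e s).
  move=> sI; rewrite /e /pcat /prv; case: ifPn => [hs|]; first by apply: jV; lra.
  by rewrite -ltNge => hs; apply: jV'; lra.
have hde : hpath d e by apply: (@hpath_in i j x x') => //; exists x.
have [cd d0 d1] := pd; have [ce e0 e1] := pe.
have h1 : hpath (pcat (fun=> x) e) e by rewrite -e0; exact: hpath_cat1p.
have h2 : hpath (pcat d (fun=> x')) d by rewrite -d1; exact: hpath_catp1.
have px := ispath_cst R x; have px' := ispath_cst R x'.
transitivity (hol i j x e x').
  rewrite -(mulg1 (hol i j x _ x)) -(hol_in Vjx Vjx' pe eV) (holM Vix Vjx Vjx' px pe).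
  exact: (hol_hpath Vix Vjx' (ispath_cat px pe) h1).
rewrite -(hol_hpath Vix Vjx' pd hde ce).
rewrite -(mul1g (hol i j x' _ x')) -(hol_in Vix Vix' pd dV) (holM Vix Vix' Vjx' pd px').
by apply/esym; exact: (hol_hpath Vix Vjx' (ispath_cat pd px') h2).
Qed.

Definition edge_hol (i j : I) : pi1 R y0 :=
  let x := xget y0 (V i `&` V j) in if meet i j then hol i j x (fun=> x) x else 1%g.

Lemma edge_holE i j x : V i x -> V j x -> edge_hol i j = hol i j x (fun=> x) x.
Proof.
move=> Vi Vj; have ne : V i `&` V j !=set0 by exists x.
rewrite /edge_hol /meet asboolT //; have [] := xgetPex y0 ne.
by move=> *; apply: hol_const.
Qed.

Definition theta : F -> pi1 R y0 :=
  free_lift (fun k => edge_hol (enum_val k).1 (enum_val k).2).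

Lemma thetaM : {morph theta : f g / (f * g)%g}.
Proof. exact: free_liftM. Qed.

Lemma theta_edge i j : theta (edge i j) = edge_hol i j.
Proof. by rewrite /theta free_lift_gen enum_rankK. Qed.

Definition triangle (i j k : I) : Prop := exists x, [/\ V i x, V j x & V k x].

Lemma edge_hol_tri i j k : triangle i j k -> (edge_hol i j * edge_hol j k)%g = edge_hol i k.
Proof.
case=> x [Vi Vj Vk]; have px := ispath_cst R x.
rewrite (edge_holE Vi Vj) (edge_holE Vj Vk) (edge_holE Vi Vk) (holM Vi Vj Vk px px).
apply: (hol_hpath Vi Vk (ispath_cat px px)); last exact: cts_const.
by apply: hpath_cat1p; exact: cts_const.
Qed.

Section Action.
Variables (S : Type) (act : S -> F -> S).
Hypothesis act1 : forall s, act s 1%g = s.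
Hypothesis actM : forall s f g, act (act s f) g = act s (f * g)%g.
Hypothesis act_tri : forall i j k s, triangle i j k -> act s (edge i j * edge j k)%g = act s (edge i k).

Definition label (y : Y) : I := sval (cid (covV y)).

Lemma act_edge_id i s : act s (edge i i) = s.
Proof.
have t : triangle i i i by exists (v i).
have := act_tri s t; rewrite -actM => /(congr1 (act^~ ((edge i i)^-1)%g)).
by rewrite !actM !mulgV mulg1 act1.
Qed.

Lemma act_edge_comp i j k s y : V i y -> V j y -> V k y ->
  act (act s (edge i j)) (edge j k) = act s (edge i k).
Proof. by move=> Vi Vj Vk; rewrite actM; apply: act_tri; exists y. Qed.

(** The triangle relations provide the cocycle condition on triple overlaps. *)
Definition act_system : local_system Y :=
  @LocalSystem Y I V S (fun i j s => act s (edge i j)) label oV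
    (fun y => svalP (cid (covV y))) act_edge_id act_edge_comp.

Notation E := (total act_system).
Notation coord := (@total_coord Y act_system).
Notation proj := (@total_proj Y act_system).

Lemma coord_change i j (e : E) : V i (proj e) -> V j (proj e) ->
  coord j e = act (coord i e) (edge i j).
Proof. by move=> Vi Vj; rewrite -(@total_coord_tr _ act_system i j). Qed.

Lemma coord_lift_in k (l : R -> E) a b : a <= b -> continuous l ->
  (forall t, a <= t <= b -> V k (proj (l t))) -> coord k (l b) = coord k (l a).
Proof.
move=> ab cl lV; have cp := @total_proj_continuous Y act_system.
have VV t : V k (proj (l (clp a b t))) by apply: lV; exact: clp_in.
pose l' t : E := @total_pt Y act_system k (coord k (l a)) (proj (l (clp a b t))).
have cl' : continuous l'.
  move=> t; apply: (@continuous_comp _ _ _ (fun t => proj (l (clp a b t)))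
      (@total_pt Y act_system k (coord k (l a)) : Y -> E)).
    by apply: (cts_comp cp); apply: (cts_comp cl); exact: clp_continuous.
  by apply: total_section_continuous; rewrite inE.
have cl2 : continuous (fun t => l (clp a b t)) by apply: (cts_comp cl); exact: clp_continuous.
have := @covering_unique _ _ _ (total_covering act_system) R (fun t => l (clp a b t)) l' a
  (connectedR (R := R)) cl2 cl'.
move=> /(_ (fun t => erefl)) h.
have : l (clp a b b) = l' b.
  apply: h; rewrite /l' clp_id ?lexx ?ab //.
  by rewrite (total_coordK (L := act_system)) //; apply: lV; rewrite lexx.
rewrite clp_id ?lexx ?ab // => ->; rewrite /l' clp_id ?lexx ?ab //.
by rewrite (total_ptK (L := act_system)) //; apply: lV; rewrite ab lexx.
Qed.

End Action.

(* Every path is covered by finitely many charts; the corresponding product of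
   edges describes both its class and its monodromy in every local system. *)
Definition describes (c : R -> Y) a b i j (w : F) : Prop :=
  theta w = hol i j (c a) (seg c a b) (c b) /\
  forall (S : Type) (act : S -> F -> S) (act1 : forall s, act s 1%g = s)
    (actM : forall s f g, act (act s f) g = act s (f * g)%g)
    (act_tri : forall i j k s, triangle i j k ->
       act s (edge i j * edge j k)%g = act s (edge i k))
    (l : R -> total (act_system act1 actM act_tri)),
  continuous l -> (forall t, a <= t <= b -> total_proj (l t) = c t) ->
  @total_coord Y (act_system act1 actM act_tri) j (l b) =
    act (@total_coord Y (act_system act1 actM act_tri) i (l a)) w.

(** By continuous induction on the interval. Near a point the path lies in one chart [k], and the
    word is the change from [i] to [k] followed by the change from [k] to [j]. *)
Lemma path_word (c : R -> Y) i j : continuous c -> V i (c 0) -> V j (c 1) ->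
  exists w, describes c 0 1 i j w.
Proof.
move=> cc; move: i j.
suff [_ H] : (0 : R) <= 1 /\ forall i j, V i (c 0) -> V j (c 1) -> exists w, describes c 0 1 i j w.
  by move=> i j Vi Vj; exact: H.
apply: (interval_ind (P := fun a b : R => a <= b /\
  forall i j, V i (c a) -> V j (c b) -> exists w, describes c a b i j w)).
  move=> a b b' _ _ [ab H1] [bb H2]; split; first exact: le_trans bb.
  move=> i j Vi Vj; have [k Vk] := covV (c b).
  have [w [tw mw]] := H1 i k Vi Vk; have [w' [tw' mw']] := H2 k j Vk Vj.
  exists (w * w')%g; split.
    rewrite thetaM tw tw' (holM Vi Vk Vj (ispath_seg a b cc) (ispath_seg b b' cc)).
    apply: (hol_hpath Vi Vj); [exact: (ispath_cat (ispath_seg a b cc) (ispath_seg b b' cc))|exact: seg_cat|].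
    by have [] := ispath_seg a b' cc.
  move=> S act act1 actM act_tri l cl pl.
  have p1 t : a <= t <= b -> total_proj (l t) = c t by move=> tI; apply: pl; lra.
  have p2 t : b <= t <= b' -> total_proj (l t) = c t by move=> tI; apply: pl; lra.
  by rewrite (mw' _ _ _ _ _ l cl p2) (mw _ _ _ _ _ l cl p1) actM.
move=> x _; have [k Vk] := covV (c x).
have : nbhs x (c @^-1` V k) by apply: cc; apply: open_nbhs_nbhs; split.
rewrite nbhs_ballP => -[e /= e0 he]; exists e => // a b xa ab bx; split=> // i j Vi Vj.
have cV t : a <= t <= b -> V k (c t).
  by move=> tI; apply: he; rewrite /ball /= ltr_distl; lra.
have Vka : V k (c a) by apply: cV; rewrite lexx.
have Vkb : V k (c b) by apply: cV; rewrite lexx ab.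
exists (edge i k * edge k j)%g; split.
  have pa := ispath_cst R (c a); have pb := ispath_cst R (c b); have ps := ispath_seg a b cc.
  have [cs s0 s1] := ps.
  rewrite thetaM !theta_edge (edge_holE Vi Vka) (edge_holE Vkb Vj).
  rewrite -(mulg1 (hol i k _ _ _)) -(hol_in Vka Vkb ps); last first.
    move=> s /andP[t0 t1]; rewrite /seg; apply: cV.
    have h : 0 <= b - a by rewrite subr_ge0.
    have h1 := mulr_ge0 h t0; have h2 := ler_wpM2l h t1.
    by apply/andP; split; lra.
  rewrite (holM Vi Vka Vkb pa ps) (holM Vi Vkb Vj (ispath_cat pa ps) pb).
  apply: (hol_hpath Vi Vj (ispath_cat (ispath_cat pa ps) pb)) => //.
  apply: (@hpath_trans _ _ (pcat (fun=> c a) (seg c a b))).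
    have := hpath_catp1 (pcat_continuous (@cts_const R Y (c a)) cs (esym s0)).
    by rewrite pcat1 s1.
  by have := hpath_cat1p cs; rewrite s0.
move=> S act act1 actM act_tri l cl pl.
have la := pl a; have lb := pl b.
rewrite (@coord_change _ _ act1 actM act_tri k j); rewrite ?lb ?lexx ?ab //.
rewrite -actM -(@coord_change _ _ act1 actM act_tri i k); rewrite ?la ?lexx ?ab //.
congr act; apply: coord_lift_in => // t tI; rewrite pl //; exact: cV.
Qed.

Hypothesis base : hpath (bpath i0 y0) (fun=> y0).

Lemma hol_base c : ispath y0 y0 c -> hol i0 i0 (c 0) (seg c 0 1) (c 1) = pclass y0 c.
Proof.
move=> pc; have [cc c0 c1] := pc; rewrite /hol /transport c0 c1.
have [cb b0 b1] := bpathP Vy0.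
have ps : ispath y0 y0 (seg c 0 1) by rewrite -{1}c0 -c1; exact: ispath_seg.
apply: pclass_hpath; [exact: (transportP (bpathP Vy0) ps (bpathP Vy0))| |by case: pc].
have [cs s0 s1] := ps.
have h1 : hpath (seg c 0 1) c.
  by apply: hpath_eq => // s _; rewrite /seg subr0 mul1r add0r.
apply: hpath_trans (hpath_cat _ (hpath_cat _ base h1) (hpath_rev base)) _.
- by rewrite pcat1 prv0 s1 b1.
- by rewrite b1 s0.
have h2 := hpath_cat1p cc; rewrite c0 in h2.
apply: hpath_trans (hpath_cat _ h2 (hpath_refl (@cts_const R Y y0))) _; first by rewrite pcat1 c1.
by have := hpath_catp1 cc; rewrite c1.
Qed.

Lemma theta_surj g : exists f, theta f = g.
Proof.
have [c pc <-] := pclass_surj g; have [cc c0 c1] := pc.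
have [||w [tw _]] := @path_word c i0 i0 cc; rewrite ?c0 ?c1 //.
by exists w; rewrite tw hol_base.
Qed.

Lemma hol_gam i : hol i0 i (gam i 0) (seg (gam i) 0 1) (gam i 1) = 1%g.
Proof.
have [cg g0 g1] := pgam i; have [cb b0 b1] := bpathP Vy0.
have [ps sV] := sigP (Vv i); have [cs s0 s1] := ps.
have pg : ispath y0 (v i) (seg (gam i) 0 1) by rewrite -{1}g0 -g1; exact: ispath_seg.
have h1 : hpath (seg (gam i) 0 1) (gam i).
  by apply: hpath_eq => [|s _]; [case: pg|rewrite /seg subr0 mul1r add0r].
rewrite g0 g1; apply: (transport_eq1 (bpathP Vy0) pg (bpathP (Vv i))).
apply: hpath_trans (hpath_cat _ base h1) _; first by case: pg => _ ->.
have h2 := hpath_cat1p cg; rewrite g0 in h2; apply: hpath_trans h2 _.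
apply: hpath_sym; have h3 : hpath (sig i (v i)) (fun=> v i).
  apply: (@hpath_in i i (v i) (v i)) => //; first by exists (v i).
  exact: ispath_cst.
apply: hpath_trans (hpath_cat _ (hpath_refl cg) h3) _; first by rewrite s0.
by have := hpath_catp1 cg; rewrite g1.
Qed.

Lemma gam_word i : exists w, describes (gam i) 0 1 i0 i w.
Proof. by have [cg g0 g1] := pgam i; apply: path_word; rewrite ?g0 ?g1. Qed.

(** The paths [gam i] follow no edges prescribed in advance, so the word read along each of them has
    to be declared trivial in the presentation; [theta] does kill it. *)
Definition gword i : F := sval (cid (gam_word i)).

Lemma gwordP i : describes (gam i) 0 1 i0 i (gword i).
Proof. exact: (svalP (cid (gam_word i))). Qed.

Lemma theta_gword i : theta (gword i) = 1%g.
Proof. by have [-> _] := gwordP i; exact: hol_gam. Qed.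

Section Monodromy.
Variables (S : Type) (act : S -> F -> S).
Hypothesis act1 : forall s, act s 1%g = s.
Hypothesis actM : forall s f g, act (act s f) g = act s (f * g)%g.
Hypothesis act_tri : forall i j k s, triangle i j k -> act s (edge i j * edge j k)%g = act s (edge i k).

Let L := act_system act1 actM act_tri.
Notation E := (total L).
Notation coord := (@total_coord Y L).
Notation proj := (@total_proj Y L).

Lemma lift_word (c : R -> Y) e : ispath y0 y0 c -> proj e = y0 ->
  exists2 w, theta w = pclass y0 c & coord i0 (lift_end proj c e) = act (coord i0 e) w.
Proof.
move=> pc pe; have [cc c0 c1] := pc.
have [||w [tw mw]] := @path_word c i0 i0 cc; rewrite ?c0 ?c1 //.
exists w; first by rewrite tw hol_base.
have [|cl pl l0] := liftP (total_covering L) cc (e := e); first by rewrite pe c0.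
by rewrite (mw _ _ act1 actM act_tri (lift proj c e)) // l0.
Qed.

Hypothesis act_gword : forall i s, act s (gword i) = s.
Hypothesis act_nomeet : forall i j s, ~~ meet i j -> act s (edge i j) = s.

Lemma coord_bpath i x e : V i x -> proj e = y0 ->
  coord i (lift_end proj (bpath i x) e) = coord i0 e.
Proof.
move=> Vx pe; have [cg g0 g1] := pgam i; have [[cs s0 s1] sV] := sigP Vx.
have cov := total_covering L.
have pe0 : proj e = gam i 0 by rewrite pe g0.
have [cl pl l0] := liftP cov cg pe0.
rewrite /bpath (lift_end_cat cov cg cs) ?g1 ?s0 //.
set e1 := lift_end proj (gam i) e.
have pe1 : proj e1 = sig i x 0 by rewrite (p_lift_end cov cg pe0) g1 s0.
have [cl' pl' l0'] := liftP cov cs pe1.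
have -> : coord i (lift_end proj (sig i x) e1) = coord i (lift proj (sig i x) e1 0).
  by apply: coord_lift_in => // t tI; rewrite pl' //; exact: sV.
rewrite l0' /e1 /lift_end.
have [_ mw] := gwordP i; rewrite (mw _ _ act1 actM act_tri (lift proj (gam i) e)) //.
by rewrite l0 act_gword.
Qed.

(** Monodromy sees only the homotopy class, so the action of [f] is determined by [theta f]. For a
    single edge the loop goes out through the chart [i] and back through the chart [j], and the
    coordinate changes only where the charts are switched. *)
Lemma monodromy_theta f : forall (c : R -> Y) e, ispath y0 y0 c -> pclass y0 c = theta f ->
  proj e = y0 -> coord i0 (lift_end proj c e) = act (coord i0 e) f.
Proof.
have cov := total_covering L.
elim/free_group_ind: f => [k|f g IHf IHg|f IHf|] c e pc ec pe; have [cc c0 c1] := pc.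
- have [[i j] ek] : exists z, k = enum_rank z by exists (enum_val k); rewrite enum_valK.
  subst k.
  have ke : theta (free_gen (enum_rank (i, j))) = edge_hol i j by exact: theta_edge.
  rewrite ke in ec; rewrite -[free_gen _]/(edge i j).
  have [m|nm] := boolP (meet i j); last first.
    rewrite act_nomeet //; rewrite /edge_hol (negPf nm) -pclass1 in ec.
    have h := (pclassP pc (ispath_cst R y0)).1 ec.
    rewrite (lift_end_hpath cov cc (@cts_const R Y y0) _ h) ?c0 //.
    by rewrite -{1}pe lift_end_cst.
  have /asboolP[x [Vi Vj]] := m.
  rewrite (edge_holE Vi Vj) /hol /transport in ec.
  have pbi := bpathP Vi; have pbj := bpathP Vj; have prj := ispath_rev pbj.
  have pbb := transportP pbi (ispath_cst R x) pbj.
  have h := (pclassP pc pbb).1 ec.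
  have [cbi bi0 bi1] := pbi; have [crj rj0 rj1] := prj; have [cbj bj0 bj1] := pbj.
  have h' : hpath c (pcat (bpath i x) (prv (bpath j x))).
    apply: hpath_trans h _; apply: hpath_cat; last exact: hpath_refl.
      by rewrite pcat1 rj0.
    by have := hpath_catp1 cbi; rewrite bi1.
  rewrite (lift_end_hpath cov cc _ _ h') ?pe ?c0 //; last first.
    by apply: pcat_continuous; rewrite ?bi1.
  rewrite (lift_end_cat cov cbi crj) ?bi1 ?bi0 ?rj0 //.
  set e1 := lift_end proj (bpath i x) e; set e2 := lift_end _ _ e1.
  have pe1 : proj e1 = x by rewrite (p_lift_end cov cbi) ?bi0 ?bi1.
  have pe2 : proj e2 = y0 by rewrite (p_lift_end cov crj) ?rj0 ?rj1.
  have ee : lift_end proj (bpath j x) e2 = e1.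
    by rewrite -[bpath j x]prvK; apply: (lift_end_rev cov crj); rewrite rj0.
  rewrite -(coord_bpath Vj pe2) ee (@coord_change _ _ act1 actM act_tri i j) ?pe1 //.
  by rewrite (coord_bpath Vi pe).
- have [c2 pc2 ec2] := pclass_surj (theta f); have [c3 pc3 ec3] := pclass_surj (theta g).
  have [cc2 a0 a1] := pc2; have [cc3 b0 b1] := pc3.
  have h : hpath c (pcat c2 c3).
    apply: (pclassP pc (ispath_cat pc2 pc3)).1.
    by rewrite pclassM // ec ec2 ec3 thetaM.
  rewrite (lift_end_hpath cov cc _ _ h) ?pe ?c0 //; last first.
    by apply: pcat_continuous; rewrite ?a1.
  rewrite (lift_end_cat cov cc2 cc3) ?a1 ?a0 ?b0 //.
  rewrite (IHg c3) //; last by rewrite (p_lift_end cov cc2) ?a0 ?a1.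
  by rewrite (IHf c2) // actM.
- set e' := lift_end proj c e.
  have pe' : proj e' = y0 by rewrite (p_lift_end cov cc) ?c0 ?c1.
  have ee : lift_end proj (prv c) e' = e by apply: (lift_end_rev cov cc); rewrite c0.
  have := IHf (prv c) e' (ispath_rev pc); rewrite ee pclassV // ec (morph_inv thetaM) invgK => -> //.
  by rewrite actM mulgV act1.
- rewrite act1; rewrite (morph_one thetaM) -pclass1 in ec.
  have h := (pclassP pc (ispath_cst R y0)).1 ec.
  rewrite (lift_end_hpath cov cc (@cts_const R Y y0) _ h) ?c0 //.
  by rewrite -{1}pe lift_end_cst.
Qed.

End Monodromy.

Notation relator_index := ((I * I * I) + (I * I) + I)%type.

Definition nerve_relator (k : relator_index) : F :=
  match k with
  | inl (inl (i, j, k)) =>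
      if `[< triangle i j k >] then (edge i j * edge j k * (edge i k)^-1)%g else 1%g
  | inl (inr (i, j)) => if meet i j then 1%g else edge i j
  | inr i => gword i
  end.

Definition nerve_rel (k : 'I_#|{: relator_index}|) : F := nerve_relator (enum_val k).

Lemma normal_closure_normal (G : groupType) (A : set G) : normal_subgroup (normal_closure A).
Proof.
split.
- by move=> N [[h _ _ _] _].
- by move=> g h Ng Nh N hN; have [[_ m _ _] _] := hN; apply: m; [exact: Ng|exact: Nh].
- by move=> g Ng N hN; have [[_ _ m _] _] := hN; apply: m; exact: Ng.
- by move=> g h Ng N hN; have [[_ _ _ m] _] := hN; apply: m; exact: Ng.
Qed.

Lemma sub_normal_closure (G : groupType) (A : set G) : A `<=` normal_closure A.
Proof. by move=> g Ag N [_]; apply. Qed.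

Let N := normal_closure (range nerve_rel).
Let nN : normal_subgroup N. Proof. exact: normal_closure_normal. Qed.

Lemma nerve_relator_in k : N (nerve_relator k).
Proof.
by apply: sub_normal_closure; exists (enum_rank k); rewrite // /nerve_rel enum_rankK.
Qed.

Lemma theta_nerve k : theta (nerve_relator k) = 1%g.
Proof.
case: k => [[[[i j] k]|[i j]]|i] /=; last exact: theta_gword.
- case: asboolP => [t|_]; last exact: morph_one thetaM.
  by rewrite !thetaM (morph_inv thetaM) !theta_edge edge_hol_tri // mulgV.
- case: ifPn => [_|nm]; first exact: morph_one thetaM.
  by rewrite theta_edge /edge_hol (negPf nm).
Qed.

(* The fibre: unions of cosets [N w], with [F] acting by right translation. *)
Definition left_invariant (A : set F) : Prop := forall n u, N n -> A u -> A (n * u)%g.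

Definition coset_union : Type := {A : set F | left_invariant A}.

Lemma coset_unionP (A B : coset_union) : (forall u, sval A u <-> sval B u) -> A = B.
Proof.
case: A B => A hA [B hB] /= e; have {}e : A = B by apply/funext => u; apply/propext.
by subst B; congr (exist left_invariant); exact: Prop_irrelevance.
Qed.

Fact coset_act_subproof (A : coset_union) (w : F) n u :
  N n -> sval A (u * w^-1)%g -> sval A (n * u * w^-1)%g.
Proof. by move=> Nn Au; rewrite -mulgA; exact: (svalP A). Qed.

Definition coset_act (A : coset_union) (w : F) : coset_union :=
  exist left_invariant (fun u => sval A (u * w^-1)%g) (@coset_act_subproof A w).

Lemma coset_act1 A : coset_act A 1%g = A.
Proof. by apply: coset_unionP => u /=; rewrite invg1 mulg1. Qed.

Lemma coset_actM A f g : coset_act (coset_act A f) g = coset_act A (f * g)%g.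
Proof. by apply: coset_unionP => u /=; rewrite invgM mulgA. Qed.

Lemma coset_act_eq A f g : N (f * g^-1)%g -> coset_act A f = coset_act A g.
Proof.
have [_ _ NV NJ] := nN.
have h f' g' : N (f' * g'^-1)%g -> forall u, sval A (u * f'^-1)%g -> sval A (u * g'^-1)%g.
  move=> Nfg u Au.
  have -> : (u * g'^-1 = (f' * g'^-1) ^ (f' * u^-1) * (u * f'^-1))%g.
    by rewrite conjgE invgM invgK !mulgA !mulgVK mulgK.
  by apply: (svalP A) => //; exact: NJ.
move=> Nfg; apply: coset_unionP => u /=; split; apply: h => //.
by have := NV _ Nfg; rewrite invgM invgK.
Qed.

(** The hard inclusion is that of the kernel of [theta] in the normal closure [N]. The action of [F]
    on unions of cosets of [N] respects all relators and hence defines a cover. If [theta w] is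
    trivial, the monodromy of the constant loop shows that [w] fixes the coset [N], whence [w] lies
    in [N]. *)
Lemma nerve_presentation : presentation nerve_rel theta.
Proof.
split; [exact: thetaM|exact: theta_surj|].
have [N1 NM NV NJ] := nN.
apply/seteqP; split=> [w /= tw|w Nw]; last first.
  apply: (Nw (theta @^-1` [set 1%g])); split.
    split=> /=.
    - exact: morph_one thetaM.
    - by move=> g h eg eh; rewrite thetaM eg eh mulg1.
    - by move=> g eg; rewrite (morph_inv thetaM) eg invg1.
    - by move=> g h eg; rewrite conjgE !thetaM (morph_inv thetaM) eg mul1g mulVg.
  by move=> _ [k _ <-]; exact: theta_nerve.
have tri i j k A : triangle i j k ->
    coset_act A (edge i j * edge j k)%g = coset_act A (edge i k).
  move=> t; apply: coset_act_eq; have := nerve_relator_in (inl (inl (i, j, k))).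
  by rewrite /nerve_relator asboolT.
have gw i A : coset_act A (gword i) = A.
  by rewrite -[RHS]coset_act1; apply: coset_act_eq; rewrite invg1 mulg1; exact: (nerve_relator_in (inr i)).
have nm i j A : ~~ meet i j -> coset_act A (edge i j) = A.
  move=> m; rewrite -[RHS]coset_act1; apply: coset_act_eq; rewrite invg1 mulg1.
  by have := nerve_relator_in (inl (inr (i, j))); rewrite /nerve_relator (negPf m).
pose A : coset_union := exist left_invariant N NM.
pose L := act_system coset_act1 coset_actM tri.
pose e : total L := @total_pt Y L i0 A y0.
have := @monodromy_theta _ _ coset_act1 coset_actM tri gw nm w (fun=> y0) e (ispath_cst R y0).
rewrite pclass1 tw => /(_ erefl erefl).
have -> : lift_end (@total_proj Y L) ((fun=> y0) : R -> Y) e = e.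
  exact: (@lift_end_cst R _ _ _ (total_covering L) e).
have -> : @total_coord Y L i0 e = A by exact: (@total_ptK Y L).
move=> /(congr1 (fun B : coset_union => sval B w)) /=; rewrite mulgV => E.
by move: N1; rewrite -E.
Qed.

End GoodCover.

Lemma pi1_presentation (R : realType) (Y : topologicalType) (y0 : Y) :
  nice_space R Y -> connected [set: Y] ->
  exists (r s : nat) (rel : 'I_s -> free_group r) (phi : free_group r -> pi1 R y0),
    presentation rel phi.
Proof.
move=> nY cY; have [I [V [v [oV covV Vv pathV nullV]]]] := good_cover nY.
have [i0 Vy0] := covV y0.
have [_ _ lpc _] := nY.
have [gam hg] : {gam : I -> R -> Y & forall i, ispath y0 (v i) (gam i)}.
  by apply: (@choice _ _ (fun i c => ispath y0 (v i) c)) => i; exact: path_connected.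
(* For the chart of [y0] the path runs backwards along [sig], so that the base path to [y0] through
   this chart is null-homotopic, as [base] demands. *)
pose gam' i := if i == i0 then prv (sig V v i0 y0) else gam i.
have [ps _] := sigP pathV Vy0.
have pg i : ispath y0 (v i) (gam' i).
  by rewrite /gam'; case: eqP => [->|_] //; exact: ispath_rev.
have base : hpath (bpath V v gam' i0 y0) (fun=> y0).
  by rewrite /bpath /gam' eqxx; have [cs _ s1] := ps; have := hpath_Vcat cs; rewrite s1.
do 4 eexists; exact: (@nerve_presentation R Y y0 I V v oV covV Vv pathV nullV i0 gam' Vy0 pg base).
Qed.

(** * Covers from finite actions *)

Section ActionCover.
Variables (R : realType) (Y : topologicalType) (y0 : Y).
Hypotheses (nY : nice_space R Y) (cY : connected [set: Y]).
Variables (S : finType) (act : S -> pi1 R y0 -> S) (s0 : S).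
Hypothesis act1 : forall s, act s 1%g = s.
Hypothesis actM : forall s g h, act (act s g) h = act s (g * h)%g.
Hypothesis act_trans : forall s t, exists g, act s g = t.

(** Pulled back along [theta], the action satisfies the triangle relations and defines a local
    system. Transitivity makes the total space connected, and self-maps of [S] that commute with the
    action become maps over [Y]. *)
Lemma action_cover : exists (Z : topologicalType) (q : Z -> Y) (pt : S -> Z),
  [/\ finite_cover q, forall s, q (pt s) = y0,
      forall s (c : R -> Y), ispath y0 y0 c -> lift_end q c (pt s) = pt (act s (pclass y0 c)),
      forall z, q z = y0 -> exists s, z = pt s &
      forall h : S -> S, (forall s g, h (act s g) = act (h s) g) ->
        exists hh : Z -> Z, [/\ continuous hh, forall z, q (hh z) = q z
          & forall s, hh (pt s) = pt (h s)]] /\ injective pt.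
Proof.
have [I [V [v [oV covV Vv pathV nullV]]]] := good_cover nY.
have [i0 Vy0] := covV y0; have [_ _ lpc _] := nY.
have [gam hg] : {gam : I -> R -> Y & forall i, ispath y0 (v i) (gam i)}.
  by apply: (@choice _ _ (fun i c => ispath y0 (v i) c)) => i; exact: path_connected.
pose gam' i := if i == i0 then prv (sig V v i0 y0) else gam i.
have [ps _] := sigP pathV Vy0.
have pg i : ispath y0 (v i) (gam' i).
  by rewrite /gam'; case: eqP => [->|_] //; exact: ispath_rev.
have base : hpath (bpath V v gam' i0 y0) (fun=> y0).
  by rewrite /bpath /gam' eqxx; have [cs _ s1] := ps; have := hpath_Vcat cs; rewrite s1.
pose th := theta y0 V v gam'.
have thM : {morph th : f g / (f * g)%g} by exact: thetaM.
pose act' s w := act s (th w).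
have act1' s : act' s 1%g = s by rewrite /act' (morph_one thM) act1.
have actM' s f g : act' (act' s f) g = act' s (f * g)%g by rewrite /act' actM thM.
have tri' i j k s : triangle V i j k -> act' s (edge i j * edge j k)%g = act' s (edge i k).
  by move=> t; rewrite /act' thM /th !theta_edge; congr act; exact: (edge_hol_tri pathV nullV pg t).
pose L := @act_system Y I V v oV covV Vv S act' act1' actM' tri'.
pose pt s : total L := @total_pt Y L i0 s y0.
have cov := total_covering L.
have ptK s : @total_coord Y L i0 (pt s) = s by exact: (@total_ptK Y L).
have ptE (z : total L) : total_proj z = y0 -> z = pt (@total_coord Y L i0 z).
  by move=> pz; rewrite -[LHS](@total_coordK Y L i0) pz.
have lft s (c : R -> Y) : ispath y0 y0 c ->
    lift_end (@total_proj Y L) c (pt s) = pt (act s (pclass y0 c)).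
  move=> pc; have [cc c0 c1] := pc.
  rewrite [LHS]ptE; last by rewrite (p_lift_end cov cc).
  have [w tw ->] := @lift_word R Y y0 I V v oV covV Vv pathV nullV i0 gam' Vy0 pg base
     S act' act1' actM' tri' c (pt s) pc erefl.
  by rewrite ptK /act' /th tw.
have conn : connected [set: total L].
  apply: (@path_connectedT R _ (pt s0)) => z.
  have [c pc] := path_connected lpc cY (total_proj z) y0; have [cc c0 c1] := pc.
  have [cl pl l0] := liftP cov cc (esym c0).
  set z1 := lift (@total_proj Y L) c z 1 in pl.
  have pz1 : total_proj z1 = y0 by rewrite /z1 pl ?c1 ?in01_1.
  have [g hg'] := act_trans s0 (@total_coord Y L i0 z1).
  have [d pd ed] := pclass_surj g; have [cd d0 d1] := pd.
  have [cl' pl' l0'] := liftP cov cd (esym d0 : total_proj (pt s0) = d 0).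
  exists (pcat (lift (@total_proj Y L) d (pt s0)) (prv (lift (@total_proj Y L) c z))).
  apply: (@ispath_cat _ _ _ z1).
    by split=> //; rewrite -/(lift_end _ _ _) lft // ed hg' -ptE.
  by apply: ispath_rev.
exists (total L), (@total_proj Y L), pt; split; last by move=> s t /(congr1 (@total_coord Y L i0)); rewrite !ptK.
split=> //.
- split=> //; first exact: total_proj_continuous.
  move=> y; have ev : evenly (@total_proj Y L) (@ls_V Y L (@ls_chart Y L y)) (@sheet Y L (@ls_chart Y L y)).
    split; [exact: sheet_cover|exact: sheet_trivIset|move=> s].
    by split; [exact: sheet_open|exact: sheet_bij|exact: sheet_open_map].
  have [n [W [h1 h2 h3]]] := evenly_ord s0 ev.
  exists (@ls_V Y L (@ls_chart Y L y)), n, W; split=> //.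
  by split; [exact: ls_open|exact: ls_chartP].
- by move=> z pz; exists (@total_coord Y L i0 z); exact: ptE.
- move=> h hc; exists (fun e : total L => (e.1, h e.2) : total L); split=> //.
    by apply: (@total_map_continuous Y L h) => i j s y _ _; exact: hc.
  by move=> s; rewrite /pt /total_pt /=; congr pair; exact: hc.
Qed.

End ActionCover.

(** * Singular 1-cycles and loops *)

Section FreeAbelian.
Variables (M : lmodType int) (K : choiceType) (f : K -> M).
Implicit Types D : {freeg K / int}.

Lemma fgliftB D D' : fglift f (D - D') = fglift f D - fglift f D'.
Proof. exact: (@lift_is_additive int). Qed.
Lemma fglift0 : fglift f 0 = 0.
Proof. by rewrite -[X in fglift _ X](subrr 0) fgliftB subrr. Qed.
Lemma fgliftN D : fglift f (- D) = - fglift f D.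
Proof. by rewrite -sub0r fgliftB fglift0 sub0r. Qed.
Lemma fgliftD D D' : fglift f (D + D') = fglift f D + fglift f D'.
Proof. by rewrite -{1}[D']opprK fgliftB fgliftN opprK. Qed.
Lemma fglift_sum (J : Type) (s : seq J) (F : J -> {freeg K / int}) :
  fglift f (\sum_(j <- s) F j) = \sum_(j <- s) fglift f (F j).
Proof. exact: (big_morph _ fgliftD fglift0). Qed.
Lemma fglift1 x : fglift f << x >> = f x.
Proof. by rewrite liftU scale1r. Qed.
Lemma fgliftZ a D : fglift f (a *: D) = a *: fglift f D.
Proof.
have h (n : nat) : fglift f (n%:Z *: D) = n%:Z *: fglift f D.
  elim: n => [|n IH]; first by rewrite !scale0r fglift0.
  by rewrite -addn1 PoszD !scalerDl fgliftD IH !scale1r.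
by case: a => n //; rewrite NegzE !scaleNr fgliftN h.
Qed.

Lemma freegU_scale a (x : K) : << a *g x >> = a *: << x >> :> {freeg K / int}.
Proof. by apply/eqP/freeg_eqP => y; rewrite coeffZ !coeffU mul1r. Qed.

Lemma freeg_sum_scale D : D = \sum_(x <- dom D) coeff x D *: << x >>.
Proof.
by rewrite -[LHS]freeg_sumE; apply: eq_bigr => x _; rewrite freegU_scale.
Qed.

End FreeAbelian.

Section Simplices.
Variables (R : realType) (Y : topologicalType).
Implicit Types (c : R -> Y).

Notation simplex n := (set_type (@std_simplex R n)).

Fact edge_pt_subproof (s : R) : (\row_(j < 2) (if j == 0 then 1 - cl01 s else cl01 s)) \in @std_simplex R 1.
Proof.
rewrite inE; have := cl01_in s => sI; split.
  by move=> j; rewrite mxE; case: ifP => _; lra.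
by rewrite big_ord_recl big_ord1 !mxE /=; lra.
Qed.
Definition edge_pt (s : R) : simplex 1 :=
  exist (fun v => v \in @std_simplex R 1) _ (edge_pt_subproof s).

Fact tri_pt_subproof (z : R * R) :
  (\row_(j < 3) (if j == 0 then 1 - cl01 z.1 else if j == 1
     then cl01 z.1 - Num.min (cl01 z.1) (cl01 z.2)
     else Num.min (cl01 z.1) (cl01 z.2))) \in @std_simplex R 2.
Proof.
rewrite inE; have h1 := cl01_in z.1; have h2 := cl01_in z.2.
set m := Num.min _ _; have m1 : m <= cl01 z.1 by rewrite ge_min lexx.
have m0 : 0 <= m by rewrite le_min; case/andP: h1 => -> _; case/andP: h2 => ->.
split.
  by move=> j; rewrite mxE; case: ifP => _; [|case: ifP => _]; lra.
by rewrite !big_ord_recl big_ord0 !mxE /=; lra.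
Qed.
(** On the triangle t <= s of the unit square the barycentric coordinates are (1 - s, s - t, t),
    with vertices (0, 0), (1, 0), (1, 1); other points of the plane are brought there by
    truncation. *)
Definition tri_pt (z : R * R) : simplex 2 :=
  exist (fun v => v \in @std_simplex R 2) _ (tri_pt_subproof z).

Lemma row_continuous (T : topologicalType) n (F : T -> 'I_n -> R) :
  (forall j, continuous (fun x => F x j)) -> continuous (fun x => \row_j F x j : 'rV[R]_n).
Proof.
move=> cF x A [P Px PA] /=.
suff H : \forall w \near x, forall k j, P k j ((\row_j F w j : 'rV[R]_n) k j).
  by apply: filterS H => w Pw; apply: PA.
apply: (@filter_forall _ _ (fun k w => forall j, P k j ((\row_j F w j : 'rV[R]_n) k j)) (nbhs x)) => k.
apply: (@filter_forall _ _ (fun j w => P k j ((\row_j F w j : 'rV[R]_n) k j)) (nbhs x)) => j.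
have := Px k j; rewrite /= mxE => Pj.
by apply: (@filterS _ (nbhs x) _ _ _ _ (cF j x _ Pj)) => w /=; rewrite mxE.
Qed.

Lemma edge_pt_continuous : continuous edge_pt.
Proof.
apply: continuous_comp_initial; apply: row_continuous => j.
by case: (j == 0); cts.
Qed.

Lemma tri_pt_continuous : continuous tri_pt.
Proof.
apply: continuous_comp_initial; apply: row_continuous => j.
by case: (j == 0); [|case: (j == 1)]; cts.
Qed.

Lemma coord_simplex_continuous n (j : 'I_n.+1) :
  continuous (fun v : simplex n => (\val v : 'rV[R]_n.+1) 0 j).
Proof.
move=> w; apply: (@continuous_comp _ _ _ (\val : simplex n -> _)
    (fun M : 'rV[R]_n.+1 => M 0 j)); first exact: initial_continuous.
exact: coord_continuous.
Qed.

Section PathSimplex.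
Variables (c : R -> Y) (cc : continuous c).
Definition path_simplex_fun (v : simplex 1) : Y := c ((\val v : 'rV[R]_2) 0 1).
Fact path_simplex_continuous : continuous path_simplex_fun.
Proof. by apply: (cts_comp cc); exact: coord_simplex_continuous. Qed.
HB.instance Definition _ := isContinuous.Build _ _ path_simplex_fun path_simplex_continuous.
Definition path_simplex : singular_simplex R Y 1 := path_simplex_fun.
End PathSimplex.

Section TriangleSimplex.
Variables (F : R * R -> Y) (cF : continuous F).
Definition tri_simplex_fun (v : simplex 2) : Y :=
  F ((\val v : 'rV[R]_3) 0 1 + (\val v : 'rV[R]_3) 0 2%:R, (\val v : 'rV[R]_3) 0 2%:R).
Fact tri_simplex_continuous : continuous tri_simplex_fun.
Proof.
have c1 := @coord_simplex_continuous 2 1; have c2 := @coord_simplex_continuous 2 2%:R.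
by apply: (cts_comp cF); cts.
Qed.
HB.instance Definition _ := isContinuous.Build _ _ tri_simplex_fun tri_simplex_continuous.
Definition tri_simplex : singular_simplex R Y 2 := tri_simplex_fun.
End TriangleSimplex.

Section PointSimplex.
Variables (y : Y).
Definition point_simplex_fun (v : simplex 0) : Y := y.
Fact point_simplex_continuous : continuous point_simplex_fun.
Proof. exact: cts_const. Qed.
HB.instance Definition _ := isContinuous.Build _ _ point_simplex_fun point_simplex_continuous.
Definition point_simplex : singular_simplex R Y 0 := point_simplex_fun.
End PointSimplex.

Definition edge_path (s : singular_simplex R Y 1) : R -> Y := fun t => s (edge_pt t).

Lemma edge_path_continuous s : continuous (edge_path s).
Proof. by apply: (@cts_comp _ _ _ s edge_pt); [exact: cts_fun|exact: edge_pt_continuous]. Qed.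

(* Total version of [path_simplex]; only meant for continuous [c]. *)
Definition simp c : singular_simplex R Y 1 :=
  match pselect (continuous c) with
  | left cc => path_simplex cc
  | right _ => path_simplex (@cts_const R Y (c 0))
  end.

Lemma simpE c (v : simplex 1) : continuous c -> simp c v = c ((\val v : 'rV[R]_2) 0 1).
Proof. by move=> cc; rewrite /simp; case: pselect. Qed.

Lemma simplex1P (v : simplex 1) : edge_pt ((\val v : 'rV[R]_2) 0 1) = v.
Proof.
apply: val_inj => /=; apply/matrixP => i j; rewrite !mxE ord1.
have [v0 v1] := set_mem (valP v); rewrite big_ord_recl big_ord1 /= in v1.
have e1 : fintype.lift ord0 ord0 = 1 :> 'I_2 by apply: val_inj.
rewrite e1 in v1; have h0 := v0 0; have h1 := v0 1.
rewrite cl01_id; last by lra.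
case: eqP => [->|nj]; first by lra.
congr (\val v 0 _); apply: val_inj; case: j nj => -[|[|m]] //= lj nj.
by case: nj; apply: val_inj.
Qed.

Lemma simp_edge_path s : simp (edge_path s) = s.
Proof.
apply/continuousEP => v; rewrite simpE; last exact: edge_path_continuous.
by rewrite /edge_path simplex1P.
Qed.

Lemma edge_path_simp c t : continuous c -> edge_path (simp c) t = c (cl01 t).
Proof. by move=> cc; rewrite /edge_path simpE // mxE. Qed.

Lemma simp_ext c d : continuous c -> continuous d ->
  (forall s, 0 <= s <= 1 -> c s = d s) -> simp c = simp d.
Proof.
move=> cc cd e; apply/continuousEP => v; rewrite !simpE //; apply: e.
have [v0 v1] := set_mem (valP v); rewrite big_ord_recl big_ord1 /= in v1.
have e1 : fintype.lift ord0 ord0 = 1 :> 'I_2 by apply: val_inj.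
by rewrite e1 in v1; have h0 := v0 0; have h1 := v0 1; lra.
Qed.

Lemma boundary1 s : boundary << s >> =
  << point_simplex (edge_path s 1) >> - << point_simplex (edge_path s 0) >> :> singular_chain R Y 0.
Proof.
rewrite /boundary fglift1 big_ord_recl big_ord1 /= expr0 scale1r expr1 scaleN1r.
have pt (v : simplex 0) : (\val v : 'rV[R]_1) 0 0 = 1.
  by have [_] := set_mem (valP v); rewrite big_ord1.
have u i j k : (i : 'I_2) = fintype.lift j k -> unlift j i = Some k by move=> ->; rewrite liftK.
have o2 (j : 'I_2) : j = 0 \/ j = 1.
  by case: j => -[|[|m]] // lj; [left|right]; apply: val_inj.
congr (<< _ >> - << _ >>); apply/continuousEP => v /=; rewrite /edge_path; congr (s _);
  apply: val_inj; apply/matrixP => i j; rewrite !mxE ?(ord1 i) ?cl01_0 ?cl01_1;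
  case: (o2 j) => ->; rewrite ?eqxx.
- by rewrite unlift_none subrr.
- by rewrite (u _ _ 0) ?pt //; apply: val_inj.
- by rewrite (u _ _ 0) ?pt ?subr0 //; apply: val_inj.
- by rewrite (_ : 1 = fintype.lift ord0 ord0) ?unlift_none //; apply: val_inj.
Qed.

Lemma boundary_tri F (cF : continuous F) : boundary << tri_simplex cF >> =
  << simp (fun s => F (1, s)) >> - << simp (fun s => F (s, s)) >> + << simp (fun s => F (s, 0)) >>
  :> singular_chain R Y 1.
Proof.
rewrite /boundary fglift1 !big_ord_recl big_ord0 /= addr0 expr0 scale1r expr1 scaleN1r.
rewrite [(-1) ^+ _]expr2 mulrNN mul1r scale1r addrA.
have sum1 (v : simplex 1) : (\val v : 'rV[R]_2) 0 0 + (\val v : 'rV[R]_2) 0 1 = 1.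
  have [_] := set_mem (valP v); rewrite big_ord_recl big_ord1 => <-.
  by congr (_ + \val v 0 _); apply: val_inj.
have u i j k : (i : 'I_3) = fintype.lift j k -> unlift j i = Some k by move=> ->; rewrite liftK.
congr (<< _ >> - << _ >> + << _ >>); apply/continuousEP => v; rewrite simpE; try by
  (apply: (cts_comp cF); cts).
- rewrite /= /tri_simplex_fun /= !mxE (u _ _ 0) ?(u _ _ 1) ?sum1 //; exact: val_inj.
- rewrite /= /tri_simplex_fun /= !mxE (u 2%:R _ 1); last exact: val_inj.
  by rewrite (_ : 1 = fintype.lift ord0 ord0) ?unlift_none ?add0r //; exact: val_inj.
- rewrite /= /tri_simplex_fun /= !mxE (u 1 _ 1); last exact: val_inj.
  by rewrite (_ : 2%:R = fintype.lift ord0 (fintype.lift ord0 ord0)) ?unlift_none ?addr0 //; exact: val_inj.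
Qed.

Lemma simplex2P (v : simplex 2) :
  tri_pt ((\val v : 'rV[R]_3) 0 1 + (\val v : 'rV[R]_3) 0 2%:R, (\val v : 'rV[R]_3) 0 2%:R) = v.
Proof.
apply: val_inj => /=; apply/matrixP => i j; rewrite !mxE ord1 /=.
have [v0 v1] := set_mem (valP v); rewrite !big_ord_recl big_ord0 addr0 in v1.
have e1 : fintype.lift ord0 ord0 = 1 :> 'I_3 by apply: val_inj.
have e2 : fintype.lift ord0 (fintype.lift ord0 ord0) = 2%:R :> 'I_3 by apply: val_inj.
rewrite e1 e2 in v1; have h0 := v0 0; have h1 := v0 1; have h2 := v0 2%:R.
have v1' : \val v 0 0 + (\val v 0 1 + \val v 0 2%:R) = 1 := v1.
rewrite !cl01_id; [|lra|lra].
rewrite min_r; last by lra.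
case: eqP => [->|nj]; first by lra.
case: eqP => [->|nj']; first by lra.
congr (\val v 0 _); apply: val_inj; case: j nj nj' => -[|[|[|]]] //= ? h h'.
- by case: h; apply: val_inj.
- by case: h'; apply: val_inj.
Qed.

Lemma tri_simplexP (t : singular_simplex R Y 2) :
  exists (F : R * R -> Y) (cF : continuous F), t = tri_simplex cF.
Proof.
have cF : continuous (fun z => t (tri_pt z)).
  by apply: (@cts_comp _ _ _ t tri_pt); [exact: cts_fun|exact: tri_pt_continuous].
exists (fun z => t (tri_pt z)), cF; apply/continuousEP => v.
by rewrite /= /tri_simplex_fun simplex2P.
Qed.

End Simplices.

Section Homologous.
Variables (R : realType) (Y : topologicalType).
Notation chain := (singular_chain R Y).

Definition homologous (x y : chain 1) : Prop := exists c : chain 2, boundary c = x - y.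

Lemma homologous_refl x : homologous x x.
Proof. by exists 0; rewrite /boundary fglift0 subrr. Qed.
Lemma homologous_sym x y : homologous x y -> homologous y x.
Proof. by case=> c e; exists (- c); rewrite /boundary fgliftN -/(boundary _) e opprB. Qed.
Lemma homologousD x y x' y' : homologous x y -> homologous x' y' -> homologous (x + x') (y + y').
Proof.
case=> c e [c' e']; exists (c + c').
by rewrite /boundary fgliftD -!/(boundary _) e e' opprD addrACA.
Qed.
Lemma homologousZ a x y : homologous x y -> homologous (a *: x) (a *: y).
Proof. by case=> c e; exists (a *: c); rewrite /boundary fgliftZ -/(boundary _) e scalerBr. Qed.
Lemma homologous_trans y x z : homologous x y -> homologous y z -> homologous x z.
Proof.
case=> c e [c' e']; exists (c + c').
by rewrite /boundary fgliftD -!/(boundary _) e e' addrA subrK.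
Qed.
Lemma homologous_sum (J : Type) (s : seq J) (F G : J -> chain 1) :
  (forall j, homologous (F j) (G j)) -> homologous (\sum_(j <- s) F j) (\sum_(j <- s) G j).
Proof.
move=> h; elim: s => [|j s IH]; first by rewrite !big_nil; exact: homologous_refl.
by rewrite !big_cons; exact: homologousD.
Qed.

Implicit Types c d : R -> Y.

Lemma homologous_triangle (F : R * R -> Y) : continuous F ->
  homologous (<< simp (fun s => F (s, 0)) >> + << simp (fun s => F (1, s)) >>)
             << simp (fun s => F (s, s)) >>.
Proof.
by move=> cF; exists << tri_simplex cF >>; rewrite boundary_tri addrC addrA.
Qed.

Lemma homologous_cst (y : Y) : homologous << simp ((fun=> y) : R -> Y) >> 0.
Proof.
have [c e] := @homologous_triangle (fun=> y) (@cts_const _ Y y).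
by exists c; rewrite e addrK subr0.
Qed.

(** The diagonal cuts the square of the homotopy into a triangle of [H] and one of its transpose
    [K]. The two vertical sides are constant, hence null-homologous. *)
Lemma homologous_hpath c d : continuous c -> continuous d -> hpath c d ->
  homologous << simp c >> << simp d >>.
Proof.
move=> cc cd [H0 cH0 [h1 h2]].
pose H z := H0 (cl01 z.1, cl01 z.2).
have cH : continuous H by apply: (cts_comp cH0); cts.
pose K z := H (z.2, z.1).
have cK : continuous K by apply: (cts_comp cH); cts.
have e0 : simp (fun s => H (s, 0)) = simp c.
  apply: simp_ext => // [|s sI]; first by apply: (cts_comp cH); cts.
  by rewrite /H /= cl01_0 cl01_id // (h1 s sI).1.
have e1 : simp (fun s => K (1, s)) = simp d.
  apply: simp_ext => // [|s sI]; first by apply: (cts_comp cK); cts.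
  by rewrite /K /H /= cl01_1 cl01_id // (h1 s sI).2.
have e2 : (fun s => H (1, s)) = fun=> c 1.
  by apply/funext => s; rewrite /H /= cl01_1 (h2 _ (cl01_in s)).2.
have e3 : (fun s => K (s, 0)) = fun=> c 0.
  by apply/funext => s; rewrite /K /H /= cl01_0 (h2 _ (cl01_in s)).1.
have t1 := homologous_triangle cH; have t2 := homologous_triangle cK.
rewrite e0 e2 in t1; rewrite e1 e3 in t2.
have := homologousD (homologous_refl << simp c >>) (homologous_sym (homologous_cst (c 1))).
rewrite addr0 => /homologous_trans; apply.
apply: homologous_trans t1 _.
have := homologousD (homologous_cst (c 0)) (homologous_refl << simp d >>).
rewrite add0r => h; apply: homologous_trans _ h.
by apply: homologous_sym.
Qed.

(** The degenerate triangle (s, t) -> (c d)((s + t) / 2) has the sides [c], [d] and the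
    concatenation. *)
Lemma homologous_cat c d : continuous c -> continuous d -> c 1 = d 0 ->
  homologous << simp (pcat c d) >> (<< simp c >> + << simp d >>).
Proof.
move=> cc cd e; have ccd := pcat_continuous cc cd e.
pose F (z : R * R) := pcat c d (2^-1 * (z.1 + z.2)).
have cF : continuous F by apply: (cts_comp ccd); cts.
have := homologous_triangle cF.
have -> : simp (fun s => F (s, s)) = simp (pcat c d).
  apply: simp_ext => // [|s sI]; first by apply: (cts_comp cF); cts.
  by rewrite /F /=; congr pcat; lra.
have -> : simp (fun s => F (s, 0)) = simp c.
  apply: simp_ext => // [|s sI]; first by apply: (cts_comp cF); cts.
  by rewrite /F /pcat /= ifT; [congr c; lra|lra].
have -> : simp (fun s => F (1, s)) = simp d.
  apply: simp_ext => // [|s sI]; first by apply: (cts_comp cF); cts.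
  rewrite /F /pcat /=; case: ifPn => h; last by congr d; lra.
  have -> : s = 0 by lra.
  by rewrite -e; congr c; lra.
exact: homologous_sym.
Qed.

Lemma homologous_rev c : continuous c -> homologous << simp (prv c) >> (- << simp c >>).
Proof.
move=> cc; have cr := prv_continuous cc.
have h1 : homologous << simp (pcat c (prv c)) >> 0.
  apply: homologous_trans (homologous_cst (c 0)).
  apply: homologous_hpath; [|exact: cts_const|exact: hpath_catV].
  by apply: pcat_continuous; rewrite ?prv0.
have h2 := homologous_trans (homologous_sym (homologous_cat cc cr (esym (prv0 c)))) h1.
have := homologousD (homologous_refl (- << simp c >>)) h2.
by rewrite addrA addNr add0r addr0.
Qed.

End Homologous.

(** * Homomorphisms to the integers and the first Betti number *)

Section BettiLower.
Variables (R : realType) (Y : topologicalType) (y0 : Y).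

Lemma transportE (c g : R -> Y) u v g' : ispath y0 u g -> ispath u v c -> ispath y0 v g' ->
  u = y0 -> v = y0 ->
  transport y0 g c g' = (pclass y0 g * pclass y0 c * (pclass y0 g')^-1)%g.
Proof.
move=> pg pc pg' eu ev; subst u v; rewrite /transport pclassM //.
- by rewrite pclassM // pclassV.
- exact: ispath_cat pc.
- exact: ispath_rev.
Qed.

(** Closing up singular 1-simplices by the paths [gam] turns each [h j] into a cochain. It vanishes
    on boundaries, because a triangle is a relation in the fundamental group, and these cochains are
    dual to the loops [l i]. *)
Lemma betti_lower (N : nat) (h : 'I_N -> pi1 R y0 -> int) (g : 'I_N -> pi1 R y0) :
  (forall y, exists c : R -> Y, ispath y0 y c) ->
  (forall j a b, h j (a * b)%g = h j a + h j b) ->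
  (forall i j, h j (g i) = (i == j)%:R) -> betti1_ge R Y N.
Proof.
move=> pcon hM hg.
have h1 j : h j 1%g = 0.
  by apply: (addrI (h j 1%g)); rewrite -hM mulg1 addr0.
have hV j a : h j (a^-1)%g = - h j a.
  by apply: (addrI (h j a)); rewrite -hM mulgV h1 subrr.
have [gam pg] : {gam : Y -> R -> Y & forall y, ispath y0 y (gam y)}.
  exact: (@choice _ _ (fun y c => ispath y0 y c)).
have [l hl] : {l : 'I_N -> R -> Y & forall i, ispath y0 y0 (l i) /\ pclass y0 (l i) = g i}.
  apply: (@choice _ _ (fun i c => ispath y0 y0 c /\ pclass y0 c = g i)) => i.
  by have [c pc <-] := pclass_surj (g i); exists c.
pose T c := transport y0 (gam (c 0)) c (gam (c 1)).
have T_hpath c d : continuous c -> continuous d -> hpath c d -> T c = T d.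
  move=> cc cd hcd; rewrite /T -(hpath0 hcd) -(hpath1 hcd).
  by apply: (transport_hpath (pg _) _ (pg _)).
pose phi j (s : singular_simplex R Y 1) : int^o := h j (T (edge_path s)).
have phi_simp j c : continuous c -> phi j (simp c) = h j (T c).
  move=> cc; congr (h j _); apply: T_hpath => //; first exact: edge_path_continuous.
  apply: hpath_eq; first exact: edge_path_continuous.
  by move=> s sI; rewrite edge_path_simp // cl01_id.
have phiB j (c : singular_chain R Y 2) : fglift (phi j) (boundary c) = 0.
  rewrite (freeg_sum_scale c) /boundary !fglift_sum big1 // => t _.
  rewrite !fgliftZ -/(boundary _).
  have [F [cF ->]] := tri_simplexP t.
  rewrite boundary_tri fgliftD fgliftB !fglift1.
  have c1 : continuous (fun s => F (1, s)) by apply: (cts_comp cF); cts.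
  have c2 : continuous (fun s => F (s, s)) by apply: (cts_comp cF); cts.
  have c3 : continuous (fun s => F (s, 0)) by apply: (cts_comp cF); cts.
  rewrite !phi_simp //.
  suff -> : T (fun s => F (s, s)) = (T (fun s => F (s, 0%R)) * T (fun s => F (1%R, s)))%g.
    have z (W : zmodType) (u v : W) : v - (u + v) + u = 0.
      by rewrite opprD addrCA subrr addr0 addNr.
    by rewrite hM (z int^o) scaler0.
  rewrite /T (transportM (v := F (1, 0)) (pg _) _ (pg _) _ (pg _)) //.
  apply: (transport_hpath (pg _) _ (pg _)) => //; last first.
    by apply: pcat_continuous.
  apply: (@hpath_plane R Y F (fun s => (s, s)) (pcat (fun s => (s, 0)) (fun s => (1, s)))) => //.
  - by cts.
  - by apply: pcat_continuous; [cts|cts|].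
  - by rewrite pcat0.
  - by rewrite pcat1.
  - by move=> s sI; rewrite /pcat; case: ifP.
exists (fun i => << simp (l i) >>); split.
  move=> i; have [[cl l0 l1] _] := hl i.
  by rewrite boundary1 !edge_path_simp // cl01_0 cl01_1 l0 l1 subrr.
move=> a [c ec] j.
have := phiB j c; rewrite ec fglift_sum (bigD1 j) //= big1 ?addr0.
  rewrite fgliftZ fglift1; have [pl el] := hl j; have [cl l0 l1] := pl.
  rewrite phi_simp // /T l0 l1 (transportE (pg _) pl (pg _)) // !hM hV el hg eqxx.
  by rewrite [h j _ + _]addrC addrK => <-; rewrite /GRing.scale /= mulr1.
move=> i ij; rewrite fgliftZ fglift1; have [pl el] := hl i; have [cl l0 l1] := pl.
rewrite phi_simp // /T l0 l1 (transportE (pg _) pl (pg _)) // !hM hV el hg (negPf ij).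
by rewrite addr0 subrr scaler0.
Qed.

End BettiLower.

Section Cycles.
Variables (R : realType) (Y : topologicalType) (y0 : Y) (gam : Y -> R -> Y).
Hypothesis pg : forall y, ispath y0 y (gam y).

Definition closed_up (s : singular_simplex R Y 1) : R -> Y :=
  pcat (pcat (gam (edge_path s 0)) (edge_path s)) (prv (gam (edge_path s 1))).

Lemma closed_upP s : ispath y0 y0 (closed_up s).
Proof.
apply: ispath_cat (ispath_rev (pg _)); apply: ispath_cat (pg _) _.
by split=> //; exact: edge_path_continuous.
Qed.

(** Tying every simplex to [y0] alters the chain by connecting paths. Their total is the image of
    [boundary z] under the map sending a point to its connecting path, and so it vanishes. *)
Lemma cycle_loops (z : singular_chain R Y 1) : boundary z = 0 ->
  homologous z (\sum_(s <- dom z) coeff s z *: << simp (closed_up s) >>).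
Proof.
move=> bz.
have /cid[v0 _] : exists v : set_type (@std_simplex R 0), True.
  have h : (const_mx 1 : 'rV[R]_1) \in @std_simplex R 0.
    by rewrite inE; split=> [i|]; rewrite ?big_ord1 mxE // ler01.
  by exists (exist (fun v => v \in @std_simplex R 0) _ h).
pose G (p : singular_simplex R Y 0) : singular_chain R Y 1 := << simp (gam (p v0)) >>.
have Gb : \sum_(s <- dom z) coeff s z *: (<< simp (gam (edge_path s 1)) >> - << simp (gam (edge_path s 0)) >>) = 0 :> singular_chain R Y 1.
  have : fglift G (boundary z) = 0 by rewrite bz fglift0.
  rewrite {1}(freeg_sum_scale z) /boundary !fglift_sum => e; rewrite -[RHS]e.
  apply: eq_bigr => s _; rewrite !fgliftZ -/(boundary _) boundary1 fgliftB !fglift1.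
  by [].
have E : z = \sum_(s <- dom z) coeff s z *: << s >> - \sum_(s <- dom z) coeff s z *: (<< simp (gam (edge_path s 1)) >> - << simp (gam (edge_path s 0)) >>).
  by rewrite Gb subr0 -freeg_sum_scale.
rewrite {1}E -sumrB.
apply: homologous_sum => s; rewrite -scalerBr; apply: homologousZ.
apply: homologous_sym.
have [c0 a0 b0] := pg (edge_path s 0); have [c1 a1 b1] := pg (edge_path s 1).
have ce := @edge_path_continuous R Y s.
have c01 : continuous (pcat (gam (edge_path s 0)) (edge_path s)) by apply: pcat_continuous.
apply: homologous_trans (homologous_cat c01 (prv_continuous c1) _) _.
  by rewrite pcat1 prv0.
apply: homologous_trans (homologousD (homologous_cat c0 ce b0) (homologous_rev c1)) _.
rewrite simp_edge_path opprB [<< s >> + _]addrA [<< s >> + _]addrC.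
exact: homologous_refl.
Qed.

End Cycles.

(** * Fox calculus along walks *)

Section LaurentEvaluation.
Variables (C : fieldType) (r : nat) (z : 'rV[C]_r).
Hypothesis z0 : forall k, z 0 k != 0.

Definition monomial (a : 'rV[int]_r) : C := \prod_k z 0 k ^ a 0 k.

Lemma monomial0 : monomial 0 = 1.
Proof. by rewrite /monomial big1 // => k _; rewrite mxE expr0z. Qed.

Lemma monomialD a b : monomial (a + b) = monomial a * monomial b.
Proof.
by rewrite /monomial -big_split /=; apply: eq_bigr => k _; rewrite mxE expfzDr.
Qed.

Lemma monomial_letter (a : letter r) :
  monomial (letter_ab a) = if a.2 then z 0 a.1 else (z 0 a.1)^-1.
Proof.
have h i : monomial (delta_mx 0 i) = z 0 i.
  rewrite /monomial (bigD1 i) //= mxE !eqxx expr1z big1 ?mulr1 // => k ki.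
  by rewrite mxE eqxx (negPf ki) expr0z.
case: a => i [] /=; rewrite /letter_ab /= ?h //.
have e : monomial (- delta_mx 0 i) * z 0 i = 1 by rewrite -[X in _ * X](h i) -monomialD addNr monomial0.
by apply: (mulIf (z0 i)); rewrite e mulVf.
Qed.

Lemma laurent_evalE D : laurent_eval z D = fglift (monomial : _ -> zmodule C) D.
Proof.
rewrite {2}(freeg_sum_scale D) fglift_sum; apply: eq_bigr => a _.
by rewrite fgliftZ fglift1 mulrzl.
Qed.

Lemma laurent_evalD D E : laurent_eval z (D + E) = laurent_eval z D + laurent_eval z E.
Proof. by rewrite !laurent_evalE fgliftD. Qed.

Lemma laurent_eval0 : laurent_eval z 0 = 0.
Proof. by rewrite laurent_evalE fglift0. Qed.

Lemma laurent_evalN D : laurent_eval z (- D) = - laurent_eval z D.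
Proof. by rewrite !laurent_evalE fgliftN. Qed.

Lemma laurent_eval1 a : laurent_eval z << a >> = monomial a.
Proof. by rewrite laurent_evalE fglift1. Qed.

Lemma laurent_eval_translate t D :
  laurent_eval z (translate t D) = monomial t * laurent_eval z D.
Proof.
rewrite !laurent_evalE {1}/translate (freeg_sum_scale D) !fglift_sum mulr_sumr.
by apply: eq_bigr => a _; rewrite !fgliftZ !fglift1 monomialD [RHS]mulrzAr.
Qed.

Definition fox_eval (i : 'I_r) (w : seq (letter r)) : C := laurent_eval z (fox_word i w).

Lemma fox_eval_nil i : fox_eval i [::] = 0.
Proof. exact: laurent_eval0. Qed.

Lemma fox_eval_cons i a w : fox_eval i (a :: w) =
  (if a.1 == i then (if a.2 then 1 else - (z 0 a.1)^-1) else 0)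
  + (if a.2 then z 0 a.1 else (z 0 a.1)^-1) * fox_eval i w.
Proof.
rewrite /fox_eval /= laurent_evalD laurent_eval_translate monomial_letter; congr (_ + _).
rewrite /fox_letter; case: ifP => _; last exact: laurent_eval0.
case: ifPn => b; first by rewrite laurent_eval1 monomial0.
by rewrite laurent_evalN laurent_eval1 monomial_letter (negPf b).
Qed.

End LaurentEvaluation.

Section Walks.
Variables (r : nat) (S : eqType) (st : S -> letter r -> S).
Hypothesis stK : forall s a, st (st s a) (letter_inv a) = s.

Definition walk (s : S) (w : seq (letter r)) : S := foldl st s w.

Lemma walk_letter_mul s a w : walk s (letter_mul a w) = walk (st s a) w.
Proof. by case: w => [|b w] //=; case: ifPn => // /eqP ->; rewrite stK. Qed.

Lemma walk_word_mul s u w : walk s (word_mul u w) = walk (walk s u) w.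
Proof. by elim: u s => //= a u IH s; rewrite walk_letter_mul IH. Qed.

Lemma walk_cat s u w : walk s (u ++ w) = walk (walk s u) w.
Proof. exact: foldl_cat. Qed.

Lemma walk_word_inv s w : walk (walk s w) (word_inv w) = s.
Proof.
elim: w s => //= a w IH s.
by rewrite /word_inv /= rev_cons -cats1 walk_cat -/(word_inv w) IH /= stK.
Qed.

Lemma walkM s (f g : free_group r) : walk s (f * g)%g = walk (walk s f) g.
Proof. exact: walk_word_mul. Qed.

Section GroupLabels.
Variables (B : groupType) (lab : S -> letter r -> B).
Hypothesis labV : forall s a, lab (st s a) (letter_inv a) = ((lab s a)^-1)%g.

Fixpoint gwalk (s : S) (w : seq (letter r)) : B :=
  if w is a :: w' then (lab s a * gwalk (st s a) w')%g else 1%g.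

Lemma gwalk_letter_mul s a w : gwalk s (letter_mul a w) = (lab s a * gwalk (st s a) w)%g.
Proof.
case: w => [|b w] //=; case: ifPn => //= /eqP ->.
by rewrite labV stK mulVKg.
Qed.

Lemma gwalk_word_mul s u w : gwalk s (word_mul u w) = (gwalk s u * gwalk (walk s u) w)%g.
Proof.
by elim: u s => [|a u IH] s /=; rewrite ?mul1g // gwalk_letter_mul IH mulgA.
Qed.

Lemma gwalkM s (f g : free_group r) : gwalk s (f * g)%g = (gwalk s f * gwalk (walk s f) g)%g.
Proof. exact: gwalk_word_mul. Qed.

End GroupLabels.

(** Signed passage through the edge (s', i), which runs from [s'] to [st s' (i, true)]. A letter
    x_i^-1 read at [s] uses the edge that starts where the letter arrives. *)
Definition edge_count (s : S) (a : letter r) (s' : S) (i : 'I_r) : int :=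
  if a.1 == i then (if a.2 then (s' == s)%:R else - (s' == st s a)%:R) else 0.

Fixpoint ecount (s : S) (w : seq (letter r)) (s' : S) (i : 'I_r) : int :=
  if w is a :: w' then edge_count s a s' i + ecount (st s a) w' s' i else 0.

Lemma edge_countV s a s' i : edge_count s a s' i + edge_count (st s a) (letter_inv a) s' i = 0.
Proof.
rewrite /edge_count /= stK; case: ifP => _; last by rewrite addr0.
by case: a.2 => /=; rewrite ?subrr ?addNr.
Qed.

Lemma ecount_letter_mul s a w s' i :
  ecount s (letter_mul a w) s' i = edge_count s a s' i + ecount (st s a) w s' i.
Proof.
case: w => [|b w] //=; case: ifPn => //= /eqP ->.
by rewrite stK addrA edge_countV add0r.
Qed.

Lemma ecount_word_mul s u w s' i :
  ecount s (word_mul u w) s' i = ecount s u s' i + ecount (walk s u) w s' i.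
Proof. by elim: u s => [|a u IH] s /=; rewrite ?add0r // ecount_letter_mul IH addrA. Qed.

Lemma ecountM s (f g : free_group r) s' i :
  ecount s (f * g)%g s' i = ecount s f s' i + ecount (walk s f) g s' i.
Proof. exact: ecount_word_mul. Qed.

End Walks.

Section Integrals.
Variables (r : nat) (S : finType) (st : S -> letter r -> S).
Hypothesis stK : forall s a, st (st s a) (letter_inv a) = s.
Variable V : zmodType.

(** The edge function [u] summed along a walk, as a pairing with edge counts; its vanishing on all
    relators is membership in the left kernel of the relation matrix. *)
Definition integral (u : S -> 'I_r -> V) (s : S) (w : seq (letter r)) : V :=
  \sum_s' \sum_i u s' i *~ ecount st s w s' i.

Definition letter_integral (u : S -> 'I_r -> V) (s : S) (a : letter r) : V :=
  if a.2 then u s a.1 else - u (st s a) a.1.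

Lemma integral_nil u s : integral u s [::] = 0.
Proof. by rewrite /integral big1 // => s' _; rewrite big1. Qed.

Lemma integral_cons u s a w :
  integral u s (a :: w) = letter_integral u s a + integral u (st s a) w.
Proof.
rewrite /integral /=; under eq_bigr do (under eq_bigr do rewrite mulrzDr; rewrite big_split /=).
rewrite big_split /=; congr (_ + _).
have h t (b : int) : \sum_s' \sum_i u s' i *~ (if a.1 == i then (s' == t)%:R * b else 0) = u t a.1 *~ b.
  rewrite (bigD1 t) //= [X in _ + X]big1 ?addr0; last first.
    by move=> s' /negPf ->; rewrite big1 // => i _; rewrite mul0r if_same.
  rewrite (bigD1 a.1) //= !eqxx mul1r big1 ?addr0 // => i /negPf; rewrite eq_sym => ->.
  by [].
rewrite /letter_integral /edge_count; case: (a.2).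
  by rewrite -[RHS](h s 1); apply: eq_bigr => s' _; apply: eq_bigr => i _; rewrite mulr1.
rewrite -[X in - X]mulr1z -mulrNz -(h (st s a) (-1)).
by apply: eq_bigr => s' _; apply: eq_bigr => i _; rewrite mulrN1.
Qed.

Lemma integral_cat u s w w' : integral u s (w ++ w') = integral u s w + integral u (walk st s w) w'.
Proof.
by elim: w s => [|a w IH] s /=; rewrite ?integral_nil ?add0r // !integral_cons IH addrA.
Qed.

Lemma integralM u s (f g : free_group r) :
  integral u s (f * g)%g = integral u s f + integral u (walk st s f) g.
Proof.
rewrite /integral -big_split /=; apply: eq_bigr => s' _; rewrite -big_split /=.
by apply: eq_bigr => i _; rewrite (ecountM stK) mulrzDr.
Qed.

Lemma integral_word_inv u s w : integral u (walk st s w) (word_inv w) = - integral u s w.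
Proof.
apply/eqP; rewrite -addr_eq0 addrC -integral_cat; apply/eqP.
elim: w s => [|a w IH] s; first exact: integral_nil.
rewrite cat_cons integral_cons /word_inv /= rev_cons -cats1 catA integral_cat.
rewrite -/(word_inv w) IH add0r.
rewrite walk_cat (walk_word_inv stK).
rewrite integral_cons integral_nil addr0 /letter_integral /= stK.
by case: a.2 => /=; rewrite ?subrr ?addNr.
Qed.

End Integrals.

(** * Block sums of matrices indexed by finite types *)

Section FinMatrix.
Variable K : fieldType.

Definition fmx (P Q : finType) (A : P -> Q -> K) : 'M[K]_(#|P|, #|Q|) :=
  \matrix_(p, q) A (enum_val p) (enum_val q).

Lemma fmxE (P Q : finType) (A : P -> Q -> K) x y : fmx A (enum_rank x) (enum_rank y) = A x y.
Proof. by rewrite mxE !enum_rankK. Qed.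

Lemma sum_enum_val (P : finType) (V : nmodType) (F : P -> V) :
  \sum_(p < #|P|) F (enum_val p) = \sum_x F x.
Proof. by rewrite -(@big_enum_val _ _ _ _ _ F); apply: eq_bigl => x. Qed.

Lemma fmxM (P Q T : finType) (A : P -> Q -> K) (B : Q -> T -> K) :
  fmx A *m fmx B = fmx (fun p t => \sum_q A p q * B q t).
Proof.
apply/matrixP => p t; rewrite !mxE -(sum_enum_val (fun q => A (enum_val p) q * B q (enum_val t))).
by apply: eq_bigr => q _; rewrite !mxE.
Qed.

Lemma fmx1 (P : finType) : fmx (fun p q : P => (p == q)%:R) = 1%:M.
Proof. by apply/matrixP => p q; rewrite !mxE (inj_eq enum_val_inj). Qed.

Lemma eq_fmx (P Q : finType) (A B : P -> Q -> K) : (forall p q, A p q = B p q) -> fmx A = fmx B.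
Proof. by move=> e; apply/matrixP => p q; rewrite !mxE. Qed.

Variables (S : finType).

Definition blk_inj m (k : S) : 'M[K]_(m, #|{: S * 'I_m}|) :=
  \matrix_(i, p) (enum_val p == (k, i))%:R.

Lemma blk_injK m k l : blk_inj m k *m (blk_inj m l)^T = (k == l)%:R%:M.
Proof.
apply/matrixP => i j; rewrite !mxE.
under eq_bigr do rewrite !mxE.
rewrite (sum_enum_val (fun x => (x == (k, i))%:R * (x == (l, j))%:R)) (bigD1 (k, i)) //=.
rewrite eqxx mul1r big1 ?addr0 => [|x /negPf ->]; last by rewrite mul0r.
by rewrite xpair_eqE -mulnb natrM mulr_natr.
Qed.

Variables (r m : nat) (B : S -> 'M[K]_(r, m)).

Definition blk (k : S) := (blk_inj r k)^T *m B k *m blk_inj m k.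

Lemma rank_blk k : \rank (blk k) = \rank (B k).
Proof.
apply/eqP; rewrite eqn_leq; apply/andP; split.
  by rewrite /blk (leq_trans (mxrankM_maxl _ _)) // mxrankM_maxr.
have -> : B k = blk_inj r k *m blk k *m (blk_inj m k)^T.
  by rewrite /blk !mulmxA blk_injK -mulmxA blk_injK eqxx mulmx1 mul1mx.
by rewrite (leq_trans (mxrankM_maxl _ _)) // mxrankM_maxr.
Qed.

(** Distinct blocks use disjoint rows and columns: a projection recovers each of them from the sum,
    and the row spaces are in direct sum. *)
Lemma rank_block_sum : \rank (\sum_k blk k)%R = (\sum_k \rank (B k))%N.
Proof.
have -> : (\sum_k \rank (B k) = \sum_k \rank (blk k))%N.
  by apply: eq_bigr => k _; rewrite rank_blk.
set T := \sum_k blk k.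
have sub k : (blk k <= T)%MS.
  have -> : blk k = (blk_inj r k)^T *m blk_inj r k *m T.
    rewrite /T mulmx_sumr (bigD1 k) //= /blk !mulmxA -(mulmxA _ (blk_inj r k)) blk_injK eqxx mulmx1.
    rewrite big1 ?addr0 // => l lk.
    by rewrite !mulmxA -(mulmxA _ (blk_inj r k)) blk_injK eq_sym (negPf lk) raddf0 mulmx0 !mul0mx.
  exact: submxMl.
have dir : mxdirect (\sum_k <<blk k>>)%MS.
  apply/mxdirect_sumsP => k _; apply/eqP/rowV0P => v; rewrite sub_capmx genmxE => /andP[vk vs].
  have e1 : v *m (blk_inj m k)^T *m blk_inj m k = v.
    have /submxP[w ->] := vk.
    by rewrite /blk !mulmxA -(mulmxA _ (blk_inj m k)) blk_injK eqxx mulmx1.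
  have e2 : v *m (blk_inj m k)^T = 0.
    apply/sub_kermxP; apply: submx_trans vs _; apply/sumsmx_subP => l lk.
    rewrite genmxE; apply/sub_kermxP.
    by rewrite /blk -(mulmxA _ (blk_inj m l)) blk_injK (negPf lk) raddf0 mulmx0.
  by rewrite -e1 e2 mul0mx.
have rk : \rank (\sum_k <<blk k>>)%MS = (\sum_k \rank (blk k))%N.
  by rewrite (mxdirectP dir) /=; apply: eq_bigr => k _; rewrite mxrank_gen.
rewrite -rk; apply/eqP; rewrite eqn_leq; apply/andP; split; apply: mxrankS.
  by apply: summx_sub => k _; apply: (sumsmx_sup k) => //; rewrite genmxE.
by apply/sumsmx_subP => k _; rewrite genmxE; exact: sub.
Qed.

Lemma blockE : \sum_k blk k =
  fmx (fun (p : S * 'I_r) (q : S * 'I_m) => (p.1 == q.1)%:R * B p.1 p.2 q.2).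
Proof.
apply/matrixP => p q; rewrite !mxE summxE.
case ep: (enum_val p) => [k i]; case eq: (enum_val q) => [l j] /=.
have E k' : blk k' p q = ((k == k') && (l == k'))%:R * B k i j.
  rewrite /blk mxE (bigD1 j) //= big1 ?addr0 => [|j' jj']; last first.
    by rewrite [blk_inj _ _ _ _]mxE eq xpair_eqE (eq_sym j) (negPf jj') andbF mulr0.
  rewrite mxE (bigD1 i) //= big1 ?addr0 => [|i' ii']; last first.
    by rewrite !mxE ep xpair_eqE (eq_sym i) (negPf ii') andbF mul0r.
  rewrite !mxE ep eq !xpair_eqE !eqxx !andbT.
  case: eqP => [->|_]; last by rewrite /= !mul0r.
  by case: eqP => _; rewrite ?mulr1 ?mul1r ?mulr0 ?mul0r.
rewrite (bigD1 k) //= E eqxx /= big1 ?addr0 => [|k' kk']; first by rewrite (eq_sym l).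
by rewrite E (eq_sym k) (negPf kk') mul0r.
Qed.

End FinMatrix.

Section RelationMatrix.
Variables (r ms : nat) (S : finType) (st : S -> letter r -> S).
Hypothesis stK : forall s a, st (st s a) (letter_inv a) = s.
Variable rel : 'I_ms -> free_group r.

(* The boundary map from 2-cells to edges of the covering 2-complex with
   vertex set [S]. *)
Definition relation_mx (K : fieldType) : 'M[K]_(#|{: S * 'I_r}|, #|{: S * 'I_ms}|) :=
  fmx (fun p q => (ecount st q.1 (rel q.2) p.1 p.2)%:~R).

Variables (C : fieldType) (psi : S -> S -> C) (z : S -> 'rV[C]_r).
Hypothesis z0 : forall k i, z k 0 i != 0.
Hypothesis psiE : forall k s i, psi k (st s (i, true)) = z k 0 i * psi k s.

Lemma psi_letter k s a :
  psi k (st s a) = (if a.2 then z k 0 a.1 else (z k 0 a.1)^-1) * psi k s.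
Proof.
case: a => i [] /=; first exact: psiE.
rewrite -{2}(stK s (i, false)) psiE /letter_inv /= mulrA mulVf ?mul1r //.
Qed.

(** Edge counts paired with the eigenfunction [psi k] obey the recursion of the Fox derivative
    evaluated at [z k]. *)
Lemma sum_ecount_psi k s w i :
  \sum_s' psi k s' * (ecount st s w s' i)%:~R = psi k s * fox_eval (z k) i w.
Proof.
elim: w s => [|a w IH] s /=.
  by rewrite fox_eval_nil mulr0 big1 // => s' _; rewrite mulr0.
under eq_bigr do rewrite rmorphD mulrDr /=.
rewrite big_split /= IH fox_eval_cons // mulrDr; congr (_ + _).
  rewrite /edge_count; case: ifP => _; last first.
    by rewrite mulr0 big1 // => s' _; rewrite mulr0.
  have h t : \sum_s' psi k s' * ((s' == t)%:R : int)%:~R = psi k t.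
    rewrite (bigD1 t) //= eqxx mulr1 big1 ?addr0 // => s' /negPf ->.
    by rewrite mulr0.
  have := psi_letter k s a; case: (a.2) => e /=; first by rewrite h mulr1.
  under eq_bigr do rewrite rmorphN mulrN.
  by rewrite sumrN h e mulrN mulrC.
by rewrite psi_letter mulrCA mulrA.
Qed.

Lemma rank_relation_mx : fmx psi \in unitmx ->
  \rank (relation_mx C) = (\sum_k \rank (alexander_matrix rel (z k)))%N.
Proof.
move=> Pu.
pose phi (s k : S) := (invmx (fmx psi)) (enum_rank s) (enum_rank k).
have phiE : fmx phi = invmx (fmx psi).
  by apply/matrixP => p q; rewrite !mxE /phi !enum_valK.
have psiphi k l : \sum_s psi k s * phi s l = (k == l)%:R.
  have := mulmxV Pu; rewrite -phiE fmxM -fmx1 => /matrixP /(_ (enum_rank k) (enum_rank l)).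
  by rewrite !fmxE.
have phipsi s t : \sum_k phi s k * psi k t = (s == t)%:R.
  have := mulVmx Pu; rewrite -phiE fmxM -fmx1 => /matrixP /(_ (enum_rank s) (enum_rank t)).
  by rewrite !fmxE.
(* [kron m A] is the Kronecker product of [A] with the identity of size [m]; in [main] these
   matrices intertwine the relation matrix with the block sum. *)
pose kron m (A : S -> S -> C) : 'M[C]_(#|{: S * 'I_m}|) :=
  fmx (fun p q : S * 'I_m => A p.1 q.1 * (p.2 == q.2)%:R).
have kronM m A B : kron m A *m kron m B = kron m (fun s t => \sum_u A s u * B u t).
  rewrite /kron fmxM; apply: eq_fmx => -[s i] [t j] /=.
  rewrite -(pair_bigA _ (fun u l => A s u * (i == l)%:R * (B u t * (l == j)%:R))) /=.
  rewrite mulr_suml; apply: eq_bigr => u _.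
  rewrite (bigD1 i) //= eqxx mulr1 big1 ?addr0 ?mulrA // => l /negPf.
  by rewrite eq_sym => ->; rewrite mulr0 mul0r.
have kron1 m A : (forall s t, A s t = (s == t)%:R) -> kron m A = 1%:M.
  move=> e; rewrite /kron -fmx1; apply: eq_fmx => -[s i] [t j] /=.
  by rewrite e xpair_eqE -mulnb natrM.
have ku m : kron m psi \in unitmx.
  by apply: (@mulmx1_unit _ _ _ (kron m phi) _).1; rewrite kronM; apply: kron1.
have main : kron r psi *m relation_mx C =
    (\sum_k blk (fun k => alexander_matrix rel (z k)) k) *m kron ms psi.
  rewrite blockE /relation_mx /kron !fmxM; apply: eq_fmx => -[k i] [s j] /=.
  rewrite -(pair_bigA _ (fun s' l => psi k s' * (i == l)%:R * (ecount st s (rel j) s' l)%:~R)) /=.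
  rewrite -(pair_bigA _ (fun l j' => (k == l)%:R * alexander_matrix rel (z k) i j' * (psi l s * (j' == j)%:R))) /=.
  transitivity (\sum_s' psi k s' * (ecount st s (rel j) s' i)%:~R).
    apply: eq_bigr => s' _; rewrite (bigD1 i) //= eqxx mulr1 big1 ?addr0 // => l /negPf.
    by rewrite eq_sym => ->; rewrite mulr0 mul0r.
  rewrite sum_ecount_psi (bigD1 k) //= [X in _ + X]big1 ?addr0 => [|l /negPf]; last first.
    by rewrite eq_sym => lk; rewrite big1 // => j' _; rewrite lk !mul0r.
  rewrite (bigD1 j) //= !eqxx mul1r mulr1 big1 ?addr0 => [|j' /negPf ->]; last by rewrite !mulr0.
  by rewrite mxE mulrC.
rewrite -(rank_block_sum (fun k => alexander_matrix rel (z k))).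
have full : row_full (kron r psi) by rewrite row_full_unit.
have free : row_free (kron ms psi) by rewrite row_free_unit.
by rewrite -[RHS](mxrankMfree _ free) -main (eqmxMfull _ full).
Qed.

End RelationMatrix.

Lemma rank_relation_mx_rat (C : numFieldType) r ms (S : finType) (st : S -> letter r -> S)
    (rel : 'I_ms -> free_group r) : \rank (relation_mx st rel rat) = \rank (relation_mx st rel C).
Proof.
rewrite -(mxrank_map (@ratr C)); congr (\rank _).
by apply/matrixP => a b; rewrite !mxE rmorph_int.
Qed.

(** * Fourier analysis on an abelian action *)

Lemma prod_Xn_sub_1 (C : numClosedFieldType) n : (0 < n)%N ->
  exists2 rs : seq C, uniq rs & 'X^n - 1 = \prod_(x <- rs) ('X - x%:P).
Proof.
move=> n0; have [rs e] := closed_field_poly_normal ('X^n - 1 : {poly C}).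
rewrite (monicP _) ?monicXnsubC // scale1r in e; exists rs => //.
by rewrite -separable.separable_prod_XsubC -e cyclotomic.separable_Xn_sub_1 // pnatr_eq0 -lt0n.
Qed.

Lemma prim_root_exists (C : numClosedFieldType) n : (0 < n)%N -> exists z : C, n.-primitive_root z.
Proof.
move=> n0; have [rs u e] := prod_Xn_sub_1 C n0.
have h : all n.-unity_root rs by apply/allP => z; rewrite -root_prod_XsubC -e.
have sz : (n < (size rs).+1)%N by rewrite -(size_prod_XsubC rs id) -e size_XnsubC.
by have [|z] := hasP (cyclic.has_prim_root n0 h _ sz); last exists z.
Qed.

(** Such a matrix is annihilated by X^m - 1, which splits with simple roots. *)
Lemma diagonalizable_finite_order (C : numClosedFieldType) n (A : 'M[C]_n) m :
  (0 < m)%N -> iter m (mulmx A) 1%:M = 1%:M -> diagonalizable A.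
Proof.
case: n A => [|n] A m0 Am.
  by exists 1%:M; rewrite ?unitmx1 //; apply/is_diag_mxP => -[].
have [rs u e] := prod_Xn_sub_1 C m0.
apply/diagonalizableP; exists rs => //; rewrite -e mxminpoly_min //.
rewrite rmorphB rmorph1 rmorphXn /= horner_mx_X.
suff -> : A ^+ m = iter m (mulmx A) 1%:M by rewrite Am subrr.
by elim: m {m0 Am e} => //= m <-; rewrite exprS.
Qed.

Section Fourier.
Variables (C : numClosedFieldType) (r : nat) (S : finType) (st : S -> letter r -> S).
Hypothesis stK : forall s a, st (st s a) (letter_inv a) = s.
Hypothesis stC : forall s i j, st (st s (i, true)) (j, true) = st (st s (j, true)) (i, true).

Lemma iter_step_id : exists2 m, (0 < m)%N & forall i s, iter m (st^~ (i, true)) s = s.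
Proof.
exists (#|S|)`!; first exact: fact_gt0.
move=> i s; set f := st^~ (i, true).
have inj : injective f by apply: (can_inj (g := st^~ (i, false))) => t; exact: stK.
have /dvdnP[q ->] : (order f s %| (#|S|)`!)%N.
  by apply: dvdn_fact; rewrite order_gt0 max_card.
by elim: q => // q IH; rewrite mulSn iterD IH iter_order.
Qed.

(** The permutation matrices of the generators commute and have finite order, so one matrix [P]
    diagonalizes them all. Its rows are the eigenfunctions [psi k], with eigenvalues [z k]; these
    are roots of unity because a row of [P] is not zero. *)
Lemma fourier_basis : exists (psi : S -> S -> C) (z : S -> 'rV[C]_r) (m : nat),
  [/\ (0 < m)%N, forall k i, z k 0 i ^+ m = 1,
      forall k s i, psi k (st s (i, true)) = z k 0 i * psi k s & fmx psi \in unitmx].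
Proof.
have [m m0 itm] := iter_step_id.
pose A (i : 'I_r) : 'M[C]_#|S| := fmx (fun t s => (t == st s (i, true))%:R).
have mulA i (D : S -> S -> C) : fmx D *m A i = fmx (fun k s => D k (st s (i, true))).
  rewrite fmxM; apply: eq_fmx => k s; rewrite (bigD1 (st s (i, true))) //= eqxx mulr1.
  by rewrite big1 ?addr0 // => t /negPf ->; rewrite mulr0.
have iterA i n : iter n (mulmx (A i)) 1%:M = fmx (fun t s => (t == iter n (st^~ (i, true)) s)%:R).
  elim: n => [|n IH]; first by rewrite -fmx1.
  have -> : iter n.+1 (mulmx (A i)) 1%:M = iter n (mulmx (A i)) 1%:M *m A i.
    elim: n {IH} => [|n IH] /=; first by rewrite mulmx1 mul1mx.
    by rewrite /= in IH; rewrite [in LHS]IH mulmxA.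
  by rewrite IH mulA; apply: eq_fmx => t s; rewrite iterSr.
have diag i : diagonalizable (A i).
  apply: (@diagonalizable_finite_order _ _ _ m) => //; rewrite iterA -fmx1.
  by apply: eq_fmx => t s; rewrite itm.
have [P Pu /allP Pd] : codiagonalizable [seq A i | i <- enum 'I_r].
  apply/codiagonalizableP; split=> [_ _ /mapP[i _ ->] /mapP[j _ ->]|_ /mapP[i _ ->] //].
  rewrite /comm_mx !mulA; apply: eq_fmx => t s; by rewrite stC.
have PD i : exists D, P *m A i = diag_mx D *m P.
  have /Pd /similar_diagPex[D hD] : A i \in [seq A i | i <- enum 'I_r].
    by apply: map_f; rewrite mem_enum.
  exists D; apply: similarPp hD.
  by rewrite submx_full // row_full_unit.
have /boolp.choice[D hD] := PD.
pose psi k s := P (enum_rank k) (enum_rank s).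
have Ppsi : fmx psi = P by apply/matrixP => p q; rewrite mxE /psi !enum_valK.
pose z k : 'rV[C]_r := \row_i D i 0 (enum_rank k).
have psiE k s i : psi k (st s (i, true)) = z k 0 i * psi k s.
  have := hD i; rewrite -Ppsi mulA => /matrixP /(_ (enum_rank k) (enum_rank s)).
  by rewrite fmxE mul_diag_mx [RHS]mxE fmxE mxE.
exists psi, z, m; split=> // [k i|]; last by rewrite Ppsi.
have [s nz] : exists s, psi k s != 0.
  apply: contrapT => /forallNP h.
  have e : row (enum_rank k) P = 0.
    apply/rowP => q; rewrite !mxE -[q]enum_valK.
    by have /negP := h (enum_val q); rewrite negbK => /eqP.
  have : delta_mx 0 (enum_rank k) *m P *m invmx P = 0 :> 'rV_ _ by rewrite -rowE e mul0mx.
  rewrite mulmxK // => /matrixP /(_ 0 (enum_rank k)); rewrite !mxE !eqxx => /eqP.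
  by rewrite oner_eq0.
apply: (mulIf nz); rewrite mul1r -{2}(itm i s).
elim: {m0 itm} m => [|n IH]; first by rewrite mul1r.
by rewrite iterS psiE -IH exprS mulrA.
Qed.

End Fourier.

Section FourierTransitive.
Variables (C : numClosedFieldType) (r : nat) (S : finType) (st : S -> letter r -> S).
Hypothesis stK : forall s a, st (st s a) (letter_inv a) = s.
Variables (s0 : S) (psi : S -> S -> C) (z : S -> 'rV[C]_r).
Hypothesis z0 : forall k i, z k 0 i != 0.
Hypothesis psiE : forall k s i, psi k (st s (i, true)) = z k 0 i * psi k s.
Hypothesis psiU : fmx psi \in unitmx.
Hypothesis st_trans : forall s, exists w, walk st s0 w = s.

Lemma psi_walk k w : exists2 c, c != 0 &
  forall l s, z l = z k -> psi l (walk st s w) = c * psi l s.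
Proof.
elim: w => [|a w [c c0 hc]]; first by exists 1; rewrite ?oner_neq0 // => l s _; rewrite mul1r.
exists (c * (if a.2 then z k 0 a.1 else (z k 0 a.1)^-1)).
  by rewrite mulf_neq0 //; case: a.2; rewrite ?invr_eq0 z0.
move=> l s e; rewrite /= hc // (psi_letter stK z0 psiE) -mulrA e.
by [].
Qed.

Lemma fmx_row_inj k l c : (forall s, psi l s = c * psi k s) -> k = l.
Proof.
move=> e; apply: contrapT => /eqP kl.
have : delta_mx 0 (enum_rank l) - c *: delta_mx 0 (enum_rank k) = 0 :> 'rV[C]_#|S|.
  rewrite -[LHS](mulmxK psiU) mulmxBl -scalemxAl -!rowE.
  set v := (X in X *m _); suff -> : v = 0 by rewrite mul0mx.
  by apply/rowP => t; rewrite !mxE !enum_rankK e subrr.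
move=> /matrixP /(_ 0 (enum_rank l)) /eqP; rewrite !mxE !eqxx /= (inj_eq enum_rank_inj).
by rewrite [l == k]eq_sym (negPf kl) mulr0 subr0 oner_eq0.
Qed.

Lemma psi_base k : psi k s0 != 0.
Proof.
apply/negP => /eqP e; have e0 s : psi k s = 0.
  by have [w <-] := st_trans s; have [c _ ->] := psi_walk k w; rewrite // e mulr0.
have : delta_mx 0 (enum_rank k) = 0 :> 'rV[C]_#|S|.
  rewrite -[LHS](mulmxK psiU) -rowE; set v := (X in X *m _); suff -> : v = 0 by rewrite mul0mx.
  by apply/rowP => t; rewrite !mxE enum_rankK e0.
by move=> /matrixP /(_ 0 (enum_rank k)) /eqP; rewrite !mxE !eqxx oner_eq0.
Qed.

(** On a transitive action an eigenfunction is determined by its eigenvalues and its value at [s0].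
    Equal eigenvalues thus make two rows proportional, against invertibility. *)
Lemma fourier_inj : injective z.
Proof.
move=> k l e; apply: (@fmx_row_inj k l (psi l s0 / psi k s0)) => s.
have [w <-] := st_trans s; have [c _ hc] := psi_walk k w.
by rewrite !hc // mulrCA -!mulrA mulVf ?mulr1 // psi_base.
Qed.

Variables (G : groupType) (act : S -> G -> S) (x : 'I_r -> G).
Hypothesis act1 : forall s, act s 1%g = s.
Hypothesis actM : forall s g h, act (act s g) h = act s (g * h)%g.
Hypothesis stE : forall s w, walk st s w = act s (word_val x w).
Hypothesis gen : forall g, exists w, word_val x w = g.

(** Every group element multiplies [psi k] by a constant, so the quotient of [psi k] by its value at
    [s0], read along the orbit, is multiplicative. *)
Lemma fourier_character k : exists2 chi : G -> C, character C chi & z k = \row_i chi (x i).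
Proof.
have nz := psi_base k.
have chiE g : exists2 c, c != 0 & forall s, psi k (act s g) = c * psi k s.
  by have [w <-] := gen g; have [c c0 hc] := psi_walk k w; exists c => // s; rewrite -stE hc.
exists (fun g => psi k (act s0 g) / psi k s0).
  split=> [g|g h]; first by have [c c0 ->] := chiE g; rewrite !mulf_neq0 // invr_eq0.
  have [d _ hd] := chiE g; have [c _ hc] := chiE h.
  by rewrite -actM !hc hd !mulfK // mulrA mulfK // mulrC.
apply/rowP => i; rewrite mxE.
have := stE s0 [:: (i, true)]; rewrite /= mulg1 => <-.
by rewrite psiE mulfK.
Qed.

End FourierTransitive.

(** * Betti numbers of abelian covers *)

Section Monodromy.
Variables (R : realType) (Y Z : topologicalType) (y0 : Y) (q : Z -> Y).
Hypothesis fq : finite_cover q.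

Lemma monodromy : exists (n : nat) (pt : 'I_n.+1 -> Z) (act : 'I_n.+1 -> pi1 R y0 -> 'I_n.+1),
  [/\ injective pt, forall s, q (pt s) = y0, forall z, q z = y0 -> exists s, z = pt s,
    (forall s, act s 1%g = s) /\ forall s g h, act (act s g) h = act s (g * h)%g &
    forall s (c : R -> Y), ispath y0 y0 c -> lift_end q c (pt s) = pt (act s (pclass y0 c))].
Proof.
have cov := finite_cover_covering fq.
have [_ _ /(_ y0) [U [n [V [[oU Uy] UV tV hV]]]]] := fq.
have fib i : exists z, V i z /\ q z = y0.
  by have [_ [_ _ /(_ _ Uy)[z Vz qz]] _] := hV i; exists z.
have [pt hpt] := boolp.choice fib; exists n, pt.
have inj : injective pt.
  move=> i j e; apply: contrapT => /eqP ij; have /trivIsetP /(_ i j I I ij) := tV.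
  by apply/eqP/set0P; exists (pt i); split; [have [] := hpt i|rewrite e; have [] := hpt j].
have qpt s : q (pt s) = y0 by have [] := hpt s.
have ptE z : q z = y0 -> exists s, z = pt s.
  move=> qz; have : (q @^-1` U) z by rewrite /= qz.
  rewrite UV => -[i _ Viz]; exists i.
  have [_ [_ inj_q _] _] := hV i; apply: inj_q; rewrite ?inE //; last by rewrite qz qpt.
  by have [] := hpt i.
have ex s (g : pi1 R y0) : exists t, forall c : R -> Y, ispath y0 y0 c -> pclass y0 c = g ->
    lift_end q c (pt s) = pt t.
  have [c pc ec] := pclass_surj g; have [cc c0 c1] := pc.
  have [|t et] := ptE (lift_end q c (pt s)).
    by rewrite (p_lift_end cov cc) // qpt c0.
  exists t => d pd ed; rewrite -et; have [cd d0 _] := pd.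
  apply: (lift_end_hpath cov cd cc); first by rewrite qpt d0.
  by apply/(pclassP pd pc); rewrite ed ec.
have [act hact] : {act : 'I_n.+1 -> pi1 R y0 -> 'I_n.+1 & forall s g (c : R -> Y),
    ispath y0 y0 c -> pclass y0 c = g -> lift_end q c (pt s) = pt (act s g)}.
  by apply: (@boolp.choice _ _ (fun s a => forall g (c : R -> Y),
    ispath y0 y0 c -> pclass y0 c = g -> lift_end q c (pt s) = pt (a g))) => s;
   have [a ha] := boolp.choice (ex s); exists a => g c pc; exact: ha.
exists act; split=> //; last by move=> s c pc; exact: hact.
split=> [s|s g h]; apply: inj.
  have <- := hact s 1%g _ (ispath_cst R y0) (pclass1 R y0).
  by rewrite -(qpt s) lift_end_cst.
have [c pc ec] := pclass_surj g; have [d pd ed] := pclass_surj h.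
rewrite -(hact s (g * h)%g _ (ispath_cat pc pd)); last by rewrite pclassM // ec ed.
have [cc c0 c1] := pc; have [cd d0 d1] := pd.
rewrite (lift_end_cat cov) ?c1 ?d0 ?qpt ?c0 //.
by rewrite (hact s g c pc ec) (hact _ h d pd ed).
Qed.

(** By regularity, deck transformations [k] and [l] carry the chosen point of the fibre to its
    images under [g] and [h]. They commute with path lifting and with each other, and so the actions
    of [g] and [h] commute. *)
Lemma monodromy_comm n (pt : 'I_n.+1 -> Z) (act : 'I_n.+1 -> pi1 R y0 -> 'I_n.+1) :
  finite_abelian_cover q -> injective pt -> (forall s, q (pt s) = y0) ->
  (forall s g h, act (act s g) h = act s (g * h)%g) ->
  (forall s (c : R -> Y), ispath y0 y0 c -> lift_end q c (pt s) = pt (act s (pclass y0 c))) ->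
  forall s g h, act (act s g) h = act (act s h) g.
Proof.
case=> _ reg com inj qpt actM hact s g h.
have cov := finite_cover_covering fq.
have deck k : deck_transformation q k -> forall t a u, k (pt t) = pt u ->
    k (pt (act t a)) = pt (act u a).
  case=> ck _ qk t a u kt; have [c pc ec] := pclass_surj a; have [cc c0 _] := pc.
  have qk' z : q (k z) = q z by rewrite -[in RHS]qk.
  rewrite -ec -!hact // -kt (lift_end_deck cov ck qk' cc) //.
  by rewrite qpt c0.
have [k dk kg] := reg (pt s) (pt (act s g)) (etrans (qpt _) (esym (qpt _))).
have [l dl lh] := reg (pt s) (pt (act s h)) (etrans (qpt _) (esym (qpt _))).
apply: inj; rewrite -(deck k dk s h _ kg) -(deck l dl s g _ lh) -lh -kg.
by have := com _ _ dk dl => /(congr1 (fun f => f (pt s))).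
Qed.

End Monodromy.

Section WordChains.
Variables (R : realType) (Y Z : topologicalType) (y0 : Y) (q : Z -> Y).
Variables (S : eqType) (pt : S -> Z) (act : S -> pi1 R y0 -> S).
Hypotheses (cov : covering q) (qpt : forall s, q (pt s) = y0).
Hypothesis act1 : forall s, act s 1%g = s.
Hypothesis actM : forall s g h, act (act s g) h = act s (g * h)%g.
Hypothesis act_lift : forall s (c : R -> Y), ispath y0 y0 c ->
  lift_end q c (pt s) = pt (act s (pclass y0 c)).
Variables (r : nat) (x : 'I_r -> pi1 R y0) (l : 'I_r -> R -> Y).
Hypothesis lP : forall i, ispath y0 y0 (l i) /\ pclass y0 (l i) = x i.

Definition act_letter (s : S) (a : letter r) : S := act s (letter_val x a).

Lemma act_letterK s a : act_letter (act_letter s a) (letter_inv a) = s.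
Proof. by rewrite /act_letter actM letter_val_inv mulgV act1. Qed.

Lemma walk_act s w : walk act_letter s w = act s (word_val x w).
Proof. by elim: w s => [|a w IH] s /=; rewrite ?act1 // IH /act_letter actM. Qed.

Definition edge_chain (s : S) (i : 'I_r) : singular_chain R Z 1 :=
  << simp (lift q (l i) (pt s)) >>.

End WordChains.

Section WordChainsFin.
Variables (R : realType) (Y Z : topologicalType) (y0 : Y) (q : Z -> Y).
Variables (S : finType) (pt : S -> Z) (act : S -> pi1 R y0 -> S).
Hypotheses (cov : covering q) (qpt : forall s, q (pt s) = y0).
Hypothesis act1 : forall s, act s 1%g = s.
Hypothesis actM : forall s g h, act (act s g) h = act s (g * h)%g.
Hypothesis act_lift : forall s (c : R -> Y), ispath y0 y0 c ->
  lift_end q c (pt s) = pt (act s (pclass y0 c)).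
Variables (r : nat) (x : 'I_r -> pi1 R y0) (l : 'I_r -> R -> Y).
Hypothesis lP : forall i, ispath y0 y0 (l i) /\ pclass y0 (l i) = x i.
Notation st := (act_letter act x).
Notation edge_chain := (edge_chain q pt l).

Lemma homologous_lift (c d : R -> Y) s : ispath y0 y0 c -> ispath y0 y0 d ->
  hpath c d -> homologous << simp (lift q c (pt s)) >> << simp (lift q d (pt s)) >>.
Proof.
case=> cc c0 _ [cd d0 _] h.
have [cl pl l0] := liftP cov cc (etrans (qpt s) (esym c0)).
have [cl' pl' l0'] := liftP cov cd (etrans (qpt s) (esym d0)).
apply: homologous_hpath => //; apply: (hpath_lift cov) => //; first by rewrite l0.
apply: hpath_trans (hpath_trans h _).
  by apply: hpath_eq => //; apply: (cts_comp cov.1).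
by apply: hpath_eq => // t tI; rewrite pl'.
Qed.

(** Lifting letter by letter, concatenations become sums and reversed loops become opposites. Only
    the class of [c] matters, so each letter is represented by the fixed loop [l i] or its
    reverse. *)
Lemma homologous_word (w : seq (letter r)) s (c : R -> Y) : ispath y0 y0 c ->
  pclass y0 c = word_val x w ->
  homologous << simp (lift q c (pt s)) >> (\sum_s' \sum_i ecount st s w s' i *: edge_chain s' i).
Proof.
elim: w s c => [|a w IH] s c pc ec /=.
  rewrite big1; last by move=> s' _; rewrite big1 // => i _; rewrite scale0r.
  have pk := ispath_cst R y0.
  apply: homologous_trans (homologous_lift s pc pk _) _.
    by apply/(pclassP pc pk); rewrite ec pclass1.
  apply: homologous_trans (homologous_cst R (pt s)).
  apply: homologous_hpath; [|exact: cts_const|].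
    by have [] := liftP cov (@cts_const R Y y0) (qpt s).
  apply: hpath_eq => [|t tI]; first by have [] := liftP cov (@cts_const R Y y0) (qpt s).
  apply: (lift_uniq cov (c := fun=> y0)) => //; first exact: cts_const.
  exact: cts_const.
have [la [pa ea]] : exists la : R -> Y, ispath y0 y0 la /\ pclass y0 la = letter_val x a.
  by have [g pg eg] := pclass_surj (letter_val x a); exists g.
have [d pd ed] := pclass_surj (word_val x w).
have [ca a0 a1] := pa; have [cd d0 d1] := pd.
have [cla pla la0] := liftP cov ca (etrans (qpt s) (esym a0)).
have ela : lift q la (pt s) 1 = pt (st s a) by rewrite -/(lift_end _ _ _) act_lift // ea.
have [cld pld ld0] := liftP cov cd (etrans (qpt (st s a)) (esym d0)).
have pad := ispath_cat pa pd.
apply: homologous_trans (homologous_lift s pc pad _) _.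
  by apply/(pclassP pc pad); rewrite ec pclassM // ea ed.
have [cad ad0 _] := pad.
have [clad _ _] := liftP cov cad (etrans (qpt s) (esym ad0)).
have ccat : continuous (pcat (lift q la (pt s)) (lift q d (pt (st s a)))).
  by apply: pcat_continuous => //; rewrite ela ld0.
rewrite (simp_ext clad ccat); last first.
  move=> t tI; rewrite (lift_cat cov) ?a1 ?d0 ?qpt ?a0 //.
  by rewrite act_lift // ea.
have eend : lift q la (pt s) 1 = lift q d (pt (st s a)) 0 by rewrite ela ld0.
apply: homologous_trans (homologous_cat cla cld eend) _.
under eq_bigr do (under eq_bigr do rewrite scalerDl; rewrite big_split /=).
rewrite big_split /=; apply: homologousD; last exact: IH.
have sumE t (b : int) : \sum_s' \sum_i (if a.1 == i then (s' == t)%:R * b else 0) *: edge_chain s' i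
    = b *: edge_chain t a.1.
  rewrite (bigD1 t) //= [X in _ + X]big1 ?addr0; last first.
    by move=> s' /negPf ->; rewrite big1 // => i _; rewrite mul0r if_same scale0r.
  rewrite (bigD1 a.1) //= !eqxx mul1r big1 ?addr0 // => i /negPf; rewrite eq_sym => ->.
  by rewrite scale0r.
rewrite /edge_count; case: a ea ela eend sumE {pla ec IH la0 cld pld ld0 pad cad ad0 clad ccat cla} => i b /=.
have [pl el] := lP i; have [cl l0 l1] := pl.
case: b => ea ela _ sumE.
  have -> : \sum_s' \sum_i0 (if i == i0 then (s' == s)%:R else 0) *: edge_chain s' i0 = edge_chain s i.
    rewrite -[RHS]scale1r -sumE; apply: eq_bigr => s' _; apply: eq_bigr => j _; by rewrite mulr1.
  by apply: homologous_lift => //; apply/(pclassP pa pl); rewrite ea el.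
have -> : \sum_s' \sum_i0 (if i == i0 then - (s' == st s (i, false))%:R else 0) *: edge_chain s' i0
    = - edge_chain (st s (i, false)) i.
  rewrite -scaleN1r -sumE; apply: eq_bigr => s' _; apply: eq_bigr => j _; by rewrite mulrN1.
have prl := ispath_rev pl.
apply: homologous_trans (homologous_lift s pa prl _) _.
  by apply/(pclassP pa prl); rewrite ea pclassV // el.
set t := st s (i, false).
have [clt _ lt0] := liftP cov cl (etrans (qpt t) (esym l0)).
have [crl rl0 _] := prl; have [clr _ _] := liftP cov crl (etrans (qpt s) (esym rl0)).
have et : lift_end q (l i) (pt t) = pt s.
  rewrite act_lift // el; congr pt.
  by have := act_letterK act1 actM x s (i, false).
rewrite (simp_ext clr (prv_continuous clt)); last first.
  by move=> u uI; rewrite -et (lift_rev cov) // qpt l0.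
exact: homologous_rev.
Qed.

End WordChainsFin.

Lemma clear_denominators n (v : 'rV[rat]_n) :
  exists (d : int) (a : 'rV[int]_n), d != 0 /\ d%:~R *: v = map_mx intr a.
Proof.
exists (\prod_i denq (v 0 i)), (\row_i (numq (v 0 i) * \prod_(j | j != i) denq (v 0 j))); split.
  by apply/prodf_neq0 => i _; exact: denq_neq0.
apply/rowP => i; rewrite !mxE (bigD1 i) //= !intrM mulrAC.
by congr (_ * _); rewrite mulrC -numqE.
Qed.

(** * A rank count for cycles in a connected graph *)

Section Independence.
Variables (N : nat) (S E F : finType).
Variables (bd : E -> S -> int) (rel : E -> F -> int) (m : 'I_N -> E -> int).
Hypothesis bd_rel : forall f s, \sum_e rel e f * bd e s = 0.
Hypothesis bd_m : forall k s, \sum_e m k e * bd e s = 0.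
Hypothesis bd_conn : forall u : S -> rat,
  (forall e, \sum_s (bd e s)%:~R * u s = 0) -> forall s t, u s = u t.
Hypothesis indep : forall (a : 'I_N -> int) (b : F -> int),
  (forall e, \sum_k a k * m k e = \sum_f b f * rel e f) -> forall k, a k = 0.

(** The rows of [M] and those of the transposed relations are independent in the kernel of the
    boundary [B]. By [bd_conn] only constant functions are killed by the coboundary, so [B] has rank
    at least |S| - 1. Clearing denominators makes [indep], an integral statement, applicable over
    the rationals. *)
Lemma independent_cycles_bound :
  (N + \rank (fmx (fun e f => (rel e f)%:~R : rat)) + #|S| <= #|E| + 1)%N.
Proof.
set D := fmx _.
pose B := fmx (fun e s => (bd e s)%:~R : rat).
pose M : 'M[rat]_(N, #|E|) := \matrix_(k, e) (m k (enum_val e))%:~R.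
have DB : D^T *m B = 0.
  apply/matrixP => f s; rewrite !mxE -[RHS](mulr0z (1 : rat)) -(bd_rel (enum_val f) (enum_val s)).
  rewrite raddf_sum -(sum_enum_val (fun e => (rel e (enum_val f) * bd e (enum_val s))%:~R)).
  by apply: eq_bigr => e _; rewrite !mxE intrM.
have MB : M *m B = 0.
  apply/matrixP => k s; rewrite !mxE -[RHS](mulr0z (1 : rat)) -(bd_m k (enum_val s)).
  rewrite raddf_sum -(sum_enum_val (fun e => (m k e * bd e (enum_val s))%:~R)).
  by apply: eq_bigr => e _; rewrite !mxE intrM.
have ind (v : 'rV_N) (w : 'rV_#|F|) : v *m M = w *m D^T -> v = 0.
  move=> e; have [d [a [d0 ha]]] := clear_denominators (row_mx v w).
  rewrite scale_row_mx -(hsubmxK a) map_row_mx in ha; have [hv hw] := eq_row_mx ha.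
  have az k : lsubmx a 0 k = 0.
    apply: (indep (a := fun k => lsubmx a 0 k) (b := fun f => rsubmx a 0 (enum_rank f))) => x.
    apply: (@intr_inj rat); have := congr1 (fun A => d%:~R *: A) e.
    rewrite !scalemxAl hv hw => /matrixP /(_ 0 (enum_rank x)).
    rewrite !mxE !raddf_sum /= => h; rewrite (eq_bigr (fun k => map_mx intr (lsubmx a) 0 k * M k (enum_rank x))).
      rewrite h -(sum_enum_val (fun f => (rsubmx a 0 (enum_rank f) * rel x f)%:~R)).
      by apply: eq_bigr => f _; rewrite !mxE enum_valK enum_rankK intrM.
    by move=> i _; rewrite !mxE enum_rankK intrM.
  apply/rowP => k; have /matrixP /(_ 0 k) := hv; rewrite !mxE => /eqP.
  have := az k; rewrite mxE => ->; rewrite mulf_eq0 intr_eq0 (negPf d0) => /eqP.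
  by [].
have rM : \rank M = N.
  apply/eqP; rewrite -/(row_free M); apply/inj_row_free => v vM.
  by apply: (ind v 0); rewrite vM mul0mx.
have disj : (M :&: D^T = 0)%MS.
  apply/eqP/rowV0P => v; rewrite sub_capmx => /andP[/submxP[a ->] /submxP[b e]].
  by rewrite (ind a b) ?mul0mx.
have sub : (M + D^T <= kermx B)%MS by rewrite addsmx_sub; apply/andP; split; apply/sub_kermxP.
have := mxrankS sub; rewrite mxrank_disjoint_sum // rM mxrank_tr mxrank_ker => h.
have kB : (kermx B^T <= (const_mx 1 : 'rV_#|S|))%MS.
  apply/row_subP => i; set v := row i _.
  have vB : v *m B^T = 0 by apply/sub_kermxP; exact: row_sub.
  clearbody v.
  have cst : forall s t, v 0 (enum_rank s) = v 0 (enum_rank t).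
    apply: (bd_conn (u := fun s => v 0 (enum_rank s))) => e.
    have /matrixP /(_ 0 (enum_rank e)) := vB; rewrite [in RHS]mxE [in LHS]mxE => vBe.
    rewrite -[RHS]vBe.
    rewrite -(sum_enum_val (fun s => (bd e s)%:~R * v 0 (enum_rank s))).
    by apply: eq_bigr => s _; rewrite enum_valK !mxE enum_rankK mulrC.
  case: (pickP (mem S)) => [s _|S0].
    apply/submxP; exists (const_mx (v 0 (enum_rank s))); apply/rowP => t.
    by rewrite [RHS]mxE big_ord1 !mxE mulr1 -[t]enum_valK -(cst (enum_val t) s).
  suff -> : v = 0 by exact: sub0mx.
  by apply/rowP => t; have := S0 (enum_val t).
have := mxrankS kB; rewrite mxrank_ker mxrank_tr => h1.
have h2 := leq_trans h1 (rank_leq_row _).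
have arith (a b e s : nat) : (a <= e - b -> b <= e -> s - b <= 1 -> a + s <= e + 1)%N by lia.
exact: arith h (rank_leq_row B) h2.
Qed.

End Independence.

Section Gradient.
Variables (r : nat) (S : finType) (st : S -> letter r -> S).
Hypothesis stK : forall s a, st (st s a) (letter_inv a) = s.

Lemma integral_gradient (V : zmodType) (u : S -> V) s w :
  integral st (fun t i => u (st t (i, true)) - u t) s w = u (walk st s w) - u s.
Proof.
elim: w s => [|a w IH] s; first by rewrite integral_nil subrr.
rewrite integral_cons IH /= addrC -[RHS](subrKA (u (st s a))); congr (_ + _).
rewrite /letter_integral; case: a => i [] //=.
by have := stK s (i, false); rewrite /letter_inv /= => ->; rewrite opprB.
Qed.

End Gradient.

Section BettiBound.
Variables (R : realType) (Y : topologicalType) (y0 : Y).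
Hypothesis nY : nice_space R Y.
Variables (r ms : nat) (rel : 'I_ms -> free_group r) (phi : free_group r -> pi1 R y0).
Hypothesis pres : presentation rel phi.
Variables (Z : topologicalType) (q : Z -> Y) (N : nat).
Hypotheses (aq : finite_abelian_cover q) (bZ : betti1_ge R Z N).

Lemma abelian_betti_bound (t : seq 'rV[R[i]]_r) :
  (forall z, alexander_variety R[i] 1 rel phi z -> torsion_point R[i] r z -> z \in t) ->
  (N <= size t * r + 1)%N.
Proof.
move=> ht; have [fq _ _] := aq; have cov := finite_cover_covering fq.
have [phiM phi_surj ker] := pres; have phiE := free_lift_uniq phiM.
set x := fun i => phi (free_gen i) in phiE.
have [n [pt [act [inj qpt ptE [act1 actM] hact]]]] := monodromy R y0 fq.
have comm := monodromy_comm fq aq inj qpt actM hact.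
pose S : finType := 'I_n.+1; pose s0 : S := ord0.
have [l lP] : {l : 'I_r -> R -> Y & forall i, ispath y0 y0 (l i) /\ pclass y0 (l i) = x i}.
  apply: (@boolp.choice _ _ (fun i c => ispath y0 y0 c /\ pclass y0 c = x i)) => i.
  by have [c pc ec] := pclass_surj (x i); exists c.
pose st : S -> letter r -> S := act_letter act x.
have stK : forall s a, st (st s a) (letter_inv a) = s by exact: act_letterK.
have stE s w : walk st s w = act s (word_val x w) by exact: walk_act.
have [_ cZ _] := fq; have lpcZ := (finite_cover_nice fq nY).
have [_ _ lpc _] := lpcZ.
(* Connectedness of [Z] makes the action on the fibre transitive: a path joining two points of the
   fibre projects to a loop. *)
have trans s : exists w, walk st s0 w = s.
  have [c [cc c0 c1]] := path_connected lpc cZ (pt s0) (pt s).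
  have pc : ispath y0 y0 (q \o c).
    by split; rewrite /= ?c0 ?c1 //; apply: (cts_comp cov.1).
  have [f ef] := phi_surj (pclass y0 (q \o c)).
  exists f; apply: inj; rewrite stE -phiE ef -hact //.
  have [cqc _ _] := pc.
  by rewrite (lift_end_uniq cov cqc cc) // c0.
have stC s i j : st (st s (i, true)) (j, true) = st (st s (j, true)) (i, true).
  exact: comm.
have [psi [z [m [m0 zm psiE psiU]]]] := fourier_basis R[i] stK stC.
have z0 k i : z k 0 i != 0.
  apply/eqP => e; have /eqP := zm k i; rewrite e expr0n; case: m m0 {zm} => //= m _.
  by rewrite eq_sym oner_eq0.
have zinj := fourier_inj stK z0 psiE psiU trans.
have gen g : exists w, word_val x w = g.
  by have [f <-] := phi_surj g; exists f; rewrite phiE.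
have rank_z k : z k \notin t -> (r - 1 <= \rank (alexander_matrix rel (z k)))%N.
  apply: contraNleq => lt; apply: ht; last by exists m.
  have [chi chic zE] := fourier_character stK z0 psiE psiU trans actM stE gen k.
  by exists chi; split=> //; rewrite -zE.
have rk := rank_relation_mx stK rel z0 psiE psiU.
(* Since [z] is injective, at most [size t] indices give a listed point; all others contribute at
   least r - 1. *)
have lower : ((#|S| - size t) * (r - 1) <= \rank (relation_mx st rel R[i]))%N.
  rewrite rk; apply: (@leq_trans (\sum_(k | z k \notin t) (r - 1))%N); last first.
    rewrite [X in (_ <= X)%N](bigID (fun k => z k \notin t)) /=.
    by apply: leq_trans (leq_addr _ _); apply: leq_sum => k; exact: rank_z.
  rewrite sum_nat_const leq_mul2r; apply/orP; right.
  have <- := cardC (fun k => z k \in t); rewrite leq_subLR leq_add //.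
  rewrite cardE -(size_map z); apply: uniq_leq_size; first by rewrite map_inj_uniq ?enum_uniq.
  by move=> v /mapP[k]; rewrite mem_enum => kt ->.
pose F : finType := (S * 'I_ms)%type; pose E : finType := (S * 'I_r)%type.
pose bd (e : E) (s : S) : int := (s == st e.1 (e.2, true))%:R - (s == e.1)%:R.
have bd_walk w s v : \sum_(e : E) ecount st s w e.1 e.2 * bd e v = (v == walk st s w)%:R - (v == s)%:R.
  rewrite -(integral_gradient stK (fun u => (v == u)%:R : int)) /integral.
  rewrite pair_bigA; apply: eq_bigr => -[a i] _ /=.
  by rewrite -mulrzr intz mulrC.
pose edge := edge_chain q pt l.
have homw := homologous_word cov qpt act1 actM hact lP.
have [gam pg] : {gam : Z -> R -> Z & forall y, ispath (pt s0) y (gam y)}.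
  exact: (@boolp.choice _ _ (fun y c => ispath (pt s0) y c) (path_connected lpc cZ _)).
have loopf (s : singular_simplex R Z 1) : exists f : free_group r,
    phi f = pclass y0 (q \o closed_up gam s).
  exact: phi_surj.
have [fs hfs] := boolp.choice loopf.
have ploop s : ispath y0 y0 (q \o closed_up gam s).
  have [cc c0 c1] := closed_upP pg s.
  by split; rewrite /= ?c0 ?c1 //; apply: (cts_comp cov.1).
have walk_fs s : walk st s0 (fs s) = s0.
  apply: inj; rewrite stE -phiE hfs -hact //.
  have [cc c0 c1] := closed_upP pg s; have [cqc _ _] := ploop s.
  by rewrite (lift_end_uniq cov cqc cc).
have hom_fs s : homologous << simp (closed_up gam s) >>
    (\sum_s' \sum_i ecount st s0 (fs s) s' i *: edge s' i).
  have := homw (fs s) s0 _ (ploop s); rewrite -phiE hfs => /(_ erefl).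
  have [cc c0 c1] := closed_upP pg s; have [cqc q0 _] := ploop s.
  have [cl pl l0] := liftP cov cqc (etrans (qpt s0) (esym q0)).
  rewrite (simp_ext cl cc) // => u uI.
  by apply: (lift_uniq cov (c := q \o closed_up gam s)).
have [zc [bzc indep]] := bZ.
(* The edge multiplicities of the k-th given cycle, after each simplex is closed up to a loop and
   replaced by the word [fs s]. *)
pose mk (k : 'I_N) (e : E) : int :=
  \sum_(s <- dom (zc k)) coeff s (zc k) * ecount st s0 (fs s) e.1 e.2.
have hom_zc k : homologous (zc k) (\sum_(e : E) mk k e *: edge e.1 e.2).
  apply: homologous_trans (cycle_loops pg (bzc k)) _.
  have -> : \sum_(e : E) mk k e *: edge e.1 e.2 = \sum_(s <- dom (zc k))
      coeff s (zc k) *: (\sum_s' \sum_i ecount st s0 (fs s) s' i *: edge s' i).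
    under eq_bigr do rewrite /mk scaler_suml.
    rewrite exchange_big; apply: eq_bigr => s _ /=.
    rewrite pair_bigA scaler_sumr; apply: eq_bigr => e _ /=; by rewrite scalerA.
  by apply: homologous_sum => s; apply: homologousZ.
have hom_rel (f : F) : homologous (\sum_(e : E) ecount st f.1 (rel f.2) e.1 e.2 *: edge e.1 e.2) 0.
  have pk := ispath_cst R y0; have [ck _ _] := pk.
  have [cl pl l0] := liftP cov ck (qpt f.1).
  apply: homologous_trans (homologous_cst R (pt f.1)).
  rewrite -(simp_ext cl (@cts_const R Z (pt f.1))); last first.
    by apply: (lift_uniq cov ck) => //; exact: cts_const.
  rewrite -(pair_bigA _ (fun s' i => ecount st f.1 (rel f.2) s' i *: edge s' i)) /=.
  apply: homologous_sym; apply: homw => //.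
  rewrite pclass1 -phiE; apply/esym.
  have : normal_closure (range rel) (rel f.2) by apply: sub_normal_closure; exists f.2.
  by rewrite -ker.
have bound := @independent_cycles_bound N S E F bd
  (fun e f => ecount st f.1 (rel f.2) e.1 e.2) mk.
have {bound} : (N + \rank (relation_mx st rel rat) + #|S| <= #|E| + 1)%N.
  apply: bound.
  - move=> f v; rewrite bd_walk stE -phiE.
    have : normal_closure (range rel) (rel f.2) by apply: sub_normal_closure; exists f.2.
    by rewrite -ker /= => ->; rewrite act1 subrr.
  - move=> k v; under eq_bigr do rewrite /mk mulr_suml.
    rewrite exchange_big big1 // => s _ /=.
    under eq_bigr do rewrite -mulrA.
    by rewrite -mulr_sumr bd_walk walk_fs subrr mulr0.
  - move=> u hu.
    have step s i : u (st s (i, true)) = u s.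
      have /eqP := hu (s, i); rewrite /bd /=.
      under eq_bigr do rewrite rmorphB mulrBl /=.
      rewrite sumrB (bigD1 (st s (i, true))) //= eqxx mul1r big1; last first.
        by move=> v /negPf ->; rewrite mul0r.
      rewrite (bigD1 s) //= eqxx mul1r big1; last by move=> v /negPf ->; rewrite mul0r.
      by rewrite !addr0 subr_eq0 => /eqP.
    have wk w s : u (walk st s w) = u s.
      elim: w s => // a w IH s; rewrite /= IH; case: a => i [] //.
      by rewrite -(step (st s (i, false)) i); have := stK s (i, false) => ->.
    by move=> s s'; have [w <-] := trans s; have [w' <-] := trans s'; rewrite !wk.
  - move=> a b hab; apply: indep.
    suff [c hc] : homologous (\sum_k a k *: zc k) 0 by exists c; rewrite hc subr0.
    apply: (@homologous_trans _ _ (\sum_k a k *: \sum_(e : E) mk k e *: edge e.1 e.2)).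
      by apply: homologous_sum => k; apply: homologousZ.
    have -> : \sum_k a k *: \sum_(e : E) mk k e *: edge e.1 e.2 =
        \sum_f b f *: \sum_(e : E) ecount st f.1 (rel f.2) e.1 e.2 *: edge e.1 e.2.
      under eq_bigr do rewrite scaler_sumr; under [RHS]eq_bigr do rewrite scaler_sumr.
      rewrite exchange_big [RHS]exchange_big; apply: eq_bigr => e _ /=.
      under eq_bigr do rewrite scalerA; under [RHS]eq_bigr do rewrite scalerA.
      by rewrite -!scaler_suml hab.
    have e0 : \sum_(f : F) b f *: (0 : singular_chain R Z 1) = 0.
      by rewrite big1 // => f _; rewrite scaler0.
    apply: (eq_ind _ (homologous _) _ _ e0).
    by apply: homologous_sum => f; apply: homologousZ.
(* With m = [size t] the count reads N + (|S| - m)(r - 1) + |S| <= |S| r + 1, so that N <= m (r - 1)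
   + 1. The case r = 0 is separate because of truncated subtraction. *)
rewrite (rank_relation_mx_rat R[i]) => h; have := leq_trans (leq_add (leq_add (leqnn N) lower) (leqnn _)) h.
rewrite card_prod !card_ord; move: (size t) => sz.
case: (r) => [|r']; first by rewrite muln0 /= => /(leq_trans (leq_addr _ _)); lia.
rewrite subn1 /=; nia.
Qed.

End BettiBound.

Lemma abelian_betti_infinite (R : realType) (Y : topologicalType) (y0 : Y)
    (r ms : nat) (rel : 'I_ms -> free_group r) (phi : free_group r -> pi1 R y0) :
  nice_space R Y -> presentation rel phi ->
  (forall N : nat, exists (Z : topologicalType) (q : Z -> Y),
     finite_abelian_cover q /\ betti1_ge R Z N) ->
  infinite_set (alexander_variety R[i] 1 rel phi `&` torsion_point R[i] r).
Proof.
move=> nY pres grow fin.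
have /finite_seqP[t et] := fin.
have [Z [q [aq bZ]]] := grow (size t * r + 2)%N.
suff : (size t * r + 2 <= size t * r + 1)%N by rewrite leq_add2l.
apply: (abelian_betti_bound nY pres aq bZ) => z zV zt.
by have : (alexander_variety R[i] 1 rel phi `&` torsion_point R[i] r) z by []; rewrite et.
Qed.

(** * Rotation covers *)

Section PushForward.
Variables (R : realType) (Y Z : topologicalType) (q : Z -> Y) (z0 : Z) (y0 : Y).
Hypotheses (cq : continuous q) (qz0 : q z0 = y0).

Lemma ispath_push (c : R -> Z) : ispath z0 z0 c -> ispath y0 y0 (q \o c).
Proof. by case=> cc c0 c1; split; rewrite /= ?c0 ?c1 ?qz0 //; apply: (cts_comp cq). Qed.

Lemma push_exists : exists Q : pi1 R z0 -> pi1 R y0,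
  {morph Q : a b / (a * b)%g} /\
  forall c : R -> Z, ispath z0 z0 c -> Q (pclass z0 c) = pclass y0 (q \o c).
Proof.
have ex (g : pi1 R z0) : exists d, forall c : R -> Z, ispath z0 z0 c -> pclass z0 c = g ->
    pclass y0 (q \o c) = d.
  have [c pc ec] := pclass_surj g; exists (pclass y0 (q \o c)) => d pd ed.
  have /(pclassP pd pc) [H cH [h1 h2]] : pclass z0 d = pclass z0 c by rewrite ed.
  apply/(pclassP (ispath_push pd) (ispath_push pc)); exists (q \o H).
    by apply: (cts_comp cq).
  by split=> s sI /=; [have [-> ->] := h1 s sI|have [-> ->] := h2 s sI].
have [Q hQ] := boolp.choice ex; exists Q; split; last by move=> c pc; rewrite -(hQ _ c pc erefl).
move=> a b; have [c pc ec] := pclass_surj a; have [d pd ed] := pclass_surj b.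
rewrite -(hQ _ c pc ec) -(hQ _ d pd ed) -pclassM; [|exact: ispath_push|exact: ispath_push].
rewrite -(hQ _ (pcat c d) (ispath_cat pc pd)); last by rewrite pclassM // ec ed.
congr (pclass _ _); apply/funext => s; rewrite /= /pcat; by case: ifP.
Qed.

End PushForward.

Section CoverClasses.
Variables (R : realType) (Y Z : topologicalType) (q : Z -> Y) (y0 : Y) (cov : covering q).
Variables (S : eqType) (pt : S -> Z) (act : S -> pi1 R y0 -> S).
Hypotheses (inj : injective pt) (qpt : forall s, q (pt s) = y0).
Hypothesis act_lift : forall s (c : R -> Y), ispath y0 y0 c ->
  lift_end q c (pt s) = pt (act s (pclass y0 c)).
Variables (s : S) (Q : pi1 R (pt s) -> pi1 R y0).
Hypothesis QE : forall c : R -> Z, ispath (pt s) (pt s) c -> Q (pclass (pt s) c) = pclass y0 (q \o c).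

Lemma push_stab g : act s (Q g) = s.
Proof.
have [c pc <-] := pclass_surj g; have pqc := ispath_push cov.1 (qpt s) pc.
apply: inj; rewrite QE // -act_lift //; have [cqc _ _] := pqc; have [cc c0 c1] := pc.
by rewrite (lift_end_uniq cov cqc cc).
Qed.

(** Together with [push_stab]: the image of the fundamental group of the cover is the stabilizer of
    [s], since a loop fixing [s] lifts to a loop. *)
Lemma push_lift g : act s g = s -> exists h, Q h = g.
Proof.
move=> sg; have [c pc ec] := pclass_surj g; have [cc c0 c1] := pc.
have [cl pl l0] := liftP cov cc (etrans (qpt s) (esym c0)).
have pL : ispath (pt s) (pt s) (lift q c (pt s)).
  by split=> //; rewrite -/(lift_end _ _ _) act_lift // ec sg.
exists (pclass (pt s) (lift q c (pt s))); rewrite QE // -ec.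
have pqL := ispath_push cov.1 (qpt s) pL.
by apply/(pclassP pqL pc); apply: hpath_eq => //; have [] := pqL.
Qed.

End CoverClasses.

Section RotationCover.
Variables (R : realType) (Y : topologicalType) (y0 : Y).
Hypotheses (nY : nice_space R Y) (cY : connected [set: Y]).
Variable f : pi1 R y0 -> free_group 2.
Hypotheses (fM : {morph f : a b / (a * b)%g}) (f_surj : forall w, exists a, f a = w).
Variable N : nat.

(** At least two residues are required for [S] to carry the ring structure of Z/(N + 2); N of them
    index the classes. *)
Let S : finType := 'I_N.+2.
Let rot (s : S) (a : letter 2) : S :=
  if a.1 == 0 then (if a.2 then s + 1 else s - 1) else s.

Let rotK s a : rot (rot s a) (letter_inv a) = s.
Proof. by rewrite /rot /=; case: eqP => // _; case: a.2 => /=; rewrite ?addrK ?subrK. Qed.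

Let act (s : S) (g : pi1 R y0) : S := walk rot s (f g).

Let actM s g h : act (act s g) h = act s (g * h)%g.
Proof. by rewrite /act fM (walkM rotK). Qed.

Let act1 s : act s 1%g = s.
Proof. by rewrite /act (morph_one fM). Qed.

Let a : free_group 2 := free_gen 0.
Let b : free_group 2 := free_gen 1.

Let walk_a s k : walk rot s (a ^+ k)%g = s + k%:R.
Proof.
elim: k s => [|k IH] s; first by rewrite addr0.
by rewrite expgS (walkM rotK) IH /= /rot /= -addrA nat1r.
Qed.

Let walk_shift s t w : walk rot (s + t) w = walk rot s w + t.
Proof.
elim: w s => // l w IH s /=; rewrite -IH; congr walk.
by rewrite /rot; case: ifP => // _; case: ifP => // _; rewrite addrAC.
Qed.

Lemma rotation_cover : exists (Z : topologicalType) (q : Z -> Y),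
  finite_abelian_cover q /\ betti1_ge R Z N.
Proof.
have trans s t : exists g, act s g = t.
  have [g eg] := f_surj (a ^+ (nat_of_ord (t - s)%R))%g; exists g.
  by rewrite /act eg walk_a natr_Zp addrC subrK.
have [Z [q [pt [[fq qpt hact ptE hh] inj]]]] := action_cover nY cY (0 : S) act1 actM trans.
have cov := finite_cover_covering fq; have [cq cZ _] := fq.
have [_ _ lpc _] := nY; have [_ _ lpcZ _] := finite_cover_nice fq nY.
have [T hT] : {T : S -> Z -> Z & forall t, [/\ continuous (T t), forall z, q (T t z) = q z
    & forall s, T t (pt s) = pt (s + t)]}.
  apply: (@boolp.choice _ _ (fun t k => [/\ continuous k, forall z, q (k z) = q z
    & forall s, k (pt s) = pt (s + t)])) => t.
  by apply: (hh (fun s => s + t)) => s g; rewrite /act walk_shift.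
(* A map over [Y] is determined by the image of one point, which identifies the deck group with the
   translations of [S]. *)
have T_eq (k : Z -> Z) t : continuous k -> (forall z, q (k z) = q z) -> k (pt 0) = pt t -> k = T t.
  move=> ck qk k0; have [cT qT T0] := hT t.
  apply/funext => z; apply: (covering_unique cov cZ ck cT (t0 := pt 0)) => [w|].
    by rewrite qk qT.
  by rewrite k0 T0 add0r.
have T_comp t u : T t \o T u = T (u + t).
  have [cT qT T0] := hT t; have [cU qU U0] := hT u.
  apply: T_eq => /= [|z|]; first by move=> z; apply: continuous_comp; [exact: cU|exact: cT].
    by rewrite qT qU.
  by rewrite U0 T0 add0r.
have T_id : T 0 = id by apply/esym/T_eq => // z; exact: cvg_id.
have deck_T t : deck_transformation q (T t).
  have [cT qT T0] := hT t; split=> //; last by apply/funext => z; exact: qT.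
  exists (T (- t)); first by have [] := hT (- t).
  split=> z; first by rewrite -[LHS]/((T (- t) \o T t) z) T_comp subrr T_id.
  by rewrite -[LHS]/((T t \o T (- t)) z) T_comp addNr T_id.
have T_deck k : deck_transformation q k -> exists t, k = T t.
  case=> ck _ qk; have qk' z : q (k z) = q z by rewrite -[in RHS]qk.
  have [t et] := ptE (k (pt 0)) (etrans (qk' _) (qpt _)).
  by exists t; apply: T_eq.
exists Z, q; split; first split=> //.
- move=> z z' e; have [c pc] := path_connected lpc cY (q z) y0; have [cc c0 c1] := pc.
  have [s es] := ptE _ (etrans (p_lift_end cov cc (esym c0)) c1).
  have [s' es'] := ptE _ (etrans (p_lift_end cov cc (etrans (esym e) (esym c0))) c1).
  exists (T (s' - s)); first exact: deck_T.
  have [cT qT T0] := hT (s' - s).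
  have qTz : q (T (s' - s) z) = c 0 by rewrite qT c0.
  rewrite -(lift_end_rev cov cc qTz) (lift_end_deck cov cT qT cc (esym c0)) es T0.
  by rewrite addrC subrK -es' (lift_end_rev cov cc) // -e c0.
- by move=> h k /T_deck[t ->] /T_deck[u ->]; rewrite !T_comp addrC.
pose u (j s : S) (i : 'I_2) : int := ((i == 1) && (s == j))%:R.
have [Q [QM QE]] := push_exists R cq (qpt 0).
have stab := push_stab cov inj qpt hact QE.
have zero j w : (forall s, integral rot (u j) s (w : free_group 2) = 0) ->
    forall s, integral rot (u j) s (w^-1)%g = 0.
  move=> h s; have := integralM rotK (u j) s (w^-1)%g w.
  by rewrite mulVg h addr0 integral_nil.
have int_a j k s : integral rot (u j) s (a ^+ k)%g = 0.
  elim: k s => [|k IH] s; first by rewrite integral_nil.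
  by rewrite expgS (integralM rotK) IH addr0 integral_cons integral_nil addr0.
pose wd (i : 'I_N) : free_group 2 := (a ^+ i * b * (a ^+ i)^-1)%g.
pose emb (i : 'I_N) : S := i%:R.
have walk_wd i : walk rot 0 (wd i) = 0.
  rewrite !(walkM rotK) walk_a add0r /= -[X in walk rot X _](add0r (i%:R)) -walk_a.
  by rewrite [LHS](walk_word_inv rotK).
have [g hg] : {g : 'I_N -> pi1 R (pt 0) & forall i, f (Q (g i)) = wd i}.
  apply: (@boolp.choice _ _ (fun i x => f (Q x) = wd i)) => i.
  have [x ex] := f_surj (wd i).
  by have [|h hx] := push_lift cov qpt hact QE (g := x); [rewrite /act ex walk_wd|exists h; rewrite hx].
apply: (@betti_lower R Z (pt 0) N (fun j x => integral rot (u (emb j)) 0 (f (Q x))) g).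
- exact: path_connected.
- move=> j x y; rewrite QM fM (integralM rotK); congr (_ + integral _ _ _ _).
  exact: stab.
- move=> i j; rewrite hg !(integralM rotK) int_a add0r zero ?addr0 => [|s]; last exact: int_a.
  rewrite walk_a integral_cons integral_nil addr0 /letter_integral /= /u /= add0r.
  congr ((_ : bool)%:R); rewrite -val_eqE /emb /= !Zp_nat /=.
  by rewrite !modn_small // (leq_trans (ltn_ord _)) // leqW.
Qed.

End RotationCover.

(** * Labelled actions and carries *)

Section LabelledAction.
Variables (R : realType) (Y : topologicalType) (y0 : Y).
Hypotheses (nY : nice_space R Y) (cY : connected [set: Y]).
Variables (r ms : nat) (rel : 'I_ms -> free_group r) (phi : free_group r -> pi1 R y0).
Hypothesis pres : presentation rel phi.
Variables (S : finType) (st : S -> letter r -> S).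
Hypothesis stK : forall s a, st (st s a) (letter_inv a) = s.
Variables (B : groupType) (lab : S -> letter r -> B).
Hypothesis labV : forall s a, lab (st s a) (letter_inv a) = ((lab s a)^-1)%g.
Hypothesis walk_rel : forall s j, walk st s (rel j) = s.
Hypothesis gwalk_rel : forall s j, gwalk st lab s (rel j) = 1%g.

(** The words that fix every vertex and have trivial label from every vertex form a normal subgroup
    containing the relators. *)
Lemma labelled_ker f : phi f = 1%g -> forall s, walk st s f = s /\ gwalk st lab s f = 1%g.
Proof.
have [_ _ ker] := pres.
pose K : set (free_group r) := [set f | forall s, walk st s f = s /\ gwalk st lab s f = 1%g].
move=> f1; suff : K f by [].
have : normal_closure (range rel) f by rewrite -ker.
apply; split; last by move=> _ [j _ <-] s.
have KM g h : K g -> K h -> K (g * h)%g.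
  move=> Kg Kh s; have [g1 g2] := Kg s; have [h1 h2] := Kh s.
  by rewrite (walkM stK) (gwalkM stK labV) g1 h1 g2 h2 mulg1.
have KV g : K g -> K (g^-1)%g.
  move=> Kg s; have [g1 g2] := Kg s.
  have w1 : walk st s (g^-1)%g = s by rewrite -{1}g1; exact: walk_word_inv.
  split=> //; have := gwalkM stK labV s g (g^-1)%g.
  by rewrite mulgV g1 g2 mul1g.
split=> // [g h Kg s].
have [g1 g2] := Kg (walk st s (h^-1)%g).
have hK : walk st (walk st s (h^-1)%g) h = s by rewrite -(walkM stK) mulVg.
rewrite /conjg !(walkM stK) !(gwalkM stK labV) g1 hK g2 mul1g; split=> //.
by rewrite -(gwalkM stK labV) mulVg.
Qed.

Lemma labelled_eq f g : phi f = phi g ->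
  forall s, walk st s f = walk st s g /\ gwalk st lab s f = gwalk st lab s g.
Proof.
have [phiM _ _] := pres.
move=> e s; have [|h1 h2] := @labelled_ker (f * g^-1)%g _ s.
  by rewrite phiM (morph_inv phiM) e mulgV.
have fE : (f * g^-1 * g)%g = f by rewrite mulgVK.
have e1 := walkM stK s (f * g^-1)%g g; have e2 := gwalkM stK labV s (f * g^-1)%g g.
by rewrite fE h1 in e1; rewrite fE h1 h2 mul1g in e2.
Qed.

Variable s0 : S.

(** The cover belongs to the orbit of [s0], where the action is transitive. Its fundamental group
    maps to the stabilizer of [s0], on which labels multiply; they do not depend on the word [lft]
    chosen for a class, by [labelled_eq]. *)
Lemma labelled_cover : exists (Z : topologicalType) (q : Z -> Y) (z : Z) (rho : pi1 R z -> B),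
  [/\ finite_cover q, {morph rho : a b / (a * b)%g}
    & forall w : free_group r, walk st s0 w = s0 -> exists a, rho a = gwalk st lab s0 w].
Proof.
have [phiM phi_surj _] := pres.
have [lft hl] := boolp.choice phi_surj.
pose act s g := walk st s (lft g).
have actE s f : act s (phi f) = walk st s f.
  by have [] := labelled_eq (hl (phi f)) s.
have actM s g h : act (act s g) h = act s (g * h)%g.
  by rewrite -(hl g) -(hl h) -phiM !actE (walkM stK).
have act1 s : act s 1%g = s by rewrite -(morph_one phiM) actE.
pose O := {s : S | `[< exists g, act s0 g = s >]}.
have actO (s : O) g : `[< exists h, act s0 h = act (val s) g >].
  by apply/asboolP; have /asboolP[h <-] := valP s; exists (h * g)%g; rewrite actM.
pose actO' (s : O) g : O := Sub (act (val s) g) (actO s g).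
have o0P : `[< exists g, act s0 g = s0 >] by apply/asboolP; exists 1%g.
pose o0 : O := Sub s0 o0P.
have actO1 s : actO' s 1%g = s by apply: val_inj; rewrite /= act1.
have actOM s g h : actO' (actO' s g) h = actO' s (g * h)%g by apply: val_inj; rewrite /= actM.
have trans s t : exists g, actO' s g = t.
  have /asboolP[g eg] := valP s; have /asboolP[h eh] := valP t.
  exists (g^-1 * h)%g; apply: val_inj; rewrite /= -eg -eh actM mulVKg //.
have [Z [q [pt [[fq qpt hact ptE _] inj]]]] := action_cover nY cY o0 actO1 actOM trans.
have cov := finite_cover_covering fq.
have [Q [QM QE]] := push_exists R cov.1 (qpt o0).
have stab := push_stab cov inj qpt hact QE.
exists Z, q, (pt o0), (fun h => gwalk st lab s0 (lft (Q h))); split=> //.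
  move=> a b; have e : phi (lft (Q (a * b)%g)) = phi (lft (Q a) * lft (Q b))%g.
    by rewrite phiM !hl QM.
  have [_ ->] := labelled_eq e s0; rewrite (gwalkM stK labV).
  have := congr1 val (stab a); rewrite /= /act => ->.
  by [].
move=> w ws; have [|h hw] := push_lift cov qpt hact QE (g := phi w).
  by apply: val_inj; rewrite /= actE.
by exists h; rewrite hw; have [] := labelled_eq (hl (phi w)) s0.
Qed.

End LabelledAction.

Section IntegerPowers.
Variable G : groupType.
Implicit Types (a : G) (e : int).

Definition zpow a e : G := match e with Posz n => (a ^+ n)%g | Negz n => (a ^- n.+1)%g end.

Lemma zpow0 a : zpow a 0 = 1%g. Proof. by []. Qed.

Lemma zpowS a e : zpow a (e + 1) = (zpow a e * a)%g.
Proof.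
case: e => n; first by rewrite -PoszD addn1 /= expgSr.
case: n => [|n]; first by rewrite NegzE addNr /= mulVg.
have -> : Negz n.+1 + 1 = Negz n by rewrite !NegzE; lia.
by rewrite /= [(a ^+ n.+2)%g]expgS invgM mulgVK.
Qed.

Lemma zpowB1 a e : zpow a (e - 1) = (zpow a e * a^-1)%g.
Proof. by rewrite -{2}(subrK 1 e) zpowS mulgK. Qed.

Lemma zpowD a e e' : zpow a (e + e') = (zpow a e * zpow a e')%g.
Proof.
elim/int_rect: e' => [|n IH|n IH]; first by rewrite addr0 mulg1.
  by rewrite -addn1 PoszD addrA !zpowS IH mulgA.
by rewrite -addn1 PoszD opprD addrA !zpowB1 IH mulgA.
Qed.

Lemma zpowN a e : zpow a (- e) = ((zpow a e)^-1)%g.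
Proof. by apply: (mulgI (zpow a e)); rewrite -zpowD subrr mulgV. Qed.

End IntegerPowers.

Section Residues.
Variable n : nat.

Definition residue (x : int) : 'I_n.+1 := inord `|(x %% n.+1%:Z)%Z|.

Lemma residueE x : (residue x)%:Z = (x %% n.+1%:Z)%Z.
Proof.
have h : (0 <= (x %% n.+1%:Z)%Z)%R by apply: modz_ge0.
have h2 := ltz_pmod x (isT : (0 < n.+1%:Z)%R).
by rewrite /residue inordK ?gez0_abs // -ltz_nat gez0_abs.
Qed.

Lemma residue_small (i : 'I_n.+1) : residue i%:Z = i.
Proof.
apply: val_inj; apply: (@mulrIn int 1); rewrite ?oner_eq0 //.
by have := residueE i%:Z; rewrite modz_small ?ltz_nat ?ltn_ord // => e; rewrite !natz.
Qed.

Lemma residue_add x d : residue ((residue x)%:Z + d) = residue (x + d).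
Proof. by rewrite /residue residueE modzDml. Qed.

(** Carries form the cocycle of the extension of Z/(n + 1) by Z: adding in steps adds the
    carries. *)
Lemma carry_add x d : ((x %/ n.+1%:Z)%Z + (((residue x)%:Z + d) %/ n.+1%:Z)%Z = ((x + d) %/ n.+1%:Z)%Z)%R.
Proof.
by rewrite residueE [X in _ = ((X + _) %/ _)%Z](divz_eq x n.+1%:Z) -[in RHS]addrA divzMDl.
Qed.

Lemma carry_small (i : 'I_n.+1) : (i%:Z %/ n.+1%:Z)%Z = 0.
Proof. by rewrite divz_small // ltz_nat ltn_ord. Qed.

End Residues.

Section CarryLabels.
Variables (r : nat) (S : finType) (st : S -> letter r -> S).
Hypothesis stK : forall s a, st (st s a) (letter_inv a) = s.
Variables (u u' : S -> 'I_r -> int) (n n' : nat).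
Hypothesis uu' : forall s i, u s i = 0 \/ u' s i = 0.

(** Vanishing letter by letter keeps the counter driven by [v] constant along the walk; a zero
    integral would only bring it back at the end. *)
Fixpoint vanishes (v : S -> 'I_r -> int) (s : S) (w : seq (letter r)) : bool :=
  if w is a :: w' then (letter_integral st v s a == 0) && vanishes v (st s a) w' else true.

Lemma vanishes_integral v s w : vanishes v s w -> integral st v s w = 0.
Proof.
elim: w s => [|a w IH] s /=; first by rewrite integral_nil.
by case/andP => /eqP h /IH e; rewrite integral_cons h e addr0.
Qed.

Lemma letter_integral_inv (v : S -> 'I_r -> int) s a :
  letter_integral st v (st s a) (letter_inv a) = - letter_integral st v s a.
Proof. by case: a => i [] /=; rewrite /letter_integral /= ?opprK ?(stK s (i, true)) //. Qed.

Lemma letter_uu' s a : letter_integral st u s a = 0 \/ letter_integral st u' s a = 0.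
Proof.
rewrite /letter_integral; case: a => i [] /=; first exact: uu'.
by have [->|->] := uu' (st s (i, false)) i; [left|right]; rewrite oppr0.
Qed.

Definition carry_state : finType := (S * 'I_n.+1 * 'I_n'.+1)%type.

Definition carry_step (t : carry_state) (a : letter r) : carry_state :=
  (st t.1.1 a, residue n (t.1.2%:Z + letter_integral st u t.1.1 a),
   residue n' (t.2%:Z + letter_integral st u' t.1.1 a)).

Let alpha : free_group 2 := free_gen 0.
Let beta : free_group 2 := free_gen 1.

(* Labels count the carries of one counter while the other counter is zero. *)
Definition carry_lab (t : carry_state) (a : letter r) : free_group 2 :=
  (zpow alpha (if t.2 == ord0 then ((t.1.2%:Z + letter_integral st u t.1.1 a) %/ n.+1%:Z)%Z else 0)
   * zpow beta (if t.1.2 == ord0 then ((t.2%:Z + letter_integral st u' t.1.1 a) %/ n'.+1%:Z)%Z else 0))%g.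

Lemma carry_stepK t a : carry_step (carry_step t a) (letter_inv a) = t.
Proof.
case: t => -[s i] j; rewrite /carry_step /= stK !residue_add !letter_integral_inv.
by rewrite !addrK !residue_small.
Qed.

Lemma carry_neg m (i : 'I_m.+1) d :
  (((residue m (i%:Z + d))%:Z - d) %/ m.+1%:Z)%Z = - ((i%:Z + d) %/ m.+1%:Z)%Z.
Proof. by have := carry_add m (i%:Z + d) (- d); rewrite addrK carry_small; lia. Qed.

Lemma carry_labV t a : carry_lab (carry_step t a) (letter_inv a) = ((carry_lab t a)^-1)%g.
Proof.
case: t => -[s i] j; rewrite /carry_lab /carry_step /= !letter_integral_inv !carry_neg.
have [->|->] := letter_uu' s a; rewrite !addr0 !residue_small !carry_small ?oppr0 !if_same zpow0.
  by rewrite !mul1g -zpowN; case: ifP; rewrite ?oppr0.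
by rewrite !mulg1 -zpowN; case: ifP; rewrite ?oppr0.
Qed.

(** While [u'] vanishes the second counter stands still, so only powers of [alpha] occur, and by
    [carry_add] their exponents telescope to one carry. It is recorded only if the second counter
    stands at zero. *)
Lemma gwalk_alpha s i j w : vanishes u' s w ->
  walk carry_step (s, i, j) w = (walk st s w, residue n (i%:Z + integral st u s w), j) /\
  gwalk carry_step carry_lab (s, i, j) w =
    zpow alpha (if j == ord0 then ((i%:Z + integral st u s w) %/ n.+1%:Z)%Z else 0).
Proof.
elim: w s i => [|a w IH] s i /=.
  by rewrite integral_nil addr0 residue_small carry_small if_same.
case/andP => /eqP h /IH {}IH; rewrite /carry_step /carry_lab /= h addr0 residue_small carry_small.
rewrite if_same zpow0 mulg1 -/carry_step -/carry_lab integral_cons.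
have [-> ->] := IH (residue n (i%:Z + letter_integral st u s a)).
rewrite residue_add addrA; split=> //; rewrite -zpowD; congr zpow.
by case: ifP => _; rewrite ?addr0 // carry_add.
Qed.

Lemma gwalk_beta s i j w : vanishes u s w ->
  walk carry_step (s, i, j) w = (walk st s w, i, residue n' (j%:Z + integral st u' s w)) /\
  gwalk carry_step carry_lab (s, i, j) w =
    zpow beta (if i == ord0 then ((j%:Z + integral st u' s w) %/ n'.+1%:Z)%Z else 0).
Proof.
elim: w s j => [|a w IH] s j /=.
  by rewrite integral_nil addr0 residue_small carry_small if_same.
case/andP => /eqP h /IH {}IH; rewrite /carry_step /carry_lab /= h addr0 residue_small carry_small.
rewrite if_same zpow0 mul1g -/carry_step -/carry_lab integral_cons.
have [-> ->] := IH (residue n' (j%:Z + letter_integral st u' s a)).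
rewrite residue_add addrA; split=> //; rewrite -zpowD; congr zpow.
by case: ifP => _; rewrite ?addr0 // carry_add.
Qed.

End CarryLabels.

Section CarryCover.
Variables (R : realType) (Y : topologicalType) (y0 : Y).
Hypotheses (nY : nice_space R Y) (cY : connected [set: Y]).
Variables (r ms : nat) (rel : 'I_ms -> free_group r) (phi : free_group r -> pi1 R y0).
Hypothesis pres : presentation rel phi.
Variables (S : finType) (st : S -> letter r -> S).
Hypothesis stK : forall s a, st (st s a) (letter_inv a) = s.
Hypothesis walk_rel : forall s j, walk st s (rel j) = s.
Variables (u u' : S -> 'I_r -> int).
Hypothesis uu' : forall s i, u s i = 0 \/ u' s i = 0.
Hypothesis cocycle : forall s j,
  (vanishes st u' s (rel j) /\ integral st u s (rel j) = 0) \/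
  (vanishes st u s (rel j) /\ integral st u' s (rel j) = 0).
Variables (p : S) (g l l' : seq (letter r)).
Hypotheses (gu : vanishes st u p g) (gu' : vanishes st u' p g).
Hypotheses (l_closed : walk st p l = p) (lu' : vanishes st u' p l).
Hypotheses (l'_closed : walk st (walk st p g) l' = walk st p g) (l'u : vanishes st u (walk st p g) l').
Hypotheses (lu : integral st u p l != 0) (l'u' : integral st u' (walk st p g) l' != 0).

Lemma carry_cover : exists (Z : topologicalType) (q : Z -> Y) (z : Z) (f : pi1 R z -> free_group 2),
  [/\ finite_cover q, {morph f : a b / (a * b)%g} & forall w, exists a, f a = w].
Proof.
(* The moduli are the absolute values of the two periods, so that [l] and [l'] each turn their
   counter exactly once and the carries are 1 or -1. *)
pose n := (`|integral st u p l|.-1)%N; pose n' := (`|integral st u' (walk st p g) l'|.-1)%N.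
have nE : n.+1 = `|integral st u p l|%N by rewrite /n prednK // absz_gt0.
have n'E : n'.+1 = `|integral st u' (walk st p g) l'|%N by rewrite /n' prednK // absz_gt0.
pose T : finType := carry_state S n n'.
pose cst : T -> letter r -> T := @carry_step r S st u u' n n'.
pose lab : T -> letter r -> free_group 2 := @carry_lab r S st u u' n n'.
have cK : forall t a, cst (cst t a) (letter_inv a) = t by exact: carry_stepK.
have cV : forall t a, lab (cst t a) (letter_inv a) = ((lab t a)^-1)%g by exact: carry_labV.
have wa := @gwalk_alpha r S st u u' n n'; have wb := @gwalk_beta r S st u u' n n'.
(* Along a relator one of the edge functions vanishes letter by letter and the other has integral
   zero; the label is thus a power of one generator, with total carry zero. *)
have relT t j : walk cst t (rel j) = t /\ gwalk cst lab t (rel j) = 1%g.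
  case: t => -[s i] k; have [[v e]|[v e]] := cocycle s j.
    have [-> ->] := wa s i k _ v; rewrite e addr0 residue_small carry_small if_same walk_rel.
    by [].
  have [-> ->] := wb s i k _ v; rewrite e addr0 residue_small carry_small if_same walk_rel.
  by [].
pose t0 : T := (p, ord0, ord0).
have [Z [q [z [f [fq fM hf]]]]] := labelled_cover nY cY pres cK cV
  (fun t j => (relT t j).1) (fun t j => (relT t j).2) t0.
exists Z, q, z, f; split=> //.
pose W (w : seq (letter r)) : free_group r := word_val (@free_gen r) w.
have letter1 (t : T) a : walk cst t (letter_val (@free_gen r) a) = cst t a /\
    gwalk cst lab t (letter_val (@free_gen r) a) = lab t a.
  by case: a => i [] /=; rewrite mulg1.
have WE w (t : T) : walk cst t (W w) = walk cst t w /\ gwalk cst lab t (W w) = gwalk cst lab t w.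
  elim: w t => // a w IH t; have [h1 h2] := letter1 t a.
  rewrite /W /= (walkM cK) (gwalkM cK cV) h1 h2.
  by have [-> ->] := IH (cst t a).
have unit_carry m (x : int) : m.+1 = `|x|%N ->
    residue m (0 + x) = ord0 /\ ((0 + x) %/ m.+1%:Z)%Z = sgz x.
  move=> e; have xE : x = sgz x * m.+1%:Z by rewrite e; exact: intEsg.
  have x0 : x != 0 by rewrite -absz_gt0 -e.
  rewrite add0r [in X in X /\ _]xE; split; last by rewrite {1}xE mulzK.
  by apply: val_inj; rewrite /= /residue modzMl inordK.
have gens i : exists a, f a = free_gen i \/ f a = ((free_gen i)^-1)%g.
  have zs (x : int) (v : free_group 2) : x != 0 -> zpow v (sgz x) = v \/ zpow v (sgz x) = (v^-1)%g.
    by case: (sgzP x) => //= _ _; [left|right]; rewrite ?expg1.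
  have : i = 0 \/ i = 1 by case: i => -[|[|]] // h; [left|right]; apply: val_inj.
  case=> ->.
    have [w1 w2] := wa p ord0 ord0 l lu'; have [e1 e2] := unit_carry _ _ nE.
    have [h1 h2] := WE l t0; rewrite /t0 /cst /lab w1 w2 e1 e2 eqxx l_closed in h1 h2.
    have [a ea] := hf _ h1; exists a; rewrite ea h2; exact: zs.
  (* The second generator comes from the conjugate g l' g^-1: both counters stay at zero along [g],
     whose label is therefore trivial. *)
  have [a1 a2] := wa p ord0 ord0 g gu'.
  rewrite (vanishes_integral gu) addr0 ?residue_small ?carry_small ?if_same in a1 a2.
  have [w1 w2] := wb (walk st p g) ord0 ord0 l' l'u; have [e1 e2] := unit_carry _ _ n'E.
  have [h1 h2] := WE l' (walk st p g, ord0, ord0); have [g1 g2] := WE g t0.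
  rewrite /t0 /cst /lab a1 a2 in g1 g2; rewrite /cst /lab w1 w2 e1 e2 eqxx l'_closed in h1 h2.
  have v1 : walk cst (walk st p g, ord0, ord0) (W g)^-1%g = t0.
    by rewrite -[LHS]/(walk cst _ (word_inv (W g))) -g1 (walk_word_inv cK).
  have v2 : gwalk cst lab (walk st p g, ord0, ord0) (W g)^-1%g = 1%g.
    have := gwalkM cK cV t0 (W g) (W g)^-1%g; rewrite mulgV /= => /esym.
    by rewrite [X in (X * _)%g]g2 mul1g [X in gwalk _ _ X]g1.
  have [|a ea] := hf (W g * W l' * (W g)^-1)%g.
    by rewrite !(walkM cK) [X in walk _ (walk _ X _) _]g1 [X in walk _ X _]h1.
  exists a; rewrite ea !(walkM cK, gwalkM cK cV) g2 [X in gwalk _ _ X (W l')]g1 h2 mul1g.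
  rewrite [X in (_ * gwalk _ _ (walk _ X _) _)%g]g1 [X in (_ * gwalk _ _ X _)%g]h1 v2 mulg1.
  exact: zs.
apply: free_group_ind.
- by move=> i; have [a [e|e]] := gens i; [exists a|exists (a^-1)%g; rewrite (morph_inv fM) e invgK].
- by move=> v w [a <-] [b <-]; exists (a * b)%g.
- by move=> v [a <-]; exists (a^-1)%g; rewrite (morph_inv fM).
- by exists 1%g; rewrite (morph_one fM).
Qed.

End CarryCover.

(** * Rank of the Alexander matrix at conjugate torsion points *)

Section CyclotomicConjugates.
Import algC.
Variables (C : numClosedFieldType) (n : nat).
Notation intrC := (map_poly (intr : int -> C)).
Notation ratrC := (map_poly (ratr : rat -> C)).
Notation ZtoQ := (map_poly (intr : int -> rat)).

Lemma ratr_intr_poly (D : numFieldType) (p : {poly int}) :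
  map_poly (ratr : rat -> D) (ZtoQ p) = map_poly (intr : int -> D) p.
Proof. by rewrite -map_poly_comp; apply: eq_map_poly => x; rewrite /= rmorph_int. Qed.

Lemma root_bigprod (I : eqType) (s : seq I) (F : I -> {poly C}) (z : C) :
  root (\prod_(i <- s) F i) z = has (fun i => root (F i) z) s.
Proof.
elim: s => [|i s IH]; first by rewrite big_nil (negPf (root1 z)).
by rewrite big_cons rootM IH.
Qed.

Lemma root_Cyclotomic_prim (z : C) : n.-primitive_root z -> root (intrC (cyclotomic.Cyclotomic n)) z.
Proof.
move=> pz; have n0 := prim_order_gt0 pz.
have map1 m : intrC ('X^m - 1) = 'X^m - 1 by rewrite rmorphB rmorph1 /= map_polyXn.
have : root (intrC (\prod_(d <- divisors n) cyclotomic.Cyclotomic d)) z.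
  by rewrite cyclotomic.prod_Cyclotomic // map1 rootE !hornerE (prim_expr_order pz) subrr.
rewrite rmorph_prod /= root_bigprod => /hasP[d]; rewrite -dvdn_divisors // => dn rd.
suff -> : n = d by [].
apply/eqP; rewrite eqn_dvd dn andbT (prim_order_dvd pz).
have d0 : (0 < d)%N by exact: dvdn_gt0 dn.
have : root (intrC (\prod_(d' <- divisors d) cyclotomic.Cyclotomic d')) z.
  rewrite rmorph_prod /= root_bigprod; apply/hasP; exists d => //.
  by rewrite -dvdn_divisors.
by rewrite cyclotomic.prod_Cyclotomic // map1 rootE !hornerE subr_eq0.
Qed.

(** A common factor has a root among the algebraic numbers; it is a primitive root of unity, whose
    minimal polynomial is the cyclotomic one and divides [p]. *)
Lemma Cyclotomic_irreducible (p : {poly rat}) :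
  (0 < n)%N -> ~~ coprimep p (ZtoQ (cyclotomic.Cyclotomic n)) -> ZtoQ (cyclotomic.Cyclotomic n) %| p.
Proof.
move=> n0; set Phi := ZtoQ _; rewrite coprimep_def => sz.
have [w0 pw0] := cyclotomic.C_prim_root_exists n0.
pose QtoC := map_poly (ratr : rat -> algC).
have Phi0 : Phi != 0.
  by rewrite map_poly_eq0_id0 ?intr_eq0 ?lead_coef_eq0 ?monic_neq0 ?cyclotomic.Cyclotomic_monic.
have g0 : gcdp p Phi != 0 by rewrite gcdp_eq0 negb_and Phi0 orbT.
have [|w rw] := closed_rootP (QtoC (gcdp p Phi)) _; first by rewrite size_map_poly.
have [rp rPhi] : root (QtoC p) w /\ root (QtoC Phi) w.
  by move: rw; rewrite /QtoC gcdp_map root_gcd => /andP.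
have PhiC : QtoC Phi = cyclotomic.cyclotomic w0 n.
  by rewrite /QtoC /Phi ratr_intr_poly (cyclotomic.Cintr_Cyclotomic pw0).
have pw : n.-primitive_root w.
  by move: rPhi; rewrite PhiC cyclotomic.root_cyclotomic.
have [pf [Dpf _] dvd] := algC.minCpolyP w.
suff -> : Phi = pf by rewrite -dvd.
apply: (map_inj_poly (fmorph_inj (ratr : {rmorphism rat -> algC}))); first exact: rmorph0.
by rewrite -Dpf (cyclotomic.minCpoly_cyclotomic pw) -(cyclotomic.Cintr_Cyclotomic pw) ratr_intr_poly.
Qed.

(** This takes the place of the Galois action: the cyclotomic polynomial divides every rational
    polynomial with which it shares a root. *)
Lemma prim_root_conj (p : {poly int}) (z w : C) : n.-primitive_root z -> n.-primitive_root w ->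
  root (intrC p) z -> root (intrC p) w.
Proof.
move=> pz pw rz; have n0 := prim_order_gt0 pz; set Phi := ZtoQ (cyclotomic.Cyclotomic n).
have : Phi %| ZtoQ p.
  apply: Cyclotomic_irreducible => //; apply/negP => cop.
  have : coprimep (ratrC (ZtoQ p)) (ratrC Phi) by rewrite coprimep_map.
  rewrite !ratr_intr_poly => cop'; have := coprimep_root cop' rz.
  by have := root_Cyclotomic_prim pz; rewrite rootE => ->.
rewrite -(dvdp_map (ratr : rat -> C)) !ratr_intr_poly => /dvdpP[s ->].
by rewrite rootM root_Cyclotomic_prim ?orbT.
Qed.

End CyclotomicConjugates.

Section Minors.
Variable F : fieldType.

Lemma nonzero_minor m n (A : 'M[F]_(m, n)) :
  exists (f : 'I_(\rank A) -> 'I_m) (g : 'I_(\rank A) -> 'I_n), \det (mxsub f g A) != 0.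
Proof.
set B := rowsub (maxrankfun A) A.
have Bf : row_full B^T.
  by rewrite /row_full mxrank_tr -/(row_free B); exact: maxrowsub_free.
exists (maxrankfun A), (fullrankfun Bf).
have := fullrowsub_unit Bf; rewrite unitmxE unitfE -det_tr.
congr (\det _ != 0); by apply/matrixP => i j; rewrite !mxE.
Qed.

Lemma minor_rank p m n (A : 'M[F]_(m, n)) (f : 'I_p -> 'I_m) (g : 'I_p -> 'I_n) :
  \det (mxsub f g A) != 0 -> (p <= \rank A)%N.
Proof.
rewrite -unitfE -unitmxE => u; rewrite -(mxrank_unit u).
have -> : mxsub f g A = rowsub f 1%:M *m A *m colsub g 1%:M.
  rewrite -rowsubE; apply/matrixP => i j; rewrite !mxE (bigD1 (g j)) //= !mxE eqxx mulr1.
  by rewrite big1 ?addr0 // => k /negPf kg; rewrite !mxE kg mulr0.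
by rewrite (leq_trans (mxrankM_maxl _ _)) // mxrankM_maxr.
Qed.

End Minors.

Section RootOfUnityEvaluation.
Variables (C : numClosedFieldType) (r ms : nat) (rel : 'I_ms -> free_group r).
Variables (n : nat) (a : 'I_r -> 'I_n.+1).

Definition root_point (x : C) : 'rV[C]_r := \row_i x ^+ a i.

Definition root_exponent (t : 'rV[int]_r) : nat := `|((\sum_i t 0 i * (a i)%:Z) %% n.+1%:Z)%Z|%N.

Lemma root_exponentE (x : C) (t : 'rV[int]_r) : x ^+ n.+1 = 1 ->
  \prod_k root_point x 0 k ^ t 0 k = x ^+ root_exponent t.
Proof.
move=> x1; have x0 : x != 0.
  by apply/eqP => e; have /eqP := x1; rewrite e expr0n eq_sym oner_eq0.
transitivity (x ^ (\sum_i t 0 i * (a i)%:Z)).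
  rewrite (big_morph (fun e : int => x ^ e) (id1 := 1) (op1 := *%R)) //; last first.
    by move=> e e'; rewrite expfzDr.
  by apply: eq_bigr => i _; rewrite mxE exprnP exprz_exp mulrC.
set s := \sum_i _; rewrite {1}(divz_eq s n.+1%:Z) expfzDr // [(s %/ _)%Z * _]mulrC -exprz_exp.
rewrite -exprnP x1 exp1rz mul1r exprnP gez0_abs //.
exact: modz_ge0.
Qed.

(** At the point with coordinates x^(a_i) the entries are integral polynomials in the single
    quantity x, and then so are all minors. *)
Definition alexander_poly : 'M[{poly int}]_(r, ms) := \matrix_(i, j)
  \sum_(t <- dom (fox i (rel j))) (coeff t (fox i (rel j))) *: 'X^(root_exponent t).

Lemma alexander_polyE (x : C) : x ^+ n.+1 = 1 ->
  alexander_matrix rel (root_point x) = map_mx (horner_eval x \o map_poly intr) alexander_poly.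
Proof.
move=> x1; apply/matrixP => i j; rewrite !mxE /= rmorph_sum /= /horner_eval horner_sum.
apply: eq_bigr => t _; rewrite root_exponentE // map_polyZ /= map_polyXn.
by rewrite !hornerE.
Qed.

(** A minor that is nonzero at [y] cannot vanish at the conjugate [x]. *)
Lemma rank_conj (x y : C) : n.+1.-primitive_root x -> n.+1.-primitive_root y ->
  (\rank (alexander_matrix rel (root_point y)) <= \rank (alexander_matrix rel (root_point x)))%N.
Proof.
move=> px py; set A := alexander_matrix rel (root_point y).
have [f [g dA]] := nonzero_minor A; move: (\rank A) f g dA => p f g dA.
apply: (@minor_rank _ _ _ _ _ f g).
apply: contraNneq dA; rewrite /A !alexander_polyE ?(prim_expr_order px) ?(prim_expr_order py) //.
rewrite -!map_mxsub !det_map_mx /= => h; apply/eqP/rootP.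
by apply: (prim_root_conj px py); apply/rootP.
Qed.

End RootOfUnityEvaluation.

(** * The fundamental formula of Fox calculus and the characters of a cyclic action *)

Section FundamentalFormula.
Variables (C : fieldType) (r : nat) (z : 'rV[C]_r).
Hypothesis z0 : forall k, z 0 k != 0.

Definition word_char (w : seq (letter r)) : C :=
  foldr (fun a c => (if a.2 then z 0 a.1 else (z 0 a.1)^-1) * c) 1 w.

Lemma fox_fundamental w : \sum_i (z 0 i - 1) * fox_eval z i w = word_char w - 1.
Proof.
elim: w => [|a w IH] /=.
  by rewrite subrr big1 // => i _; rewrite fox_eval_nil mulr0.
under eq_bigr do rewrite fox_eval_cons // mulrDr [X in _ + X]mulrCA.
rewrite big_split /= -mulr_sumr IH (bigD1 a.1) //= eqxx big1 ?addr0; last first.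
  by move=> i /negPf; rewrite eq_sym => ->; rewrite mulr0.
case: a.2; first by ring.
by field; exact: z0.
Qed.

(** By the fundamental formula the vector of the z_i - 1 lies in the left kernel, and it is not zero
    at a nontrivial character. *)
Lemma rank_alexander_le ms (rel : 'I_ms -> free_group r) i0 :
  (forall j, word_char (rel j) = 1) -> z 0 i0 != 1 ->
  (\rank (alexander_matrix rel z) <= r - 1)%N.
Proof.
move=> relz zi; set A := alexander_matrix rel z.
have v0 : (\row_i (z 0 i - 1) : 'rV_r) != 0.
  by apply/eqP => /rowP /(_ i0) /eqP; rewrite !mxE subr_eq0 (negPf zi).
have vA : (\row_i (z 0 i - 1) : 'rV_r) *m A = 0.
  apply/rowP => j; rewrite !mxE -[RHS](subrr 1) -{2}(relz j) -fox_fundamental.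
  by apply: eq_bigr => i _; rewrite !mxE.
have : (0 < \rank (kermx A))%N.
  rewrite lt0n mxrank_eq0; apply: contra_neq v0 => k0; apply/eqP.
  by rewrite -submx0 -k0; apply/sub_kermxP.
by rewrite mxrank_ker; have := rank_leq_row A; lia.
Qed.

End FundamentalFormula.

Section CyclicAction.
Variables (r n : nat) (a : 'I_r -> 'I_n.+1).

Definition shift (v : 'I_n.+1) (l : letter r) : 'I_n.+1 :=
  if l.2 then v + a l.1 else v - a l.1.

Lemma shiftK v l : shift (shift v l) (letter_inv l) = v.
Proof. by case: l => i []; rewrite /shift /= ?addrK ?subrK. Qed.

Lemma walk_shift s t w : walk shift (s + t) w = walk shift s w + t.
Proof.
elim: w s => //= l w IH s; rewrite -IH; congr walk.
by rewrite /shift; case: ifP => _; rewrite addrAC.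
Qed.

Variables (C : numClosedFieldType) (ms : nat) (rel : 'I_ms -> free_group r) (x : C).
Hypothesis px : n.+1.-primitive_root x.

Let z (k : 'I_n.+1) := root_point a (x ^+ k).
Let psi (k v : 'I_n.+1) : C := x ^+ (k * v).

Let x0 : x != 0.
Proof. by rewrite (prim_root_eq0 px). Qed.

Let z0 k i : z k 0 i != 0.
Proof. by rewrite mxE !expf_neq0. Qed.

Let psiE k v i : psi k (shift v (i, true)) = z k 0 i * psi k v.
Proof.
rewrite /psi /shift mxE -exprM -exprD -mulnDr addnC /=.
by apply/eqP; rewrite (eq_prim_root_expr px) modnMmr.
Qed.

Lemma word_char_psi k v w : psi k (walk shift v w) = word_char (z k) w * psi k v.
Proof.
elim: w v => [|l w IH] v /=; first by rewrite mul1r.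
by rewrite IH (psi_letter shiftK z0 psiE) mulrCA mulrA.
Qed.

Let psiU : fmx psi \in unitmx.
Proof.
have nz : (n.+1%:R : C) != 0 by rewrite pnatr_eq0.
apply: (@mulmx1_unit _ _ _ ((n.+1%:R)^-1 *: fmx (fun v k : 'I_n.+1 => (x ^+ (k * v))^-1)) _).1.
rewrite -scalemxAr fmxM -fmx1; apply/matrixP => p q; rewrite !mxE.
move: (enum_val p) (enum_val q) => k l; rewrite /psi.
have [->|kl] := eqVneq k l.
  under eq_bigr do rewrite mulfV ?expf_neq0 //.
  by rewrite sumr_const card_ord -[_ *+ _]mulr_natr mul1r mulVf.
rewrite [X in _ * X](_ : _ = 0) ?mulr0 //.
pose y := x ^+ k / x ^+ l.
have y1 : y - 1 != 0.
  rewrite subr_eq0; apply: contra_neq kl => e.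
  have e' : x ^+ k == x ^+ l by rewrite -[X in X == _](divfK (expf_neq0 l x0)) -/y e mul1r.
  by move: e'; rewrite (eq_prim_root_expr px) !modn_small // => /eqP/val_inj.
have yn : y ^+ n.+1 = 1 by rewrite expr_div_n -!exprM ![(_ * n.+1)%N]mulnC !exprM (prim_expr_order px) !expr1n divr1.
apply: (mulfI y1); rewrite mulr0 -[RHS](subrr 1) -{2}yn subrX1; congr (_ * _).
by apply: eq_bigr => v _; rewrite !exprM -exprVn -exprMn.
Qed.

Hypothesis walk_rel : forall s j, walk shift s (rel j) = s.
Hypothesis n0 : (0 < n)%N.
Hypothesis x_gen : forall k : 'I_n.+1, k != 0 -> exists i, x ^+ (k * a i) != 1.
Hypothesis low : (\rank (alexander_matrix rel (root_point a x)) < r - 1)%N.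

(** The index k = 0 contributes at most r and every other index at most r - 1; the phi(n + 1)
    indices prime to n + 1 give conjugates of [x] and lose one more. *)
Lemma cyclic_rank_bound : (\rank (relation_mx shift rel C) + totient n.+1 <= n.+1 * (r - 1) + 1)%N.
Proof.
rewrite (rank_relation_mx shiftK rel z0 psiE psiU) totient_count_coprime big_mkord -big_split /=.
have -> : (n.+1 * (r - 1) + 1 = \sum_(k < n.+1) (r - 1 + (k == ord0)))%N.
  rewrite big_split /= sum_nat_const card_ord; congr addn.
  by rewrite (bigD1 ord0) //= big1 // => k /negPf ->.
apply: leq_sum => k _; have [->|k0] := eqVneq k ord0.
  have := rank_leq_row (alexander_matrix rel (z ord0)); rewrite /coprime gcdn0.
  have -> : (n.+1 == 1)%N = false by rewrite eqSS; apply/negbTE; rewrite -lt0n.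
  by rewrite /= addn0; move: low; lia.
have [i xi] := x_gen k0.
have le : (\rank (alexander_matrix rel (z k)) <= r - 1)%N.
  apply: (@rank_alexander_le _ _ _ (z0 k) _ rel i); last by rewrite mxE -exprM.
  move=> j; have := word_char_psi k 0 (rel j); rewrite walk_rel /psi muln0 expr0.
  by rewrite mulr1.
case: (boolP (coprime n.+1 k)) => [co|_]; last by rewrite addn0 (leq_trans le) ?leq_addr.
have pk : n.+1.-primitive_root (x ^+ k) by rewrite prim_root_exp_coprime // coprime_sym.
have := rank_conj rel a px pk; move: low; rewrite /z /=; lia.
Qed.

End CyclicAction.

(** * Cocycles without potential *)

Section NonGradient.
Variables (r ms : nat) (S : finType) (st : S -> letter r -> S).
Hypothesis stK : forall s a, st (st s a) (letter_inv a) = s.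
Variables (rel : 'I_ms -> free_group r) (Q : pred S).

Lemma rank_row_mx_leq (F : fieldType) m n p (A : 'M[F]_(m, n)) (B : 'M[F]_(m, p)) :
  (\rank (row_mx A B) <= \rank A + p)%N.
Proof.
rewrite -mxrank_tr tr_row_mx -addsmxE; apply: leq_trans (mxrank_adds_leqif _ _).1 _.
by rewrite mxrank_tr leq_add2l rank_leq_row.
Qed.

(** A dimension count: the cocycles vanishing on the edges that touch [Q] form a space of dimension
    at least |S| r - rank D - 2 r |Q|, whereas gradients of functions on [S], cut off at those
    edges, span at most |S| dimensions. *)
Lemma exists_nongradient :
  (#|S| + \rank (relation_mx st rel rat) + 2 * r * #|Q| < #|S| * r)%N ->
  exists u : S -> 'I_r -> int,
    [/\ forall s j, integral st u s (rel j) = 0,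
        forall s i, Q s || Q (st s (i, true)) -> u s i = 0
      & forall g : S -> int, ~ forall s i, ~~ Q s -> ~~ Q (st s (i, true)) ->
          u s i = g (st s (i, true)) - g s].
Proof.
move=> bound; apply: contrapT => /forallNP none.
set D := relation_mx st rel rat in bound.
pose E : finType := (S * 'I_r)%type.
pose bad (e : E) := Q e.1 || Q (st e.1 (e.2, true)).
pose T : finType := ({x | Q x} * 'I_r * bool)%type.
(* The edges at a point of [Q]: outgoing for [true], incoming for [false]. The columns of [B] impose
   vanishing on them. *)
pose edge_of (t : T) : E :=
  (if t.2 then val t.1.1 else st (val t.1.1) (t.1.2, false), t.1.2).
pose B : 'M[rat]_(#|E|, #|T|) := fmx (fun e t => (e == edge_of t)%:R).
pose G : 'M[rat]_(#|S|, #|E|) := fmx (fun s e =>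
  if bad e then 0 else (s == st e.1 (e.2, true))%:R - (s == e.1)%:R).
have sub : (kermx (row_mx D B) <= G)%MS.
  apply/row_subP => k; set v := row k _.
  have : v *m row_mx D B = 0 by apply/sub_kermxP; exact: row_sub.
  clearbody v; rewrite mul_mx_row -[RHS]row_mx0 => /eq_row_mx[vD vB].
  have [d [a [d0 ha]]] := clear_denominators v.
  pose u s i : int := a 0 (enum_rank ((s, i) : E)).
  have uE s i : (u s i)%:~R = d%:~R * v 0 (enum_rank ((s, i) : E)) :> rat.
    by have /matrixP /(_ 0 (enum_rank ((s, i) : E))) := ha; rewrite !mxE.
  have uint s j : integral st u s (rel j) = 0.
    apply: (@intr_inj rat); rewrite /integral pair_bigA rmorph_sum /=.
    have /matrixP /(_ 0 (enum_rank ((s, j) : (S * 'I_ms)%type))) := vD.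
    rewrite [LHS]mxE [RHS]mxE => vDe.
    rewrite -[RHS](mulr0 (d%:~R)) -[in RHS]vDe mulr_sumr.
    rewrite -(sum_enum_val (fun p : E => (u p.1 p.2 *~ ecount st s (rel j) p.1 p.2)%:~R : rat)).
    apply: eq_bigr => e _; rewrite mxE enum_rankK /= mulrzz intrM uE mulrA.
    by rewrite -surjective_pairing enum_valK.
  have vz (t : T) : v 0 (enum_rank (edge_of t)) = 0.
    have /matrixP /(_ 0 (enum_rank t)) := vB; rewrite !mxE => vBe; rewrite -[RHS]vBe.
    rewrite (bigD1 (enum_rank (edge_of t))) //= mxE !enum_rankK eqxx mulr1.
    rewrite big1 ?addr0 // => e ne; rewrite mxE enum_rankK -(inj_eq enum_rank_inj) enum_valK.
    by rewrite (negPf ne) mulr0.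
  have ubad s i : Q s || Q (st s (i, true)) -> u s i = 0.
    move=> h; apply: (@intr_inj rat); rewrite uE.
    suff [t et] : exists t : T, edge_of t = (s, i) by rewrite -et vz mulr0.
    case: (boolP (Q s)) h => /= [qs _|_ qs]; first by exists (exist _ s qs, i, true).
    exists (exist (fun x => Q x) _ qs, i, false); rewrite /edge_of /=.
    by have := stK s (i, true) => ->.
  have [g hg] : exists g : S -> int, forall s i, ~~ Q s -> ~~ Q (st s (i, true)) ->
      u s i = g (st s (i, true)) - g s.
    by apply: contrapT => /forallNP ng; apply: (none u).
  suff aG : map_mx intr a = (\row_s (g (enum_val s))%:~R : 'rV[rat]_#|S|) *m G.
    have -> : v = d%:~R^-1 *: map_mx intr a by rewrite -ha scalerA mulVf ?scale1r // intr_eq0.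
    by rewrite aG scalemx_sub // submxMl.
  apply/rowP => p; rewrite [LHS]mxE [RHS]mxE -[p]enum_valK; case: (enum_val p) => s i.
  rewrite -/(u s i).
  transitivity (\sum_t (g t)%:~R * (if bad (s, i) then 0
      else (t == st s (i, true))%:R - (t == s)%:R) : rat); last first.
    rewrite -(sum_enum_val (fun t => (g t)%:~R * (if bad (s, i) then 0
      else (t == st s (i, true))%:R - (t == s)%:R) : rat)).
    by apply: eq_bigr => t _; rewrite !mxE enum_rankK.
  rewrite /bad /=; case: (boolP (Q s || _)) => [qs|].
    by rewrite ubad // big1 // => t _; rewrite mulr0.
  rewrite negb_or => /andP[q1 q2]; rewrite hg // rmorphB /=.
  have pick t0 : \sum_t (g t)%:~R * (t == t0)%:R = (g t0)%:~R :> rat.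
    rewrite (bigD1 t0) //= eqxx mulr1 big1 ?addr0 // => t /negPf ->; by rewrite mulr0.
  by under eq_bigr do rewrite mulrBr; rewrite sumrB !pick.
have := mxrankS sub; rewrite mxrank_ker.
have r1 := rank_row_mx_leq D B; have r2 := rank_leq_row G.
have cT : #|T| = (#|Q| * r * 2)%N by rewrite !card_prod card_sig card_ord card_bool.
have cE : #|E| = (#|S| * r)%N by rewrite card_prod card_ord.
have arith (s d t e e' x g q : nat) :
  (s + d + q < e' -> e = e' -> t = q -> x <= d + t -> g <= s -> e - x <= g -> False)%N by lia.
apply: arith bound cE _ r1 r2.
by rewrite cT; lia.
Qed.

End NonGradient.

(** * Coarse components *)

Section Restriction.
Variables (r : nat) (S : finType) (st : S -> letter r -> S).
Hypothesis stK : forall s a, st (st s a) (letter_inv a) = s.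

Definition restrict (C : pred S) (v : S -> 'I_r -> int) (s : S) (i : 'I_r) : int :=
  if C s && C (st s (i, true)) then v s i else 0.

Lemma letter_restrict C v s a : letter_integral st (restrict C v) s a =
  if C s && C (st s a) then letter_integral st v s a else 0.
Proof.
case: a => i [] //=; rewrite /letter_integral /restrict /=.
have := stK s (i, false); rewrite /letter_inv /= => ->; rewrite andbC.
by case: ifP; rewrite ?oppr0.
Qed.

Lemma vanishesP (v : S -> 'I_r -> int) s w :
  (forall w1 a w2, w = w1 ++ a :: w2 -> letter_integral st v (walk st s w1) a = 0) ->
  vanishes st v s w.
Proof.
elim: w s => //= a w IH s h; rewrite (h [::] a w) // eqxx /=.
by apply: IH => w1 b w2 e; apply: (h (a :: w1) b w2); rewrite e.
Qed.

Lemma eq_integral (v v' : S -> 'I_r -> int) s w :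
  (forall w1 a w2, w = w1 ++ a :: w2 ->
     letter_integral st v (walk st s w1) a = letter_integral st v' (walk st s w1) a) ->
  integral st v s w = integral st v' s w.
Proof.
elim: w s => [|a w IH] s h; first by rewrite !integral_nil.
rewrite !integral_cons (h [::] a w) //=; congr (_ + _).
by apply: IH => w1 b w2 e; apply: (h (a :: w1) b w2); rewrite e.
Qed.

Lemma vanishes_cat v s w w' : vanishes st v s (w ++ w') = vanishes st v s w && vanishes st v (walk st s w) w'.
Proof. by elim: w s => //= a w IH s; rewrite IH andbA. Qed.

Variables (tau tau' : S -> S).
Hypotheses (tauK : cancel tau tau') (tauK' : cancel tau' tau).
Hypothesis tauE : forall s a, tau (st s a) = st (tau s) a.

Definition translate_edges (v : S -> 'I_r -> int) (s : S) (i : 'I_r) : int := v (tau' s) i.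

Lemma tau'E s a : tau' (st s a) = st (tau' s) a.
Proof. by rewrite -{1}[s]tauK' -tauE tauK. Qed.

Lemma walk_tau s w : walk st (tau s) w = tau (walk st s w).
Proof. by elim: w s => //= a w IH s; rewrite -tauE IH. Qed.

Lemma letter_translate v s a :
  letter_integral st (translate_edges v) s a = letter_integral st v (tau' s) a.
Proof. by rewrite /letter_integral /translate_edges tau'E. Qed.

Lemma integral_translate v s w :
  integral st (translate_edges v) s w = integral st v (tau' s) w.
Proof.
elim: w s => [|a w IH] s; first by rewrite !integral_nil.
by rewrite !integral_cons letter_translate IH tau'E.
Qed.

Lemma vanishes_translate v s w :
  vanishes st (translate_edges v) s w = vanishes st v (tau' s) w.
Proof. by elim: w s => //= a w IH s; rewrite letter_translate IH tau'E. Qed.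

End Restriction.

Section Coarse.
Variables (r ms : nat) (S : finType) (st : S -> letter r -> S).
Hypothesis stK : forall s a, st (st s a) (letter_inv a) = s.
Variables (rel : 'I_ms -> free_group r) (Q : pred S) (L : nat).
Hypothesis L0 : (0 < L)%N.
Hypothesis relL : forall j, (size (rel j) <= L)%N.
Hypothesis walk_rel : forall s j, walk st s (rel j) = s.

(** [L] bounds the length of the relators, so the points outside [Q] visited by one relator lie in a
    single component of this relation. The joining word itself may cross [Q]. *)
Definition near_points (s t : S) : bool :=
  [&& ~~ Q s, ~~ Q t & `[< exists2 w, (size w <= L)%N & walk st s w = t >]].

Lemma near_points_sym : symmetric near_points.
Proof.
have h s t : near_points s t -> near_points t s.
  case/and3P => qs qt /asboolP[w wL e]; apply/and3P; split=> //; apply/asboolP.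
  by exists (word_inv w); [rewrite /word_inv size_rev size_map|rewrite -e; exact: walk_word_inv].
by move=> s t; apply/idP/idP; exact: h.
Qed.

Lemma coarse_sym : connect_sym near_points.
Proof. exact: sym_connect_sym near_points_sym. Qed.

Lemma visited_word s w1 w2 w1' w2' : w1 ++ w2 = w1' ++ w2' -> (size (w1 ++ w2) <= L)%N ->
  exists2 w, (size w <= L)%N & walk st (walk st s w1) w = walk st s w1'.
Proof.
wlog le : w1 w2 w1' w2' / (size w1 <= size w1')%N => [hw|] e wL.
  have [le|/ltnW le] := leqP (size w1) (size w1'); first exact: hw le e wL.
  have [|w sw we] := hw _ _ _ _ le (esym e); first by rewrite -e.
  exists (word_inv w); first by rewrite /word_inv size_rev size_map.
  by rewrite -we; exact: walk_word_inv.
have e1 : w1 = take (size w1) w1' by rewrite -(takel_cat w2' le) -e take_size_cat.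
exists (drop (size w1) w1').
  by rewrite size_drop (leq_trans (leq_subr _ _)) // (leq_trans _ wL) // e size_cat leq_addr.
by rewrite -{2}(cat_take_drop (size w1) w1') -e1 walk_cat.
Qed.

Lemma near_visited s w1 w2 w1' w2' : w1 ++ w2 = w1' ++ w2' -> (size (w1 ++ w2) <= L)%N ->
  ~~ Q (walk st s w1) -> ~~ Q (walk st s w1') -> near_points (walk st s w1) (walk st s w1').
Proof.
by move=> e wL q q'; rewrite /near_points q q' /=; apply/asboolP; exact: visited_word e wL.
Qed.

Variable u : S -> 'I_r -> int.
Hypothesis u_rel : forall s j, integral st u s (rel j) = 0.
Hypothesis u_bad : forall s i, Q s || Q (st s (i, true)) -> u s i = 0.

Variable rho : S.
Hypothesis rhoQ : ~~ Q rho.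
Let C : pred S := connect near_points rho.
Notation uC := (restrict st C u).

Lemma coarse_notin s : C s -> ~~ Q s.
Proof.
move=> /connectP[p pp ->]; elim: p rho rhoQ pp => //= t p IH s' q /andP[/and3P[_ qt _]].
exact: IH.
Qed.

Lemma coarse_near s t : C s -> near_points s t -> C t.
Proof. by move=> Cs st'; apply: connect_trans Cs (connect1 st'). Qed.

Lemma letter_bad s a : Q s || Q (st s a) -> letter_integral st u s a = 0.
Proof.
case: a => i [] /= q; rewrite /letter_integral /=; first exact: u_bad.
rewrite u_bad ?oppr0 //; have := stK s (i, false); rewrite /letter_inv /= => ->.
by rewrite orbC.
Qed.

Lemma visits_dichotomy s w :
  (forall w1 w2, w = w1 ++ w2 -> ~~ C (walk st s w1)) \/
  (exists w1 w2, w = w1 ++ w2 /\ C (walk st s w1)).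
Proof.
have [h|/forallNP h] := pselect (exists w1 w2, w = w1 ++ w2 /\ C (walk st s w1)); first by right.
left=> w1 w2 e; apply/negP => c; apply: (h w1); exists w2; by split.
Qed.

Lemma restrict_vanishes s w : (forall w1 w2, w = w1 ++ w2 -> ~~ C (walk st s w1)) -> vanishes st uC s w.
Proof.
by move=> h; apply: vanishesP => w1 a w2 e; rewrite (letter_restrict stK) (negPf (h _ _ e)).
Qed.

(** Once a short word visits [C], all its points outside [Q] belong to [C]; the remaining letters
    touch [Q], where [u] vanishes. *)
Lemma restrict_integral s w : (size w <= L)%N ->
  (exists w1 w2, w = w1 ++ w2 /\ C (walk st s w1)) -> integral st uC s w = integral st u s w.
Proof.
move=> wL [w1 [w2 [e c]]]; apply: eq_integral => v1 a v2 e'; rewrite (letter_restrict stK).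
have nr v v' : v ++ v' = w -> Q (walk st s v) || C (walk st s v).
  move=> ev; case: (boolP (Q _)) => //= q; apply: (coarse_near c).
  by apply: (near_visited (w2 := w2) (w2' := v')); rewrite -?e ?ev // coarse_notin.
have := nr v1 (a :: v2) (esym e').
have := nr (v1 ++ [:: a]) v2; rewrite -catA /= => /(_ (esym e')); rewrite walk_cat /=.
case: ifP => // /negbT; rewrite negb_and => /orP[/negPf -> | /negPf ->]; rewrite !orbF => q1 q2;
  by rewrite letter_bad // ?q1 ?q2 ?orbT.
Qed.

Lemma restrict_rel s j : integral st uC s (rel j) = 0.
Proof.
have [h|h] := visits_dichotomy s (rel j); last by rewrite restrict_integral.
exact/vanishes_integral/restrict_vanishes.
Qed.

(** Walks that return to [C] after at most [L] letters each time; between returns they are free to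
    leave [C]. *)
Inductive coarse_walk : S -> seq (letter r) -> S -> Prop :=
| coarse_nil p : C p -> coarse_walk p [::] p
| coarse_cons p w l t : C p -> (size w <= L)%N -> coarse_walk (walk st p w) l t ->
    coarse_walk p (w ++ l) t.

Lemma coarse_walk_start p l t : coarse_walk p l t -> C p.
Proof. by case. Qed.

Lemma coarse_walk_end p l t : coarse_walk p l t -> walk st p l = t /\ C t.
Proof. by elim=> // {}p w {}l {}t _ _ _ [e c]; rewrite walk_cat. Qed.

Lemma coarse_walk_cat p l t l' t' :
  coarse_walk p l t -> coarse_walk t l' t' -> coarse_walk p (l ++ l') t'.
Proof. by elim=> // {}p w {}l {}t c wL _ IH /IH; rewrite -catA; exact: coarse_cons. Qed.

Lemma coarse_walk1 p w : C p -> (size w <= L)%N -> C (walk st p w) ->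
  coarse_walk p w (walk st p w).
Proof.
by move=> c wL c'; rewrite -[w in coarse_walk _ w _]cats0; apply: coarse_cons => //; exact: coarse_nil.
Qed.

Lemma coarse_walk_rev p l t : coarse_walk p l t -> exists2 l', coarse_walk t l' p &
  integral st uC t l' = - integral st uC p l.
Proof.
elim=> [{}p c|{}p w {}l {}t c wL h [l' h' e]].
  by exists [::]; [exact: coarse_nil|rewrite integral_nil oppr0].
have pE := walk_word_inv stK p w.
have c' := coarse_walk_start h.
have hw : coarse_walk (walk st p w) (word_inv w) p.
  by rewrite -{2}pE; apply: coarse_walk1; rewrite ?pE // /word_inv size_rev size_map.
exists (l' ++ word_inv w); first exact: coarse_walk_cat h' hw.
have [e' _] := coarse_walk_end h'.
by rewrite !integral_cat e e' (integral_word_inv stK) opprD addrC.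
Qed.

Lemma coarse_walk_exists p t : C p -> C t -> exists l, coarse_walk p l t.
Proof.
move=> cp ct; have : connect near_points p t.
  by apply: connect_trans ct; rewrite coarse_sym.
move=> /connectP[ps pp ->]; elim: ps p cp pp {ct} => /= [|q ps IH] p cp.
  by move=> _; exists [::]; exact: coarse_nil.
case/andP => nq pp; have cq := coarse_near cp nq; have [l hl] := IH q cq pp.
have /and3P[_ _ /asboolP[w wL we]] := nq.
by exists (w ++ l); apply: coarse_cons => //; rewrite we.
Qed.

(** As for closed forms: without periods, the integral along any coarse walk from [p] is a
    primitive. *)
Lemma coarse_potential p : C p ->
  (forall l, coarse_walk p l p -> integral st uC p l = 0) ->
  exists g : S -> int, forall s i, C s -> C (st s (i, true)) -> u s i = g (st s (i, true)) - g s.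
Proof.
move=> cp zero.
have ex t : exists l, C t -> coarse_walk p l t.
  by have [ct|nc] := boolP (C t); [have [l h] := coarse_walk_exists cp ct; exists l|exists [::]].
have [lw hlw] := boolp.choice ex.
exists (fun t => integral st uC p (lw t)) => s i cs cs'.
have [l' h' e'] := coarse_walk_rev (hlw _ cs').
have h1 : coarse_walk s [:: (i, true)] (st s (i, true)) by apply: (coarse_walk1 (w := [:: (i, true)])).
have := zero _ (coarse_walk_cat (coarse_walk_cat (hlw _ cs) h1) h').
have [e1 _] := coarse_walk_end (hlw _ cs).
rewrite !integral_cat walk_cat e1 /= e' integral_cons integral_nil addr0.
rewrite /letter_integral /= /restrict cs cs' /= => e.
by move: e; lia.
Qed.

End Coarse.

Section CoarseCover.
Variables (R : realType) (Y : topologicalType) (y0 : Y).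
Hypotheses (nY : nice_space R Y) (cY : connected [set: Y]).
Variables (r ms : nat) (rel : 'I_ms -> free_group r) (phi : free_group r -> pi1 R y0).
Hypothesis pres : presentation rel phi.
Variables (S : finType) (st : S -> letter r -> S).
Hypothesis stK : forall s a, st (st s a) (letter_inv a) = s.
Hypothesis st_trans : forall s t, exists w, walk st s w = t.
Hypothesis walk_rel : forall s j, walk st s (rel j) = s.
Variables (Q : pred S) (L : nat).
Hypothesis L0 : (0 < L)%N.
Hypothesis relL : forall j, (size (rel j) <= L)%N.
Notation near := (near_points st Q L).
Hypothesis separated : forall rho, ~~ Q rho -> exists tau tau' : S -> S,
  [/\ cancel tau tau', cancel tau' tau, forall s a, tau (st s a) = st (tau s) a
    & forall s s' w, connect near rho s -> connect near rho s' -> (size w <= L)%N ->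
        walk st s w <> tau s'].
Variable u : S -> 'I_r -> int.
Hypothesis u_rel : forall s j, integral st u s (rel j) = 0.
Hypothesis u_bad : forall s i, Q s || Q (st s (i, true)) -> u s i = 0.
Hypothesis u_pot : forall g : S -> int, ~ forall s i, ~~ Q s -> ~~ Q (st s (i, true)) ->
  u s i = g (st s (i, true)) - g s.

Lemma coarse_cover : exists (Z : topologicalType) (q : Z -> Y) (z : Z) (f : pi1 R z -> free_group 2),
  [/\ finite_cover q, {morph f : a b / (a * b)%g} & forall w, exists a, f a = w].
Proof.
have csym := coarse_sym stK Q L.
(* Otherwise every component carries a potential. Selected through the representative
   [fingraph.root] of each component, these form one potential outside [Q], against [u_pot]. *)
have [rho [rhoQ loops]] : exists rho, ~~ Q rho /\ forall p, connect near rho p ->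
    exists2 l, coarse_walk st Q L rho p l p &
      integral st (restrict st (connect near rho) u) p l != 0.
  apply: contrapT => /forallNP no.
  have ex rho : exists g : S -> int, ~~ Q rho -> forall s i, connect near rho s ->
      connect near rho (st s (i, true)) -> u s i = g (st s (i, true)) - g s.
    case: (boolP (Q rho)) => [_|rq]; first by exists (fun=> 0).
    have /not_andP[//|/existsNP[p /not_implyP[cp np]]] := no rho.
    have [|g hg] := coarse_potential stK L0 rq cp (u := u); last by exists g.
    move=> l hl; apply: contrapT => /eqP nz; apply: np; by exists l.
  have [g hg] := boolp.choice ex.
  refine (u_pot (g := fun s => g (fingraph.root near s) s) _) => s i q q'.
  have ns : near s (st s (i, true)).
    by rewrite /near_points q q'; apply/asboolP; exists [:: (i, true)].
  have cr := connect_root near s.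
  have re : fingraph.root near s = fingraph.root near (st s (i, true)) by apply/(fingraph.rootP csym)/connect1.
  rewrite -re; apply: hg; first exact: coarse_notin cr.
    by rewrite csym.
  by rewrite csym re connect_root.
have [tau [tau' [tauK tauK' tauE sep]]] := separated rhoQ.
set C := connect near rho in loops sep.
set uC := restrict st C u in loops.
pose u' := translate_edges tau' uC.
have wtau s w := walk_tau tauE s w.
have wtau' s w : walk st (tau' s) w = tau' (walk st s w).
  by apply: (can_inj tauK); rewrite -wtau !tauK'.
have van s w := @restrict_vanishes _ _ _ stK Q L u rho s w.
(* Separation is used in both directions: short words from [C] avoid the translate of [C] by [tau],
   and short words from the translate avoid [C]. *)
have piece p w : C p -> (size w <= L)%N -> vanishes st uC (tau' p) w.
  move=> cp wL; apply: restrict_vanishes => // w1 w2 e; apply/negP => c.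
  apply: (sep p (walk st (tau' p) w1) w1) => //; last by rewrite -wtau tauK'.
  by rewrite (leq_trans _ wL) // e size_cat leq_addr.
have piece' p w : C p -> (size w <= L)%N -> vanishes st uC (tau p) w.
  move=> cp wL; apply: restrict_vanishes => // w1 w2 e; apply/negP => c.
  apply: (sep (walk st (tau p) w1) p (word_inv w1)) => //; last exact: walk_word_inv.
  by rewrite /word_inv size_rev size_map (leq_trans _ wL) // e size_cat leq_addr.
have long p l t : coarse_walk st Q L rho p l t -> vanishes st uC (tau' p) l.
  by elim=> // {}p w {}l {}t cp wL _ IH; rewrite vanishes_cat piece //= wtau'.
have long' p l t : coarse_walk st Q L rho p l t -> vanishes st uC (tau p) l.
  by elim=> // {}p w {}l {}t cp wL _ IH; rewrite vanishes_cat piece' //= wtau.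
(* [g] is a shortest word from [C] to its translate. By minimality no letter of it joins two points
   of [C] or two points of the translate, so both edge functions vanish along it. *)
pose P k := `[< exists p w, [/\ C p, C (tau' (walk st p w)) & size w = k] >].
have exP : exists k, P k.
  have [w e] := st_trans rho (tau rho); exists (size w); apply/asboolP; exists rho, w.
  by split; rewrite ?e ?tauK //; exact: connect0.
case: (ex_minnP exP) => m /asboolP[p [g [cp cg gm]]] min.
have gmin q w : C q -> C (tau' (walk st q w)) -> (size g <= size w)%N.
  by move=> cq cw; rewrite gm; apply: min; apply/asboolP; exists q, w.
have [l hl lu] := loops p cp; have [l' hl' lu'] := loops _ cg.
have [el _] := coarse_walk_end hl; have [el' _] := coarse_walk_end hl'.
apply: (@carry_cover R Y y0 nY cY r ms rel phi pres S st stK walk_rel uC u' _ _ p g l l').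
- move=> s i; rewrite /u' /translate_edges /uC /restrict.
  case: (boolP (C s)) => [cs|_]; last by left.
  case: (boolP (C (tau' s))) => [cs'|_]; last by right.
  by have := @sep s (tau' s) [::] cs cs' isT; rewrite tauK'.
- move=> s j; have [h|[w1 [w2 [e c]]]] := visits_dichotomy st Q L rho s (rel j).
    right; split; first exact: van.
    by rewrite (integral_translate tauK tauK' tauE); exact: (restrict_rel stK relL u_rel u_bad rhoQ).
  left; split; last exact: (restrict_rel stK relL u_rel u_bad rhoQ).
  rewrite (vanishes_translate tauK tauK' tauE); apply: van => v1 v2 e'; apply/negP => c'.
  have wL : (size (w1 ++ w2) <= L)%N by rewrite -e.
  have [w sw we] := visited_word stK s (etrans (esym e) e') wL.
  by apply: (sep _ _ w c c' sw); rewrite we wtau' tauK'.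
- apply: (vanishesP (st := st)) => w1 a w2 e; rewrite (letter_restrict stK).
  case: ifP => // /andP[_ c]; have : (size g <= size w2)%N.
    by apply: (gmin _ _ c); move: cg; rewrite e walk_cat.
  by rewrite e size_cat /= addnS ltnNge leq_addl.
- rewrite (vanishes_translate tauK tauK' tauE).
  apply: (vanishesP (st := st)) => w1 a w2 e; rewrite (letter_restrict stK).
  case: ifP => // /andP[c _]; have := gmin p w1 cp; rewrite -wtau' => /(_ c).
  by rewrite e size_cat /= addnS ltnNge leq_addr.
- exact: el.
- by rewrite (vanishes_translate tauK tauK' tauE); exact: long hl.
- by rewrite -{1}[walk st p g]tauK' wtau el' tauK'.
- by rewrite -[walk st p g]tauK'; exact: long' hl'.
- exact: lu.
- by rewrite (integral_translate tauK tauK' tauE).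
Qed.

End CoarseCover.

(** * Zones of a cyclic action *)

(** With M = 2 r + 1 and t = k / M rounded down, K (k + 1) <= (t + 1)^2, and (t + 1)^(2 r) < (t +
    1)^M <= 2^(t M) <= 2^k. *)
Lemma exp_beats_poly r K : exists k0, forall k, (k0 <= k)%N -> ((K * k.+1) ^ r < 2 ^ k)%N.
Proof.
pose M := (2 * r).+1; exists (M * (K * M).+1)%N => k hk.
pose t := (k %/ M)%N.
have tK : (K * M < t)%N by rewrite /t leq_divRL // mulnC.
have kt : (k.+1 <= M * t.+1)%N by rewrite mulnC ltn_ceil.
have b1 : (K * k.+1 <= t.+1 ^ 2)%N.
  apply: leq_trans (_ : K * (M * t.+1) <= _)%N; first by rewrite leq_mul2l kt orbT.
  by rewrite mulnA expnS expn1 leq_mul2r (leqW (ltnW tK)) orbT.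
have b2 : (t.+1 <= 2 ^ t)%N by exact: ltn_expl.
apply: leq_ltn_trans (_ : (t.+1 ^ 2) ^ r < _)%N; first by have [->|r0] := posnP r; rewrite ?expn0 ?leq_exp2r.
rewrite -expnM; apply: leq_trans (_ : t.+1 ^ M <= _)%N.
  by rewrite ltn_exp2l //; case: (t) tK.
apply: leq_trans (_ : (2 ^ t) ^ M <= _)%N; first by rewrite leq_exp2r.
by rewrite -expnM leq_exp2l // leq_trunc_div.
Qed.

(** The i-th entry is at least i + 1, so the product of the p / (p - 1) is at most that of the (i +
    1) / i, which telescopes. *)
Lemma prod_primes_bound (s : seq nat) : sorted ltn s -> all (leq 2) s ->
  (\prod_(p <- s) p <= (size s).+1 * \prod_(p <- s) p.-1)%N.
Proof.
elim/last_ind: s => [|s p IH] srt; first by rewrite !big_nil.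
rewrite all_rcons => /andP[p2 s2].
have srt' : sorted ltn s by move: srt; rewrite -cats1 => /(subseq_sorted ltn_trans (prefix_subseq s [:: p])).
have sp x : x \in s -> (x < p)%N.
  move=> xs; move: srt; rewrite -cats1 => srt2; have := order_path_min.
  by move: srt2; rewrite sorted_pairwise ?pairwise_cat; [|exact: ltn_trans];
     case/and3P => /allrelP h _ _ _; apply: h; rewrite ?inE.
have sz : ((size s).+2 <= p)%N.
  have : (size s <= size (iota 2 (p - 2)))%N.
    apply: uniq_leq_size; first by apply: (sorted_uniq ltn_trans ltnn).
    by move=> x xs; rewrite mem_iota (allP s2) //= subnKC // sp.
  by rewrite size_iota; lia.
rewrite size_rcons -cats1 !big_cat !big_seq1 /=.
have := IH srt' s2; move: (\prod_(_ <- _) _)%N (\prod_(_ <- _) _)%N (size s) sz => B A k sz h.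
have h1 := leq_mul h (leqnn p); apply: (leq_trans h1).
have h2 : (k.+1 * p <= k.+2 * p.-1)%N by nia.
have := leq_mul (leqnn A) h2; nia.
Qed.

Lemma totient_bound N : (0 < N)%N -> (N <= totient N * (size (primes N)).+1)%N.
Proof.
move=> N0; have pr2 : all (leq 2) (primes N).
  by apply/allP => p; rewrite mem_primes => /andP[/prime_gt1].
have h := prod_primes_bound (sorted_primes N) pr2.
have A0 : (0 < \prod_(p <- primes N) p.-1)%N.
  by rewrite big_seq prodn_cond_gt0 // => p /(allP pr2); case: p => [|[]].
rewrite totientE // -(leq_pmul2r A0) {1}(prod_prime_decomp N0) prime_decompE big_map /=.
have -> : (\prod_(p <- primes N) p ^ logn p N =
    \prod_(p <- primes N) p * \prod_(p <- primes N) p ^ (logn p N).-1)%N.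
  rewrite -big_split big_seq [RHS]big_seq; apply: eq_bigr => p pN /=.
  by rewrite -expnS prednK // logn_gt0.
rewrite big_split /=.
move: h; move: (\prod_(_ <- _) _)%N (\prod_(_ <- _) _.-1)%N (\prod_(_ <- _) _ ^ _)%N (size _) => A B D k h.
have := leq_mul (leqnn (D * B)) h; nia.
Qed.

Lemma exp_size_primes N : (0 < N)%N -> (2 ^ size (primes N) <= N)%N.
Proof.
move=> N0; rewrite {2}(prod_prime_decomp N0) prime_decompE big_map /=.
have : all (fun p => 0 < logn p N)%N (primes N).
  by apply/allP => p; rewrite logn_gt0.
have : all prime (primes N) by apply/allP => p; rewrite mem_primes => /andP[].
elim: (primes N) => [|p s IH]; first by rewrite big_nil.
move=> /= /andP[pp ps] /andP[p0 s0]; rewrite big_cons expnS leq_mul ?IH //.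
by apply: leq_trans (prime_gt1 pp) _; rewrite -{1}[p]expn1 leq_pexp2l // prime_gt0.
Qed.

(** Pigeonhole: the n + 1 multiples of the vector [a] fall into q^r boxes. [k] is the difference of
    two multipliers that share a box, and [e] is the difference of the corresponding residues. *)
Lemma dirichlet_approx (r n q : nat) (a : 'I_r -> 'I_n.+1) : (0 < q)%N -> (q ^ r < n.+1)%N ->
  exists (k : nat) (e : 'I_r -> int), [/\ (0 < k)%N, (k < n.+1)%N &
    forall i, (n.+1%:Z %| (k * a i)%N%:Z - e i)%Z /\ (`|e i| * q < n.+1)%N].
Proof.
move=> q0 qr; pose x (k : 'I_n.+1) i := ((k * a i) %% n.+1)%N.
have bx k i : ((x k i * q) %/ n.+1 < q)%N.
  by rewrite ltn_divLR // [(q * _)%N]mulnC ltn_pmul2r // ltn_mod.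
pose f (k : 'I_n.+1) : {ffun 'I_r -> 'I_q} := [ffun i => Ordinal (bx k i)].
have /injectivePn[k1 [k2 k12 fk]] : ~~ injectiveb f.
  apply/negP => /injectiveP /leq_card; rewrite card_ffun !card_ord leqNgt; by rewrite qr.
wlog lt : k1 k2 k12 fk / (k1 < k2)%N => [hw|].
  have [lt|gt|e] := ltngtP k1 k2; first exact: hw lt.
    by apply: (hw k2 k1) => //; rewrite eq_sym.
  by move/val_inj: e k12 => ->; rewrite eqxx.
exists (k2 - k1)%N, (fun i => (x k2 i)%:Z - (x k1 i)%:Z); split; first by rewrite subn_gt0.
  by rewrite (leq_ltn_trans (leq_subr _ _)).
move=> i; split.
  have h (k : 'I_n.+1) : (n.+1%:Z %| (k * a i)%N%:Z - (x k i)%:Z)%Z.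
    apply/dvdzP; exists ((k * a i) %/ n.+1)%N%:Z.
    by rewrite {1}(divn_eq (k * a i) n.+1) PoszD addrK.
  have := rpredB (h k2) (h k1).
  by rewrite mulnBl -subzn ?leq_mul2r ?(ltnW lt) ?orbT //; congr (_ %| _)%Z; ring.
have := congr1 (fun g : {ffun 'I_r -> 'I_q} => val (g i)) fk; rewrite !ffunE /=.
have := divn_eq (x k1 i * q) n.+1; have := divn_eq (x k2 i * q) n.+1.
have := ltn_pmod (x k1 i * q) (isT : 0 < n.+1)%N; have := ltn_pmod (x k2 i * q) (isT : 0 < n.+1)%N.
move: (_ %% _)%N (_ %% _)%N (_ %/ _)%N (_ %/ _)%N => m1 m2 d1 d2 h1 h2 e1 e2 e3.
have : (`|(x k2 i * q)%N%:Z - (x k1 i * q)%N%:Z| < n.+1)%N by subst; lia.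
by rewrite !PoszM -mulrBl abszM.
Qed.

Section Geometry.
Variables (r n : nat) (a : 'I_r -> 'I_n.+1) (k : nat) (e : 'I_r -> int) (q L : nat).
Hypotheses (k0 : (0 < k)%N) (q0 : (0 < q)%N) (L0 : (0 < L)%N).
Hypothesis ke : forall i, (n.+1%:Z %| (k * a i)%N%:Z - e i)%Z /\ (`|e i| * q < n.+1)%N.

(** [k] may fail to be invertible modulo n + 1, so that k v only takes multiples of [d]; dividing by
    [d] makes the circle Z/m, on which [k'] is invertible. *)
Let d := gcdn k n.+1.
Let m := (n.+1 %/ d)%N.
Let k' := (k %/ d)%N.

Let d0 : (0 < d)%N. Proof. by rewrite gcdn_gt0 orbT. Qed.
Let nE : (n.+1 = m * d)%N. Proof. by rewrite divnK // dvdn_gcdr. Qed.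
Let nZ : n.+1%:Z = m%:Z * d%:Z. Proof. by rewrite -PoszM -nE. Qed.
Let kE : (k = k' * d)%N. Proof. by rewrite divnK // dvdn_gcdl. Qed.
Let m0 : (0 < m)%N. Proof. by have := nE; case: (m). Qed.

Let k'm : coprime k' m.
Proof.
by rewrite /coprime -(eqn_pmul2r d0) muln_gcdl -kE -nE mul1n.
Qed.

(* The residue of [k v] modulo [N = n + 1], divided by [d = gcd (k, N)]. *)
Definition height (v : 'I_n.+1) : nat := ((k' * v) %% m)%N.

Let cong (x y : int) := exists t : int, x = y + t * m%:Z.

Let height_lt v : (height v < m)%N. Proof. exact: ltn_pmod. Qed.

Let step (i : 'I_r) : int := (e i %/ d%:Z)%Z.

Let stepE i : e i = step i * d%:Z.
Proof.
apply/esym/divzK; have [h _] := ke i.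
have h2 : (d%:Z %| (k * a i)%N%:Z - e i)%Z by apply: dvdz_trans h; exact: (dvdn_gcdr k n.+1).
have h3 : (d%:Z %| (k * a i)%N%:Z)%Z by exact: (dvdn_mulr (a i) (dvdn_gcdl k n.+1)).
by have := rpredB h3 h2; rewrite opprB addrC subrK.
Qed.

Let height_nat v : cong (height v)%:Z (k' * v)%N%:Z.
Proof.
exists (- ((k' * v) %/ m)%N%:Z).
by rewrite {1}(divn_eq (k' * v) m) PoszD PoszM mulNr addrC addKr.
Qed.

Let heightD (v w : 'I_n.+1) : cong (height (v + w)%R)%:Z ((height v)%:Z + (height w)%:Z).
Proof.
have [t1 e1] := height_nat v; have [t2 e2] := height_nat w.
have [t e3] := height_nat (v + w)%R.
have e4 : ((v + w)%R : nat)%:Z = v%:Z + w%:Z - ((v + w) %/ n.+1)%N%:Z * n.+1%:Z.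
  by have := divn_eq (v + w) n.+1; rewrite /=; lia.
exists (t - t1 - t2 - k'%:Z * ((v + w) %/ n.+1)%N%:Z * d%:Z).
rewrite e3 e1 e2 !PoszM e4 nZ; ring.
Qed.

Let height_step i : cong (height (a i))%:Z (step i).
Proof.
have [t e1] := height_nat (a i); have [h _] := ke i; have /dvdzP[t2 e2] := h.
exists (t + t2); rewrite e1; apply: (mulIf (x := d%:Z)); first by rewrite gt_eqF.
have : (k * a i)%N%:Z = e i + t2 * n.+1%:Z by rewrite -e2 addrC subrK.
rewrite stepE {1}kE nZ !PoszM => e3.
rewrite mulrDl [k'%:Z * _ * _]mulrAC e3; ring.
Qed.

Let beta : nat := \max_i `|step i|%N.

Let step_beta i : (`|step i| <= beta)%N.
Proof. exact: (leq_bigmax_cond (F := fun i => `|step i|%N)). Qed.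

Let beta_lt : (beta * d * q < n.+1)%N.
Proof.
have [r0|r0] := posnP #|'I_r|.
  by rewrite /beta big1 // => i; have := card0_eq r0 i.
rewrite /beta; have [i ->] := @bigop.eq_bigmax _ (fun i => `|step i|%N) r0.
by have [_] := ke i; rewrite stepE abszM.
Qed.

Let height_letter v l : exists2 x : int, (`|x| <= beta)%N &
  cong (height (shift a v l))%:Z ((height v)%:Z + x).
Proof.
case: l => i b; have [t1 e1] := height_step i.
rewrite /shift /=; case: b.
  have [t2 e2] := heightD v (a i); exists (step i) => //.
  by exists (t1 + t2); rewrite e2 e1; ring.
have [t2 e2] := heightD (v - a i)%R (a i); rewrite subrK in e2.
exists (- step i); first by rewrite abszN.
by exists (- t1 - t2); rewrite e2 e1; ring.
Qed.

Let height_word v w : exists2 x : int, (`|x| <= size w * beta)%N &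
  cong (height (walk (shift a) v w))%:Z ((height v)%:Z + x).
Proof.
elim: w v => [|l w IH] v /=; first by exists 0 => //; exists 0; rewrite mul0r !addr0.
have [x xb [t e1]] := height_letter v l; have [y yb [t' e2]] := IH (shift a v l).
exists (x + y); last by exists (t + t'); rewrite e2 e1; ring.
by rewrite mulSn (leq_trans _ (leq_add xb yb)) //; lia.
Qed.

(** One more than the largest change of height along a word of length [L]. *)
Definition zone_width : nat := (L * beta).+1.
Let W := zone_width.
Definition half_height : nat := (m %/ 2)%N.
Let M := half_height.

(** Two arcs of the circle Z/m, at 0 and at M. The last clause catches the single leftover height
    when m is odd, so that both halves have the same length and translation by M exchanges them. *)
Definition zone (v : 'I_n.+1) : bool :=
  [|| height v < W, M <= height v < M + W | 2 * M <= height v]%N.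

Let M2 : (2 * M <= m)%N. Proof. by rewrite mulnC leq_trunc_div. Qed.
Let M2' : (m <= 2 * M + 1)%N.
Proof. by have := ltn_ceil m (isT : 0 < 2)%N; rewrite /M /half_height; lia. Qed.

Let arc v : bool := (M <= height v)%N.

(** A word of length at most [L] moves the height by less than the width of an arc, so it cannot
    jump over one. *)
Let crossing s w : ~~ zone s -> ~~ zone (walk (shift a) s w) -> (size w <= L)%N ->
  arc s = arc (walk (shift a) s w).
Proof.
have [x xb [t ht]] := height_word s w.
move=> zs zt wL; have {xb} xW : (`|x| < W)%N.
  by rewrite ltnS (leq_trans xb) // leq_mul2r wL orbT.
move: ht zs zt; rewrite /zone /arc; move: (height_lt s) (height_lt (walk (shift a) s w)).
move: (height s) (height (walk (shift a) s w)) => y y' ym y'm ht zs zt.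
have zs' : (W <= y)%N && ((y < M)%N || (M + W <= y)%N) && (y < 2 * M)%N by move: zs; lia.
have zt' : (W <= y')%N && ((y' < M)%N || (M + W <= y')%N) && (y' < 2 * M)%N by move: zt; lia.
have [t0|[t0|t0]] : t = 0 \/ (1 <= t \/ t <= -1) by lia.
- move: ht; rewrite t0 mul0r addr0; lia.
- have : m%:Z <= t * m%:Z by rewrite -{1}[m%:Z]mul1r ler_wpM2r.
  by move: ht; lia.
- have : t * m%:Z <= - m%:Z by rewrite -[- m%:Z]mulN1r ler_wpM2r.
  by move: ht; lia.
Qed.

(** At most 2 W + 1 heights are removed, and each is taken at most [d] times: as [k'] is invertible
    modulo [m], the height determines [v] modulo [m]. *)
Lemma card_zone : (#|zone| <= d * (2 * W + 1))%N.
Proof.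
pose ys := (iota 0 W ++ iota M W ++ [:: 2 * M])%N.
rewrite mulnC -[X in (_ <= X)%N](_ : size [seq (y, j) | y <- ys, j <- iota 0 d] = _); last first.
  by rewrite size_allpairs !size_cat !size_iota /=; congr muln; lia.
pose h (v : 'I_n.+1) := (height v, v %/ m)%N.
have inj : injective h.
  move=> v w [e1 e2]; apply: val_inj; suff evw : (v == w %[mod m])%N.
    by rewrite /= (divn_eq v m) (divn_eq w m) e2 (eqP evw).
  have e3 : (k' * v == k' * w %[mod m])%N by apply/eqP.
  have mk : coprime m k' by rewrite coprime_sym.
  wlog le : v w e1 e2 e3 / (v <= w)%N => [hw|].
    by have [le|/ltnW le] := leqP v w; [exact: hw|rewrite eq_sym; apply: hw => //; rewrite eq_sym].
  move: e3; rewrite eq_sym eqn_mod_dvd ?leq_mul2l ?le ?orbT // -mulnBr Gauss_dvdr //.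
  by rewrite -eqn_mod_dvd // eq_sym.
rewrite cardE -(size_map h); apply: uniq_leq_size; first by rewrite map_inj_uniq ?enum_uniq.
move=> p /mapP[v]; rewrite mem_enum => zv ->; apply: allpairs_f.
  rewrite /ys !mem_cat !mem_iota inE /=; have := height_lt v; move: zv.
  rewrite unfold_in /zone; lia.
by rewrite mem_iota /= add0n ltn_divLR // mulnC -nE.
Qed.

(** [u] satisfies k' u = -1 modulo m, so (m - u) M has height M modulo m. *)
Let shift_half : exists v0 : 'I_n.+1, forall v, cong (height (v + v0)%R)%:Z ((height v)%:Z + M%:Z).
Proof.
have [u um] := Bezoutl k' m0; rewrite gcdnC (eqP k'm) => /dvdnP[c ec].
pose x := ((m - u) * M)%N; exists (inord (x %% n.+1)) => v.
have [t1 e1] := heightD v (inord (x %% n.+1)).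
have [t2 e2] := height_nat (inord (x %% n.+1)).
have xE : (inord (x %% n.+1) : 'I_n.+1)%:Z = x%:Z - (x %/ n.+1)%N%:Z * n.+1%:Z.
  by rewrite inordK ?ltn_mod //; have := divn_eq x n.+1; lia.
have uE : k'%:Z * u%:Z = c%:Z * m%:Z - 1 by move: ec; lia.
rewrite PoszM xE /x PoszM -subzn ?(ltnW um) // nZ in e2.
exists (t1 + t2 + k'%:Z * M%:Z - c%:Z * M%:Z - k'%:Z * (x %/ n.+1)%N%:Z * d%:Z).
have e5 : k'%:Z * ((m%:Z - u%:Z) * M%:Z) = k'%:Z * m%:Z * M%:Z - (c%:Z * m%:Z - 1) * M%:Z.
  by rewrite -uE; ring.
rewrite e1 e2 mulrBr e5; ring.
Qed.

(** By [crossing] a component stays in one half. The translation goes up by M from the lower half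
    and down by M from the upper half, so it avoids the zone and lands in the other half, which no
    short word reaches from the first. *)
Lemma zone_separated rho : ~~ zone rho -> exists tau tau' : 'I_n.+1 -> 'I_n.+1,
  [/\ cancel tau tau', cancel tau' tau, forall s l, tau (shift a s l) = shift a (tau s) l
    & forall s s' w, connect (near_points (shift a) zone L) rho s ->
        connect (near_points (shift a) zone L) rho s' -> (size w <= L)%N ->
        walk (shift a) s w <> tau s'].
Proof.
move=> zr; have [v0 hv0] := shift_half.
have arcE s : connect (near_points (shift a) zone L) rho s -> arc s = arc rho.
  move=> /connectP[p pp ->]; elim: p rho zr pp => //= t p IH s' q' /andP[/and3P[_ qt ww] pp].
  rewrite IH //; have /asboolP[w wL we] := ww.
  by rewrite -we; apply/esym/crossing => //; rewrite we.
have notin s : connect (near_points (shift a) zone L) rho s -> ~~ zone s by exact: coarse_notin.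
have comm (v : 'I_n.+1) s l : (shift a s l + v)%R = shift a (s + v)%R l.
  by rewrite /shift; case: ifP => _; rewrite addrAC.
have key (v : 'I_n.+1) : (forall s, connect (near_points (shift a) zone L) rho s ->
    ~~ zone (s + v)%R /\ arc (s + v)%R = ~~ arc rho) ->
    forall s s' w, connect (near_points (shift a) zone L) rho s ->
        connect (near_points (shift a) zone L) rho s' -> (size w <= L)%N ->
        walk (shift a) s w <> (s' + v)%R.
  move=> hv s s' w cs cs' wL ew; have [z' a'] := hv s' cs'.
  have := crossing (notin s cs) _ wL; rewrite ew => /(_ z'); rewrite a' (arcE s cs).
  by case: (arc rho).
case: (boolP (arc rho)) => ar.
  exists (fun s => s - v0)%R, (fun s => s + v0)%R; split.
  - by move=> s; rewrite subrK.
  - by move=> s; rewrite addrK.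
  - by move=> s l; rewrite comm.
  apply: key => s cs; have := arcE s cs; rewrite ar => as_; have zs := notin s cs.
  have [t ht] := hv0 (s - v0)%R; rewrite subrK in ht.
  move: ht zs as_; rewrite /zone /arc; have := height_lt s; have := height_lt (s - v0)%R.
  move: (height s) (height (s - v0)%R) => y y' y'm ym ht zs as_.
  have zs' : (M + W <= y)%N && (y < 2 * M)%N by move: zs as_; lia.
  have t0 : t = 0.
    have [//|[t1|t1]] : t = 0 \/ (1 <= t \/ t <= -1) by lia.
    - have : m%:Z <= t * m%:Z by rewrite -{1}[m%:Z]mul1r ler_wpM2r.
      by move: ht; lia.
    - have : t * m%:Z <= - m%:Z by rewrite -[- m%:Z]mulN1r ler_wpM2r.
      by move: ht; lia.
  move: ht; rewrite t0 mul0r addr0; lia.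
exists (fun s => s + v0)%R, (fun s => s - v0)%R; split.
- by move=> s; rewrite addrK.
- by move=> s; rewrite subrK.
- by move=> s l; rewrite comm.
apply: key => s cs; have := arcE s cs; rewrite (negPf ar) => as_; have zs := notin s cs.
have [t ht] := hv0 s.
move: ht zs as_; rewrite /zone /arc; have := height_lt s; have := height_lt (s + v0)%R.
move: (height s) (height (s + v0)%R) => y y' y'm ym ht zs as_.
have zs' : (W <= y)%N && (y < M)%N by move: zs as_; lia.
have t0 : t = 0.
  have [//|[t1|t1]] : t = 0 \/ (1 <= t \/ t <= -1) by lia.
  - have : m%:Z <= t * m%:Z by rewrite -{1}[m%:Z]mul1r ler_wpM2r.
    by move: ht; lia.
  - have : t * m%:Z <= - m%:Z by rewrite -[- m%:Z]mulN1r ler_wpM2r.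
    by move: ht; lia.
move: ht; rewrite t0 mul0r addr0; lia.
Qed.

(** If [beta] were 0, all the k a_i would be 0 modulo n + 1. With [beta] positive, 2 W + 1 = 2 L
    beta + 3 is at most (2 L + 3) beta, and beta d q < n + 1. *)
Lemma card_zone_bound : ~ (forall i, (n.+1 %| k * a i)%N) ->
  (#|zone| * q < (2 * L + 3) * n.+1)%N /\ ((2 * L + 3) * n.+1 > q)%N.
Proof.
move=> nz; have b0 : (0 < beta)%N.
  rewrite lt0n; apply/negP => /eqP b0; apply: nz => i.
  have := step_beta i; rewrite b0 leqn0 absz_eq0 => /eqP s0.
  by have [h _] := ke i; move: h; rewrite stepE s0 mul0r subr0.
have := card_zone; have := beta_lt; have := d0; rewrite /W /zone_width.
move: (#|zone|) beta d b0 => z b dd b0 dd0 h1 h2.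
have h3 : (dd * (2 * (L * b).+1 + 1) <= (2 * L + 3) * (b * dd))%N by nia.
have h4 : (z * q <= (2 * L + 3) * (b * dd * q))%N.
  apply: leq_trans (_ : (2 * L + 3) * (b * dd) * q <= _)%N; last by rewrite -!mulnA.
  by rewrite leq_mul2r (leq_trans h2 h3) orbT.
split; first by apply: leq_ltn_trans h4 _; rewrite ltn_pmul2l ?addn3 //; exact: h1.
have : (q <= b * dd * q)%N by rewrite leq_pmull // muln_gt0 b0.
nia.
Qed.

End Geometry.

Lemma roots_of_unity_finite (C : numClosedFieldType) r B : (0 < B)%N ->
  finite_set [set z : 'rV[C]_r | forall i, z 0 i ^+ B = 1].
Proof.
move=> B0; have [rs _ ers] := prod_Xn_sub_1 C B0.
apply: (@sub_finite_set _ _ ((fun g : {ffun 'I_r -> 'I_(size rs)} => \row_i rs`_(g i)) @` setT)).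
  move=> z /= zB; have mem i : z 0 i \in rs.
    by rewrite -root_prod_XsubC -ers rootE !hornerE zB subrr.
  have lt i : (index (z 0%R i) rs < size rs)%N by rewrite index_mem.
  exists [ffun i => Ordinal (lt i)] => //; apply/rowP => i; rewrite mxE ffunE /=.
  by rewrite nth_index.
by apply: finite_image; exact: finite_finset.
Qed.

Section ShiftTransitive.
Variables (r n : nat) (a : 'I_r -> 'I_n.+1).

Let reach (x : int) := exists w, (n.+1%:Z %| (walk (shift a) 0%R w)%:Z - x)%Z.

Let val_add (v w : 'I_n.+1) : (n.+1%:Z %| (v + w)%R%:Z - (v%:Z + w%:Z))%Z.
Proof.
apply/dvdzP; exists (- ((v + w) %/ n.+1)%N%:Z).
by have := divn_eq (v + w) n.+1; rewrite /=; lia.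
Qed.

Let reachD x y : reach x -> reach y -> reach (x + y).
Proof.
move=> [w hw] [w' hw']; exists (w ++ w').
have -> : walk (shift a) 0 (w ++ w') = walk (shift a) 0 w' + walk (shift a) 0 w.
  by rewrite walk_cat -{1}[walk _ 0 w]add0r walk_shift.
have := rpredD (val_add (walk (shift a) 0 w') (walk (shift a) 0 w)) (rpredD hw hw').
by congr (_ %| _)%Z; ring.
Qed.

Let reachN x : reach x -> reach (- x).
Proof.
move=> [w hw]; exists (word_inv w); set v := walk (shift a) 0 w in hw.
have e : walk (shift a) 0 (word_inv w) + v = 0.
  by rewrite -walk_shift add0r /v; exact: walk_word_inv (shiftK a) _ _.
have := val_add (walk (shift a) 0 (word_inv w)) v; rewrite e => h.
by have := rpredD h hw; rewrite -rpredN; congr (_ %| _)%Z; rewrite /=; ring.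
Qed.

Let reach0 : reach 0. Proof. by exists [::]; rewrite /= subrr. Qed.

Let reachM x y : reach x -> reach (y * x).
Proof.
move=> hx; elim/int_rect: y => [|y IH|y IH]; first by rewrite mul0r.
  by rewrite -addn1 PoszD mulrDl mul1r; exact: reachD.
by rewrite -addn1 PoszD opprD mulrDl mulN1r; exact: reachD (reachN hx).
Qed.

Hypothesis gen : forall k, (0 < k < n.+1)%N -> ~ forall i, (n.+1 %| k * a i)%N.

(** The integers congruent to reachable positions are the multiples of a divisor [h] of n + 1. If
    [h] were not 1, the number (n + 1) / h would contradict [gen]. *)
Lemma shift_trans s t : exists w, walk (shift a) s w = t.
Proof.
have reachN1 : reach n.+1%:Z by exists [::]; rewrite /= sub0r rpredN dvdzz.
have ex : exists h, (0 < h)%N && `[< reach h%:Z >] by exists n.+1; rewrite /=; apply/asboolP.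
case: (ex_minnP ex) => h /andP[h0 /asboolP hr] hmin.
have dvdh x : reach x -> (h%:Z %| x)%Z.
  move=> hx; have : reach (x %% h%:Z)%Z.
    have -> : (x %% h%:Z)%Z = x + - ((x %/ h%:Z)%Z * h%:Z) by rewrite {2}(divz_eq x h%:Z); ring.
    by apply: reachD => //; apply/reachN/reachM.
  have ge : (0 <= (x %% h%:Z)%Z)%R by rewrite modz_ge0 // gt_eqF.
  have lt := ltz_pmod x (h0 : (0 < h%:Z)%R).
  case E : (x %% h%:Z)%Z ge lt => [[|m]|m] // _ lt rm; first exact/dvdz_mod0P.
  by have := hmin m.+1; rewrite /= => /(_ (asboolT rm)); rewrite leqNgt -ltz_nat lt.
have h1 : h = 1%N.
  apply: contrapT => /eqP hn1; have hN : (h %| n.+1)%N by exact: dvdh reachN1.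
  have [m em] := dvdnP hN.
  apply: (@gen m).
    apply/andP; split; first by rewrite lt0n; apply/negP => /eqP m0; rewrite m0 in em.
    by rewrite em ltn_Pmulr; [|lia|]; case: (m) em.
  move=> i; have : (h %| a i)%N.
    apply: (dvdh (a i)%:Z); exists [:: (i, true)].
    by rewrite -[walk _ _ _]/(0 + a i)%R add0r subrr.
  by case/dvdnP => c ->; rewrite em mulnCA dvdn_mull.
have [w hw] : reach (t - s)%R%:Z by rewrite -[X in reach X]mulr1; apply: reachM; rewrite h1 in hr; exact: hr.
exists w; rewrite -[s]add0r walk_shift; suff -> : walk (shift a) 0 w = t - s by rewrite subrK.
apply: val_inj; move: hw; rewrite -eqz_mod_dvd => /eqP.
by rewrite !modz_nat !modn_small // => -[].
Qed.

End ShiftTransitive.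

(** * From torsion points of large order to a free quotient: choice of the constants *)

Section InfiniteTorsion.
Variables (R : realType) (Y : topologicalType) (y0 : Y).
Hypotheses (nY : nice_space R Y) (cY : connected [set: Y]).
Variables (r ms : nat) (rel : 'I_ms -> free_group r) (phi : free_group r -> pi1 R y0).
Hypothesis pres : presentation rel phi.
Hypothesis inf : infinite_set (alexander_variety R[i] 1 rel phi `&` torsion_point R[i] r).

(** Only finitely many points satisfy z^(B!) = 1, so some torsion point of the variety does not, and
    its order exceeds [B]. The last clause is the minimality of that order. *)
Lemma large_order_point B : exists (n : nat) (a : 'I_r -> 'I_n.+1) (x : R[i]),
  [/\ (B < n.+1)%N, n.+1.-primitive_root x,
    alexander_variety R[i] 1 rel phi (root_point a x) &
    forall k, (0 < k < n.+1)%N -> exists i, x ^+ (k * a i) != 1].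
Proof.
have [z [[zV [m m0 zm]] zB]] : exists z, (alexander_variety R[i] 1 rel phi `&` torsion_point R[i] r) z
    /\ ~ forall i, z 0 i ^+ B`! = 1.
  apply: contrapT => /forallNP no; apply: inf.
  apply: sub_finite_set (roots_of_unity_finite R[i] r (fact_gt0 B)) => z zVT /=.
  by apply: contrapT => nz; apply: (no z).
have ex : exists m, (0 < m)%N && [forall i, z 0 i ^+ m == 1].
  by exists m; rewrite m0; apply/forallP => i; rewrite zm.
case: (ex_minnP ex) => -[//|n] /= /forallP zn nmin.
have [x px] := prim_root_exists R[i] (isT : (0 < n.+1)%N).
have ai i : {j : 'I_n.+1 | z 0 i = x ^+ j} by apply: (prim_rootP px); apply/eqP.
exists n, (fun i => sval (ai i)), x; have zE : root_point (fun i => sval (ai i)) x = z.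
  by apply/rowP => i; rewrite mxE -(svalP (ai i)).
split=> //; last 1 first.
- move=> k /andP[k0 kn]; apply: contrapT => /forallNP h.
  have := nmin k; rewrite k0 /= leqNgt kn => /(_ _)/negP; apply=> //; apply/forallP => i.
  by have /negP := h i; rewrite negbK mulnC exprM -(svalP (ai i)).
- rewrite ltnNge; apply/negP => nB; apply: zB => i.
  have /dvdnP[c ->] : (n.+1 %| B`!)%N by apply: dvdn_fact.
  by rewrite mulnC exprM (eqP (zn i)) expr1n.
- by rewrite zE.
Qed.

Lemma infinite_torsion_cover : exists (Z : topologicalType) (q : Z -> Y) (z : Z) (f : pi1 R z -> free_group 2),
  [/\ finite_cover q, {morph f : a b / (a * b)%g} & forall w, exists a, f a = w].
Proof.
have [phiM _ ker] := pres; have phiE := free_lift_uniq phiM.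
pose L := (\max_j size (rel j)).+1.
have relL j : (size (rel j) <= L)%N by rewrite leqW // (leq_bigmax (F := fun j => size (rel j))).
(* Chosen so that (1 + 2 r |Z|) q < K N whenever |Z| q < (2 L + 3) N and q < (2 L + 3) N. With q = K
   (omega + 1) this gives (1 + 2 r |Z|)(omega + 1) < N <= phi(N) (omega + 1). *)
pose K := ((2 * r + 1) * (2 * L + 3))%N.
have [k0 hk0] := exp_beats_poly r K.
have [n [a [x [nB px zV xgen]]]] := large_order_point (K * k0.+1 ^ 1 + (K * k0.+1) ^ r).+1.
have [chi [chic zE low]] := zV; have [chi0 chiM] := chic.
have n0 : (0 < n)%N by move: nB; lia.
have genN k : (0 < k < n.+1)%N -> ~ forall i, (n.+1 %| k * a i)%N.
  move=> hk h; have [i xi] := xgen k hk; have /dvdnP[c ec] := h i.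
  by move: xi; rewrite ec mulnC exprM (prim_expr_order px) expr1n eqxx.
pose st := shift a; have stK := shiftK a.
have z0 i : root_point a x 0 i != 0 by rewrite zE mxE.
have chi_word w : chi (word_val (fun i => phi (free_gen i)) w) = word_char (root_point a x) w.
  have chi1 : chi 1%g = 1.
    by apply: (mulfI (chi0 1%g)); rewrite -chiM mulg1 mulr1.
  elim: w => [|l w IH] //=; rewrite chiM IH zE; congr (_ * _).
  case: l => i [] /=; rewrite /letter_val /= mxE //.
  by apply: (mulfI (chi0 (phi (free_gen i)))); rewrite -chiM mulgV chi1 mulfV.
(* [chi] is trivial on relators, and v -> x^v is injective on Z/(n + 1) because [x] is primitive; so
   the total translation along a relator is zero. *)
have walk_rel s j : walk st s (rel j) = s.
  suff h : walk st 0 (rel j) = 0 by rewrite -[s in LHS]add0r walk_shift h add0r.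
  have one : (inord 1 : 'I_n.+1) = 1%N :> nat by rewrite inordK.
  have := word_char_psi a px (inord 1) 0 (rel j); rewrite one expr1 -chi_word -phiE.
  have : normal_closure (range rel) (rel j) by apply: sub_normal_closure; exists j.
  rewrite -ker /= => ->.
  have -> : chi 1%g = 1 by apply: (mulfI (chi0 1%g)); rewrite -chiM mulg1 mulr1.
  rewrite mul1r !mul1n => /eqP; rewrite (eq_prim_root_expr px) !modn_small // => /eqP hw.
  by apply: val_inj; rewrite /= hw.
have xgen' (k : 'I_n.+1) : k != 0 -> exists i, x ^+ (k * a i) != 1.
  by move=> kn; apply: xgen; rewrite ltn_ord andbT lt0n.
have rkb := cyclic_rank_bound px walk_rel n0 xgen' low.
pose om := size (primes n.+1).
pose q := (K * om.+1)%N.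
have q0 : (0 < q)%N by rewrite !muln_gt0 addn1 addn3.
(* For omega >= k0 by [exp_beats_poly] and N >= 2^omega; for smaller omega by the lower bound
   imposed on the order N = n + 1. *)
have qr : (q ^ r < n.+1)%N.
  have [le|lt] := leqP k0 om.
    exact: leq_trans (hk0 om le) (exp_size_primes (isT : (0 < n.+1)%N)).
  apply: leq_ltn_trans (_ : (K * k0.+1) ^ r < _)%N.
    by have [->|r0] := posnP r; rewrite ?expn0 // leq_exp2r // leq_mul2l ltnS (ltnW lt) orbT.
  by move: nB; lia.
have [k [e [kpos kn ke]]] := dirichlet_approx a q0 qr.
have L0 : (0 < L)%N by [].
have [zq qz] := card_zone_bound kpos q0 L0 ke (genN k (introT andP (conj kpos kn))).
set Z := zone k e L in zq.
have tot := totient_bound (isT : (0 < n.+1)%N).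
have r2 : (2 <= r)%N by move: low; lia.
have phi_big : (1 + 2 * r * #|Z| < totient n.+1)%N.
  rewrite -(ltn_pmul2r (isT : (0 < om.+1)%N)); apply: leq_trans tot.
  have c1 : ((1 + 2 * r * #|Z|) * q < K * n.+1)%N.
    have h : (2 * r * (#|Z| * q) <= 2 * r * ((2 * L + 3) * n.+1))%N by rewrite leq_mul2l (ltnW zq) orbT.
    have -> : (K * n.+1 = (2 * L + 3) * n.+1 + 2 * r * ((2 * L + 3) * n.+1))%N by rewrite /K; ring.
    by rewrite mulnDl mul1n -mulnA -addSn leq_add.
  move: c1; rewrite /q mulnCA ltn_pmul2l //.
  by rewrite muln_gt0 addn1 addn3.
have [|u [u_rel u_bad u_pot]] := @exists_nongradient r ms _ st stK rel Z.
  rewrite (rank_relation_mx_rat R[i]) card_ord.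
  have e1 : (n.+1 * r = n.+1 * (r - 1) + n.+1)%N by rewrite mulnBr muln1 subnK // leq_pmulr //; lia.
  have arith (N rk w t y : nat) : (rk + t <= y + 1 -> 1 + w < t -> N + rk + w < y + N)%N by lia.
  by rewrite e1; apply: arith rkb phi_big.
exact: (coarse_cover nY cY pres stK (shift_trans genN) walk_rel L0 relL
  (fun rho => zone_separated kpos q0 L0 ke (rho := rho)) u_rel u_bad u_pot).
Qed.

End InfiniteTorsion.

Theorem theorem1p1 (R : realType) (X : topologicalType)
    (X_CW : finite_CW_complex R X) (X_nonempty : [set: X] !=set0)
    (X_connected : connected [set: X]) :
  [<-> large R X;
       exists (Y : topologicalType) (p : Y -> X), finite_cover p /\
         forall N : nat, exists (Z : topologicalType) (q : Z -> Y),
           finite_abelian_cover q /\ betti1_ge R Z N;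
       exists (Y : topologicalType) (p : Y -> X), finite_cover p /\
         exists (y : Y) (r s : nat) (rel : 'I_s -> free_group r)
                (phi : free_group r -> pi1 R y),
           presentation rel phi /\
           infinite_set (alexander_variety R[i] 1 rel phi
                         `&` torsion_point R[i] r)].
Proof.
have nX := CW_nice X_CW.
tfae.
- case=> Y [p [fp [y [f [fM fsurj]]]]]; have [_ cY _] := fp; exists Y, p; split=> // N.
  exact: (rotation_cover (finite_cover_nice fp nX) cY fM fsurj N).
- case=> Y [p [fp grow]]; have [_ cY _] := fp; have nY := finite_cover_nice fp nX.
  exists Y, p; split=> //; have [x _] := X_nonempty; have [y _] := finite_cover_surj fp x.
  have [r [s [rel [phi pres]]]] := pi1_presentation y nY cY.
  by exists y, r, s, rel, phi; split=> //; exact: abelian_betti_infinite nY pres grow.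
- case=> Y [p [fp [y [r [s [rel [phi [pres inf]]]]]]]]; have [_ cY _] := fp.
  have nY := finite_cover_nice fp nX.
  have [Z [q [z [f [fq fM fsurj]]]]] := infinite_torsion_cover nY cY pres inf.
  exists Z, (p \o q); split; first exact: finite_cover_comp.
  by exists z, f.
Qed.
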